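(* Let $s>\frac52$ and let $F(\alpha,\beta,\overline{\alpha},\overline{\beta})$ be a polynomial in $\alpha,\beta,\overline{\alpha},\overline{\beta}$ with complex coefficients. Suppose that there exists $\psi\in H^s(\mathbb{T})$ such that $$\int_{\mathbb{T}}\operatorname{Im}F_\beta\big(\psi(x),\partial_x\psi(x),\overline{\psi(x)},\overline{\partial_x\psi(x)}\big)\,dx\neq0.$$ Then there exists $\phi\in H^s(\mathbb{T})$ such that for no $T>0$ the Cauchy problem $$\partial_t u+i\partial_x^2u=F(u,\partial_xu,\overline{u},\overline{\partial_xu}),\qquad u|_{t=0}=\phi,$$ has a solution in $C([0,T];H^s(\mathbb{T}))$ or in $C([-T,0];H^s(\mathbb{T}))$.
   Context: $\mathbb{T}=\mathbb{R}/2\pi\mathbb{Z}$, $\int_{\mathbb{T}}f\,dx:=\frac1{2\pi}\int_{-\pi}^{\pi}f(x)\,dx$, and $H^s(\mathbb{T})$ is the $L^2$-based Sobolev space of complex-valued functions. For $\beta=a+ib$ with $a,b\in\mathbb{R}$, $F_\beta=\frac{\partial F}{\partial\beta}:=\frac12\big(\frac{\partial F}{\partial a}-i\frac{\partial F}{\partial b}\big)$. Solution: for $s>\frac32$, $T>0$, $\phi\in H^s(\mathbb{T})$, $u$ is a solution in $H^s(\mathbb{T})$ on $[0,T]$ if $u\in L^\infty([0,T];H^s(\mathbb{T}))$ and for every $\chi\in C_c^\infty([0,T)\times\mathbb{T})$, $$-\int_0^T\!\!\int_{\mathbb{T}}u\,\partial_t\chi\,dx\,dt-\int_{\mathbb{T}}\phi(x)\chi(0,x)\,dx+i\int_0^T\!\!\int_{\mathbb{T}}u\,\partial_x^2\chi\,dx\,dt=\int_0^T\!\!\int_{\mathbb{T}}F(u,\partial_xu,\overline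 u,\overline{\partial_xu})\chi\,dx\,dt.$$ A solution on $[-T,0]$ is defined in the similar manner (with $\chi\in C_c^\infty((-T,0]\times\mathbb{T})$, time integrals over $[-T,0]$, and the initial term having the sign $+\int_{\mathbb{T}}\phi(x)\chi(0,x)dx$). *)

(* Defs.v *)
From HB Require Import structures.
From mathcomp Require Import all_boot all_order all_algebra.
From mathcomp Require Import all_classical all_reals all_analysis.
From mathcomp Require Import complex.
(* Not imported: the notations of mpoly clash with those of analysis. *)
From mathcomp Require mpoly.

Set Implicit Arguments.
Unset Strict Implicit.
Unset Printing Implicit Defensive.

Import Order.TTheory GRing.Theory Num.Theory.
Import numFieldNormedType.Exports.

Local Open Scope classical_set_scope.
Local Open Scope complex_scope.
Local Open Scope ring_scope.

Section Calculus.
Context {R : realType}.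
Local Notation C := R[i].
Local Notation Re := (@complex.Re R).
Local Notation Im := (@complex.Im R).
Local Notation normc := (@ComplexField.Normc.normc R).
Local Notation mu := (@lebesgue_measure R).

Definition cint (D : set R) (f : R -> C) : C :=
  (\int[mu]_(x in D) Re (f x)) +i* (\int[mu]_(x in D) Im (f x)).

Definition cderive1 (f : R -> C) (x : R) : C :=
  derive1 (Re \o f) x +i* derive1 (Im \o f) x.

Definition cderivable (f : R -> C) (x : R) : Prop :=
  derivable (Re \o f) x 1 /\ derivable (Im \o f) x 1.

(* For G a function of z = a + ib: (1/2) (dG/da - i dG/db). *)
Definition wirtinger (G : C -> C) (z : C) : C :=
  2^-1 * (cderive1 (fun a => G (a +i* Im z)) (Re z)
          - 'i%C * cderive1 (fun b => G (Re z +i* b)) (Im z)).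

(* Functions on T = R / 2 pi Z are 2 pi-periodic functions on R. *)
Definition periodic2pi (f : R -> C) : Prop := forall x, f (x + 2 * pi) = f x.

Definition period : set R := `[- pi, pi].

(* The normalized integral over T, for real- and complex-valued functions. *)
Definition rtint (f : R -> R) : R :=
  (2 * pi)^-1 * \int[mu]_(x in period) f x.

Definition tint (f : R -> C) : C := rtint (Re \o f) +i* rtint (Im \o f).

(* Elements of L^2(T) and H^s(T) are given by everywhere-defined
   representatives; two representatives are at H^s-distance 0 iff they agree
   almost everywhere. *)
Definition L2T (f : R -> C) : Prop :=
  [/\ periodic2pi f,
      measurable_fun setT (Re \o f), measurable_fun setT (Im \o f) &
      (\int[mu]_(x in period) (normc (f x) ^+ 2)%:E
         < +oo)%E].

Definition fourier (f : R -> C) (k : int) : C :=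
  tint (fun x => f x * (cos (k%:~R * x) -i* sin (k%:~R * x))).

Definition Hs_sqnorm (s : R) (f : R -> C) : \bar R :=
  \esum_(k in [set: int])
    (((1 + (k%:~R : R) ^+ 2) `^ s)
       * normc (fourier f k) ^+ 2)%:E.

Definition Hs (s : R) (f : R -> C) : Prop :=
  L2T f /\ (Hs_sqnorm s f < +oo)%E.

(* Only meaningful on Hs s: fine sends +oo to 0. *)
Definition Hs_norm (s : R) (f : R -> C) : R := Num.sqrt (fine (Hs_sqnorm s f)).

Definition smoothT (chi : R -> C) : Prop :=
  periodic2pi chi /\ forall n x, cderivable (iter n cderive1 chi) x.

Definition weak_deriv (f g : R -> C) : Prop :=
  L2T g /\ forall chi, smoothT chi ->
    tint (fun x => f x * cderive1 chi x) = - tint (fun x => g x * chi x).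

(* A representative of the distributional derivative of f (unique up to a.e.
   equality), and 0 if that derivative is not in L^2(T). *)
Definition dx (f : R -> C) : R -> C := xget (cst 0) [set g | weak_deriv f g].

(* Functions of (t, x). *)
Definition pderiv (b : bool) (chi : R -> R -> C) : R -> R -> C :=
  if b then fun t x => cderive1 (fun t' => chi t' x) t
  else fun t x => cderive1 (chi t) x.

Definition dt_test := pderiv true.
Definition dx_test := pderiv false.

(* C^oo: iterated partial derivatives of all orders exist and are
   (Frechet) differentiable. *)
Definition smooth_tx (chi : R -> R -> C) : Prop :=
  forall (w : seq bool) (p : R * R),
    differentiable (fun q : R * R => Re (foldr pderiv chi w q.1 q.2)) p /\
    differentiable (fun q : R * R => Im (foldr pderiv chi w q.1 q.2)) p.

(* C_c^oo([0, T) x T): such functions are represented by an extension to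
   R x T, by zero to t >= T and smoothly to t < 0. *)
Definition test_fwd (T : R) (chi : R -> R -> C) : Prop :=
  [/\ smooth_tx chi, forall t, periodic2pi (chi t) &
      exists2 T', T' < T & forall t x, T' <= t -> chi t x = 0].

(* C_c^oo((-T, 0] x T) *)
Definition test_bwd (T : R) (chi : R -> R -> C) : Prop :=
  [/\ smooth_tx chi, forall t, periodic2pi (chi t) &
      exists2 T', - T < T' & forall t x, t <= T' -> chi t x = 0].

End Calculus.

Section Evolution.
Context {R : realType}.
Local Notation C := R[i].
Local Notation mu := (@lebesgue_measure R).

Definition simple_Hs (s : R) (v : R -> R -> C) : Prop :=
  [/\ finite_set (range v), range v `<=` Hs s &
      forall g, measurable (v @^-1` [set g])].

(* Bochner measurability on [a, b] with values in H^s. *)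
Definition strongly_measurable_Hs (s a b : R) (u : R -> R -> C) : Prop :=
  exists2 v : nat -> R -> R -> C, forall n, simple_Hs s (v n) &
    {ae mu, forall t, t \in `[a, b] ->
      Hs s (u t) /\ Hs_norm s (v n t \- u t) @[n --> \oo] --> (0 : R)}.

Definition Linfty_Hs (s a b : R) (u : R -> R -> C) : Prop :=
  strongly_measurable_Hs s a b u /\
  exists M : R, {ae mu, forall t, t \in `[a, b] ->
    Hs s (u t) /\ Hs_norm s (u t) <= M}.

Definition C_Hs (s a b : R) (u : R -> R -> C) : Prop :=
  forall t0, t0 \in `[a, b] -> Hs s (u t0) /\
    Hs_norm s (u t \- u t0) @[t --> within `[a, b] (nbhs t0)] --> (0 : R).

(* The four variables of F stand for alpha, beta and their conjugates. *)
Definition evalF (F : mpoly.mpoly 4 C) (alpha beta : C) : C :=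
  mpoly.meval (fun i : 'I_4 => [:: alpha; beta; (alpha^*)%C; (beta^*)%C]`_i) F.

Definition F_beta (F : mpoly.mpoly 4 C) (alpha beta : C) : C :=
  wirtinger (evalF F alpha) beta.

Definition solution_fwd (s T : R) (F : mpoly.mpoly 4 C) (phi : R -> C)
    (u : R -> R -> C) : Prop :=
  Linfty_Hs s 0 T u /\
  forall chi, test_fwd T chi ->
    - cint `[0, T] (fun t => tint (fun x => u t x * dt_test chi t x))
    - tint (fun x => phi x * chi 0 x)
    + 'i%C * cint `[0, T]
             (fun t => tint (fun x => u t x * dx_test (dx_test chi) t x))
    = cint `[0, T]
        (fun t => tint (fun x => evalF F (u t x) (dx (u t) x) * chi t x)).

Definition solution_bwd (s T : R) (F : mpoly.mpoly 4 C) (phi : R -> C)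
    (u : R -> R -> C) : Prop :=
  Linfty_Hs s (- T) 0 u /\
  forall chi, test_bwd T chi ->
    - cint `[- T, 0] (fun t => tint (fun x => u t x * dt_test chi t x))
    + tint (fun x => phi x * chi 0 x)
    + 'i%C * cint `[- T, 0]
             (fun t => tint (fun x => u t x * dx_test (dx_test chi) t x))
    = cint `[- T, 0]
        (fun t => tint (fun x => evalF F (u t x) (dx (u t) x) * chi t x)).

End Evolution.

(* Main.v *)
Require Import Defs.
From mathcomp Require Import all_boot all_order all_algebra.
From mathcomp Require Import all_classical all_reals all_analysis.
From mathcomp Require Import measurable_realfun complex.
From mathcomp Require Import zify ring lra.
From mathcomp Require mpoly.

(* The idea is Mizohata's: linearizing at phi, the coefficient A = F_beta(phi, phi')
   of u_x can be conjugated to its mean, and the imaginary part of the mean makes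
   either the positive or the negative frequencies grow like exp(c |n| |t|), whichever
   the direction of time. To exploit it, take phi to be a trigonometric polynomial
   close to psi plus a lacunary series with coefficients e M^-s 2^-i at the
   frequencies +- D M, M = (4^i)^16, so that phi is C^2 and in H^s, but no better.

   Let n = +- D M and let u solve the equation. Splitting u into frequencies below M
   (low part) and above M, the terms of F(u, u_x) depending on the low part only have
   degree too small to reach frequency n, and the remaining ones are linear in the
   high part up to a negligible error. With G' = (i/2)(A - lam) G and P = G_M e_(-n),
   G_M being the truncation of G, the pairing y = <u, P> satisfies
     y' = i (n^2 + lam n) y + i n z + error,   z' = - i n^2 z + error,
   where z pairs the conjugate of u with (F_conj(beta) G)_M e_(-n) and oscillates. The
   combination Y = y + z / (2 n) thus satisfies Y' = i (n^2 + lam n) Y + error. For a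
   time tau = 4^(-10 i) the coefficients stay within O(4^-i) of those at time 0, so the
   error is O(M^(1-s) 4^-i). For the sign of n for which |Y| grows at the rate
   c M along the evolution, boundedness of Y at time tau gives Y(0) = O(M^-s 4^-i),
   whereas the data give |Y(0)| ~ M^-s 2^-i, a contradiction as i tends to infinity. *)

Set Implicit Arguments.
Unset Strict Implicit.
Unset Printing Implicit Defensive.

Import Order.TTheory GRing.Theory Num.Theory.
Import numFieldNormedType.Exports.

Local Open Scope classical_set_scope.
Local Open Scope complex_scope.
Local Open Scope ring_scope.

(** * Calculus of complex-valued functions *)

Section ComplexFunctions.
Context {R : realType}.
Local Notation C := R[i].
Local Notation Re := (@complex.Re R).
Local Notation Im := (@complex.Im R).
Local Notation normc := (@ComplexField.Normc.normc R).
Local Notation mu := (@lebesgue_measure R).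

(** The obstacle is that G is only twice differentiable, since A involves phi', while the equation
    may be tested against smooth functions only. Truncating G at M turns the test into a
    trigonometric polynomial and loses a factor 1/M, affordable against the size M^(1-s) of the
    differentiated high part. It also localizes the pairing: <phi, P> sees only the window of radius
    M around n, where phi has the single mode n, so it equals the mean of G times that coefficient.
    This mean can be made nonzero because lam may be shifted by an even integer. The exponents are
    tied together through N = 4^i. A mode k moves at speed O(1 + k^2), so up to time N^(-10) the
    displacements of all modes below N^2, derivatives included, add up to O(1/N); the modes above
    N^2 contribute O(N^(-2)) by the H^s bound. This is the factor 4^-i. At frequency M = N^16 the
    growth over that time is exp(c N^6) or more, which beats every power of N. The factor D = d + 3,
    with d bounding the degree of F, leaves room for the truncated G besides the low part of F. *)

Lemma ReD (z w : C) : Re (z + w) = Re z + Re w. Proof. by case: z w => ? ? []. Qed.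
Lemma ImD (z w : C) : Im (z + w) = Im z + Im w. Proof. by case: z w => ? ? []. Qed.
Lemma ReN (z : C) : Re (- z) = - Re z. Proof. by case: z. Qed.
Lemma ImN (z : C) : Im (- z) = - Im z. Proof. by case: z. Qed.
Lemma ReM (z w : C) : Re (z * w) = Re z * Re w - Im z * Im w.
Proof. by case: z w => ? ? []. Qed.
Lemma ImM (z w : C) : Im (z * w) = Re z * Im w + Im z * Re w.
Proof. by case: z w => ? ? []. Qed.
Lemma ReJ (z : C) : Re (z^*)%C = Re z. Proof. by case: z. Qed.
Lemma ImJ (z : C) : Im (z^*)%C = - Im z. Proof. by case: z. Qed.
Lemma cext (z w : C) : Re z = Re w -> Im z = Im w -> z = w.
Proof. by case: z w => ? ? [? ?] /= -> ->. Qed.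
Definition ReImE := (ReD, ImD, ReN, ImN, ReM, ImM, ReJ, ImJ).

Lemma normc_ge0 (z : C) : 0 <= normc z.
Proof. by case: z => a b; exact: sqrtr_ge0. Qed.
Lemma sqr_normcE (z : C) : normc z ^+ 2 = Re z ^+ 2 + Im z ^+ 2.
Proof. by case: z => a b /=; rewrite sqr_sqrtr// addr_ge0// sqr_ge0. Qed.
Lemma normc_mul (z w : C) : normc (z * w) = normc z * normc w.
Proof. exact: ComplexField.Normc.normcM. Qed.
Lemma normc_opp (z : C) : normc (- z) = normc z.
Proof. by case: z => a b /=; rewrite !sqrrN. Qed.
Lemma normc_conj (z : C) : normc (z^*)%C = normc z.
Proof. by case: z => a b /=; rewrite !sqrrN. Qed.
Lemma normc_add (z w : C) : normc (z + w) <= normc z + normc w.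
Proof. exact: le_normcD. Qed.
Lemma normc_sub (z w : C) : normc (z - w) <= normc z + normc w.
Proof. by rewrite -(normc_opp w); exact: normc_add. Qed.
Lemma normc_zero : normc 0 = 0. Proof. exact: ComplexField.Normc.normc0. Qed.
Lemma normc_one : normc 1 = 1. Proof. exact: ComplexField.Normc.normc1. Qed.
Lemma normc_eq0 (z : C) : normc z = 0 -> z = 0.
Proof. exact: ComplexField.Normc.eq0_normc. Qed.
Lemma normc_X (z : C) n : normc (z ^+ n) = normc z ^+ n.
Proof. by elim: n => [|n IH]; rewrite ?expr0 ?normc_one// !exprS normc_mul IH. Qed.
Lemma normc_real (r : R) : normc r%:C = `|r|.
Proof. by rewrite /= expr0n/= addr0 sqrtr_sqr. Qed.
Lemma normc_i : normc 'i%C = 1.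
Proof. by rewrite /= expr0n/= expr1n add0r sqrtr1. Qed.
Lemma normc_Re (z : C) : `|Re z| <= normc z.
Proof.
rewrite -(ler_pXn2r (ltn0Sn 1)) ?nnegrE ?normc_ge0// sqr_normcE.
by rewrite real_normK ?num_real// lerDl sqr_ge0.
Qed.
Lemma normc_Im (z : C) : `|Im z| <= normc z.
Proof.
rewrite -(ler_pXn2r (ltn0Sn 1)) ?nnegrE ?normc_ge0// sqr_normcE.
by rewrite real_normK ?num_real// lerDr sqr_ge0.
Qed.
Lemma normc_le_ReIm (z : C) : normc z <= `|Re z| + `|Im z|.
Proof.
rewrite -(ler_pXn2r (ltn0Sn 1)) ?nnegrE ?normc_ge0 ?addr_ge0// sqr_normcE.
rewrite sqrrD !real_normK ?num_real// -addrA (addrC (_ *+ 2)) addrA lerDl.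
by rewrite mulrn_wge0// mulr_ge0.
Qed.
Lemma normc_sum (I : Type) (r : seq I) (P : pred I) (F : I -> C) :
  normc (\sum_(i <- r | P i) F i) <= \sum_(i <- r | P i) normc (F i).
Proof.
elim/big_ind2 : _ => [|x y z w h1 h2|//]; first by rewrite normc_zero.
exact: le_trans (normc_add _ _) (lerD h1 h2).
Qed.
Lemma conjcD (z w : C) : ((z + w)^*)%C = (z^*)%C + (w^*)%C.
Proof. exact: rmorphD. Qed.
Lemma conjcM (z w : C) : ((z * w)^*)%C = (z^*)%C * (w^*)%C.
Proof. exact: rmorphM. Qed.

Definition ccont (f : R -> C) := continuous (Re \o f) /\ continuous (Im \o f).

Lemma ccont_cst c : ccont (fun=> c).
Proof. by split => x; exact: cvg_cst. Qed.
Lemma ccontD f g : ccont f -> ccont g -> ccont (fun x => f x + g x).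
Proof.
move=> [fr fi] [gr gi]; split => x.
  rewrite (_ : Re \o _ = (Re \o f) \+ (Re \o g)); first by apply: (@continuousD _ _ _ _ _ x); [exact: fr|exact: gr].
  by apply/funext => y /=; rewrite ReD.
rewrite (_ : Im \o _ = (Im \o f) \+ (Im \o g)); first by apply: (@continuousD _ _ _ _ _ x); [exact: fi|exact: gi].
by apply/funext => y /=; rewrite ImD.
Qed.
Lemma ccontN f : ccont f -> ccont (fun x => - f x).
Proof.
move=> [fr fi]; split => x.
  rewrite (_ : Re \o _ = \- (Re \o f)); first by apply: (@continuousN _ _ _ _ x); exact: fr.
  by apply/funext => y /=; rewrite ReN.
rewrite (_ : Im \o _ = \- (Im \o f)); first by apply: (@continuousN _ _ _ _ x); exact: fi.
by apply/funext => y /=; rewrite ImN.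
Qed.
Lemma ccontB f g : ccont f -> ccont g -> ccont (fun x => f x - g x).
Proof. by move=> hf hg; apply: ccontD => //; exact: ccontN. Qed.
Lemma ccontM f g : ccont f -> ccont g -> ccont (fun x => f x * g x).
Proof.
move=> [fr fi] [gr gi]; split => x.
  rewrite (_ : Re \o _ = (Re \o f) \* (Re \o g) \- (Im \o f) \* (Im \o g)).
    by apply: (@continuousB _ _ _ _ _ x); apply: (@continuousM _ _ _ _ x); [exact: fr|exact: gr|exact: fi|exact: gi].
  by apply/funext => y /=; rewrite ReM.
rewrite (_ : Im \o _ = (Re \o f) \* (Im \o g) \+ (Im \o f) \* (Re \o g)).
  by apply: (@continuousD _ _ _ _ _ x); apply: (@continuousM _ _ _ _ x); [exact: fr|exact: gi|exact: fi|exact: gr].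
by apply/funext => y /=; rewrite ImM.
Qed.
Lemma ccontJ f : ccont f -> ccont (fun x => ((f x)^*)%C).
Proof.
move=> [fr fi]; split => x.
  rewrite (_ : Re \o _ = Re \o f); first exact: fr.
  by apply/funext => y /=; rewrite ReJ.
rewrite (_ : Im \o _ = \- (Im \o f)); first by apply: (@continuousN _ _ _ _ x); exact: fi.
by apply/funext => y /=; rewrite ImJ.
Qed.
Lemma ccont_sum (I : Type) (r : seq I) (P : pred I) (F : I -> R -> C) :
  (forall i, P i -> ccont (F i)) -> ccont (fun x => \sum_(i <- r | P i) F i x).
Proof.
move=> h; elim: r => [|i r IH].
  rewrite (_ : (fun x => _) = (fun=> 0)); first exact: ccont_cst.
  by apply/funext => x; rewrite big_nil.
case Pi: (P i).
  rewrite (_ : (fun x => _) =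
     (fun x => F i x + \sum_(i <- r | P i) F i x)); last first.
    by apply/funext => x; rewrite big_cons Pi.
  by apply: ccontD => //; exact: h.
rewrite (_ : (fun x => _) = (fun x => \sum_(i <- r | P i) F i x))//.
by apply/funext => x; rewrite big_cons Pi.
Qed.
Lemma continuous_normc f : ccont f -> continuous (fun x => normc (f x)).
Proof.
move=> [fr fi] x; rewrite (_ : (fun _ => _) =
   Num.sqrt \o ((Re \o f) \* (Re \o f) \+ (Im \o f) \* (Im \o f))).
  apply: continuous_comp; last exact: sqrt_continuous.
  by apply: (@continuousD _ _ _ _ _ x); apply: (@continuousM _ _ _ _ x);
    [exact: fr|exact: fr|exact: fi|exact: fi].
by apply/funext => y /=; case: (f y) => a b; rewrite /= -!expr2.
Qed.
Lemma continuous_sqr_normc f : ccont f -> continuous (fun x => normc (f x) ^+ 2).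
Proof.
by move=> h x; apply: (@continuousM _ _ _ _ x); exact: continuous_normc.
Qed.

(** The derivative is carried along as an explicit companion function, so that the calculus rules
    compose; [isd_cderive1] and [cderivable_isd] translate to and from [cderive1]. *)
Definition isd (f f' : R -> C) := forall x : R,
  is_derive x (1 : R) (Re \o f) (Re (f' x)) /\ is_derive x (1 : R) (Im \o f) (Im (f' x)).

Lemma isd_ext f g f' g' : f =1 g -> f' =1 g' -> isd f f' -> isd g g'.
Proof. by move=> /funext -> /funext ->. Qed.
Lemma isd_cst c : isd (fun=> c) (fun=> 0).
Proof. by move=> x; split; exact: is_derive_cst. Qed.
Lemma isdD f g f' g' : isd f f' -> isd g g' ->
  isd (fun x => f x + g x) (fun x => f' x + g' x).
Proof.
move=> hf hg x; have [fr fi] := hf x; have [gr gi] := hg x; split.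
  rewrite (_ : Re \o _ = (Re \o f) + (Re \o g)).
    by rewrite ReD; exact: is_deriveD.
  by apply/funext => y /=; rewrite ReD.
rewrite (_ : Im \o _ = (Im \o f) + (Im \o g)).
  by rewrite ImD; exact: is_deriveD.
by apply/funext => y /=; rewrite ImD.
Qed.
Lemma isdN f f' : isd f f' -> isd (fun x => - f x) (fun x => - f' x).
Proof.
move=> hf x; have [fr fi] := hf x; split.
  rewrite (_ : Re \o _ = - (Re \o f)).
    by rewrite ReN; exact: is_deriveN.
  by apply/funext => y /=; rewrite ReN.
rewrite (_ : Im \o _ = - (Im \o f)).
  by rewrite ImN; exact: is_deriveN.
by apply/funext => y /=; rewrite ImN.
Qed.
Lemma isdB f g f' g' : isd f f' -> isd g g' ->
  isd (fun x => f x - g x) (fun x => f' x - g' x).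
Proof. by move=> hf hg; apply: isdD => //; exact: isdN. Qed.
Lemma isdM f g f' g' : isd f f' -> isd g g' ->
  isd (fun x => f x * g x) (fun x => f' x * g x + f x * g' x).
Proof.
move=> hf hg x; have [fr fi] := hf x; have [gr gi] := hg x; split.
  rewrite (_ : Re \o _ = (Re \o f) * (Re \o g) - (Im \o f) * (Im \o g)).
    apply: is_derive_eq; rewrite !ReImE /= /GRing.scale/=; ring.
  by apply/funext => y /=; rewrite ReM.
rewrite (_ : Im \o _ = (Re \o f) * (Im \o g) + (Im \o f) * (Re \o g)).
  apply: is_derive_eq; rewrite !ReImE /= /GRing.scale/=; ring.
by apply/funext => y /=; rewrite ImM.
Qed.
Lemma isdZ c f f' : isd f f' -> isd (fun x => c * f x) (fun x => c * f' x).
Proof.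
move=> hf; apply: isd_ext (isdM (isd_cst c) hf) => x //=.
by rewrite mul0r add0r.
Qed.
Lemma isdJ f f' : isd f f' -> isd (fun x => ((f x)^*)%C) (fun x => ((f' x)^*)%C).
Proof.
move=> hf x; have [fr fi] := hf x; split.
  rewrite (_ : Re \o _ = (Re \o f)); first by rewrite ReJ.
  by apply/funext => y /=; rewrite ReJ.
rewrite (_ : Im \o _ = - (Im \o f)).
  by rewrite ImJ; exact: is_deriveN.
by apply/funext => y /=; rewrite ImJ.
Qed.
Lemma isd_sum (I : Type) (r : seq I) (P : pred I) (F F' : I -> R -> C) :
  (forall i, P i -> isd (F i) (F' i)) ->
  isd (fun x => \sum_(i <- r | P i) F i x) (fun x => \sum_(i <- r | P i) F' i x).
Proof.
move=> h; elim: r => [|i r IH].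
  by apply: isd_ext (isd_cst 0) => x; rewrite big_nil.
case Pi: (P i).
  apply: isd_ext (isdD (h i Pi) IH) => x; by rewrite big_cons Pi.
by apply: isd_ext IH => x; rewrite big_cons Pi.
Qed.
Lemma isd_ccont f f' : isd f f' -> ccont f.
Proof.
move=> hf; split => x; have [fr fi] := hf x.
  by apply/differentiable_continuous/derivable1_diffP; exact: ex_derive.
by apply/differentiable_continuous/derivable1_diffP; exact: ex_derive.
Qed.
Lemma isd_cderive1 f f' : isd f f' -> cderive1 f = f'.
Proof.
move=> hf; apply/funext => x; have [fr fi] := hf x.
by rewrite /cderive1 !derive1E !derive_val; case: (f' x).
Qed.
Lemma isd_cderivable f f' : isd f f' -> forall x, cderivable f x.
Proof. by move=> hf x; have [fr fi] := hf x; split; exact: ex_derive. Qed.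
Lemma cderivable_isd f : (forall x, cderivable f x) -> isd f (cderive1 f).
Proof.
move=> h x; have [h1 h2] := h x; split; rewrite /cderive1 /=.
  by rewrite derive1E; exact/derivableP.
by rewrite derive1E; exact/derivableP.
Qed.
(** The translate of [f'] by a period is again a derivative of [f], and derivatives are unique. *)
Lemma periodic_isd f f' : isd f f' -> periodic2pi f -> periodic2pi f'.
Proof.
move=> hf pf x.
have h : isd f (fun x => f' (x + 2 * pi)).
  move=> y; have [hr hi] := hf (y + 2 * pi).
  have sh : is_derive y (1:R) (fun y : R => y + 2 * pi : R) 1.
    by apply: is_derive_eq; rewrite addr0.
  split.
    rewrite (_ : Re \o f = (Re \o f) \o (fun y => y + 2 * pi)); last first.
      by apply/funext => z /=; rewrite pf.
    by apply: is_derive_eq; rewrite mulr1.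
  rewrite (_ : Im \o f = (Im \o f) \o (fun y => y + 2 * pi)); last first.
    by apply/funext => z /=; rewrite pf.
  by apply: is_derive_eq; rewrite mulr1.
by move: (isd_cderive1 h) (isd_cderive1 hf) => -> /(congr1 (fun f => f x)).
Qed.

End ComplexFunctions.

(** * Integration over the circle *)

Section TorusIntegral.
Context {R : realType}.
Local Notation C := R[i].
Local Notation Re := (@complex.Re R).
Local Notation Im := (@complex.Im R).
Local Notation normc := (@ComplexField.Normc.normc R).
Local Notation mu := (@lebesgue_measure R).

Let pi_pos : 0 < pi :> R. Proof. exact: pi_gt0. Qed.
Let ipi_pos : 0 < (2 * pi)^-1 :> R.
Proof. by rewrite invr_gt0 mulr_gt0. Qed.
Let pi_lt : - pi < pi :> R. Proof. by apply: lt_trans pi_pos; rewrite oppr_lt0. Qed.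

Definition rint (f : R -> R) := mu.-integrable (@period R) (EFin \o f).

Lemma measurable_period : measurable (@period R).
Proof. exact: measurable_itv. Qed.
Hint Resolve measurable_period : core.

Lemma rint_cont f : continuous f -> rint f.
Proof.
move=> cf; apply: continuous_compact_integrable; first exact: segment_compact.
exact: continuous_subspaceT.
Qed.
Lemma rintD f g : rint f -> rint g -> rint (fun x => f x + g x).
Proof. exact: integrableD. Qed.
Lemma rintZ c f : rint f -> rint (fun x => c * f x).
Proof. by move=> hf; apply: (@integrableZl _ _ _ mu _ _ c (EFin \o f)). Qed.
Lemma rintN f : rint f -> rint (fun x => - f x).
Proof. by move=> hf; apply: (@integrableN _ _ _ mu _ (EFin \o f)). Qed.

Lemma rtintD f g : rint f -> rint g -> rtint (fun x => f x + g x) = rtint f + rtint g.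
Proof. by move=> hf hg; rewrite /rtint RintegralD// mulrDr. Qed.
Lemma rtintZ c f : rint f -> rtint (fun x => c * f x) = c * rtint f.
Proof. by move=> hf; rewrite /rtint RintegralZl// mulrCA. Qed.
Lemma rtintN f : rint f -> rtint (fun x => - f x) = - rtint f.
Proof.
move=> hf; rewrite -mulN1r -rtintZ//; congr rtint; apply/funext => x.
by rewrite mulN1r.
Qed.
Lemma rtint_le f g : rint f -> rint g ->
  (forall x, period x -> f x <= g x) -> rtint f <= rtint g.
Proof.
move=> hf hg h; rewrite /rtint ler_pM2l//.
exact: le_Rintegral.
Qed.
Lemma rtint_cst c : rtint (fun=> c : R) = c.
Proof.
have mE : fine (mu (@period R)) = 2 * pi.
  have := lebesgue_measure_itv `[- pi, pi : R]; rewrite /= lte_fin pi_lt/= opprK.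
  by rewrite /period => -> /=; rewrite mulr_natl mulr2n.
rewrite /rtint Rintegral_cst// mE mulrCA mulVf ?mulr1//.
by rewrite mulf_neq0 ?gt_eqF.
Qed.
Lemma rtint_ge0 (f : R -> R) : (forall x, period x -> 0 <= f x) -> 0 <= rtint f.
Proof.
move=> h; rewrite /rtint; apply: mulr_ge0; first exact: ltW.
exact: Rintegral_ge0.
Qed.
Lemma eq_rtint (f g : R -> R) : (forall x, period x -> f x = g x) -> rtint f = rtint g.
Proof.
move=> h; rewrite /rtint; congr (_ * _); apply: eq_Rintegral => x.
by rewrite inE => /h.
Qed.

Definition cintg (f : R -> C) := rint (Re \o f) /\ rint (Im \o f).

Lemma cintg_cont f : ccont f -> cintg f.
Proof. by move=> [fr fi]; split; exact: rint_cont. Qed.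
Lemma cintgD f g : cintg f -> cintg g -> cintg (fun x => f x + g x).
Proof.
move=> [fr fi] [gr gi]; split.
  rewrite (_ : _ \o _ = (fun x => Re (f x) + Re (g x))); first exact: rintD.
  by apply/funext => x /=; rewrite ReD.
rewrite (_ : _ \o _ = (fun x => Im (f x) + Im (g x))); first exact: rintD.
by apply/funext => x /=; rewrite ImD.
Qed.
Lemma cintgZ c f : cintg f -> cintg (fun x => c * f x).
Proof.
move=> [fr fi]; split.
  rewrite (_ : _ \o _ = (fun x => Re c * Re (f x) + - Im c * Im (f x))).
    by apply: rintD; exact: rintZ.
  by apply/funext => x /=; rewrite ReM mulNr.
rewrite (_ : _ \o _ = (fun x => Re c * Im (f x) + Im c * Re (f x))).
  by apply: rintD; exact: rintZ.
by apply/funext => x /=; rewrite ImM.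
Qed.
Lemma cintgN f : cintg f -> cintg (fun x => - f x).
Proof.
move=> /(cintgZ (-1)); congr cintg; apply/funext => x.
by rewrite mulN1r.
Qed.
Lemma cintgB f g : cintg f -> cintg g -> cintg (fun x => f x - g x).
Proof. by move=> hf hg; apply: cintgD => //; exact: cintgN. Qed.
Lemma tintD f g : cintg f -> cintg g ->
  tint (fun x => f x + g x) = tint f + tint g.
Proof.
move=> [fr fi] [gr gi]; apply: cext; rewrite ?ReImE /tint/= -rtintD//.
  by apply: eq_rtint => x _ /=; rewrite ReD.
by apply: eq_rtint => x _ /=; rewrite ImD.
Qed.
Lemma tintZ c f : cintg f -> tint (fun x => c * f x) = c * tint f.
Proof.
move=> [fr fi]; apply: cext; rewrite ?ReImE /tint/=.
  rewrite -mulNr -!rtintZ// -rtintD ?rintZ//.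
  by apply: eq_rtint => x _ /=; rewrite ReM mulNr.
rewrite -!rtintZ// -rtintD ?rintZ//.
by apply: eq_rtint => x _ /=; rewrite ImM.
Qed.
Lemma tintN f : cintg f -> tint (fun x => - f x) = - tint f.
Proof.
move=> hf; rewrite -mulN1r -tintZ//; congr tint; apply/funext => x.
by rewrite mulN1r.
Qed.
Lemma tintB f g : cintg f -> cintg g ->
  tint (fun x => f x - g x) = tint f - tint g.
Proof. by move=> hf hg; rewrite tintD ?tintN//; exact: cintgN. Qed.
Lemma eq_tint (f g : R -> C) : (forall x, period x -> f x = g x) -> tint f = tint g.
Proof. by move=> h; congr (_ +i* _); apply: eq_rtint => x /h /= ->. Qed.
Lemma tint_cst c : tint (fun=> c : C) = c.
Proof.
apply: cext; rewrite /tint/=.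
  by rewrite (_ : _ \o _ = fun=> Re c)// rtint_cst.
by rewrite (_ : _ \o _ = fun=> Im c)// rtint_cst.
Qed.
Lemma tintJ f : cintg f -> tint (fun x => ((f x)^*)%C) = ((tint f)^*)%C.
Proof.
move=> [fr fi]; apply: cext; rewrite ?ReImE /tint/=.
  by apply: eq_rtint => x _ /=; rewrite ReJ.
by rewrite -rtintN//; apply: eq_rtint => x _ /=; rewrite ImJ.
Qed.
Lemma cintg_sum (I : Type) (r : seq I) (P : pred I) (F : I -> R -> C) :
  (forall i, P i -> cintg (F i)) -> cintg (fun x => \sum_(i <- r | P i) F i x).
Proof.
move=> h; elim: r => [|i r IH].
  rewrite (_ : (fun x => _) = (fun=> 0)); first exact/cintg_cont/ccont_cst.
  by apply/funext => x; rewrite big_nil.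
case Pi: (P i).
  rewrite (_ : (fun x => _) =
     (fun x => F i x + \sum_(i <- r | P i) F i x)); last first.
    by apply/funext => x; rewrite big_cons Pi.
  by apply: cintgD => //; exact: h.
rewrite (_ : (fun x => _) = (fun x => \sum_(i <- r | P i) F i x))//.
by apply/funext => x; rewrite big_cons Pi.
Qed.
Lemma tint_sum (I : Type) (r : seq I) (P : pred I) (F : I -> R -> C) :
  (forall i, P i -> cintg (F i)) ->
  tint (fun x => \sum_(i <- r | P i) F i x) = \sum_(i <- r | P i) tint (F i).
Proof.
move=> h; elim: r => [|i r IH].
  rewrite big_nil -[RHS]tint_cst; apply: eq_tint => x _; by rewrite big_nil.
rewrite big_cons; case Pi: (P i).
  rewrite -IH -tintD//; [|exact: h|exact: cintg_sum].
  by apply: eq_tint => x _; rewrite big_cons Pi.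
by rewrite -IH; apply: eq_tint => x _; rewrite big_cons Pi.
Qed.

(** The factor 2 comes from bounding the real and imaginary parts separately; only orders of
    magnitude matter later. *)
Lemma tint_le f (b : R -> R) : cintg f -> rint b ->
  (forall x, period x -> normc (f x) <= b x) -> normc (tint f) <= 2 * rtint b.
Proof.
move=> [fr fi] hb h; apply: le_trans (normc_le_ReIm _) _.
have aux g : rint g -> (forall x, period x -> `|g x| <= b x) -> `|rtint g| <= rtint b.
  move=> hg gb; rewrite ler_norml -rtintN//; apply/andP; split; apply: rtint_le => //.
  - exact: rintN.
  - by move=> x /gb; rewrite ler_norml => /andP[].
  - by move=> x /gb; rewrite ler_norml => /andP[].
rewrite mulr_natl mulr2n; apply: lerD; apply: aux => // x /h; apply: le_trans.
  exact: normc_Re.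
exact: normc_Im.
Qed.
Lemma tint_le_cst f c : cintg f -> (forall x, period x -> normc (f x) <= c) ->
  normc (tint f) <= 2 * c.
Proof.
move=> hf h; rewrite -(rtint_cst c); apply: tint_le => //.
exact/rint_cont/cst_continuous.
Qed.

Lemma tint_deriv (f f' : R -> C) : isd f f' -> ccont f' -> periodic2pi f -> tint f' = 0.
Proof.
move=> hf [cr ci] pf.
have aux (g : R -> R) g' : continuous g' ->
    (forall x : R, is_derive x (1 : R) g (g' x)) -> g pi = g (- pi) -> rtint g' = 0.
  move=> cg' dg e; rewrite /rtint /Rintegral.
  have cg : continuous g.
    move=> x; apply/differentiable_continuous/derivable1_diffP.
    by have [] := dg x.
  rewrite (@continuous_FTC2 R g' g (- pi) pi)//.
  - by rewrite e /= subrr mulr0.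
  - exact: continuous_subspaceT.
  - split; first by move=> x _; have [] := dg x.
      by apply: cvg_at_right_filter; exact: cg.
    by apply: cvg_at_left_filter; exact: cg.
  - by move=> x _; rewrite derive1E; have [_ ->] := dg x.
have e : f pi = f (- pi) by rewrite -(pf (- pi)); congr f; ring.
apply: cext; rewrite /tint/=.
  apply: (aux (Re \o f)) => //=; last by rewrite e.
  by move=> x; have [] := hf x.
apply: (aux (Im \o f)) => //=; last by rewrite e.
by move=> x; have [] := hf x.
Qed.

Lemma periodicM (f g : R -> C) : periodic2pi f -> periodic2pi g ->
  periodic2pi (fun x => f x * g x).
Proof. by move=> pf pg x; rewrite pf pg. Qed.
Lemma periodicJ (f : R -> C) : periodic2pi f -> periodic2pi (fun x => ((f x)^*)%C).
Proof. by move=> pf x; rewrite pf. Qed.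

Lemma tint_by_parts (f f' g g' : R -> C) : isd f f' -> isd g g' -> ccont f' -> ccont g' ->
  periodic2pi f -> periodic2pi g ->
  tint (fun x => f' x * g x) = - tint (fun x => f x * g' x).
Proof.
move=> hf hg cf' cg' pf pg.
have cf := isd_ccont hf; have cg := isd_ccont hg.
apply/eqP; rewrite -subr_eq0 opprK -tintD; last 2 first.
- exact/cintg_cont/ccontM.
- exact/cintg_cont/ccontM.
apply/eqP; apply: tint_deriv (isdM hf hg) _ _; last exact: periodicM.
by apply: ccontD; exact: ccontM.
Qed.

Definition ex (k : int) (x : R) : C := cos (k%:~R * x) +i* sin (k%:~R * x).

Lemma ex0 x : ex 0 x = 1.
Proof. by rewrite /ex mul0r cos0 sin0. Qed.
Lemma exD j k x : ex (j + k) x = ex j x * ex k x.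
Proof.
rewrite /ex intrD mulrDl cosD sinD; apply: cext; rewrite ?ReImE/=; ring.
Qed.
Lemma exN k x : ex (- k) x = ((ex k x)^*)%C.
Proof. by rewrite /ex mulrNz mulNr cosN sinN. Qed.
Lemma normc_ex k x : normc (ex k x) = 1.
Proof. by rewrite /ex /= cos2Dsin2 sqrtr1. Qed.
Lemma exJ k x : ((ex k x)^*)%C = ex (- k) x. Proof. by rewrite exN. Qed.
Lemma isd_ex k : isd (ex k) (fun x => 'i%C * k%:~R * ex k x).
Proof.
have kE : (k%:~R : C) = (k%:~R : R)%:C by rewrite -(rmorph_int (real_complex R)).
have lin (x : R) : is_derive x (1 : R) (fun x : R => k%:~R * x : R) k%:~R.
  by apply: is_derive_eq; rewrite /GRing.scale/= ?mulr1 ?mulr0 ?addr0.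
move=> x; rewrite kE; split.
  rewrite (_ : Re \o _ = cos \o (fun x : R => k%:~R * x))//.
  by apply: is_derive_eq; rewrite !ReImE/=; ring.
rewrite (_ : Im \o _ = sin \o (fun x : R => k%:~R * x))//.
by apply: is_derive_eq; rewrite !ReImE/=; ring.
Qed.
Lemma ccont_ex k : ccont (ex k). Proof. exact: isd_ccont (isd_ex k). Qed.
Lemma periodic_ex k : periodic2pi (ex k).
Proof.
have nat_case (n : nat) x : ex n (x + 2 * pi) = ex n x.
  elim: n => [|n IH]; first by rewrite !ex0.
  rewrite intS !exD IH; congr (_ * _); rewrite /ex !mul1r.
  by rewrite mulr_natl cosD2pi sinD2pi.
move=> x; case: k => n; first exact: nat_case.
by rewrite NegzE !exN nat_case.
Qed.
Lemma tint_ex k : tint (ex k) = (k == 0)%:R.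
Proof.
case: eqP => [->|/eqP k0].
  by rewrite -[RHS]tint_cst; apply: eq_tint => x _; rewrite ex0.
have := tint_deriv (isd_ex k) (ccontM (ccont_cst _) (ccont_ex k)) (@periodic_ex k).
rewrite tintZ; last exact/cintg_cont/ccont_ex.
move=> /eqP; rewrite mulf_eq0 => /orP[|/eqP->//].
rewrite mulf_eq0 intr_eq0 (negbTE k0) orbF => /eqP[]/eqP.
by rewrite oner_eq0.
Qed.
Lemma fourierE (f : R -> C) k : fourier f k = tint (fun x => f x * ex (- k) x).
Proof. by rewrite /fourier; apply: eq_tint => x _; rewrite exN. Qed.

Definition L2sq (f : R -> C) : R := rtint (fun x => normc (f x) ^+ 2).

Lemma L2sq_ge0 f : 0 <= L2sq f.
Proof. by apply: rtint_ge0 => x _; exact: sqr_ge0. Qed.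
Lemma L2sqD (f g : R -> C) : ccont f -> ccont g ->
  L2sq (fun x => f x + g x) <= 2 * (L2sq f + L2sq g).
Proof.
move=> hf hg; rewrite /L2sq -rtintD; last 2 first.
- exact/rint_cont/continuous_sqr_normc.
- exact/rint_cont/continuous_sqr_normc.
rewrite -rtintZ; last first.
  by apply: rintD; exact/rint_cont/continuous_sqr_normc.
apply: rtint_le.
- exact/rint_cont/continuous_sqr_normc/ccontD.
- by apply/rintZ/rintD; exact/rint_cont/continuous_sqr_normc.
move=> x _; rewrite !sqr_normcE !ReImE.
have := sqr_ge0 (Re (f x) - Re (g x)); have := sqr_ge0 (Im (f x) - Im (g x)).
by lra.
Qed.
(** A substitute for Cauchy-Schwarz: pointwise [p q <= (b / a) p^2 / 2 + (a / b) q^2 / 2],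
    integrated with weights tuned to the given L^2 bounds. Dividing by these bounds is why they are
    taken positive. *)
Lemma tintM_le (f g h : R -> C) (a b c : R) : ccont f -> ccont g -> ccont h ->
  L2sq f <= a ^+ 2 -> L2sq g <= b ^+ 2 -> (forall x, period x -> normc (h x) <= c) ->
  0 < a -> 0 < b ->
  normc (tint (fun x => f x * g x * h x)) <= 2 * (a * b * c).
Proof.
move=> cf cg ch hf hg hh a0 b0.
have c0 : 0 <= c.
  by apply: le_trans (hh 0 _); rewrite ?normc_ge0// /period /= in_itv/= oppr_le0 ltW.
have sf := rint_cont (continuous_sqr_normc cf).
have sg := rint_cont (continuous_sqr_normc cg).
apply: le_trans (tint_le (b := fun x => c / 2 * b / a * normc (f x) ^+ 2 +
  c / 2 * a / b * normc (g x) ^+ 2) _ _ _) _.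
- by apply/cintg_cont/ccontM => //; exact: ccontM.
- by apply: rintD; exact: rintZ.
- move=> x /hh hx; rewrite !normc_mul.
  set p := normc (f x); set q := normc (g x).
  have p0 : 0 <= p := normc_ge0 _; have q0 : 0 <= q := normc_ge0 _.
  apply: le_trans (ler_wpM2l (mulr_ge0 p0 q0) hx) _.
  rewrite -subr_ge0 (_ : _ - _ = c / 2 / (a * b) * (b * p - a * q) ^+ 2).
    by rewrite mulr_ge0 ?sqr_ge0// !mulr_ge0 ?invr_ge0// mulr_ge0 ?ltW.
  by field; rewrite !gt_eqF.
rewrite rtintD; [|exact: rintZ|exact: rintZ].
rewrite (rtintZ _ sf) (rtintZ _ sg).
rewrite ler_pM2l//.
have -> : a * b * c = c / 2 * b / a * a ^+ 2 + c / 2 * a / b * b ^+ 2.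
  by field; rewrite !gt_eqF.
have ab x y : 0 < x -> 0 < y -> 0 <= c / 2 * x / y.
  by move=> x0 y0; rewrite !mulr_ge0 ?invr_ge0 ?(ltW x0) ?(ltW y0).
by apply: lerD; apply: ler_wpM2l => //; exact: ab.
Qed.

End TorusIntegral.
Hint Resolve measurable_period : core.

(** * Trigonometric series *)

Section TrigSums.
Context {R : realType}.
Local Notation C := R[i].
Local Notation Re := (@complex.Re R).
Local Notation Im := (@complex.Im R).
Local Notation normc := (@ComplexField.Normc.normc R).

Lemma is_derive_eps (g : R -> R) (x l : R) :
  (forall e : R, 0 < e -> exists2 d, 0 < d & forall h, 0 < `|h| < d ->
     `|g (x + h) - g x - h * l| <= e * `|h|) ->
  is_derive x (1 : R) g l.
Proof.
move=> H.
have cv : h^-1 *: (g (h *: (1 : R) + x) - g x) @[h --> (0 : R)^'] --> l.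
  apply/cvgrPdist_le => e e0; have [d d0 Hd] := H e e0.
  near=> h.
  have h0 : 0 < `|h|.
    by rewrite normr_gt0; near: h; exact: nbhs_dnbhs_neq.
  have hd : `|h| < d.
    by near: h; apply: dnbhs0_lt.
  have := Hd h; rewrite h0 hd => /(_ isT) hh.
  have hne : h != 0 by rewrite -normr_gt0.
  rewrite /GRing.scale/= mulr1 -(ler_pM2r h0) -normrM.
  apply: le_trans hh; rewrite le_eqVlt; apply/orP; left; apply/eqP.
  by rewrite -normrN (addrC h x); congr (`|_|); field.
by apply: DeriveDef; [apply/cvg_ex; exists l|exact: cvg_lim cv].
Unshelve. all: by end_near. Qed.

Lemma unif_continuous (g : R -> R) (gm : nat -> R -> R) :
  (forall m, continuous (gm m)) ->
  (forall e : R, 0 < e -> exists m, forall x, `|gm m x - g x| <= e) ->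
  continuous g.
Proof.
move=> cg H x; apply/cvgrPdist_le => e e0.
have e3 : 0 < e / 3 by rewrite divr_gt0.
have [m Hm] := H _ e3.
have /cvgrPdist_le/(_ _ e3) := cg m x; apply: filterS => y hy.
have := Hm x; have := Hm y; move: hy; rewrite !ler_norml => /andP[? ?] /andP[? ?] /andP[? ?].
by apply/andP; split; lra.
Qed.

Lemma MVT_at (g d : R -> R) (x h : R) : (forall x : R, is_derive x (1 : R) g (d x)) ->
  exists2 y, `|y - x| <= `|h| & g (x + h) - g x = h * d y.
Proof.
move=> Hg.
have cg : continuous g.
  by move=> y; apply/differentiable_continuous/derivable1_diffP; have [] := Hg y.
have [h0|h0|<-] := ltgtP 0 h.
- have [||y] := @MVT R g d x (x + h); first by rewrite ltrDl.
  + exact: continuous_subspaceT.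
  rewrite in_itv/= => /andP[y1 y2] ->; exists y; last by ring.
  by rewrite (gtr0_norm h0) ger0_norm ?subr_ge0 ?(ltW y1)// lerBlDl ltW.
- have [||y] := @MVT R g d (x + h) x; first by rewrite gtrDl.
  + exact: continuous_subspaceT.
  rewrite in_itv/= => /andP[y1 y2] e; exists y.
    by rewrite (ltr0_norm h0) ler0_norm ?subr_le0 ?(ltW y2)//; lra.
  by have -> : h * d y = - (d y * (x - (x + h))); [ring|rewrite -e; ring].
by exists x; rewrite ?subrr ?addr0 ?subrr ?mul0r.
Qed.

Lemma unif_derive (g d : R -> R) (gm dm : nat -> R -> R) :
  (forall m (x : R), is_derive x (1 : R) (gm m) (dm m x)) ->
  (forall e : R, 0 < e -> exists m, forall x, `|gm m x - g x| <= e /\ `|dm m x - d x| <= e) ->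
  continuous d -> forall x : R, is_derive x (1 : R) g (d x).
Proof.
move=> Hm H cd x; apply: is_derive_eps => e e0.
have e4 : 0 < e / 4 by rewrite divr_gt0.
have /cvgrPdist_le/(_ _ e4)/nbhs_ballP[r r0 Hr] := cd x.
exists r => // h /andP[h0 hr].
(* The approximant is chosen after [h]: its values are within [e |h| / 4] of the limit, an error
   that survives division by [h], and its own increment is handled by the mean value theorem. *)
have mn0 : 0 < Num.min (e / 4) (e / 4 * `|h|) by rewrite lt_min e4 mulr_gt0.
have [m M] := H _ mn0.
have [y yx E] := MVT_at x h (Hm m).
have [M1 M1'] := M x; have [M2 M2'] := M (x + h); have [_ M3] := M y.
have Y : `|d x - d y| <= e / 4.
  by apply: Hr; rewrite /ball/= distrC; exact: le_lt_trans yx hr.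
have m1 : Num.min (e / 4) (e / 4 * `|h|) <= e / 4 by rewrite ge_min lexx.
have m2 : Num.min (e / 4) (e / 4 * `|h|) <= e / 4 * `|h| by rewrite ge_min lexx orbT.
have -> : g (x + h) - g x - h * d x =
  (gm m x - g x) - (gm m (x + h) - g (x + h)) + h * ((dm m y - d y) - (d x - d y)).
  have -> : h * ((dm m y - d y) - (d x - d y)) = h * dm m y - h * d x by ring.
  by rewrite -E; ring.
apply: le_trans (ler_normD _ _) _.
have -> : e * `|h| = (e / 4 * `|h| + e / 4 * `|h|) + `|h| * (e / 4 + e / 4) by field.
apply: lerD.
  by apply: le_trans (ler_normB _ _) _; apply: lerD; exact: le_trans _ m2.
rewrite normrM ler_wpM2l//.
by apply: le_trans (ler_normB _ _) _; apply: lerD => //; exact: le_trans _ m1.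
Qed.

(* Sums over the integers k with m <= k < m' or - m' <= k < - m. *)
Definition zs {V : nmodType} (m m' : nat) (g : int -> V) : V :=
  \sum_(m <= j < m') (g (Posz j) + g (Negz j)).

Definition zin (m : nat) (k : int) : bool :=
  match k with Posz j => (j < m)%N | Negz j => (j < m)%N end.

Lemma eq_zs {V : nmodType} m m' (g h : int -> V) : g =1 h -> zs m m' g = zs m m' h.
Proof. by move=> e; apply: eq_bigr => j _; rewrite !e. Qed.
Lemma zs_cat {V : nmodType} m n p (g : int -> V) : (m <= n)%N -> (n <= p)%N ->
  zs m p g = zs m n g + zs n p g.
Proof. by move=> mn np; rewrite /zs (big_cat_nat mn np). Qed.
Lemma zsD {V : nmodType} m m' (g h : int -> V) :
  zs m m' (fun k => g k + h k) = zs m m' g + zs m m' h.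
Proof. by rewrite /zs -big_split; apply: eq_bigr => j _; rewrite addrACA. Qed.
Lemma zsZ (V : pzRingType) m m' (a : V) (g : int -> V) :
  zs m m' (fun k => a * g k) = a * zs m m' g.
Proof. by rewrite /zs big_distrr; apply: eq_bigr => j _ /=; rewrite mulrDr. Qed.
Lemma zsN (V : zmodType) m m' (g : int -> V) :
  zs m m' (fun k => - g k) = - zs m m' g.
Proof. by rewrite /zs -sumrN; apply: eq_bigr => j _; rewrite opprD. Qed.
Lemma zs_geq {V : nmodType} m m' (g : int -> V) : (m' <= m)%N -> zs m m' g = 0.
Proof. by move=> h; rewrite /zs big_geq. Qed.
Lemma zs_le m m' (g h : int -> R) : (forall k, ~~ zin m k -> g k <= h k) ->
  zs m m' g <= zs m m' h.
Proof.
move=> gh; rewrite /zs big_nat_cond [leRHS]big_nat_cond; apply: ler_sum => j /andP[/andP[mj _] _].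
by apply: lerD; apply: gh; rewrite /= -leqNgt.
Qed.
Lemma zs_ge0 m m' (g : int -> R) : (forall k, 0 <= g k) -> 0 <= zs m m' g.
Proof. by move=> h; apply: sumr_ge0 => j _; rewrite addr_ge0. Qed.
Lemma zs_sub m n p q (g : int -> R) : (forall k, 0 <= g k) ->
  (m <= n)%N -> (p <= q)%N -> zs n p g <= zs m q g.
Proof.
move=> g0 mn pq; case: (leqP n p) => np; last by rewrite zs_geq ?zs_ge0// ltnW.
rewrite (zs_cat _ mn (leq_trans np pq)) (zs_cat _ np pq).
by have := zs_ge0 m n g0; have := zs_ge0 p q g0; lra.
Qed.
Lemma normc_zs m m' (g : int -> C) : normc (zs m m' g) <= zs m m' (normc \o g).
Proof.
apply: le_trans (normc_sum _ _ _) _; apply: ler_sum => j _; exact: normc_add.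
Qed.
Lemma zs_mem (m : nat) (k : int) (g : int -> R) : (forall k, 0 <= g k) -> zin m k ->
  g k <= zs 0 m g.
Proof.
move=> g0; case: k => j /= jm; rewrite /zs (bigD1_seq j) ?mem_index_iota ?iota_uniq//=.
  by rewrite -addrA lerDl addr_ge0// sumr_ge0// => i _; rewrite addr_ge0.
by rewrite addrAC lerDr addr_ge0// sumr_ge0// => i _; rewrite addr_ge0.
Qed.
Lemma zs_delta (V : pzRingType) m k (g : int -> V) :
  zs 0 m (fun j => g j * (j == k)%:R) = if zin m k then g k else 0.
Proof.
rewrite /zs; case: k => n /=; case: ltnP => nm.
- rewrite (bigD1_seq n) ?mem_index_iota ?iota_uniq//= eqxx mulr1 mulr0 addr0.
  rewrite big1 ?addr0// => j /negbTE jn.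
  by rewrite (_ : (Posz j == Posz n) = (j == n))// jn !mulr0 addr0.
- rewrite big_nat big1// => j /andP[_ jm].
  by rewrite (_ : (Posz j == Posz n) = (j == n))// ltn_eqF ?(leq_trans jm)// !mulr0 addr0.
- rewrite (bigD1_seq n) ?mem_index_iota ?iota_uniq//= eqxx mulr1 mulr0 add0r.
  rewrite big1 ?addr0// => j /negbTE jn.
  by rewrite (_ : (Negz j == Negz n) = (j == n))// jn !mulr0 addr0.
- rewrite big_nat big1// => j /andP[_ jm].
  by rewrite (_ : (Negz j == Negz n) = (j == n))// ltn_eqF ?(leq_trans jm)// !mulr0 addr0.
Qed.

Definition Tz (m m' : nat) (c : int -> C) (x : R) : C := zs m m' (fun k => c k * ex k x).
(** Differentiation on the Fourier side. It commutes with truncation, so [Tz m m' (Dz c)] is the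
    derivative of [Tz m m' c]. *)
Definition Dz (c : int -> C) (k : int) : C := 'i%C * k%:~R * c k.

Lemma ccont_Tz m m' c : ccont (Tz m m' c).
Proof.
apply: ccont_sum => j _; apply: ccontD; apply: ccontM; try exact: ccont_cst; exact: ccont_ex.
Qed.
Lemma periodic_Tz m m' c : periodic2pi (Tz m m' c).
Proof. by move=> x; apply: eq_zs => k; rewrite periodic_ex. Qed.
Lemma isd_Tz m m' c : isd (Tz m m' c) (Tz m m' (Dz c)).
Proof.
apply: isd_sum => j _; apply: isdD.
  by apply: isd_ext (isdZ (c (Posz j)) (isd_ex (Posz j))) => x //; rewrite /Dz; ring.
by apply: isd_ext (isdZ (c (Negz j)) (isd_ex (Negz j))) => x //; rewrite /Dz; ring.
Qed.
Lemma Tz_cat m n p c x : (m <= n)%N -> (n <= p)%N -> Tz m p c x = Tz m n c x + Tz n p c x.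
Proof. exact: zs_cat. Qed.
Lemma normc_Tz m m' c x : normc (Tz m m' c x) <= zs m m' (normc \o c).
Proof.
apply: le_trans (normc_zs _ _ _) _; apply: zs_le => k _ /=.
by rewrite normc_mul normc_ex mulr1.
Qed.
Lemma tint_Tz m m' c (f : R -> C) : ccont f ->
  tint (fun x => Tz m m' c x * f x) = zs m m' (fun k => c k * tint (fun x => ex k x * f x)).
Proof.
move=> cf; have ce k : ccont (fun x => c k * (ex k x * f x)).
  by apply: ccontM (ccont_cst _) (ccontM (ccont_ex _) cf).
rewrite (eq_tint (g := fun x => \sum_(m <= j < m')
   (c (Posz j) * (ex (Posz j) x * f x) + c (Negz j) * (ex (Negz j) x * f x)))).
  rewrite tint_sum => [|j _]; last by apply: cintgD; apply/cintg_cont.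
  apply: eq_bigr => j _; rewrite tintD; try exact: cintg_cont.
  by rewrite !tintZ//; apply/cintg_cont/(ccontM (ccont_ex _)).
move=> x _; rewrite /Tz /zs big_distrl; apply: eq_bigr => j _ /=; ring.
Qed.
Lemma fourier_Tz m c k : fourier (Tz 0 m c) k = if zin m k then c k else 0.
Proof.
rewrite fourierE tint_Tz; last exact: ccont_ex.
rewrite -zs_delta; apply: eq_zs => j; congr (_ * _).
rewrite (eq_tint (g := ex (j - k))); last by move=> x _; rewrite exD.
by rewrite tint_ex subr_eq0.
Qed.
Lemma L2sqE (f : R -> C) : ccont f -> (L2sq f)%:C = tint (fun x => f x * ((f x)^*)%C).
Proof.
move=> cf; apply: cext; rewrite /tint /L2sq /=.
  by apply: eq_rtint => x _; rewrite /= sqr_normcE !ReImE; ring.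
rewrite (_ : _ \o _ = fun=> 0) ?rtint_cst//.
by apply/funext => x /=; rewrite !ReImE; ring.
Qed.
Lemma mulJ_normc (z : C) : z * (z^*)%C = (normc z ^+ 2)%:C.
Proof. by apply: cext; rewrite !ReImE /= ?sqr_normcE; ring. Qed.
Lemma zs_real m m' (g : int -> R) : zs m m' (fun k => (g k)%:C : C) = (zs m m' g)%:C.
Proof.
rewrite /zs (rmorph_sum (real_complex R)); apply: eq_bigr => j _.
by rewrite (rmorphD (real_complex R)).
Qed.
Lemma tint_TzJ m m' c k : tint (fun x => ex k x * ((Tz m m' c x)^*)%C) =
  ((zs m m' (fun j => c j * (j == k)%:R))^*)%C.
Proof.
transitivity ((tint (fun x => Tz m m' c x * ex (- k) x))^*)%C.
  rewrite -tintJ; last by apply/cintg_cont/(ccontM (ccont_Tz _ _ _))/ccont_ex.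
  by apply: eq_tint => x _; rewrite conjcM exJ opprK mulrC.
rewrite tint_Tz; last exact: ccont_ex.
congr (_^*)%C; apply: eq_zs => j; congr (_ * _).
rewrite (eq_tint (g := ex (j - k))); last by move=> x _; rewrite exD.
by rewrite tint_ex subr_eq0.
Qed.
Lemma L2sq_Tz0 m c : L2sq (Tz 0 m c) = zs 0 m (fun k => normc (c k) ^+ 2).
Proof.
apply: complexI; rewrite L2sqE; last exact: ccont_Tz.
rewrite tint_Tz; last exact/ccontJ/ccont_Tz.
rewrite -zs_real; rewrite /zs big_nat [RHS]big_nat; apply: eq_bigr => j /andP[_ jm].
by rewrite !tint_TzJ !zs_delta /= jm !mulJ_normc.
Qed.
Lemma L2sq_Tz m m' c : L2sq (Tz m m' c) = zs m m' (fun k => normc (c k) ^+ 2).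
Proof.
case: (leqP m m') => mm'; last first.
  rewrite zs_geq 1?ltnW//; rewrite /L2sq -[RHS]rtint_cst; apply: eq_rtint => x _.
  by rewrite /Tz zs_geq 1?ltnW// normc_zero expr0n.
(* Erasing the coefficients below [m] reduces the claim to windows that start at 0. *)
pose c' k := if zin m k then 0 else c k.
have z0 j : (j < m)%N -> c' (Posz j) = 0 /\ c' (Negz j) = 0.
  by move=> jm; rewrite /c' /= jm.
have z1 j : (m <= j)%N -> c' (Posz j) = c (Posz j) /\ c' (Negz j) = c (Negz j).
  by move=> jm; rewrite /c' /= ltnNge jm.
transitivity (L2sq (Tz 0 m' c')).
  apply: eq_rtint => x _; congr (normc _ ^+ 2).
  rewrite (Tz_cat _ _ (leq0n m) mm') [X in _ = X + _](_ : _ = 0) ?add0r.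
    rewrite /Tz /zs big_nat [RHS]big_nat; apply: eq_bigr => j /andP[/z1[-> ->]] //.
  by rewrite /Tz /zs big_nat big1// => j /andP[_ /z0[-> ->]]; rewrite !mul0r addr0.
rewrite L2sq_Tz0 (zs_cat _ (leq0n m) mm') [X in X + _](_ : _ = 0) ?add0r.
  rewrite /zs big_nat [RHS]big_nat; apply: eq_bigr => j /andP[/z1[-> ->]] //.
rewrite /zs big_nat big1// => j /andP[_ /z0[-> ->]].
by rewrite normc_zero expr0n/= addr0.
Qed.
(** The partial sum is the orthogonal projection of [f]: both cross terms and its own square equal
    [S], so the squared distance between the two is [L2sq f - S]. *)
Lemma bessel (f : R -> C) m : ccont f -> zs 0 m (fun k => normc (fourier f k) ^+ 2) <= L2sq f.
Proof.
move=> cf; set c := fourier f; set S := zs _ _ _.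
have cT := ccont_Tz 0 m c.
have cross : tint (fun x => Tz 0 m c x * ((f x)^*)%C) = S%:C.
  rewrite tint_Tz; last exact: ccontJ.
  rewrite /S -zs_real; apply: eq_zs => k; rewrite -mulJ_normc; congr (_ * _).
  rewrite /c fourierE -tintJ; last by apply/cintg_cont/(ccontM cf)/ccont_ex.
  by apply: eq_tint => x _; rewrite conjcM exJ opprK mulrC.
have cross' : tint (fun x => f x * ((Tz 0 m c x)^*)%C) = S%:C.
  transitivity ((S%:C)^*)%C; last by apply: cext; rewrite ?ReImE/= ?oppr0.
  rewrite -cross -tintJ; last by apply/cintg_cont/(ccontM cT)/ccontJ.
  by apply: eq_tint => x _; rewrite conjcM conjcK mulrC.
have self : tint (fun x => Tz 0 m c x * ((Tz 0 m c x)^*)%C) = S%:C.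
  by rewrite -L2sqE// L2sq_Tz0.
have : (L2sq (fun x => f x - Tz 0 m c x))%:C = (L2sq f - S)%:C.
  rewrite L2sqE; last exact: ccontB.
  rewrite (eq_tint (g := fun x => (f x * ((f x)^*)%C - f x * ((Tz 0 m c x)^*)%C) -
    (Tz 0 m c x * ((f x)^*)%C - Tz 0 m c x * ((Tz 0 m c x)^*)%C))); last first.
    by move=> x _; rewrite (rmorphB (@conjc R)); ring.
  have fJ := ccontJ cf; have TJ := ccontJ cT.
  rewrite tintB; last 2 first.
  - by apply/cintg_cont/ccontB; exact: ccontM.
  - by apply/cintg_cont/ccontB; exact: ccontM.
  rewrite tintB; [|exact/cintg_cont/ccontM|exact/cintg_cont/ccontM].
  rewrite tintB; [|exact/cintg_cont/ccontM|exact/cintg_cont/ccontM].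
  by rewrite -L2sqE// cross cross' self subrr subr0 (rmorphB (real_complex R)).
move=> /complexI E; have := L2sq_ge0 (fun x => f x - Tz 0 m c x).
by rewrite E subr_ge0.
Qed.

End TrigSums.

(** * Uniformly convergent Fourier series *)

Section UniformSeries.
Context {R : realType}.
Local Notation C := R[i].
Local Notation Re := (@complex.Re R).
Local Notation Im := (@complex.Im R).
Local Notation normc := (@ComplexField.Normc.normc R).

(** Uniform convergence of the partial sums on the whole line. It determines [f] at every point,
    whereas Fourier coefficients alone determine a function only almost everywhere. *)
Definition ulim (f : R -> C) (c : int -> C) := forall e : R, 0 < e ->
  exists M, forall m, (M <= m)%N -> forall x, normc (f x - Tz 0 m c x) <= e.

Lemma ulim_ccont f c : ulim f c -> ccont f.
Proof.
move=> H; have [cT dT] : (forall m, continuous (Re \o Tz 0 m c)) /\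
    (forall m, continuous (Im \o Tz 0 m c)).
  by split=> m; have [] := ccont_Tz 0 m c.
split.
  apply: (unif_continuous cT) => e /H[M hM]; exists M => x.
  by have := hM _ (leqnn M) x; apply: le_trans; rewrite distrC -ReN -ReD normc_Re.
apply: (unif_continuous dT) => e /H[M hM]; exists M => x.
by have := hM _ (leqnn M) x; apply: le_trans; rewrite distrC -ImN -ImD normc_Im.
Qed.
Lemma normc_small (z : C) (k : R) : 0 <= k -> (forall e, 0 < e -> normc z <= k * e) -> z = 0.
Proof.
move=> k0 H; apply: normc_eq0; apply/eqP; rewrite eq_le normc_ge0 andbT.
apply/ler_addgt0Pl => e e0; rewrite addr0.
have k1 : 0 < k + 1 by apply: ltr_wpDl.
apply: le_trans (H (e / (k + 1)) _) _; first exact: divr_gt0.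
by rewrite mulrCA ler_piMr ?(ltW e0)// ler_pdivrMr// mul1r lerDl.
Qed.
Lemma ulim_periodic f c : ulim f c -> periodic2pi f.
Proof.
move=> H x; apply/eqP; rewrite -subr_eq0; apply/eqP.
apply: (@normc_small _ 2) => // e /H[M hM].
rewrite (_ : _ - _ = (f (x + 2 * pi) - Tz 0 M c (x + 2 * pi)) -
  (f x - Tz 0 M c x)); last by rewrite periodic_Tz; ring.
have -> : 2 * e = e + e by ring.
by apply: le_trans (normc_sub _ _) _; apply: lerD; exact: hM.
Qed.
Lemma fourierB (f g : R -> C) k : cintg (fun x => f x * ex (- k) x) ->
  cintg (fun x => g x * ex (- k) x) ->
  fourier (fun x => f x - g x) k = fourier f k - fourier g k.
Proof.
move=> hf hg; rewrite !fourierE -tintB//; apply: eq_tint => x _; ring.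
Qed.
(** A partial sum long enough to contain [k] has [k]-th coefficient exactly [c k], and a uniform
    error [e] moves a coefficient by at most [2 e]. *)
Lemma ulim_fourier f c k : ulim f c -> fourier f k = c k.
Proof.
move=> H; apply/eqP; rewrite -subr_eq0; apply/eqP.
have cf := ulim_ccont H.
apply: (@normc_small _ 2) => // e /H[M hM].
pose m := maxn M (absz k).+1.
have zk : zin m k by rewrite /m /zin; clear m; case: k => n /=; rewrite leq_max; apply/orP; right; rewrite /absz ?leqnSn ?ltnSn.
have := fourier_Tz m c k; rewrite zk => <-.
rewrite -fourierB; last 2 first.
- exact/cintg_cont/(ccontM cf)/ccont_ex.
- exact/cintg_cont/(ccontM (ccont_Tz _ _ _))/ccont_ex.
rewrite fourierE; apply: tint_le_cst.
  by apply/cintg_cont/ccontM; [exact/ccontB/ccont_Tz|exact: ccont_ex].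
by move=> x _; rewrite normc_mul normc_ex mulr1; apply: hM; exact: leq_maxl.
Qed.
Lemma ulim_isd f f' c : ulim f c -> ulim f' (Dz c) -> isd f f'.
Proof.
move=> H H' x; have [cr ci] := ulim_ccont H'.
have both e : 0 < e -> exists m, forall x, normc (f x - Tz 0 m c x) <= e /\
    normc (f' x - Tz 0 m (Dz c) x) <= e.
  move=> e0; have [M hM] := H e e0; have [M' hM'] := H' e e0.
  exists (maxn M M') => y; split; [apply: hM|apply: hM'].
    exact: leq_maxl.
  exact: leq_maxr.
split.
  apply: (@unif_derive _ _ (Re \o f') (fun m => Re \o Tz 0 m c)
    (fun m => Re \o Tz 0 m (Dz c))) => //.
    by move=> m y; have [] := isd_Tz 0 m c y.
  move=> e /both[m hm]; exists m => y; have [h1 h2] := hm y.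
  by split; [apply: le_trans h1|apply: le_trans h2]; rewrite distrC -ReN -ReD normc_Re.
apply: (@unif_derive _ _ (Im \o f') (fun m => Im \o Tz 0 m c)
  (fun m => Im \o Tz 0 m (Dz c))) => //.
  by move=> m y; have [] := isd_Tz 0 m c y.
move=> e /both[m hm]; exists m => y; have [h1 h2] := hm y.
by split; [apply: le_trans h1|apply: le_trans h2]; rewrite distrC -ImN -ImD normc_Im.
Qed.
Lemma ulim_tail f c m r x : ulim f c -> (forall m', zs m m' (normc \o c) <= r) ->
  normc (f x - Tz 0 m c x) <= r.
Proof.
move=> H hr; apply/ler_addgt0Pl => e /H[M hM].
pose p := maxn M m.
rewrite (_ : _ - _ = (f x - Tz 0 p c x) + Tz m p c x); last first.
  by rewrite (Tz_cat c x (leq0n m) (leq_maxr M m)); ring.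
apply: le_trans (normc_add _ _) _; apply: lerD.
  by apply: hM; exact: leq_maxl.
exact: le_trans (normc_Tz _ _ _ _) (hr _).
Qed.
Lemma ulim_sup f c r x : ulim f c -> (forall m', zs 0 m' (normc \o c) <= r) ->
  normc (f x) <= r.
Proof.
move=> H hr; have := ulim_tail x H hr.
by rewrite /Tz zs_geq// subr0.
Qed.
(** The remainder is a finite sum, whose L^2 norm is known exactly, plus a uniformly small function;
    separating the two costs the factor 2. *)
Lemma ulim_L2 f c m B : ulim f c -> (forall m', zs m m' (fun k => normc (c k) ^+ 2) <= B) ->
  L2sq (fun x => f x - Tz 0 m c x) <= 2 * B.
Proof.
move=> H hr; have cf := ulim_ccont H.
apply/ler_addgt0Pl => e e0.
have e2 : 0 < Num.min 1 (e / 2) by rewrite lt_min ltr01 divr_gt0.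
have [M hM] := H _ e2.
pose p := maxn M m.
rewrite (_ : (fun x => _) = (fun x => (f x - Tz 0 p c x) + Tz m p c x)); last first.
  apply/funext => x; rewrite (Tz_cat c x (leq0n m) (leq_maxr M m)); ring.
have cT := ccont_Tz m p c; have cb := ccontB cf (ccont_Tz 0 p c).
apply: le_trans (L2sqD cb cT) _.
rewrite L2sq_Tz mulrDr; apply: lerD; last by rewrite ler_pM2l.
have -> : e = 2 * (e / 2) by field.
rewrite ler_pM2l//.
rewrite -(@rtint_cst R (e / 2)); apply: rtint_le.
- exact/rint_cont/continuous_sqr_normc.
- exact/rint_cont/cst_continuous.
move=> x _; have := hM p (leq_maxl _ _) x; rewrite le_min => /andP[h1 h2].
apply: le_trans h2; rewrite expr2 ler_piMl ?normc_ge0//.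
Qed.
Lemma ulimB f g c d : ulim f c -> ulim g d ->
  ulim (fun x => f x - g x) (fun k => c k - d k).
Proof.
move=> H H' e e0; have e2 : 0 < e / 2 by rewrite divr_gt0.
have [M hM] := H _ e2; have [M' hM'] := H' _ e2.
exists (maxn M M') => m; rewrite geq_max => /andP[m1 m2] x.
rewrite (_ : _ - _ = (f x - Tz 0 m c x) - (g x - Tz 0 m d x)).
  apply: le_trans (normc_sub _ _) _.
  by rewrite [leRHS](splitr e); apply: lerD; [exact: hM|exact: hM'].
rewrite /Tz (@eq_zs C _ _ _ (fun k => c k * ex k x + - (d k * ex k x))).
  by rewrite zsD zsN; ring.
by move=> k; ring.
Qed.

Lemma cauchy_eps_cvg (u : nat -> R) (r : nat -> R) :
  (forall e, 0 < e -> exists M, forall m, (M <= m)%N -> r m <= e) ->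
  (forall m m', (m <= m')%N -> `|u m' - u m| <= r m) ->
  forall m, `|lim (u n @[n --> \oo]) - u m| <= r m.
Proof.
move=> hr hu m.
have cu : cvg (u n @[n --> \oo]).
  apply: cauchy_cvg; apply: cauchy_exP => e /= e0.
  have [M hM] := hr _ (divr_gt0 e0 (ltr0Sn R 1)).
  exists (u M); exists M => // n /= Mn; rewrite /ball/= distrC.
  apply: le_lt_trans (hu _ _ Mn) _; apply: le_lt_trans (hM _ (leqnn _)) _.
  by rewrite gtr_pMr// invf_lt1// ltr1n.
have := cu => /(@cvgr_dist_le _ _ _ _ _ _ _) H.
apply/ler_addgt0Pl => e e0; have [M _ HM] := H _ e0.
have := HM (maxn M m) (leq_maxl _ _) => /= h1.
have h2 := hu _ _ (leq_maxr M m).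
rewrite (_ : _ - _ = (lim (u n @[n --> \oo]) - u (maxn M m)) +
   (u (maxn M m) - u m)); last by ring.
by apply: le_trans (ler_normD _ _) _; exact: lerD.
Qed.

(** The sum of the Fourier series with coefficients [c]. The limits have no meaning when the partial
    sums diverge, so [syn c] is always accompanied by a proof of [ulim (syn c) c]. *)
Definition syn (c : int -> C) (x : R) : C :=
  lim ((fun n => Re (Tz 0 n c x)) n @[n --> \oo]) +i*
  lim ((fun n => Im (Tz 0 n c x)) n @[n --> \oo]).

(** The Weierstrass test, with [r] a majorant of the tails of the series of moduli. *)
Lemma ulim_syn c (r : nat -> R) :
  (forall e, 0 < e -> exists M, forall m, (M <= m)%N -> r m <= e) ->
  (forall m m', (m <= m')%N -> zs m m' (normc \o c) <= r m) -> ulim (syn c) c.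
Proof.
move=> hr hc e e0; have [M hM] := hr _ (divr_gt0 e0 (ltr0Sn R 1)).
have step m m' x : (m <= m')%N -> normc (Tz 0 m' c x - Tz 0 m c x) <= r m.
  move=> mm'; rewrite (Tz_cat c x (leq0n m) mm') addrAC subrr add0r.
  exact: le_trans (normc_Tz _ _ _ _) (hc _ _ mm').
exists M => m Mm x; apply: le_trans (normc_le_ReIm _) _.
rewrite (splitr e); apply: lerD; apply: le_trans (hM _ Mm); rewrite !ReImE /=.
  apply: (cauchy_eps_cvg (u := fun n => Re (Tz 0 n c x)) hr) => p q pq.
  by rewrite -ReN -ReD; apply: le_trans (normc_Re _) (step _ _ _ pq).
apply: (cauchy_eps_cvg (u := fun n => Im (Tz 0 n c x)) hr) => p q pq.
by rewrite -ImN -ImD; apply: le_trans (normc_Im _) (step _ _ _ pq).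
Qed.

End UniformSeries.

(** * Uniqueness of the Fourier coefficients of a continuous function *)

Section Uniqueness.
Context {R : realType}.
Local Notation C := R[i].
Local Notation Re := (@complex.Re R).
Local Notation Im := (@complex.Im R).
Local Notation normc := (@ComplexField.Normc.normc R).

Lemma isdX (f f' : R -> C) n : isd f f' ->
  isd (fun x => f x ^+ n) (fun x => n%:R * f x ^+ n.-1 * f' x).
Proof.
move=> hf; elim: n => [|n IH].
  by apply: isd_ext (isd_cst 1) => x; rewrite ?expr0 ?mul0r.
apply: isd_ext (isdM hf IH) => x; first by rewrite exprS.
rewrite -[n.+1.-1]/n; case: n {IH} => [|n]; first by rewrite expr0; ring.
by rewrite /= !exprS -[in RHS]addn1 natrD; ring.
Qed.
Lemma ccontX (f : R -> C) n : ccont f -> ccont (fun x => f x ^+ n).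
Proof.
move=> cf; elim: n => [|n IH].
  rewrite (_ : (fun x => _) = fun=> 1); first exact: ccont_cst.
  by apply/funext => x; rewrite expr0.
rewrite (_ : (fun x => _) = fun x => f x * f x ^+ n); first exact: ccontM.
by apply/funext => x; rewrite exprS.
Qed.

(* The kernel [cos ((x - x0) / 2) ^ (2 n)], which concentrates at [x0]. *)
Definition ker (x0 x : R) : R := cos ((x - x0) / 2) ^+ 2.

(** With [th = x - x0], the functions [ker_exp], [ker_sin] and [ker_c] are [exp (i th)], [sin th]
    and [cos (th / 2) ^ 2], written through characters; [ker_c] is thus a complex form of [ker] that
    is visibly a trigonometric polynomial. *)
Definition ker_exp (x0 x : R) : C := ex 1 x * ex (- 1) x0.
Local Notation E := ker_exp.
Definition ker_sin (x0 x : R) : C := (E x0 x - ((E x0 x)^*)%C) / (2 * 'i%C).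
Local Notation S := ker_sin.
Definition ker_c (x0 x : R) : C := (2 + E x0 x + ((E x0 x)^*)%C) / 4.
Local Notation Q := ker_c.

Lemma ker_expE (x0 x : R) : E x0 x = cos (x - x0) +i* sin (x - x0).
Proof.
rewrite /ker_exp exN /ex cosB sinB !mul1r; apply: cext; rewrite ?ReImE/=; ring.
Qed.
Lemma ker_cos (x0 x : R) : ker x0 x = (1 + cos (x - x0)) / 2.
Proof.
rewrite /ker; have {2}-> : x - x0 = (x - x0) / 2 + (x - x0) / 2 by field.
by rewrite cosD -!expr2 sin2cos2; field.
Qed.
Lemma ker_cE (x0 x : R) : Q x0 x = (ker x0 x)%:C.
Proof.
rewrite ker_cos /ker_c ker_expE; have -> : (4 : C)^-1 = ((4 : R)^-1)%:C.
  by rewrite (fmorphV (real_complex R)) (rmorph_nat (real_complex R)).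
have -> : (2 : C) = (2 : R)%:C by rewrite (rmorph_nat (real_complex R)).
apply: cext; rewrite ?ReImE/=; last by ring.
by field.
Qed.
Lemma isd_ker_exp x0 : isd (E x0) (fun x => 'i%C * E x0 x).
Proof.
apply: isd_ext (isdM (isd_ex 1) (isd_cst (ex (-1) x0))) => x //.
by rewrite /ker_exp; ring.
Qed.
Lemma i_sqr : 'i%C * 'i%C = -1 :> C. Proof. by rewrite -expr2 sqr_i. Qed.
Lemma i_neq0 : 'i%C != 0 :> C.
Proof. by rewrite eq_complex/= eqxx oner_eq0. Qed.
Lemma isd_ker_c x0 : isd (Q x0) (fun x => - S x0 x / 2).
Proof.
have h := isdZ (4^-1) (isdD (isdD (isd_cst 2) (isd_ker_exp x0)) (isdJ (isd_ker_exp x0))).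
apply: isd_ext h => x; rewrite /ker_c /ker_sin; first by rewrite mulrC.
have -> : (('i%C * E x0 x)^*)%C = - 'i%C * ((E x0 x)^*)%C.
  by rewrite conjcM; congr (_ * _); apply: cext; rewrite /= ?oppr0.
have -> : (2 * 'i%C)^-1 = - 'i%C / 2 :> C.
  by rewrite invfM mulrC; congr (_ / _); apply: (mulfI i_neq0); rewrite mulfV ?i_neq0// mulrN i_sqr opprK.
by field.
Qed.
Lemma isd_ker_sin x0 : isd (S x0) (fun x => 2 * Q x0 x - 1).
Proof.
have h := isdZ ((2 * 'i%C)^-1) (isdB (isd_ker_exp x0) (isdJ (isd_ker_exp x0))).
apply: isd_ext h => x; rewrite /ker_c /ker_sin; first by rewrite mulrC.
have -> : (('i%C * E x0 x)^*)%C = - 'i%C * ((E x0 x)^*)%C.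
  by rewrite conjcM; congr (_ * _); apply: cext; rewrite /= ?oppr0.
by field; rewrite i_neq0.
Qed.
Lemma ker_sin_sqr x0 x : S x0 x * S x0 x = 4 * Q x0 x * (1 - Q x0 x).
Proof.
have h : E x0 x * ((E x0 x)^*)%C = 1.
  by rewrite mulJ_normc /ker_exp normc_mul !normc_ex mulr1 expr1n.
rewrite /ker_sin /ker_c.
set e := E x0 x in h *; set e' := (e^*)%C in h *.
have -> : (e - e') / (2 * 'i%C) * ((e - e') / (2 * 'i%C)) =
   ((e - e') * (e - e')) / (4 * ('i%C * 'i%C)) by field; rewrite i_neq0.
rewrite i_sqr (_ : (e - e') * (e - e') = e * e + e' * e' - 2 * (e * e')); last by ring.
have -> : 4 * ((2 + e + e') / 4) * (1 - (2 + e + e') / 4) =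
   (4 - (e * e + e' * e' + 2 * (e * e'))) / 4 by field.
by rewrite h; field.
Qed.

Lemma ccont_ker_c x0 : ccont (Q x0). Proof. exact: isd_ccont (isd_ker_c x0). Qed.
Lemma continuous_kerX x0 n : continuous (fun x => ker x0 x ^+ n).
Proof.
rewrite (_ : (fun x => _) = Re \o (fun x => Q x0 x ^+ n)).
  by have [] := ccontX n (ccont_ker_c x0).
by apply/funext => x /=; rewrite ker_cE -(rmorphXn (real_complex R)).
Qed.

(** The derivative of [ker ^ n] times [sin (x - x0)] has integral 0 over a period; since the squared
    sine is [4 ker (1 - ker)], this is a Wallis recursion. The ratio [1 - 1 / (2 n + 2)] tends to 1,
    that is, the mass of [ker ^ n] concentrates where [ker] is close to 1. *)
Lemma rtint_kerS x0 n : rtint (fun x => ker x0 x ^+ n.+1) =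
  (2 * n%:R + 1) / (2 * n%:R + 2) * rtint (fun x => ker x0 x ^+ n).
Proof.
have hd := isdM (isdX n (isd_ker_c x0)) (isd_ker_sin x0).
have pE : periodic2pi (E x0) by move=> x; rewrite /ker_exp periodic_ex.
have pQ : periodic2pi (Q x0) by move=> x; rewrite /ker_c pE.
have pS : periodic2pi (S x0) by move=> x; rewrite /ker_sin pE.
have d2 : (2 * n%:R + 2 : R) != 0 by rewrite gt_eqF// ltr_wpDl// mulr_ge0.
have : isd (fun x => Q x0 x ^+ n * S x0 x)
   (fun x => ((2 * n%:R + 2) * ker x0 x ^+ n.+1 - (2 * n%:R + 1) * ker x0 x ^+ n)%:C).
  apply: isd_ext hd => x //.
  have -> : n%:R * Q x0 x ^+ n.-1 * (- S x0 x / 2) * S x0 x =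
     - n%:R * Q x0 x ^+ n.-1 * (S x0 x * S x0 x) / 2 by ring.
  rewrite ker_sin_sqr.
  have -> : - n%:R * Q x0 x ^+ n.-1 * (4 * Q x0 x * (1 - Q x0 x)) / 2 =
     - n%:R * 2 * Q x0 x ^+ n * (1 - Q x0 x).
    case: (n) => [|k]; first by rewrite oppr0 !mul0r.
    by rewrite /= exprS; field.
  rewrite ker_cE !(rmorphB, rmorphM, rmorphD, rmorphXn, rmorph_nat, rmorph1) /= exprS.
  by ring.
move=> hF; have ck m : continuous (fun x => ker x0 x ^+ m) by exact: continuous_kerX.
pose F x := (2 * n%:R + 2) * ker x0 x ^+ n.+1 - (2 * n%:R + 1) * ker x0 x ^+ n.
have cF : continuous F.
  move=> x; apply: (@continuousB _ _ _ _ _ x);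
  by apply: (@continuousM _ _ _ _ x); [exact: cst_continuous|exact: ck].
have := tint_deriv hF.
rewrite -[fun x => _%:C]/(fun x => (F x)%:C) => /(_ _ _)/(congr1 Re) /= H.
have {H} : rtint F = 0.
  apply: H; first by split => //; exact: cst_continuous.
  by apply: periodicM => // x; rewrite pQ.
have i m : rint (fun x => ker x0 x ^+ m) by exact/rint_cont/ck.
rewrite /F; under eq_fun do rewrite -mulNr.
rewrite rtintD ?rtintZ//; [|exact: rintZ|exact: rintZ].
move=> /eqP; rewrite mulNr subr_eq0 => /eqP e.
by apply: (mulfI d2); rewrite e; field.
Qed.

(** Suppose [a = g x0 > 0]. Then [g >= a / 2 - K (1 - ker)] on the period: near [x0] because
    [g >= a / 2], elsewhere because [1 - ker >= eta] and [K eta = |min g| + a]. Integrating against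
    [ker ^ n] and using the recursion gives [a / 2 <= K / (2 n + 2)], false for large [n]. *)
Lemma uniq_real (g : R -> R) (x0 : R) : continuous g -> - pi < x0 < pi ->
  (forall n, rtint (fun x => g x * ker x0 x ^+ n) = 0) -> g x0 <= 0.
Proof.
move=> cg /andP[x1 x2] Hg; rewrite leNgt; apply/negP => a0.
set a := g x0 in a0.
have pp : - pi <= pi :> R by apply: (ltW (lt_trans x1 x2)).
have [m1 _ gm1] := EVT_min pp (continuous_subspaceT cg).
have [d d0 hd] : exists2 d, 0 < d & forall x, `|x0 - x| < d -> a / 2 <= g x.
  have /cvgrPdist_le/(_ _ (divr_gt0 a0 (ltr0Sn R 1)))/nbhs_ballP[d d0 hd] := cg x0.
  exists d => // x /hd /=; rewrite -/a ler_norml => /andP[_]; lra.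
(* The distance of [x0] to both ends of the period enters so that [|x - x0| / 2] stays in
   [[d1 / 2, pi - d1 / 2]] off the neighbourhood, where the sine has a positive minimum;
   [d1 <= d / 2] keeps the neighbourhood inside the region where [g >= a / 2]. *)
pose d1 := Num.min (d / 2) (Num.min ((pi - x0) / 2) ((x0 + pi) / 2)).
have d10 : 0 < d1.
  by rewrite !lt_min !divr_gt0 ?subr_gt0//= -ltrBlDr sub0r.
have [d1a d1b d1c] : [/\ d1 <= d / 2, d1 <= (pi - x0) / 2 & d1 <= (x0 + pi) / 2].
  by split; rewrite /d1 !ge_min lexx ?orbT.
have sc : continuous (fun y : R => sin y) by exact: continuous_sin.
have le1 : d1 / 2 <= pi - d1 / 2 :> R by lra.
have [m2 m2in sm2] := EVT_min le1 (continuous_subspaceT sc).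
pose eta := sin m2 ^+ 2.
have eta0 : 0 < eta.
  rewrite exprn_gt0// sin_gt0_pi//; move: m2in; rewrite in_itv/=; lra.
have keta x : period x -> d1 <= `|x - x0| -> eta <= 1 - ker x0 x.
  rewrite /period /= in_itv/= => /andP[p1 p2] dx.
  rewrite /ker cos2sin2 opprB addrC subrK /eta.
  have -> : sin ((x - x0) / 2) ^+ 2 = sin (`|x - x0| / 2) ^+ 2.
    case: (lerP 0 (x - x0)) => h; first by rewrite ger0_norm.
    by rewrite ltr0_norm// mulNr sinN sqrrN.
  have hin : `|x - x0| / 2 \in `[d1 / 2, pi - d1 / 2].
    rewrite in_itv/=; have : `|x - x0| <= 2 * pi - d1 by rewrite ler_norml; apply/andP; split; lra.
    by move: dx => ? ?; apply/andP; split; lra.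
  have h1 := sm2 _ hin; have s0 : 0 <= sin m2.
    by rewrite ltW// sin_gt0_pi//; move: m2in; rewrite in_itv/=; lra.
  by rewrite ler_sqr ?nnegrE// (le_trans s0).
have ker01 x : 0 <= ker x0 x <= 1.
  rewrite /ker sqr_ge0/=; have := sqr_ge0 (sin ((x - x0) / 2)).
  by rewrite cos2sin2; lra.
pose K := (`|g m1| + a) / eta.
have K0 : 0 < K by rewrite divr_gt0// ltr_wpDl.
have low x : period x -> a / 2 - K * (1 - ker x0 x) <= g x.
  move=> px; have /andP[k0 k1] := ker01 x.
  case: (ltP `|x - x0| d1) => h.
    have : a / 2 <= g x by apply: hd; rewrite distrC; lra.
    by apply: le_trans; rewrite gerBl mulr_ge0 ?(ltW K0)// subr_ge0.
  apply: le_trans (gm1 x px).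
  have h2 : K * eta <= K * (1 - ker x0 x) by rewrite ler_pM2l// keta.
  rewrite (_ : K * eta = `|g m1| + a) in h2; last by rewrite /K divfK// gt_eqF.
  have := ler_norm (- g m1); rewrite normrN; lra.
pose r n := rtint (fun x => ker x0 x ^+ n).
have ck m : continuous (fun x => ker x0 x ^+ m) by exact: continuous_kerX.
have i m : rint (fun x => ker x0 x ^+ m) by exact/rint_cont/ck.
have r0 n : 0 < r n.
  elim: n => [|n IH].
    suff -> : r 0%N = 1 by [].
    by rewrite -[RHS](@rtint_cst R); apply: eq_rtint => x _; rewrite expr0.
  by rewrite /r rtint_kerS mulr_gt0// divr_gt0// ltr_wpDl// mulr_ge0.
have key n : r n * (a / 2 - K / (2 * n%:R + 2)) <= 0.
  have d2 : (2 * n%:R + 2 : R) != 0 by rewrite gt_eqF// ltr_wpDl// mulr_ge0.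
  have -> : r n * (a / 2 - K / (2 * n%:R + 2)) = (a / 2 - K) * r n + K * r n.+1.
    by rewrite /r rtint_kerS; field.
  rewrite -(Hg n) /r -!rtintZ// -rtintD; try exact: rintZ.
  apply: rtint_le.
  - by apply: rintD; exact: rintZ.
  - by apply: rint_cont => x; apply: (@continuousM _ _ _ _ x); [exact: cg|exact: ck].
  move=> x px; have /andP[k0 k1] := ker01 x.
  have -> : (a / 2 - K) * ker x0 x ^+ n + K * ker x0 x ^+ n.+1 =
      (a / 2 - K * (1 - ker x0 x)) * ker x0 x ^+ n by rewrite exprS; ring.
  by rewrite ler_wpM2r ?low// exprn_ge0.
pose n := Num.truncn (K / a).
have := key n; rewrite pmulr_rle0// leNgt => /negP; apply.
rewrite subr_gt0 ltr_pdivrMr; last by rewrite ltr_wpDl// mulr_ge0.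
have : K / a < n.+1%:R.
  by rewrite /n truncnS_gt.
rewrite ltr_pdivrMr// -natr1 => h; lra.
Qed.

(** The powers of the kernel are trigonometric polynomials, so [f] is orthogonal to all of them;
    [uniq_real] applies to plus and minus the real and imaginary parts at interior points, and
    continuity with periodicity settles the endpoints. *)
Lemma uniq_cont (f : R -> C) : ccont f -> periodic2pi f ->
  (forall k, fourier f k = 0) -> forall x, period x -> f x = 0.
Proof.
move=> cf pf Hf.
have Hn x0 n k : tint (fun x => f x * (Q x0 x ^+ n * ex k x)) = 0.
  elim: n k => [|n IH] k.
    rewrite -(Hf (- k)) fourierE opprK; apply: eq_tint => x _.
    by rewrite expr0 mul1r.
  pose b := ex (- 1) x0 / 4 : C; pose b' := ((ex (-1) x0)^*)%C / 4 : C.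
  (* One factor of the kernel is expanded as [1 / 2 + b ex 1 + b' ex (-1)], which only shifts the
     frequency; this is why the induction is over all [k]. *)
  rewrite (eq_tint (g := fun x => (2^-1 * (f x * (Q x0 x ^+ n * ex k x)) +
     b * (f x * (Q x0 x ^+ n * ex (1 + k) x))) +
     b' * (f x * (Q x0 x ^+ n * ex (- 1 + k) x)))); last first.
    move=> x _; rewrite exprS {1}/ker_c /ker_exp conjcM (exJ 1) !exD /b /b'; by field.
  have ce j : ccont (fun x => f x * (Q x0 x ^+ n * ex j x)).
    apply: ccontM => //; apply: ccontM; last exact: ccont_ex.
    exact/ccontX/ccont_ker_c.
  have ie j c : cintg (fun x => c * (f x * (Q x0 x ^+ n * ex j x))).
    exact/cintgZ/cintg_cont.
  rewrite tintD; [|by apply: cintgD|by []].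
  by rewrite tintD// !tintZ ?IH ?mulr0 ?addr0//; exact: cintg_cont.
have ck x0 m : continuous (fun x => ker x0 x ^+ m) by exact: continuous_kerX.
have H1 x0 n : rtint (fun x => Re (f x) * ker x0 x ^+ n) = 0 /\
    rtint (fun x => Im (f x) * ker x0 x ^+ n) = 0.
  have e : tint (fun x => f x * (ker x0 x ^+ n)%:C) = 0.
    rewrite -(Hn x0 n 0); apply: eq_tint => x _.
    by rewrite ker_cE ex0 mulr1 (rmorphXn (real_complex R)).
  split.
    have := congr1 Re e; rewrite /= => <-; apply: eq_rtint => x _ /=.
    by rewrite ReM /= mulr0 subr0.
  have := congr1 Im e; rewrite /= => <-; apply: eq_rtint => x _ /=.
  by rewrite ImM /= mulr0 add0r.
have [cr ci] := cf.
have neg (g : R -> R) x0 n : continuous g -> rtint (fun x => g x * ker x0 x ^+ n) = 0 ->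
    rtint (fun x => - g x * ker x0 x ^+ n) = 0.
  move=> cg h; under eq_fun do rewrite mulNr.
  rewrite rtintN ?h ?oppr0//; apply: rint_cont => x.
  by apply: (@continuousM _ _ _ _ x); [exact: cg|exact: ck].
have int x0 : - pi < x0 < pi -> f x0 = 0.
  move=> hx; apply: cext; apply/eqP; rewrite eq_le; apply/andP; split.
  - by apply: (uniq_real cr hx) => n; have [] := H1 x0 n.
  - rewrite -oppr_le0; apply: (@uniq_real (fun x => - Re (f x))) hx _.
      by move=> x; apply: (@continuousN _ _ _ _ x); exact: cr.
    by move=> n; apply: neg => //; have [] := H1 x0 n.
  - by apply: (uniq_real ci hx) => n; have [] := H1 x0 n.
  - rewrite -oppr_le0; apply: (@uniq_real (fun x => - Im (f x))) hx _.
      by move=> x; apply: (@continuousN _ _ _ _ x); exact: ci.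
    by move=> n; apply: neg => //; have [] := H1 x0 n.
have pi0 : 0 < pi :> R := pi_gt0 R.
have atpi : f pi = 0.
  apply: (@normc_small _ _ 1) => // e e0.
  have cn := continuous_normc cf.
  have /cvgrPdist_le/(_ _ e0)/nbhs_ballP[d d0 hd] := cn pi.
  pose y := Num.max 0 (pi - d / 2).
  have y0 : f y = 0.
    apply: int; rewrite /y lt_max gt_max pi0 oppr_lt0 pi0/=.
    by rewrite gtrBl divr_gt0.
  have := hd y; rewrite y0 normc_zero subr0 ger0_norm ?normc_ge0// mul1r; apply.
  rewrite /ball/= /y ger0_norm; last by rewrite subr_ge0 ge_max (ltW pi0) gerBl ltW// divr_gt0.
  rewrite ltrBlDr -ltrBlDl; apply: (@lt_le_trans _ _ (pi - d / 2)); last by rewrite le_max lexx orbT.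
  by rewrite ltrD2l ltrN2 gtr_pMr// invf_lt1// ltr1n.
move=> x; rewrite /period /= in_itv/= => /andP[]; rewrite !le_eqVlt.
move=> /predU1P[<-|x1] /predU1P[x2|x2].
- by rewrite -(pf (- pi)) (_ : - pi + 2 * pi = pi)//; ring.
- by rewrite -(pf (- pi)) (_ : - pi + 2 * pi = pi)//; ring.
- by rewrite x2.
- by apply: int; rewrite x1.
Qed.

End Uniqueness.

(** * Smooth test functions *)

Section Bump.
Context {R : realType}.
Local Notation C := R[i].
Local Notation Re := (@complex.Re R).
Local Notation Im := (@complex.Im R).
Local Notation normc := (@ComplexField.Normc.normc R).

(* [bump 1 k] is [exp (- k / y)] on y > 0, extended by 0; the polynomial factors
   in [1 / y] make this family stable under differentiation. *)
Definition bump (p : {poly R}) (k y : R) : R :=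
  if 0 < y then p.[y^-1] * expR (- (k * y^-1)) else 0.

(** The chain rule in the variable [z = 1 / y], with [dz/dy = - z^2], applied to
    [p(z) exp (- k z)]. *)
Definition bump_poly (k : R) (p : {poly R}) : {poly R} := 'X^2 * (k%:P * p - p^`()).

Lemma horner_bound (p : {poly R}) : exists2 M, 0 <= M &
  forall z, 1 <= z -> `|p.[z]| <= M * z ^+ size p.
Proof.
exists (\sum_(i < size p) `|p`_i|); first by rewrite sumr_ge0.
move=> z z1; have z0 : 0 <= z by apply: le_trans z1.
rewrite horner_coef mulr_suml; apply: le_trans (ler_norm_sum _ _ _) _.
apply: ler_sum => i _; rewrite normrM ler_wpM2l// normrX ger0_norm//.
by rewrite ler_weXn2l// ltnW.
Qed.

Lemma expR_gt_pow n (x : R) : 0 <= x -> x ^+ n.+1 / (n.+1)`!%:R <= expR x.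
Proof.
by move=> x0; have := expR_ge1Dxn n x0; apply: le_trans; rewrite lerDr.
Qed.

(** In [z = 1 / y] the polynomial is at most [P z^n], while the exponential series gives
    [exp (k z) >= (k z)^(n+2) / (n+2)!]. The two spare powers of [z] become [y^2]. *)
Lemma bump_small (p : {poly R}) (k : R) : 0 < k -> exists2 M, 0 <= M &
  forall y, y <= 1 -> `|bump p k y| <= M * y ^+ 2.
Proof.
move=> k0; have [P P0 hP] := horner_bound p; set n := size p in hP.
have fac : 0 <= ((n.+2)`!%:R : R) by [].
exists (P * ((n.+2)`!%:R / k ^+ n.+2)).
  by rewrite !mulr_ge0// invr_ge0 exprn_ge0// ltW.
move=> y y1; rewrite /bump; case: ifP => y0; last first.
  by rewrite normr0 mulr_ge0 ?sqr_ge0// mulr_ge0// divr_ge0 ?exprn_ge0 ?(ltW k0).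
set z := y^-1; have z0 : 0 < z by rewrite invr_gt0.
have z1 : 1 <= z by rewrite invf_ge1.
have e0 := expR_gt0 (- (k * z)).
rewrite normrM (gtr0_norm e0).
apply: le_trans (ler_wpM2r (ltW e0) (hP _ z1)) _.
rewrite -(mulrA P (z ^+ n)) -(mulrA P _ (y ^+ 2)) ler_wpM2l//.
have := expR_gt_pow n.+1 (ltW (mulr_gt0 k0 z0)); rewrite exprMn => h.
have kn : 0 < k ^+ n.+2 by rewrite exprn_gt0.
have f0 : 0 < ((n.+2)`!%:R : R) by rewrite ltr0n fact_gt0.
have -> : z ^+ n * expR (- (k * z)) =
   ((k ^+ n.+2 * z ^+ n.+2 / (n.+2)`!%:R) * expR (- (k * z))) *
     ((n.+2)`!%:R / k ^+ n.+2 * y ^+ 2).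
  have -> : y = z^-1 by rewrite invrK.
  rewrite -[in z ^+ n.+2](addn2 n) exprD; field.
  by rewrite !gt_eqF.
rewrite -[leRHS]mul1r; apply: ler_wpM2r.
  by rewrite mulr_ge0 ?sqr_ge0// divr_ge0// ltW.
by rewrite expRN ler_pdivrMr ?expR_gt0// mul1r.
Qed.

Lemma is_derive_bump (p : {poly R}) (k y : R) : 0 < k ->
  is_derive y (1 : R) (bump p k) (bump (bump_poly k p) k y).
Proof.
move=> k0; case: (ltrgtP 0 y) => y0.
- pose g (y : R) := p.[y^-1] * expR (- (k * y^-1)).
  apply: (@near_eq_is_derive _ _ _ g).
    near=> z; rewrite /g /bump ifT//.
    by near: z; exact: lt_nbhsr.
  have yn0 : y != 0 by rewrite gt_eqF.
  have dinv : is_derive y (1 : R) (fun y : R => y^-1 : R) (- y ^- 2).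
    have := @is_deriveV R id y 1 1 yn0 (is_derive_id _ _).
    by rewrite /GRing.scale/= mulr1.
  have dp : is_derive y (1 : R) (horner p \o (fun y : R => y^-1)) (p^`().[y^-1] * - y ^- 2).
    exact: is_derive1_comp.
  have de : is_derive y (1 : R) (expR \o (fun y : R => - (k * y^-1)))
     (expR (- (k * y^-1)) * (k * y ^- 2)).
    apply: is_derive1_comp.
    have := is_deriveN (is_deriveZ k dinv).
    by rewrite /GRing.scale/= mulrN opprK.
  rewrite /g (_ : (fun y => _) = (horner p \o (fun y : R => y^-1)) *
    (expR \o (fun y : R => - (k * y^-1))))//.
  apply: is_derive_eq; rewrite /bump y0 /bump_poly /GRing.scale/=.
  by rewrite !hornerE/= exprVn; ring.
- apply: (@near_eq_is_derive _ _ _ (cst 0)).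
    near=> z; rewrite /bump ifF//; apply/negbTE; rewrite -leNgt ltW//.
    by near: z; exact: lt_nbhsl.
  by rewrite /bump ifF; [exact: is_derive_cst|apply/negbTE; rewrite -leNgt ltW].
(* At the junction the quadratic bound forces the derivative 0, which is also the value given by the
   formula. *)
- rewrite -y0 [X in is_derive _ _ _ X]/bump ltxx; apply: is_derive_eps => e e0.
  have [M M0 hM] := bump_small p k0.
  have M1 : 0 < M + 1 by rewrite ltr_wpDl.
  exists (Num.min 1 (e / (M + 1))); first by rewrite lt_min ltr01 divr_gt0.
  move=> h /andP[h0]; rewrite lt_min => /andP[h1 h2].
  rewrite add0r {2}/bump ltxx mulr0 !subr0.
  apply: le_trans (hM h _) _; first exact: le_trans (ler_norm _) (ltW h1).
  rewrite -(real_normK (num_real h)) expr2 mulrA ler_wpM2r//.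
  rewrite ltr_pdivlMr// in h2; apply: le_trans (ltW h2).
  by rewrite mulrC ler_wpM2l// lerDl.
Unshelve. all: by end_near. Qed.

Lemma continuous_bump (p : {poly R}) (k : R) : 0 < k -> continuous (bump p k).
Proof.
move=> k0 y; apply/differentiable_continuous/derivable1_diffP.
by have [] := is_derive_bump p y k0.
Qed.

Lemma bump01 (k y : R) : 0 < k -> 0 <= bump 1 k y <= 1.
Proof.
move=> k0; rewrite /bump; case: ifP => y0; last by rewrite lexx ler01.
rewrite hornerC mul1r expR_ge0/= -expR0 ler_expR oppr_le0.
by rewrite mulr_ge0 ?invr_ge0 ?(ltW k0) ?(ltW y0).
Qed.

Lemma cvg_bump (y : R) :
  (fun n : nat => bump 1 (n.+1%:R^-1) y) @ \oo --> ((0 < y)%R%:R : R).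
Proof.
case: (ltP 0 y) => y0; last first.
  rewrite (_ : (fun n : nat => _) = fun=> 0); first exact: cvg_cst.
  by apply/funext => n; rewrite /bump ltNge y0.
rewrite (_ : (fun n : nat => _) = (fun n : nat => expR (- (n.+1%:R^-1 * y^-1)))); last first.
  by apply/funext => n; rewrite /bump y0 hornerC mul1r.
have -> : true%:R = expR (- (0 * y^-1)) :> R by rewrite mul0r oppr0 expR0.
have h : (fun n : nat => n.+1%:R^-1 * y^-1 : R) @ \oo --> 0 * y^-1.
  by apply: cvgMl; exact: cvg_harmonic.
exact: (continuous_cvg _ (@continuous_expR R _) (cvgN h)).
Qed.

End Bump.

(** * Fourier series of C^1 functions, and their pairing with integrable functions *)

Section L1Uniqueness.
Context {R : realType}.
Local Notation C := R[i].
Local Notation Re := (@complex.Re R).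
Local Notation Im := (@complex.Im R).
Local Notation normc := (@ComplexField.Normc.normc R).
Local Notation mu := (@lebesgue_measure R).

Lemma cont_bounded (g : R -> R) : continuous g -> exists2 M, 0 < M &
  forall x, period x -> `|g x| <= M.
Proof.
move=> cg; have pp : - pi <= pi :> R by rewrite ge0_cp ?pi_ge0.
have [m1 _ h1] := EVT_min pp (continuous_subspaceT cg).
have [m2 _ h2] := EVT_max pp (continuous_subspaceT cg).
exists (1 + `|g m1| + `|g m2|); first by rewrite -addrA ltr_wpDr ?addr_ge0.
move=> x px; have := h1 x px; have := h2 x px.
have := ler_norm (g m2); have := ler_norm (- g m1); rewrite normrN => ? ? ? ?.
have := normr_ge0 (g m1); have := normr_ge0 (g m2) => ? ?.
by rewrite ler_norml; apply/andP; split; lra.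
Qed.
Lemma ccont_bounded (g : R -> C) : ccont g -> exists2 M, 0 < M &
  forall x, period x -> normc (g x) <= M.
Proof.
move=> /continuous_normc/cont_bounded[M M0 h]; exists M => // x /h.
by rewrite ger0_norm ?normc_ge0.
Qed.

Lemma rintM f g : rint f -> continuous g -> rint (fun x => f x * g x : R).
Proof.
move=> hf cg; have [M M0 hM] := cont_bounded cg.
apply: (@integrableMl _ _ _ mu _ measurable_period _ g hf).
  by apply: measurable_funTS; exact: continuous_measurable_fun.
exists M; split; first exact: num_real.
by move=> m Mm x px; apply: le_trans (hM x px) (ltW Mm).
Qed.
Lemma cintgM f g : cintg f -> ccont g -> cintg (fun x => f x * g x : C).
Proof.
move=> [fr fi] [gr gi]; split.
  rewrite (_ : _ \o _ = (fun x => Re (f x) * Re (g x) + - (Im (f x) * Im (g x)))).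
    by apply: rintD; [|apply: rintN]; exact: rintM.
  by apply/funext => x /=; rewrite ReM.
rewrite (_ : _ \o _ = (fun x => Re (f x) * Im (g x) + Im (f x) * Re (g x))).
  by apply: rintD; exact: rintM.
by apply/funext => x /=; rewrite ImM.
Qed.
Lemma rint_norm f : rint f -> rint (fun x => `|f x| : R).
Proof. by move=> hf; apply: (@integrable_abse _ _ _ mu _ (EFin \o f)). Qed.

Lemma tint_ulim0 (f h : R -> C) c : cintg f -> (forall k, fourier f k = 0) -> ulim h c ->
  tint (fun x => f x * h x) = 0.
Proof.
move=> hf H0 H; have ch := ulim_ccont H; have [fr fi] := hf.
pose A := rtint (fun x => `|Re (f x)| + `|Im (f x)|).
have iA : rint (fun x => `|Re (f x)| + `|Im (f x)|).
  by apply: rintD; exact: rint_norm.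
have A0 : 0 <= A by apply: rtint_ge0 => x _; rewrite addr_ge0.
apply: (@normc_small _ _ (2 * A)); first by rewrite mulr_ge0.
move=> e e0; have [M hM] := H e e0; have {}hM := hM M (leqnn M).
have z : tint (fun x => f x * Tz 0 M c x) = 0.
  rewrite (eq_tint (g := fun x => \sum_(0 <= j < M)
     (c (Posz j) * (f x * ex (Posz j) x) + c (Negz j) * (f x * ex (Negz j) x)))); last first.
    by move=> x _; rewrite /Tz /zs mulr_sumr; apply: eq_bigr => j _; ring.
  have ie k : cintg (fun x => f x * ex k x) by apply: cintgM => //; exact: ccont_ex.
  have z k : tint (fun x => f x * ex k x) = 0 by rewrite -(H0 (- k)) fourierE opprK.
  rewrite tint_sum => [|j _]; last by apply: cintgD; exact: cintgZ.
  by rewrite big1// => j _; rewrite tintD ?tintZ ?z ?mulr0 ?addr0//; exact: cintgZ.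
have -> : tint (fun x => f x * h x) = tint (fun x => f x * (h x - Tz 0 M c x)).
  rewrite -[LHS]subr0 -z -tintB; [|exact: cintgM|by apply: cintgM => //; exact: ccont_Tz].
  by apply: eq_tint => x _; ring.
have -> : 2 * A * e = 2 * (e * A) by ring.
rewrite -rtintZ//; apply: tint_le.
- by apply: cintgM => //; apply: ccontB => //; exact: ccont_Tz.
- exact: rintZ.
move=> x _; rewrite normc_mul mulrC; apply: ler_pM; rewrite ?normc_ge0//.
exact: normc_le_ReIm.
Qed.

(** Another substitute for Cauchy-Schwarz: [2 q <= k w q^2 + 1 / (k w)] termwise. The parameter [k]
    is left to the caller, who balances the two sums with it. *)
Lemma zs_l1 (c : int -> C) (w : int -> R) (m m' : nat) (A B k : R) :
  (forall j, ~~ zin m j -> 0 < w j) -> 0 < k ->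
  zs m m' (fun j => w j * normc (c j) ^+ 2) <= A ->
  zs m m' (fun j => (w j)^-1) <= B ->
  zs m m' (normc \o c) <= (k * A + B / k) / 2.
Proof.
move=> w0 k0 hA hB.
have k0' : 0 <= k^-1 by rewrite invr_ge0 ltW.
have -> : (k * A + B / k) / 2 = k / 2 * A + k^-1 / 2 * B by field; rewrite gt_eqF.
apply: le_trans (lerD (ler_wpM2l _ hA) (ler_wpM2l _ hB)); last 2 first.
- by rewrite divr_ge0// ltW.
- by rewrite divr_ge0.
rewrite -!zsZ -zsD; apply: zs_le => j /w0 wj /=.
set q := normc (c j).
rewrite -subr_ge0 (_ : _ - _ = k^-1 / (2 * w j) * (k * w j * q - 1) ^+ 2).
  by rewrite mulr_ge0 ?sqr_ge0// divr_ge0// mulr_ge0// ltW.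
by field; rewrite !gt_eqF.
Qed.

Lemma Posz_sqr (j : nat) : ((Posz j)%:~R : R) ^+ 2 = j%:R ^+ 2.
Proof. by []. Qed.
Lemma Negz_sqr (j : nat) : ((Negz j)%:~R : R) ^+ 2 = j.+1%:R ^+ 2.
Proof. by rewrite NegzE mulrNz sqrrN. Qed.
Lemma zin_sqr m (k : int) : ~~ zin m k -> m%:R ^+ 2 <= (k%:~R : R) ^+ 2.
Proof.
case: k => j; rewrite /= -leqNgt => mj; rewrite ?Posz_sqr ?Negz_sqr;
  rewrite ler_sqr ?nnegrE// ler_nat//; exact: leqW.
Qed.

(** Telescoping: [1 / n^2 + 1 / (n+1)^2 <= 4 / n - 4 / (n+1)], the two terms on the left being those
    of the frequencies [n] and [- (n+1)]. *)
Lemma sum_inv_sqr m m' : (0 < m)%N ->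
  zs m m' (fun k => ((k%:~R : R) ^+ 2)^-1) <= 4 / m%:R.
Proof.
move=> m0; case: (leqP m m') => mm'; last by rewrite zs_geq ?divr_ge0// ltnW.
have key p : zs m (m + p) (fun k => ((k%:~R : R) ^+ 2)^-1) <= 4 / m%:R - 4 / (m + p)%:R.
  elim: p => [|p IH]; first by rewrite addn0 subrr zs_geq.
  rewrite addnS /zs big_nat_recr ?leq_addr//=; move: IH; rewrite /zs => IH.
  have -> : 4 / m%:R - 4 / (m + p).+1%:R =
     (4 / m%:R - 4 / (m + p)%:R) + (4 / (m + p)%:R - 4 / (m + p).+1%:R) :> R by ring.
  apply: (lerD IH).
  set n := (m + p)%N; have n0 : (0 : R) < n%:R by rewrite ltr0n addn_gt0 m0.
  have n1 : (1 : R) <= n%:R by rewrite ler1n addn_gt0 m0.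
  have N0 : (0 : R) < n%:R + 1 by rewrite ltr_wpDl// ltW.
  rewrite Posz_sqr Negz_sqr -natr1 -subr_ge0.
  rewrite (_ : _ - _ = (2 * n%:R ^+ 2 + 2 * n%:R - 1) / (n%:R ^+ 2 * (n%:R + 1) ^+ 2)).
    by rewrite divr_ge0 ?mulr_ge0 ?sqr_ge0// subr_ge0; nra.
  by field; rewrite !gt_eqF.
rewrite -(subnKC mm'); apply: le_trans (key _) _.
by rewrite gerBl divr_ge0.
Qed.


Lemma fourier_deriv (f f' : R -> C) k : isd f f' -> ccont f' -> periodic2pi f ->
  fourier f' k = Dz (fourier f) k.
Proof.
move=> hf cf pf.
have ce : ccont (fun x => 'i%C * (- k)%:~R * ex (- k) x : C).
  by apply: ccontM; [exact: ccont_cst|exact: ccont_ex].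
rewrite !fourierE (tint_by_parts hf (isd_ex (- k)) cf ce pf (@periodic_ex R (- k))).
rewrite /Dz fourierE -tintZ; last first.
  by apply/cintg_cont/ccontM; [exact: isd_ccont hf|exact: ccont_ex].
rewrite -tintN; last by apply/cintg_cont/ccontM => //; exact: isd_ccont hf.
by apply: eq_tint => x _; rewrite mulrNz; ring.
Qed.

Lemma normc_int (k : int) : normc (k%:~R : C) = `|k%:~R|.
Proof. by rewrite -(rmorph_int (real_complex R)) normc_real. Qed.
Lemma normc_Dz (c : int -> C) k : normc (Dz c k) = `|k%:~R| * normc (c k).
Proof. by rewrite /Dz !normc_mul normc_i mul1r normc_int. Qed.
Lemma normc_Dz_sqr (c : int -> C) k :
  normc (Dz c k) ^+ 2 = (k%:~R : R) ^+ 2 * normc (c k) ^+ 2.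
Proof. by rewrite normc_Dz exprMn real_normK ?num_real. Qed.

Lemma zin_neq0 m k : (0 < m)%N -> ~~ zin m k -> 0 < (k%:~R : R) ^+ 2.
Proof.
by move=> m0 /zin_sqr; apply: lt_le_trans; rewrite exprn_gt0// ltr0n.
Qed.

(** [zs_l1] with weight [k^2] and parameter [1 / sqrt m]: one derivative in L^2 makes the tails of
    the series of moduli decay like [m^(-1/2)]. *)
Lemma c1_sum (c : int -> C) (A : R) m m' : (0 < m)%N ->
  (forall m, zs 0 m (fun k => normc (Dz c k) ^+ 2) <= A) ->
  zs m m' (normc \o c) <= (A + 4) / 2 / Num.sqrt m%:R.
Proof.
move=> m0 hA; have r0 : 0 < Num.sqrt (m%:R : R) by rewrite sqrtr_gt0 ltr0n.
have -> : (A + 4) / 2 / Num.sqrt m%:R =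
   ((Num.sqrt m%:R)^-1 * A + (4 / m%:R) / (Num.sqrt m%:R)^-1) / 2.
  rewrite -[in 4 / _](@sqr_sqrtr R m%:R)//; field; by rewrite gt_eqF.
apply: (zs_l1 (w := fun k => k%:~R ^+ 2)).
- by move=> j; exact: zin_neq0.
- by rewrite invr_gt0.
- apply: le_trans (hA m'); under eq_zs do rewrite -normc_Dz_sqr.
  by apply: zs_sub => // k; exact: sqr_ge0.
- exact: sum_inv_sqr.
Qed.

Lemma sqrt_rate (A e : R) : 0 < e -> exists2 M, (0 < M)%N & forall m, (M <= m)%N ->
  A / Num.sqrt m%:R <= e.
Proof.
move=> e0; pose B := `|A| + 1; have B0 : 0 < B by rewrite ltr_wpDl.
exists (Num.truncn ((B / e) ^+ 2)).+1 => // m hm.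
have r0 : 0 < Num.sqrt (m%:R : R) by rewrite sqrtr_gt0 ltr0n (leq_trans _ hm).
have h : B / e <= Num.sqrt m%:R.
  rewrite -(ler_pXn2r (ltn0Sn 1)) ?nnegrE ?sqrtr_ge0 ?divr_ge0 ?(ltW B0) ?(ltW e0)//.
  rewrite sqr_sqrtr//; apply: le_trans (ltW (truncnS_gt _)) _.
  by rewrite ler_nat.
rewrite ler_pdivrMr//; rewrite ler_pdivrMr// mulrC in h; apply: le_trans h.
by rewrite /B; have := ler_norm A; lra.
Qed.

Lemma c1_ulim_syn (c : int -> C) (A : R) :
  (forall m, zs 0 m (fun k => normc (Dz c k) ^+ 2) <= A) -> ulim (syn c) c.
Proof.
(* The weight [k^2] vanishes at frequency 0, so the window of the frequencies 0 and -1 is counted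
   separately when the sum starts at 0. *)
move=> hA; pose r m := if m == 0%N then zs 0 1 (normc \o c) + (A + 4) / 2 / Num.sqrt 1%:R
  else (A + 4) / 2 / Num.sqrt m%:R.
apply: (@ulim_syn _ _ r) => [e e0|m m' mm'].
  have [M M0 hM] := sqrt_rate ((A + 4) / 2) e0; exists M => m Mm.
  by rewrite /r -[m == 0%N]negbK -lt0n (leq_trans M0 Mm)/= hM.
rewrite /r; case: eqP => [->|/eqP]; last by rewrite -lt0n => m0; exact: c1_sum.
case: m' mm' => [|m'] _.
  rewrite zs_geq// addr_ge0//; first by apply: zs_ge0 => k; exact: normc_ge0.
  by apply: le_trans (c1_sum 0 (ltn0Sn 0) hA); rewrite zs_geq.
by rewrite (@zs_cat _ 0 1)// lerD2l; exact: c1_sum.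
Qed.

Lemma c1_syn (f f' : R -> C) : isd f f' -> ccont f' -> periodic2pi f ->
  ulim (syn (fourier f)) (fourier f) /\
  forall x, period x -> f x = syn (fourier f) x.
Proof.
move=> hf cf pf; have cf0 := isd_ccont hf.
have U : ulim (syn (fourier f)) (fourier f).
  apply: (@c1_ulim_syn _ (L2sq f')) => m.
  under eq_zs do rewrite -(fourier_deriv _ hf cf pf).
  exact: bessel.
split=> // x px; apply/eqP; rewrite -subr_eq0; apply/eqP.
have cs := ulim_ccont U.
apply: (uniq_cont (f := fun x => f x - syn (fourier f) x)) px => //.
- exact: ccontB.
- by move=> y; rewrite pf (ulim_periodic U).
- move=> k; rewrite fourierB; last 2 first.
  + exact/cintg_cont/(ccontM cf0)/ccont_ex.
  + exact/cintg_cont/(ccontM cs)/ccont_ex.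
  by rewrite (ulim_fourier _ U) subrr.
Qed.

(** A periodic C^1 function is the uniform limit of its partial sums, and an integrable function
    without Fourier coefficients annihilates those. *)
Lemma tint_c1_0 f h h' : cintg f -> (forall k, fourier f k = 0) ->
  isd h h' -> ccont h' -> periodic2pi h -> tint (fun x => f x * h x : C) = 0.
Proof.
move=> hf H0 hh ch ph; have [U E] := c1_syn hh ch ph.
by rewrite -(tint_ulim0 hf H0 U); apply: eq_tint => x /E ->.
Qed.

End L1Uniqueness.

(** * Uniqueness of Fourier coefficients almost everywhere *)

Section L1UniquenessAE.
Context {R : realType}.
Local Notation C := R[i].
Local Notation Re := (@complex.Re R).
Local Notation Im := (@complex.Im R).
Local Notation normc := (@ComplexField.Normc.normc R).
Local Notation mu := (@lebesgue_measure R).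

(** This is [2 cos (y / 2) sin ((x - y) / 2)], positive on the period exactly for [y] in []- pi,
    x[]. The form as a sum makes periodicity in [y] visible. *)
Definition arc (x y : R) : R := sin (x / 2) + sin (x / 2 - y).

Lemma arc_gt0 (x y : R) : - pi < x < pi -> period y -> (0 < arc x y) = (y \in `]- pi, x[).
Proof.
move=> /andP[x1 x2]; rewrite /period /= !in_itv/= => /andP[y1 y2].
have -> : arc x y = 2 * (cos (y / 2) * sin ((x - y) / 2)).
  rewrite /arc; have -> : x / 2 - y = (x - y) / 2 - y / 2 by field.
  have {1}-> : x / 2 = (x - y) / 2 + y / 2 by field.
  by rewrite sinD sinB; ring.
rewrite pmulr_rgt0//; case: (ltrP y x) => xy; last first.
  rewrite andbF; apply/negbTE; rewrite -leNgt mulr_ge0_le0//.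
    by apply: cos_ge0_pihalf; lra.
  rewrite -oppr_ge0 -sinN; apply: sin_ge0_pi; lra.
rewrite andbT; move: y1; rewrite le_eqVlt => /predU1P[<-|y1].
  by rewrite ltxx mulNr cosN cos_pihalf mul0r ltxx.
rewrite y1 mulr_gt0//; first by apply: cos_gt0_pihalf; lra.
by apply: sin_gt0_pi; lra.
Qed.

Lemma continuous_arc x : continuous (arc x).
Proof.
move=> y; apply: (@continuousD _ _ _ _ _ y); first exact: cst_continuous.
apply: continuous_comp; last exact: continuous_sin.
by apply: (@continuousB _ _ _ _ _ y); [exact: cst_continuous|exact: id].
Qed.

Lemma is_derive_arc (x y : R) : is_derive y (1 : R) (arc x) (- cos (x / 2 - y)).
Proof.
have h : is_derive y (1 : R) (fun y : R => x / 2 - y : R) (- 1).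
  have := is_deriveB (is_derive_cst (x / 2) y (1 : R)) (is_derive_id y (1 : R)).
  by rewrite sub0r.
have := is_deriveD (is_derive_cst (sin (x / 2)) y (1 : R))
  (@is_derive1_comp R sin (fun y : R => x / 2 - y) y _ _ (is_derive_sin _) h).
by rewrite add0r mulrN1.
Qed.

(** As the parameter tends to 0, [bump] of [arc x] tends to the indicator of []- pi, x[]. By
    dominated convergence [g] has integral 0 over all these intervals, and Lebesgue differentiation
    of the primitive gives [g = 0] almost everywhere. *)
Lemma ae_zero_real (g : R -> R) : rint g ->
  (forall x n, - pi < x < pi -> rtint (fun y => g y * bump 1 (n.+1%:R^-1) (arc x y)) = 0) ->
  {ae mu, forall x, period x -> g x = 0}.
Proof.
move=> hg H; have pi0 : 0 < pi :> R := pi_gt0 R.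
have mg : measurable_fun period g by apply/measurable_EFinP; exact: measurable_int hg.
have mp := @measurable_period R.
have k0 n : 0 < n.+1%:R^-1 :> R by rewrite invr_gt0.
have int0 x : - pi < x < pi -> \int[mu]_(y in `]- pi, x[) g y = 0.
  move=> hx.
  have cb n : continuous (fun y => bump 1 (n.+1%:R^-1) (arc x y)).
    by move=> y; apply: continuous_comp; [exact: continuous_arc|exact: continuous_bump].
  have I0 n : (\int[mu]_(y in @period R) (g y * bump 1 (n.+1%:R^-1) (arc x y))%:E = 0)%E.
    have := H x n hx; rewrite /rtint => /eqP; rewrite mulf_eq0 invr_eq0 mulf_eq0.
    rewrite pnatr_eq0 (gt_eqF pi0)/= => /eqP; rewrite /Rintegral => h.
    rewrite -[LHS]fineK ?h//; apply: integrable_fin_num; first exact: measurable_period.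
    by apply: rintM => //; exact: cb.
  have ptw y : (fun n => (g y * bump 1 (n.+1%:R^-1) (arc x y))%:E) @ \oo -->
      (g y * (0 < arc x y)%R%:R)%:E.
    by apply: cvg_EFin; [exact: nearW|apply: cvgMr; exact: cvg_bump].
  have D : (\int[mu]_(y in @period R) (g y * bump 1 (n.+1%:R^-1) (arc x y))%:E)%E @[n --> \oo]
      --> (\int[mu]_(y in @period R) (g y * (0 < arc x y)%R%:R)%:E)%E.
    apply: (@dominated_cvg _ _ _ mu _ measurable_period
      (fun n y => (g y * bump 1 (n.+1%:R^-1) (arc x y))%:E) _ (fun y => (`|g y|)%:E)).
    - move=> n; apply/measurable_EFinP; apply: measurable_funM => //.
      by apply: measurable_funTS; exact: continuous_measurable_fun.
    - by move=> y _; exact: ptw.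
    - by [].
    - exact: rint_norm.
    - move=> n y _; rewrite lee_fin normrM ler_piMr//.
      have /andP[b0 b1] := bump01 (arc x y) (k0 n).
      by rewrite ger0_norm.
  have {D} : (0 = \int[mu]_(y in @period R) (g y * (0 < arc x y)%R%:R)%:E)%E.
    apply: (cvg_unique (@ereal_hausdorff R) _ D).
    rewrite (_ : (fun n => _) = fun=> 0%E); first exact: cvg_cst.
    by apply/funext => n; rewrite I0.
  move=> /(congr1 fine)/= h.
  have sub : `]- pi, x[ `<=` @period R.
    move=> y; rewrite /period /= !in_itv/= => /andP[/ltW -> y2]/=.
    by apply: ltW; apply: lt_trans y2 _; case/andP: hx.
  rewrite -(setIidr sub) Rintegral_mkcondr /Rintegral h; congr fine.
  apply: eq_integral => y; rewrite inE => py; congr EFin.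
  rewrite arc_gt0// patchE mem_setE; case: ifP => _; by rewrite ?mulr1 ?mulr0.
pose f := g \_ (@period R).
have If : mu.-integrable setT (EFin \o f).
  rewrite /f -restrict_EFin; apply/integrable_restrict => //=.
  by rewrite setTI.
have Lf : locally_integrable [set: R] f by exact: integrable_locally.
have Ify y : mu.-integrable [set` Interval (BRight (- pi)) (BRight y)] (EFin \o f).
  by apply: integrableS If => //; exact: measurable_itv.
have := FTC1 Ify Lf => /= hae.
have hne z : {ae mu, forall x : R, x <> z}.
  exists [set z]; split => //; first exact: lebesgue_measure_set1.
  by move=> x /= /contrapT.
have aeF := ae_filter_ringOfSetsType mu.
apply: filterS3 hae (hne (- pi)) (hne pi) => x + n1 n2.
rewrite /period /= in_itv/= => + /andP[]; rewrite !le_eqVlt.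
move=> + /predU1P[/esym//|x1] /predU1P[//|x2].
rewrite lte_fin x1 => /(_ isT)[_]; rewrite derive1E => D.
have fx : f x = g x.
  by rewrite /f patchE mem_set//= /period/= in_itv/= (ltW x1) (ltW x2).
rewrite -fx -D; apply: derive_val.
apply: (@near_eq_is_derive R R R (cst 0)).
near=> z; have z1 : - pi < z by near: z; exact: lt_nbhsr.
have z2 : z < pi by near: z; exact: lt_nbhsl.
have sub : `]- pi, z] `<=` @period R.
  move=> y; rewrite /period /= !in_itv/= => /andP[/ltW -> y2]/=.
  by apply: ltW; exact: le_lt_trans y2 z2.
rewrite /f -Rintegral_mkcondr (setIidl sub) -Rintegral_itv_bndo_bndc.
  by rewrite int0// z1.
apply: integrableS hg => // y; rewrite /= in_itv/= => /andP[y1 y2].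
by apply: sub; rewrite /= in_itv/= y1 (ltW y2).
Unshelve. all: by end_near. Qed.

Lemma isd_realC (b b' : R -> R) : (forall x : R, is_derive x (1 : R) b (b' x)) ->
  isd (fun x => (b x)%:C) (fun x => (b' x)%:C).
Proof.
move=> hb x; split; first exact: hb.
exact: is_derive_cst.
Qed.
Lemma ccont_realC (b : R -> R) : continuous b -> ccont (fun x => (b x)%:C).
Proof. by move=> cb; split=> // x; exact: cst_continuous. Qed.

(** The functions [bump 1 k] of [arc x] are periodic and C^1, hence annihilated by [f]; being real
    they test the real and imaginary parts separately. *)
Lemma ae_zero (f : R -> C) : cintg f -> (forall k, fourier f k = 0) ->
  {ae mu, forall x, period x -> f x = 0}.
Proof.
move=> cf H0; have [fr fi] := cf.
have key x n : tint (fun y => f y * (bump 1 (n.+1%:R^-1) (arc x y))%:C) = 0.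
  have k0 : 0 < n.+1%:R^-1 :> R by rewrite invr_gt0.
  pose b' y := bump (bump_poly (n.+1%:R^-1) 1) (n.+1%:R^-1) (arc x y) * - cos (x / 2 - y).
  apply: (tint_c1_0 (h' := fun y => (b' y)%:C)) => //.
  - apply: isd_realC => y; apply: is_derive1_comp; first exact: is_derive_bump.
    exact: is_derive_arc.
  - apply: ccont_realC => y; apply: (@continuousM _ _ _ _ y).
      by apply: continuous_comp; [exact: continuous_arc|exact: continuous_bump].
    apply: (@continuousN _ _ _ _ y); apply: continuous_comp; last exact: continuous_cos.
    by apply: (@continuousB _ _ _ _ _ y); [exact: cst_continuous|exact: id].
  - move=> y; rewrite /arc; congr (bump _ _ (_ + _))%:C.
    by rewrite opprD addrA mulr_natl -[LHS](@sinD2pi R) subrK.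
have ar : {ae mu, forall x, period x -> Re (f x) = 0}.
  apply: (ae_zero_real fr) => x n _; have := congr1 Re (key x n); rewrite /= => <-.
  by apply: eq_rtint => y _ /=; rewrite ReM /= mulr0 subr0.
have ai : {ae mu, forall x, period x -> Im (f x) = 0}.
  apply: (ae_zero_real fi) => x n _; have := congr1 Im (key x n); rewrite /= => <-.
  by apply: eq_rtint => y _ /=; rewrite ImM /= mulr0 add0r.
have aeF := ae_filter_ringOfSetsType mu.
by apply: filterS2 ar ai => x h1 h2 px; apply: cext; [exact: h1|exact: h2].
Qed.

End L1UniquenessAE.

(** * Sobolev spaces in terms of Fourier coefficients *)

Section SobolevCoefficients.
Context {R : realType}.
Local Notation C := R[i].
Local Notation Re := (@complex.Re R).
Local Notation Im := (@complex.Im R).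
Local Notation normc := (@ComplexField.Normc.normc R).
Local Notation mu := (@lebesgue_measure R).

Definition wt (s : R) (k : int) : R := (1 + (k%:~R : R) ^+ 2) `^ s.

(* The H^s norm of the Fourier series with coefficients [c] is at most [B]. *)
Definition HB (s B : R) (c : int -> C) :=
  forall m, zs 0 m (fun k => wt s k * normc (c k) ^+ 2) <= B ^+ 2.

Lemma wt_ge0 s k : 0 <= wt s k. Proof. exact: powR_ge0. Qed.
Lemma wtterm_ge0 s (c : int -> C) k : 0 <= wt s k * normc (c k) ^+ 2.
Proof. by rewrite mulr_ge0 ?wt_ge0 ?sqr_ge0. Qed.

Definition zlist (m : nat) : seq int :=
  [seq Posz j | j <- index_iota 0 m] ++ [seq Negz j | j <- index_iota 0 m].
Lemma mem_zlist m k : (k \in zlist m) = zin m k.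
Proof.
rewrite mem_cat; case: k => n /=.
  rewrite mem_map ?mem_index_iota//; last by move=> x y [].
  by apply/orb_idr => /mapP[].
rewrite (mem_map (f := Negz)) ?mem_index_iota//; last by move=> x y [].
by apply/orb_idl => /mapP[].
Qed.
Lemma uniq_zlist m : uniq (zlist m).
Proof.
rewrite cat_uniq !map_inj_uniq ?iota_uniq; try by move=> x y [].
by rewrite andbT; apply/hasPn => k /mapP[j _ ->]; apply/negP => /mapP[].
Qed.
Lemma sum_zlist m (g : int -> R) : \sum_(k <- zlist m) g k = zs 0 m g.
Proof. by rewrite big_cat !big_map /zs big_split. Qed.

Lemma zs_le_esum (g : int -> R) (B : R) m : (forall k, 0 <= g k) ->
  (\esum_(k in [set: int]) (g k)%:E <= B%:E)%E -> zs 0 m g <= B.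
Proof.
move=> g0 h; rewrite -lee_fin; apply: le_trans h; apply: ereal_sup_ubound.
exists [set` zlist m]; first by split=> //; exact: finite_seq.
by rewrite -fsbig_seq ?uniq_zlist// sumEFin sum_zlist.
Qed.
Lemma esum_le_zs (g : int -> R) (B : R) : (forall k, 0 <= g k) ->
  (forall m, zs 0 m g <= B) -> (\esum_(k in [set: int]) (g k)%:E <= B%:E)%E.
Proof.
move=> g0 h; apply: ge_ereal_sup => _ [A [fA _] <-].
have [m hm] : exists m, A `<=` [set` zlist m].
  have /finite_seqP[r rE] := fA.
  exists (\max_(k <- r) (absz k).+1)%N => k; rewrite rE /= => kr.
  have : ((absz k).+1 <= \max_(k <- r) (absz k).+1)%N by exact: leq_bigmax_seq.
  rewrite mem_zlist; case: k {kr} => n //=; exact: leq_trans.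
apply: (@le_trans _ _ (\sum_(k \in [set` zlist m]) (g k)%:E)%E).
  apply: lee_fsum_nneg_subset => //; first exact: finite_seq.
    by move=> k; rewrite !inE; exact: hm.
  by move=> k _; rewrite lee_fin.
by rewrite -fsbig_seq ?uniq_zlist// sumEFin sum_zlist lee_fin.
Qed.

Lemma Hs_HB s f B : Hs s f -> Hs_norm s f <= B -> HB s B (fourier f).
Proof.
move=> [_ hf] hB m; rewrite /Hs_norm in hB.
have B0 : 0 <= B := le_trans (sqrtr_ge0 _) hB.
apply: zs_le_esum => [k|]; first exact: wtterm_ge0.
have h0 : (0 <= Hs_sqnorm s f)%E.
  by apply: esum_ge0 => k _; rewrite lee_fin; exact: wtterm_ge0.
rewrite -[leLHS]/(Hs_sqnorm s f) -[leLHS]fineK; last first.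
  by rewrite ge0_fin_numE.
rewrite lee_fin -(@sqr_sqrtr _ (fine _)) ?fine_ge0//.
by rewrite ler_sqr ?nnegrE ?sqrtr_ge0.
Qed.
Lemma HB_Hs s f B : L2T f -> HB s B (fourier f) -> Hs s f.
Proof.
move=> hf hB; split=> //; apply: (@le_lt_trans _ _ (B ^+ 2)%:E); last exact: ltry.
by apply: esum_le_zs => // k; exact: wtterm_ge0.
Qed.

(** The order of magnitude, in L^2, of the part of an H^s function beyond frequency [m]. *)
Definition dec (s : R) (m : nat) : R := (m%:R `^ s)^-1.

Lemma dec_gt0 s m : (0 < m)%N -> 0 < dec s m.
Proof. by move=> m0; rewrite invr_gt0 powR_gt0// ltr0n. Qed.

Lemma powR_ge1 (a t : R) : 1 <= a -> 0 <= t -> 1 <= a `^ t.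
Proof. by move=> a1 t0; rewrite -(powRr0 a); exact: ler_powR. Qed.
Lemma wt_ge1 s (k : int) : 0 <= s -> 1 <= wt s k.
Proof. by move=> s0; apply: powR_ge1 => //; rewrite lerDl sqr_ge0. Qed.
Lemma base_ge m k : ~~ zin m k -> (m%:R : R) ^+ 2 <= 1 + (k%:~R : R) ^+ 2.
Proof. by move=> /(@zin_sqr R) h; apply: (le_trans h); rewrite lerDr. Qed.
Lemma powR_sqr (x s : R) : 0 <= x -> (x ^+ 2) `^ s = (x `^ s) ^+ 2.
Proof.
by move=> x0; rewrite -powR_mulrn// -powRrM mulrC powRrM powR_mulrn// powR_ge0.
Qed.
Lemma powR_mono (x y t : R) : 0 <= t -> 0 <= x -> x <= y -> x `^ t <= y `^ t.
Proof.
by move=> t0 x0 xy; apply: ge0_ler_powR => //; rewrite nnegrE// (le_trans x0).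
Qed.
Lemma powR_split (x t : R) : 0 < x -> x `^ (1 + t) = x * x `^ t.
Proof.
by move=> x0; rewrite powRD ?powRr1 ?(ltW x0)//; rewrite (gt_eqF x0) implybT.
Qed.
Lemma wt_dec s m k : 0 <= s -> (0 < m)%N -> ~~ zin m k -> 1 <= dec s m ^+ 2 * wt s k.
Proof.
move=> s0 m0 mk; rewrite exprVn mulrC ler_pdivlMr ?mul1r; last first.
  by rewrite exprn_gt0// powR_gt0// ltr0n.
by rewrite -powR_sqr//; apply: powR_mono; rewrite ?sqr_ge0 ?base_ge.
Qed.
Lemma wt_dec_deriv s m k : 1 <= s -> (0 < m)%N -> ~~ zin m k ->
  (k%:~R : R) ^+ 2 <= (m%:R * dec s m) ^+ 2 * wt s k.
Proof.
move=> s1 m0 mk; have mp : (0 : R) < m%:R ^+ 2 by rewrite exprn_gt0// ltr0n.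
have b0 : 0 < 1 + (k%:~R : R) ^+ 2 by apply: lt_le_trans mp (base_ge mk).
have wE : wt s k = (1 + (k%:~R : R) ^+ 2) * (1 + (k%:~R : R) ^+ 2) `^ (s - 1).
  by rewrite -powR_split// /wt; congr (_ `^ _); ring.
have dE : (m%:R * dec s m) ^+ 2 = ((m%:R ^+ 2) `^ (s - 1))^-1.
  rewrite exprMn exprVn -powR_sqr// -[in LHS](subrK 1 s) [s - 1 + 1]addrC powR_split//.
  by rewrite invfM mulrA mulfV ?mul1r// gt_eqF.
have q0 : 0 < (m%:R ^+ 2 : R) `^ (s - 1) by rewrite powR_gt0.
rewrite wE dE ler_pdivlMl//.
apply: le_trans (ler_wpM2r (sqr_ge0 _) (_ : _ <= (1 + (k%:~R : R) ^+ 2) `^ (s - 1))) _.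
  by apply: powR_mono; rewrite ?subr_ge0 ?sqr_ge0 ?base_ge.
by rewrite mulrC; apply: ler_wpM2r; [exact: powR_ge0|rewrite lerDr].
Qed.
(** Here [s > 5/2] enters: with [b = 1 + k^2], the weight is [b^2 b^(s-2)] and
    [b^(s-2) >= b^(1/2) >= m]. The gain [m] makes the differentiated Fourier series converge
    absolutely at the rate [1 / m]. *)
Lemma wt_52 s m k : 5 / 2 < s -> ~~ zin m k -> m%:R * ((k%:~R : R) ^+ 2) ^+ 2 <= wt s k.
Proof.
move=> s52 mk; set b := 1 + (k%:~R : R) ^+ 2.
have b1 : 1 <= b by rewrite lerDl sqr_ge0.
have b0 : 0 < b by apply: lt_le_trans b1.
have e : wt s k = b * (b * b `^ (s - 2)).
  rewrite -powR_split// -powR_split//; rewrite /wt -/b; congr (_ `^ _); ring.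
have h : m%:R <= b `^ (s - 2).
  apply: (@le_trans _ _ (b `^ (2^-1))); last by apply: ler_powR => //; lra.
  rewrite powR12_sqrt ?(ltW b0)// -[leLHS]ger0_norm// -sqrtr_sqr ler_wsqrtr//.
  exact: base_ge.
have k0 := sqr_ge0 (k%:~R : R).
have kb : (k%:~R : R) ^+ 2 <= b by rewrite lerDr.
rewrite e mulrA mulrC; apply: ler_pM; rewrite ?sqr_ge0//.
by rewrite expr2; apply: ler_pM.
Qed.

Lemma HB_L2 s B c m m' : 0 <= s -> (0 < m)%N -> HB s B c ->
  zs m m' (fun k => normc (c k) ^+ 2) <= (B * dec s m) ^+ 2.
Proof.
move=> s0 m0 hB; rewrite exprMn mulrC.
apply: le_trans (ler_wpM2l (sqr_ge0 _) (hB m')); rewrite -zsZ.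
apply: (@le_trans _ _ (zs m m' (fun k => dec s m ^+ 2 * (wt s k * normc (c k) ^+ 2)))).
  apply: zs_le => k mk; rewrite mulrA -[leLHS]mul1r ler_wpM2r ?sqr_ge0//.
  exact: wt_dec.
by apply: zs_sub => // k; rewrite mulr_ge0 ?sqr_ge0 ?wtterm_ge0.
Qed.
Lemma HB_L2_deriv s B c m m' : 1 <= s -> (0 < m)%N -> HB s B c ->
  zs m m' (fun k => normc (Dz c k) ^+ 2) <= (B * (m%:R * dec s m)) ^+ 2.
Proof.
move=> s0 m0 hB; rewrite exprMn mulrC.
apply: le_trans (ler_wpM2l (sqr_ge0 _) (hB m')); rewrite -zsZ.
apply: (@le_trans _ _ (zs m m' (fun k => (m%:R * dec s m) ^+ 2 * (wt s k * normc (c k) ^+ 2)))).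
  apply: zs_le => k mk; rewrite normc_Dz_sqr mulrA ler_wpM2r ?sqr_ge0//.
  exact: wt_dec_deriv.
by apply: zs_sub => // k; rewrite mulr_ge0 ?sqr_ge0 ?wtterm_ge0.
Qed.
(** [zs_l1] with weight [k^2] applied to [Dz c]. Its two sums are at most [B^2 / m] and [4 / m], and
    the parameter [2 / B] balances them. *)
Lemma HB_l1_deriv s B c m m' : 5 / 2 < s -> 0 < B -> (0 < m)%N -> HB s B c ->
  zs m m' (normc \o Dz c) <= 2 * B / m%:R.
Proof.
move=> s52 B0 m0 hB; have mp : (0 : R) < m%:R by rewrite ltr0n.
have -> : 2 * B / m%:R = ((2 / B) * (B ^+ 2 / m%:R) + (4 / m%:R) / (2 / B)) / 2.
  by field; rewrite !gt_eqF.
apply: (zs_l1 (w := fun k => k%:~R ^+ 2)).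
- by move=> j; exact: zin_neq0.
- by rewrite divr_gt0.
- rewrite ler_pdivlMr// mulrC -zsZ.
  apply: le_trans (hB m').
  apply: (@le_trans _ _ (zs m m' (fun k => wt s k * normc (c k) ^+ 2))).
    apply: zs_le => k mk; rewrite normc_Dz_sqr.
    rewrite (_ : _ * _ = m%:R * (k%:~R ^+ 2) ^+ 2 * normc (c k) ^+ 2); last by ring.
    by rewrite ler_wpM2r ?sqr_ge0//; exact: wt_52.
  by apply: zs_sub => // k; exact: wtterm_ge0.
- exact: sum_inv_sqr.
Qed.
Lemma normc_le_Dz (c : int -> C) k : ~~ zin 1 k -> normc (c k) <= normc (Dz c k).
Proof.
move=> k1; rewrite normc_Dz -[leLHS]mul1r ler_wpM2r ?normc_ge0//.
by rewrite -(ler_pXn2r (ltn0Sn 1)) ?nnegrE// expr1n real_normK ?num_real//; have := @zin_sqr R _ _ k1; rewrite expr1n.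
Qed.
Lemma zin_mono m n k : (m <= n)%N -> ~~ zin n k -> ~~ zin m k.
Proof. by move=> mn; case: k => j; rewrite /= -!leqNgt; exact: leq_trans. Qed.
Lemma HB_l1 s B c m m' : 5 / 2 < s -> 0 < B -> (0 < m)%N -> HB s B c ->
  zs m m' (normc \o c) <= 2 * B / m%:R.
Proof.
move=> s52 B0 m0 hB; apply: le_trans (HB_l1_deriv m' s52 B0 m0 hB).
by apply: zs_le => k mk /=; apply: normc_le_Dz; exact: zin_mono mk.
Qed.
Lemma HB_coef s B c k : 0 <= s -> 0 < B -> HB s B c -> normc (c k) <= B.
Proof.
move=> s0 B0 hB; rewrite -(ler_pXn2r (ltn0Sn 1)) ?nnegrE ?normc_ge0 ?(ltW B0)//.
pose m := (absz k).+1.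
have zk : zin m k by rewrite /zin {}/m; case: k => n //=; exact: ltnW.
apply: le_trans (hB m); apply: le_trans (zs_mem _ zk); last by move=> j; exact: wtterm_ge0.
by rewrite -[leLHS]mul1r ler_wpM2r ?sqr_ge0// wt_ge1.
Qed.
Lemma HB_l1_full s B c m' : 5 / 2 < s -> 0 < B -> HB s B c ->
  zs 0 m' (normc \o c) <= 4 * B /\ zs 0 m' (normc \o Dz c) <= 4 * B.
Proof.
move=> s52 B0 hB; have s0 : 0 <= s by move: s52; lra.
have cB k := HB_coef k s0 B0 hB.
case: m' => [|m']; first by rewrite !zs_geq// !mulr_ge0// ltW.
rewrite (@zs_cat _ 0 1 m'.+1 (normc \o c))// (@zs_cat _ 0 1 m'.+1 (normc \o Dz c))//.
have h1 := HB_l1 m'.+1 s52 B0 (ltn0Sn 0) hB.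
have h2 := HB_l1_deriv m'.+1 s52 B0 (ltn0Sn 0) hB.
rewrite divr1 in h1 h2.
(* The first window consists of the frequencies 0 and -1, which the tail estimates leave out; a
   single coefficient is at most [B] since the H^s weight is at least 1. *)
have e : zs 0 1 (normc \o c) <= 2 * B.
  rewrite /zs big_nat1 /=; have := cB (Posz 0); have := cB (Negz 0); lra.
have e' : zs 0 1 (normc \o Dz c) <= 2 * B.
  rewrite /zs big_nat1 /= !normc_Dz /=; have := cB (Posz 0); have := cB (Negz 0).
  by rewrite normr0 mul0r NegzE mulrNz normrN normr1 mul1r; lra.
by split; lra.
Qed.

Lemma inv_rate (A e : R) : 0 < e -> exists2 M, (0 < M)%N & forall m, (M <= m)%N ->
  A / m%:R <= e.
Proof.
move=> e0; exists (Num.truncn (`|A| / e)).+1 => // m hm.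
have mp : (0 : R) < m%:R by rewrite ltr0n (leq_trans _ hm).
rewrite ler_pdivrMr//; apply: le_trans (ler_norm _) _.
rewrite mulrC -ler_pdivrMr//; apply: le_trans (ltW (truncnS_gt _)) _.
by rewrite ler_nat.
Qed.

Lemma l1_ulim_syn (c : int -> C) (A A' : R) :
  (forall m', zs 0 m' (normc \o c) <= A') ->
  (forall m m', (0 < m)%N -> zs m m' (normc \o c) <= A / m%:R) -> ulim (syn c) c.
Proof.
move=> h0 h1; apply: (@ulim_syn _ _ (fun m => if m == 0%N then A' else A / m%:R)).
  move=> e e0; have [M M0 hM] := inv_rate A e0; exists M => m Mm.
  by rewrite -[m == 0%N]negbK -lt0n (leq_trans M0 Mm)/= hM.
move=> m m' _; case: eqP => [->|/eqP]; first exact: h0.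
by rewrite -lt0n => m0; exact: h1.
Qed.

Lemma HB_ulim s B c : 5 / 2 < s -> 0 < B -> HB s B c ->
  ulim (syn c) c /\ ulim (syn (Dz c)) (Dz c).
Proof.
move=> s52 B0 hB; split.
  apply: (@l1_ulim_syn _ (2 * B) (4 * B)) => [m'|m m' m0].
    by have [] := HB_l1_full m' s52 B0 hB.
  exact: (HB_l1 m' s52 B0 m0 hB).
apply: (@l1_ulim_syn _ (2 * B) (4 * B)) => [m'|m m' m0].
  by have [] := HB_l1_full m' s52 B0 hB.
exact: (HB_l1_deriv m' s52 B0 m0 hB).
Qed.

End SobolevCoefficients.

(** * Continuous representatives of H^s functions and of their derivatives *)

Section SobolevRepresentatives.
Context {R : realType}.
Local Notation C := R[i].
Local Notation Re := (@complex.Re R).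
Local Notation Im := (@complex.Im R).
Local Notation normc := (@ComplexField.Normc.normc R).
Local Notation mu := (@lebesgue_measure R).

Definition cmeas (f : R -> C) := measurable_fun setT (Re \o f) /\ measurable_fun setT (Im \o f).

Lemma cmeas_cont f : ccont f -> cmeas f.
Proof. by move=> [fr fi]; split; exact: continuous_measurable_fun. Qed.
Lemma cmeasD f g : cmeas f -> cmeas g -> cmeas (fun x => f x + g x).
Proof.
move=> [fr fi] [gr gi]; split.
  rewrite (_ : _ \o _ = (Re \o f) \+ (Re \o g)); first exact: measurable_funD.
  by apply/funext => y /=; rewrite ReD.
rewrite (_ : _ \o _ = (Im \o f) \+ (Im \o g)); first exact: measurable_funD.
by apply/funext => y /=; rewrite ImD.
Qed.
Lemma cmeasM f g : cmeas f -> cmeas g -> cmeas (fun x => f x * g x).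
Proof.
move=> [fr fi] [gr gi]; split.
  rewrite (_ : _ \o _ = (Re \o f) \* (Re \o g) \- (Im \o f) \* (Im \o g)).
    by apply: measurable_funB; exact: measurable_funM.
  by apply/funext => y /=; rewrite ReM.
rewrite (_ : _ \o _ = (Re \o f) \* (Im \o g) \+ (Im \o f) \* (Re \o g)).
  by apply: measurable_funD; exact: measurable_funM.
by apply/funext => y /=; rewrite ImM.
Qed.
Lemma cmeasJ f : cmeas f -> cmeas (fun x => ((f x)^*)%C).
Proof.
move=> [fr fi]; split.
  rewrite (_ : Re \o _ = Re \o f)//.
  by apply/funext => y /=; rewrite ReJ.
rewrite (_ : Im \o _ = \- (Im \o f)); first exact: measurableT_comp.
by apply/funext => y /=; rewrite ImJ.
Qed.

Lemma rtint_ae (f g : R -> R) : measurable_fun setT f -> measurable_fun setT g ->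
  {ae mu, forall x, period x -> f x = g x} -> rtint f = rtint g.
Proof.
move=> mf mg h; rewrite /rtint /Rintegral; congr (_ * fine _).
have aeF := ae_filter_ringOfSetsType mu.
apply: ae_eq_integral; first exact: measurable_period.
- by apply/measurable_EFinP; exact: measurable_funTS.
- by apply/measurable_EFinP; exact: measurable_funTS.
- by apply: filterS h => x h px; rewrite h.
Qed.
Lemma tint_ae (f g : R -> C) : cmeas f -> cmeas g ->
  {ae mu, forall x, period x -> f x = g x} -> tint f = tint g.
Proof.
move=> [fr fi] [gr gi] h; have aeF := ae_filter_ringOfSetsType mu.
by congr (_ +i* _); apply: rtint_ae => //; apply: filterS h => x h px /=; rewrite h.
Qed.

Lemma L2T_cmeas (f : R -> C) : L2T f -> cmeas f. Proof. by case. Qed.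

Lemma L2T_cintg (f : R -> C) : L2T f -> cintg f.
Proof.
move=> [pf fr fi h].
have mn : measurable_fun setT (fun x => normc (f x) ^+ 2).
  rewrite (_ : (fun x => _) = (fun x => Re (f x) ^+ 2 + Im (f x) ^+ 2)).
    by apply: measurable_funD; apply: measurable_funX.
  by apply/funext => x; rewrite sqr_normcE.
have i2 : rint (fun x => 1 + normc (f x) ^+ 2).
  apply: rintD; first exact/rint_cont/cst_continuous.
  apply/integrableP; split.
    by apply/measurable_EFinP; exact: measurable_funTS.
  apply: le_lt_trans h; rewrite le_eqVlt; apply/orP; left; apply/eqP.
  by apply: eq_integral => x _; rewrite /= ger0_norm// sqr_ge0.
have b (z r : R) : 0 <= r -> `|z| <= r -> `|z| <= `|1 + r ^+ 2|.
  move=> r0 h1; rewrite [leRHS]ger0_norm ?addr_ge0 ?sqr_ge0//; apply: (le_trans h1).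
  by have := sqr_ge0 (r - 1); nra.
split; apply: (@le_integrable _ _ _ mu _ measurable_period _ _ _ _ i2).
- by apply/measurable_EFinP; exact: measurable_funTS.
- by move=> x _; rewrite lee_fin; apply: b; rewrite ?normc_ge0 ?normc_Re.
- by apply/measurable_EFinP; exact: measurable_funTS.
- by move=> x _; rewrite lee_fin; apply: b; rewrite ?normc_ge0 ?normc_Im.
Qed.

Lemma L2T_cont (f : R -> C) : ccont f -> periodic2pi f -> L2T f.
Proof.
move=> cf pf; have [mr mi] := cmeas_cont cf; split=> //.
have /integrableP[_] := rint_cont (continuous_sqr_normc cf).
apply: le_lt_trans; rewrite le_eqVlt; apply/orP; left; apply/eqP.
by apply: eq_integral => x _; rewrite /= ger0_norm// sqr_ge0.
Qed.

Lemma isd_iter_ex k n : exists c : C, iter n cderive1 (ex k) = (fun x => c * ex k x).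
Proof.
elim: n => [|n [c IH]]; first by exists 1; apply/funext => x /=; rewrite mul1r.
exists (c * ('i%C * k%:~R)); rewrite iterS IH (isd_cderive1 (isdZ c (isd_ex k))).
by apply/funext => x; rewrite mulrA.
Qed.
Lemma smoothT_ex k : smoothT (@ex R k).
Proof.
split; first exact: periodic_ex.
move=> n; have [c ->] := isd_iter_ex k n.
exact: isd_cderivable (isdZ c (isd_ex k)).
Qed.

Lemma fourier_weak (f g : R -> C) k : cintg f -> weak_deriv f g ->
  fourier g k = Dz (fourier f) k.
Proof.
move=> cf [_ /(_ _ (smoothT_ex (- k)))].
rewrite !fourierE (isd_cderive1 (isd_ex (- k))) /Dz fourierE => /esym/eqP.
rewrite eqr_oppLR => /eqP ->.
rewrite -tintZ; last by apply: cintgM => //; exact: ccont_ex.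
rewrite -tintN; last first.
  by apply: cintgM => //; apply: ccontM; [exact: ccont_cst|exact: ccont_ex].
by apply: eq_tint => x _; rewrite mulrNz; ring.
Qed.

Lemma cintg_fourierB (f g : R -> C) k : cintg f -> cintg g ->
  fourier (fun x => f x - g x) k = fourier f k - fourier g k.
Proof. by move=> cf cg; apply: fourierB; apply: cintgM => //; exact: ccont_ex. Qed.

Lemma ulim_ae (f g : R -> C) c : cintg f -> ulim g c -> (forall k, fourier f k = c k) ->
  {ae mu, forall x, period x -> f x = g x}.
Proof.
move=> cf U H; have cg := cintg_cont (ulim_ccont U).
have aeF := ae_filter_ringOfSetsType mu.
have z : {ae mu, forall x, period x -> f x - g x = 0}.
  apply: ae_zero; first exact: cintgB.
  by move=> k; rewrite cintg_fourierB// H (ulim_fourier _ U) subrr.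
by apply: filterS z => x h px; apply/eqP; rewrite -subr_eq0 h.
Qed.

Section Representative.
Context (s B : R) (f : R -> C) (hs : 5 / 2 < s) (B0 : 0 < B) (hf : L2T f)
  (hB : HB s B (fourier f)).

Lemma HB_isd (c : int -> C) : HB s B c -> isd (syn c) (syn (Dz c)).
Proof. by move=> h; have [U U'] := HB_ulim hs B0 h; exact: ulim_isd U U'. Qed.

Lemma rep_ae : {ae mu, forall x, period x -> f x = syn (fourier f) x}.
Proof.
have [U _] := HB_ulim hs B0 hB.
by apply: (ulim_ae _ U) => //; exact: L2T_cintg.
Qed.

Lemma rep_weak_deriv : weak_deriv f (syn (Dz (fourier f))).
Proof.
have [U U'] := HB_ulim hs B0 hB; split.
  by apply: L2T_cont; [exact: ulim_ccont U'|exact: ulim_periodic U'].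
move=> chi [pchi schi].
have d0 : isd chi (cderive1 chi) by apply: cderivable_isd => x; exact: (schi 0%N).
have d1 : isd (cderive1 chi) (cderive1 (cderive1 chi)).
  by apply: cderivable_isd => x; exact: (schi 1%N).
have cc := isd_ccont d1.
have aeF := ae_filter_ringOfSetsType mu.
transitivity (tint (fun x => syn (fourier f) x * cderive1 chi x)).
  apply: tint_ae.
  - by apply: cmeasM; [exact: L2T_cmeas|exact: cmeas_cont].
  - by apply: cmeas_cont; apply: ccontM => //; exact: ulim_ccont U.
  - by apply: filterS rep_ae => x h px; rewrite h.
rewrite (tint_by_parts (HB_isd hB) d0 (ulim_ccont U') cc (ulim_periodic U) pchi).
by rewrite opprK.
Qed.

(** The series differentiated term by term is a weak derivative, so the choice made by [dx] does not
    fall back on its default 0. *)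
Lemma dx_weak : weak_deriv f (dx f).
Proof.
rewrite /dx; apply: (xgetPex (cst 0) (P := [set g | weak_deriv f g])).
by exists (syn (Dz (fourier f))); exact: rep_weak_deriv.
Qed.

Lemma dx_L2T : L2T (dx f). Proof. by have [] := dx_weak. Qed.

(** Every weak derivative has the Fourier coefficients [Dz (fourier f)], whatever representative
    [dx] has chosen. *)
Lemma dx_ae : {ae mu, forall x, period x -> dx f x = syn (Dz (fourier f)) x}.
Proof.
have [_ U'] := HB_ulim hs B0 hB.
apply: (ulim_ae _ U'); first exact/L2T_cintg/dx_L2T.
by move=> k; apply: fourier_weak; [exact: L2T_cintg|exact: dx_weak].
Qed.

End Representative.
End SobolevRepresentatives.

(** * Polynomial nonlinearities *)

Section PolynomialNonlinearity.
Context {R : realType}.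
Local Notation C := R[i].
Local Notation Re := (@complex.Re R).
Local Notation Im := (@complex.Im R).
Local Notation normc := (@ComplexField.Normc.normc R).

(* A syntax for polynomials in four variables: the ring structure of mpoly is not
   accessible here, since mpoly cannot be imported along with analysis. *)
Inductive pexp := PC of C | PX of 'I_4 | PA of pexp & pexp | PM of pexp & pexp.

Fixpoint ev (p : pexp) (v : 'I_4 -> C) : C :=
  match p with
  | PC c => c | PX i => v i
  | PA p q => ev p v + ev q v | PM p q => ev p v * ev q v
  end.
Fixpoint pder (i : 'I_4) (p : pexp) : pexp :=
  match p with
  | PC c => PC 0 | PX j => PC (i == j)%:R
  | PA p q => PA (pder i p) (pder i q)
  | PM p q => PA (PM (pder i p) q) (PM p (pder i q))
  end.

Lemma pexp_of_mpoly (F : mpoly.mpoly 4 C) :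
  exists p, forall v, mpoly.meval v F = ev p v.
Proof.
have pow (i : 'I_4) k : exists p, forall v, v i ^+ k = ev p v.
  elim: k => [|k [p hp]]; first by exists (PC 1) => v; rewrite expr0.
  by exists (PM (PX i) p) => v; rewrite exprS hp.
have prd (r : seq 'I_4) (e : 'I_4 -> nat) :
    exists p, forall v, \prod_(i <- r) v i ^+ e i = ev p v.
  elim: r => [|i r [p hp]]; first by exists (PC 1) => v; rewrite big_nil.
  by have [q hq] := pow i (e i); exists (PM q p) => v; rewrite big_cons hp hq.
suff [p hp] : exists p, forall v, \sum_(m <- mpoly.msupp F)
    mpoly.mcoeff m F * \prod_i v i ^+ (mpoly.fun_of_multinom m i) = ev p v.
  by exists p => v; rewrite -hp mpoly.mevalE.
elim: (mpoly.msupp F : seq _) => [|m r [p hp]].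
  by exists (PC 0) => v; rewrite big_nil.
have [q hq] := prd (index_enum 'I_4) (mpoly.fun_of_multinom m).
by exists (PA (PM (PC (mpoly.mcoeff m F)) q) p) => v; rewrite big_cons hp hq.
Qed.

Definition N4 (h : 'I_4 -> C) : R := \sum_i normc (h i).
(** The differential of [ev p] at [v] in the direction [h], the four variables being treated as
    independent. *)
Definition D4 (p : pexp) (v h : 'I_4 -> C) : C := \sum_i ev (pder i p) v * h i.

Lemma N4_ge0 h : 0 <= N4 h.
Proof. by apply: sumr_ge0 => i _; exact: normc_ge0. Qed.
Lemma N4_coord h i : normc (h i) <= N4 h.
Proof. by rewrite /N4 (bigD1 i)//= lerDl sumr_ge0// => j _; exact: normc_ge0. Qed.

Lemma ev_bound p (r : R) : exists2 K, 0 <= K &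
  forall v, (forall i, normc (v i) <= r) -> normc (ev p v) <= K.
Proof.
elim: p => [c|i|p [K K0 hK] q [L L0 hL]|p [K K0 hK] q [L L0 hL]].
- by exists (normc c) => [|v _]; rewrite ?normc_ge0// /ev mpoly.mevalC.
- exists `|r| => // v h; rewrite /=; exact: le_trans (h i) (ler_norm _).
- exists (K + L) => [|v h]; first exact: addr_ge0.
  rewrite /=; apply: le_trans (normc_add _ _) _.
  by apply: lerD; [exact: hK|exact: hL].
- exists (K * L) => [|v h]; first exact: mulr_ge0.
  rewrite /= normc_mul.
  by apply: ler_pM; rewrite ?normc_ge0//; [exact: hK|exact: hL].
Qed.

Lemma D4_bound p (r : R) : exists2 K, 0 <= K &
  forall v h, (forall i, normc (v i) <= r) -> normc (D4 p v h) <= K * N4 h.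
Proof.
have H i : exists2 K, 0 <= K & forall v, (forall i, normc (v i) <= r) ->
    normc (ev (pder i p) v) <= K by exact: ev_bound.
exists (\sum_i sval (cid2 (H i))) => [|v h hv].
  by apply: sumr_ge0 => i _; case: cid2.
apply: le_trans (normc_sum _ _ _) _; rewrite /N4 mulr_sumr; apply: ler_sum => i _.
rewrite normc_mul ler_wpM2r ?normc_ge0//.
apply: (@le_trans _ _ (sval (cid2 (H i)))); first by case: cid2 => K /= K0; apply.
by rewrite (bigD1 i)//= lerDl sumr_ge0// => j _; case: cid2.
Qed.

Lemma D4D p q v h : D4 (PA p q) v h = D4 p v h + D4 q v h.
Proof.
rewrite /D4 -big_split; apply: eq_bigr => i _ /=.
by rewrite mulrDl.
Qed.
Lemma D4M p q v h : D4 (PM p q) v h = D4 p v h * ev q v + ev p v * D4 q v h.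
Proof.
rewrite /D4 mulr_suml mulr_sumr -big_split; apply: eq_bigr => i _ /=.
by ring.
Qed.

Lemma ev_lip p (r : R) : exists2 K, 0 <= K & forall v w,
  (forall i, normc (v i) <= r) -> (forall i, normc (w i) <= r) ->
  normc (ev p v - ev p w) <= K * N4 (fun i => v i - w i).
Proof.
elim: p => [c|i|p [K K0 hK] q [L L0 hL]|p [K K0 hK] q [L L0 hL]].
- by exists 0 => // v w _ _; rewrite /= subrr normc_zero mul0r.
- exists 1 => // v w _ _; rewrite /= mul1r.
  exact: (N4_coord (fun i => v i - w i)).
- exists (K + L) => [|v w hv hw]; first exact: addr_ge0.
  rewrite /= mulrDl.
  rewrite opprD addrACA; apply: le_trans (normc_add _ _) _.
  by apply: lerD; [exact: hK|exact: hL].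
- have [P P0 hP] := ev_bound p r; have [Q Q0 hQ] := ev_bound q r.
  exists (K * Q + P * L) => [|v w hv hw]; first by rewrite addr_ge0 ?mulr_ge0.
  rewrite /=.
  rewrite (_ : _ - _ = (ev p v - ev p w) * ev q v + ev p w * (ev q v - ev q w)); last by ring.
  apply: le_trans (normc_add _ _) _; rewrite !normc_mul mulrDl mulrAC -mulrA.
  set n := N4 _.
  apply: lerD; last by rewrite -mulrA; apply: ler_pM; rewrite ?normc_ge0 ?hP ?hL.
  by rewrite mulrA; apply: ler_pM; rewrite ?normc_ge0 ?hK ?hQ.
Qed.

Lemma ev_taylor p (r : R) : exists2 K, 0 <= K & forall v h,
  (forall i, normc (v i) <= r) -> (forall i, normc (v i + h i) <= r) ->
  normc (ev p (fun i => v i + h i) - ev p v - D4 p v h) <= K * N4 h ^+ 2.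
Proof.
elim: p => [c|i|p [K K0 hK] q [L L0 hL]|p [K K0 hK] q [L L0 hL]].
- exists 0 => // v h _ _; rewrite /= subrr sub0r mul0r.
  rewrite /D4 big1 ?normc_opp ?normc_zero// => i _.
  by rewrite /= mul0r.
- exists 0 => // v h _ _; rewrite mul0r /= [v i + _]addrC addrK.
  rewrite (_ : D4 _ _ _ = h i) ?subrr ?normc_zero//.
  rewrite /D4 (bigD1 i)//= big1 ?addr0 => [|j /negbTE ji]; first by rewrite eqxx mul1r.
  by rewrite /= ji mul0r.
- exists (K + L) => [|v h hv hw]; first exact: addr_ge0.
  rewrite D4D /= mulrDl.
  set a := ev p _; set b := ev q _.
  rewrite (_ : _ - _ = (a - ev p v - D4 p v h) + (b - ev q v - D4 q v h)); last by ring.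
  by apply: le_trans (normc_add _ _) _; apply: lerD; [exact: hK|exact: hL].
- have [P P0 hP] := ev_bound p r; have [Q Q0 hQ] := ev_bound q r.
  have [K' K'0 hK'] := ev_lip p r; have [L' L'0 hL'] := D4_bound q r.
  exists (K * Q + P * L + K' * L') => [|v h hv hw].
    by rewrite !addr_ge0 ?mulr_ge0.
  rewrite D4M /=.
  have lip : normc (ev p (fun i => v i + h i) - ev p v) <= K' * N4 h.
    apply: le_trans (hK' _ _ hw hv) _; rewrite ler_wpM2l// le_eqVlt; apply/orP; left.
    by apply/eqP; apply: eq_bigr => i _; rewrite addrAC subrr add0r.
  have := hP _ hw; have := hK _ _ hv hw; have := hL _ _ hv hw; have := hQ _ hv.
  have := hL' v h hv; move: lip.
  set a := ev p (fun i => v i + h i); set b := ev q (fun i => v i + h i).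
  set n := N4 h; have n0 : 0 <= n := N4_ge0 h.
  move=> h1 h2 h3 h4 h5 h6.
  (* The remainder of a product: each factor contributes its own remainder times a bounded quantity,
     and the mixed term is quadratic as a Lipschitz increment times a differential. *)
  rewrite (_ : _ - _ = (a - ev p v - D4 p v h) * ev q v +
    a * (b - ev q v - D4 q v h) + (a - ev p v) * D4 q v h); last by ring.
  have -> : (K * Q + P * L + K' * L') * n ^+ 2 =
     K * n ^+ 2 * Q + P * (L * n ^+ 2) + K' * n * (L' * n) by ring.
  apply: le_trans (normc_add _ _) _; apply: lerD.
    apply: le_trans (normc_add _ _) _; rewrite !normc_mul.
    by apply: lerD; apply: ler_pM; rewrite ?normc_ge0.
  by rewrite normc_mul; apply: ler_pM; rewrite ?normc_ge0.
Qed.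

(** An induction principle: any property of functions that holds for constants and passes to sums
    and products passes to polynomial expressions. It serves for continuity, measurability and C^1
    regularity. *)
Lemma ev_closed (P : (R -> C) -> Prop) (v : R -> 'I_4 -> C) p :
  (forall c, P (fun=> c)) -> (forall i, P (fun x => v x i)) ->
  (forall f g, P f -> P g -> P (fun x => f x + g x)) ->
  (forall f g, P f -> P g -> P (fun x => f x * g x)) ->
  P (fun x => ev p (v x)).
Proof.
move=> hC hX hD hM; elim: p => [c|i|p hp q hq|p hp q hq].
- exact: hC.
- exact: hX.
- exact: hD.
- exact: hM.
Qed.

Definition vec (a b : C) : 'I_4 -> C := fun i => [:: a; b; (a^*)%C; (b^*)%C]`_i.

Lemma I4_ind (P : 'I_4 -> Prop) :
  P 0%R -> P 1%R -> P 2%R -> P 3%R -> forall i, P i.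
Proof.
move=> h0 h1 h2 h3 [[|[|[|[|//]]]] hi].
- by rewrite (_ : Ordinal hi = 0%R)//; apply/val_inj.
- by rewrite (_ : Ordinal hi = 1%R)//; apply/val_inj.
- by rewrite (_ : Ordinal hi = 2%R)//; apply/val_inj.
- by rewrite (_ : Ordinal hi = 3%R)//; apply/val_inj.
Qed.

Lemma evalFE (F : mpoly.mpoly 4 C) p : (forall v, mpoly.meval v F = ev p v) ->
  forall a b, evalF F a b = ev p (vec a b).
Proof. by move=> h a b; exact: h. Qed.
Lemma vecD a b c d i : vec (a + c) (b + d) i = vec a b i + vec c d i.
Proof. by elim/I4_ind: i; rewrite /vec/= ?conjcD. Qed.
Lemma vecB a b c d i : vec (a - c) (b - d) i = vec a b i - vec c d i.
Proof. by elim/I4_ind: i; rewrite /vec/= ?(rmorphB (@conjc R)). Qed.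
Lemma vec_le a b r i : normc a <= r -> normc b <= r -> normc (vec a b i) <= r.
Proof. by move=> ha hb; elim/I4_ind: i; rewrite /vec/= ?normc_conj. Qed.
Lemma sum4 (V : nmodType) (g : 'I_4 -> V) : \sum_i g i = g 0%R + g 1%R + g 2%R + g 3%R.
Proof.
rewrite !big_ord_recl big_ord0 addr0 !addrA.
by congr (g _ + g _ + g _ + g _); apply/val_inj.
Qed.
Lemma N4_vec a b : N4 (vec a b) = 2 * (normc a + normc b).
Proof. by rewrite /N4 sum4 /vec/= !normc_conj; ring. Qed.

(** The formal partial derivatives; the indices 0 to 3 stand for alpha, beta and their conjugates,
    so 1 is the derivative in beta and 3 the one in its conjugate. *)
Definition Fd (F : pexp) (i : 'I_4) (a b : C) : C := ev (pder i F) (vec a b).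

Lemma D4_vec F a b c d : D4 F (vec a b) (vec c d) =
  Fd F 0%R a b * c + Fd F 1%R a b * d + Fd F 2%R a b * (c^*)%C + Fd F 3%R a b * (d^*)%C.
Proof. by rewrite /D4 sum4. Qed.

Definition pv (F : pexp) (a b : C) : C := ev F (vec a b).

Lemma pv_taylor F r : exists2 K, 0 <= K & forall a b c d,
  normc a <= r -> normc b <= r -> normc (a + c) <= r -> normc (b + d) <= r ->
  normc (pv F (a + c) (b + d) - pv F a b - (Fd F 0%R a b * c + Fd F 1%R a b * d +
    Fd F 2%R a b * (c^*)%C + Fd F 3%R a b * (d^*)%C)) <= K * (normc c + normc d) ^+ 2.
Proof.
have [K K0 hK] := ev_taylor F r; exists (K * 4) => [|a b c d h1 h2 h3 h4].
  exact: mulr_ge0.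
have := hK (vec a b) (vec c d); rewrite N4_vec D4_vec exprMn mulrA /pv.
rewrite (_ : (fun i => _) = vec (a + c) (b + d)); last first.
  by apply/funext => i; rewrite vecD.
rewrite (_ : 2 ^+ 2 = 4); last by rewrite -natrX.
apply=> i; first exact: vec_le.
by rewrite -vecD; exact: vec_le.
Qed.

Lemma Fd_lip F i r : exists2 K, 0 <= K & forall a b c d,
  normc a <= r -> normc b <= r -> normc c <= r -> normc d <= r ->
  normc (Fd F i a b - Fd F i c d) <= K * (normc (a - c) + normc (b - d)).
Proof.
have [K K0 hK] := ev_lip (pder i F) r; exists (K * 2) => [|a b c d h1 h2 h3 h4].
  exact: mulr_ge0.
have := hK (vec a b) (vec c d); rewrite (_ : (fun i => _) = vec (a - c) (b - d)); last first.
  by apply/funext => j; rewrite vecB.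
by rewrite N4_vec mulrA; apply=> j; exact: vec_le.
Qed.
Lemma Fd_bound F i r : exists2 K, 0 <= K & forall a b, normc a <= r -> normc b <= r ->
  normc (Fd F i a b) <= K.
Proof.
have [K K0 hK] := ev_bound (pder i F) r; exists K => // a b ha hb.
by apply: hK => j; exact: vec_le.
Qed.
Lemma pv_lip F r : exists2 K, 0 <= K & forall a b c d,
  normc a <= r -> normc b <= r -> normc c <= r -> normc d <= r ->
  normc (pv F a b - pv F c d) <= K * (normc (a - c) + normc (b - d)).
Proof.
have [K K0 hK] := ev_lip F r; exists (K * 2) => [|a b c d h1 h2 h3 h4].
  exact: mulr_ge0.
have := hK (vec a b) (vec c d); rewrite (_ : (fun i => _) = vec (a - c) (b - d)); last first.
  by apply/funext => j; rewrite vecB.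
by rewrite N4_vec mulrA; apply=> j; exact: vec_le.
Qed.

Lemma ev_vec_closed (P : (R -> C) -> Prop) (f g : R -> C) p :
  (forall c, P (fun=> c)) -> P f -> P g ->
  (forall f, P f -> P (fun x => ((f x)^*)%C)) ->
  (forall f g, P f -> P g -> P (fun x => f x + g x)) ->
  (forall f g, P f -> P g -> P (fun x => f x * g x)) ->
  P (fun x => ev p (vec (f x) (g x))).
Proof.
move=> hC hf hg hJ hD hM; apply: (@ev_closed P (fun x => vec (f x) (g x))) => //.
by elim/I4_ind; rewrite /vec/=; [exact: hf|exact: hg|exact: hJ|exact: hJ].
Qed.

(** Along the real line through [b] with unit direction [d] the derivative is [A d + B conj d], by
    the quadratic Taylor bound. Taking [d = 1] and [d = i], the Wirtinger combination cancels
    [B]. *)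
Lemma F_betaE (G : mpoly.mpoly 4 C) F a b : (forall v, mpoly.meval v G = ev F v) ->
  F_beta G a b = Fd F 1%R a b.
Proof.
move=> GF; have [K K0 hK] := pv_taylor F (normc a + normc b + 1).
have a1 : normc a <= normc a + normc b + 1 by rewrite -addrA lerDl addr_ge0 ?normc_ge0.
have b1 : normc b <= normc a + normc b + 1 by have := normc_ge0 a; lra.
set A := Fd F 1%R a b; set B := Fd F 3%R a b.
have key (d : C) (g : R -> C) (x0 : R) : normc d = 1 ->
    (forall h : R, g (x0 + h) = pv F a (b + h%:C * d)) ->
    cderive1 g x0 = A * d + B * (d^*)%C.
  move=> nd hg.
  have g0 : g x0 = pv F a b by rewrite -[x0]addr0 hg mul0r addr0.
  have est h : `|h| <= 1 -> normc (g (x0 + h) - g x0 - h%:C * (A * d + B * (d^*)%C)) <=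
      K * `|h| ^+ 2.
    move=> h1; have := hK a b 0 (h%:C * d) a1 b1.
    rewrite addr0 => /(_ a1 _); rewrite normc_zero add0r normc_mul normc_real nd mulr1.
    rewrite hg g0 conjc0 !mulr0 add0r addr0 conjcM.
    rewrite (_ : ((h%:C)^*)%C = h%:C); last by apply: cext; rewrite /= ?oppr0.
    rewrite (_ : _ * (A * d + _) = A * (h%:C * d) + B * (h%:C * (d^*)%C)); last by ring.
    apply; apply: le_trans (normc_add _ _) _; rewrite normc_mul normc_real nd mulr1.
    by rewrite [leRHS]addrAC; have := normc_ge0 a; lra.
  have der (P : C -> R) (PM : forall z w, P (z - w) = P z - P w)
      (PZ : forall (t : R) z, P (t%:C * z) = t * P z) (Pn : forall z, `|P z| <= normc z) :
      derive1 (P \o g) x0 = P (A * d + B * (d^*)%C).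
    rewrite derive1E; apply: derive_val; apply: is_derive_eps => e e0.
    have K1 : 0 < K + 1 by apply: ltr_wpDl.
    exists (Num.min 1 (e / (K + 1))); first by rewrite lt_min ltr01 divr_gt0.
    move=> h /andP[h0]; rewrite lt_min => /andP[h1 h2].
    rewrite /= -PZ -!PM; apply: le_trans (Pn _) _; apply: le_trans (est h (ltW h1)) _.
    rewrite expr2 mulrA ler_wpM2r//; rewrite ltr_pdivlMr// in h2.
    by apply: le_trans (ltW h2); rewrite mulrC ler_wpM2l// lerDl.
  apply: cext; rewrite /cderive1 /=.
    by apply: der => [z w|t z|z]; rewrite ?ReImE /= ?mul0r ?subr0// normc_Re.
  by apply: der => [z w|t z|z]; rewrite ?ReImE /= ?mul0r ?addr0// normc_Im.
rewrite /F_beta /wirtinger.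
have GE : evalF G a = pv F a by apply/funext => z; exact: GF.
rewrite GE.
rewrite (key 1); last 2 first.
- exact: normc_one.
- by move=> h; congr pv; apply: cext; rewrite ?ReImE /=; ring.
rewrite (key 'i%C); last 2 first.
- exact: normc_i.
- by move=> h; congr pv; apply: cext; rewrite ?ReImE /=; ring.
have -> : (('i%C : C)^*)%C = - 'i%C by apply: cext; rewrite /= ?oppr0.
rewrite conjc1 (_ : 'i%C * (A * 'i%C + B * - 'i%C) = ('i%C * 'i%C) * (A - B)); last by ring.
by rewrite i_sqr; field.
Qed.

End PolynomialNonlinearity.

(** * Trigonometric polynomials and the gauge transformation *)

Section TrigDegree.
Context {R : realType}.
Local Notation C := R[i].
Local Notation Re := (@complex.Re R).
Local Notation Im := (@complex.Im R).
Local Notation normc := (@ComplexField.Normc.normc R).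

Inductive trig : nat -> (R -> C) -> Prop :=
| trig_ex M k c : (`|k| <= M)%N -> trig M (fun x => c * ex k x)
| trig_add M f g : trig M f -> trig M g -> trig M (fun x => f x + g x).

Lemma trig_eq M f g : trig M f -> f =1 g -> trig M g.
Proof. by move=> h /funext <-. Qed.
Lemma trig_mono M M' f : (M <= M')%N -> trig M f -> trig M' f.
Proof.
move=> h hf; elim: hf M' h => [M0 k c hk|M0 g g' _ IH _ IH'] M' h.
  by apply: trig_ex; exact: leq_trans hk h.
by apply: trig_add; [exact: IH|exact: IH'].
Qed.
Lemma trig_cst c : trig 0 (fun=> c).
Proof. by apply: (trig_eq (@trig_ex 0 0 c _)) => // x; rewrite ex0 mulr1. Qed.
Lemma trig_mul M M' f g : trig M f -> trig M' g -> trig (M + M') (fun x => f x * g x).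
Proof.
move=> hf; elim: hf g => {M f} [M k c hk|M f f' _ IH _ IH'] g hg.
  elim: hg => {M' g} [M' k' c' hk'|M' g g' _ IH _ IH'].
    apply: (trig_eq (@trig_ex (M + M') (k + k') (c * c') _)).
      by lia.
    by move=> x; rewrite exD; ring.
  by apply: (trig_eq (trig_add IH IH')) => x; rewrite mulrDr.
by apply: (trig_eq (trig_add (IH _ hg) (IH' _ hg))) => x; rewrite mulrDl.
Qed.
Lemma trigJ M f : trig M f -> trig M (fun x => ((f x)^*)%C).
Proof.
elim=> {M f} [M k c hk|M f f' _ IH _ IH'].
  apply: (trig_eq (@trig_ex M (- k) (c^*)%C _)); first by lia.
  by move=> x; rewrite conjcM exJ.
by apply: (trig_eq (trig_add IH IH')) => x; rewrite conjcD.
Qed.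
Lemma trig_Tz m c : trig m (Tz 0 m c).
Proof.
have h n : (n <= m)%N -> trig m (Tz 0 n c).
  elim: n => [|n IH] nm.
    apply: (trig_mono (leq0n m)); apply: (trig_eq (trig_cst 0)) => x.
    by rewrite /Tz zs_geq.
  have h1 : trig m (fun x => c (Posz n) * ex (Posz n) x) by apply: trig_ex; lia.
  have h2 : trig m (fun x => c (Negz n) * ex (Negz n) x) by apply: trig_ex; lia.
  apply: (trig_eq (trig_add (IH (ltnW nm)) (trig_add h1 h2))) => x.
  by rewrite /Tz /zs big_nat_recr.
exact: h.
Qed.
Lemma trig_ccont M f : trig M f -> ccont f.
Proof.
elim=> {M f} [M k c _|M f g _ hf _ hg]; last exact: ccontD.
by apply: ccontM; [exact: ccont_cst|exact: ccont_ex].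
Qed.
Lemma trig_periodic M f : trig M f -> periodic2pi f.
Proof.
elim=> {M f} [M k c _ x|M f g _ hf _ hg x]; first by rewrite periodic_ex.
by rewrite hf hg.
Qed.
Lemma trig_isd M f : trig M f -> exists2 f', trig M f' & isd f f'.
Proof.
elim=> {M f} [M k c hk|M f g _ [f' tf hf] _ [g' tg hg]].
  exists (fun x => c * ('i%C * k%:~R) * ex k x); first exact: trig_ex.
  by apply: isd_ext (isdZ c (isd_ex k)) => x //; rewrite mulrA.
by exists (fun x => f' x + g' x); [exact: trig_add|exact: isdD].
Qed.
Lemma trig_orth M f k : trig M f -> (M < `|k|)%N -> tint (fun x => f x * ex k x) = 0.
Proof.
elim=> {M f} [M j c hj|M f g tf hf tg hg] Mk.
  rewrite (eq_tint (g := fun x => c * ex (j + k) x)); last first.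
    by move=> x _; rewrite exD mulrA.
  rewrite tintZ; last exact/cintg_cont/ccont_ex.
  rewrite tint_ex (_ : (j + k == 0) = false) ?mulr0//.
  by apply/eqP; lia.
rewrite (eq_tint (g := fun x => f x * ex k x + g x * ex k x)); last first.
  by move=> x _; rewrite mulrDl.
rewrite tintD ?hf ?hg ?addr0//.
  by apply/cintg_cont/ccontM; [exact: trig_ccont tf|exact: ccont_ex].
by apply/cintg_cont/ccontM; [exact: trig_ccont tg|exact: ccont_ex].
Qed.
(** The number [d] bounds the degree of [F]; at a sum the two bounds are added instead of compared,
    which is enough here. *)
Lemma trig_pv (F : @pexp R) : exists d, forall M f g, trig M f -> trig M g ->
  trig (d * M) (fun x => pv F (f x) (g x)).
Proof.
rewrite /pv; elim: F => [c|i|p [d hd] q [d' hd']|p [d hd] q [d' hd']].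
- by exists 0%N => M f g _ _; exact: trig_cst.
- exists 1%N => M f g hf hg; rewrite mul1n.
  by elim/I4_ind: i; rewrite /vec /=; [exact: hf|exact: hg|exact: trigJ|exact: trigJ].
- exists (d + d')%N => M f g hf hg.
  apply: trig_add; first by apply: trig_mono (hd _ _ _ hf hg); lia.
  by apply: trig_mono (hd' _ _ _ hf hg); lia.
- exists (d + d')%N => M f g hf hg; rewrite mulnDl.
  by apply: trig_mul; [exact: hd|exact: hd'].
Qed.

End TrigDegree.

(** * The gauge factor *)

Section Gauge.
Context {R : realType}.
Local Notation C := R[i].
Local Notation Re := (@complex.Re R).
Local Notation Im := (@complex.Im R).
Local Notation normc := (@ComplexField.Normc.normc R).

Lemma periodic_shift (f : R -> C) (k : int) x : periodic2pi f -> f (x + k%:~R * (2 * pi)) = f x.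
Proof.
move=> pf; have h (n : nat) y : f (y + n%:R * (2 * pi)) = f y.
  elim: n => [|n IH]; first by rewrite mul0r addr0.
  by rewrite -natr1 mulrDl mul1r addrA pf IH.
case: k => n; first exact: h.
by rewrite NegzE mulrNz mulNr -[LHS](h n.+1) subrK.
Qed.
Lemma eq_periodic (f g : R -> C) : periodic2pi f -> periodic2pi g ->
  (forall x, period x -> f x = g x) -> f =1 g.
Proof.
move=> pf pg h x; have p0 : 0 < 2 * pi :> R by rewrite mulr_gt0// pi_gt0.
pose k := Num.floor ((x + pi) / (2 * pi)).
rewrite -(periodic_shift (- k) x pf) -(periodic_shift (- k) x pg); apply: h.
have /andP[h1 h2] := floor_itv ((x + pi) / (2 * pi)).
rewrite -/k ler_pdivlMr// in h1; rewrite -/k ltr_pdivrMr// intrD mulrDl mul1r in h2.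
rewrite /period /= in_itv/= mulrNz mulNr.
set q := k%:~R * (2 * pi) in h1 h2 *; move: h1 h2; move: (pi : R) => p h1 h2.
by apply/andP; split; lra.
Qed.

Definition cexp (z : C) : C := expR (Re z) *: (cos (Im z) +i* sin (Im z) : Rcomplex R).

Lemma isd_cexp (f f' : R -> C) : isd f f' ->
  isd (fun x => cexp (f x)) (fun x => f' x * cexp (f x)).
Proof.
move=> hf x; have [hr hi] := hf x; split.
  rewrite (_ : Re \o _ = (expR \o (Re \o f)) * (cos \o (Im \o f)))//.
  by apply: is_derive_eq; rewrite /cexp ReM /GRing.scale/=; ring.
rewrite (_ : Im \o _ = (expR \o (Re \o f)) * (sin \o (Im \o f)))//.
by apply: is_derive_eq; rewrite /cexp ImM /GRing.scale/=; ring.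
Qed.
Lemma cexp_neq0 z : cexp z != 0.
Proof.
have h : Re (cexp z) ^+ 2 + Im (cexp z) ^+ 2 = expR (Re z) ^+ 2.
  by rewrite /cexp /= !exprMn -mulrDr cos2Dsin2 mulr1.
apply/eqP => e; move: h; rewrite e /= expr0n/= addr0 => /esym/eqP.
by rewrite sqrf_eq0 gt_eqF ?expR_gt0.
Qed.

Lemma c1_synT (f f' : R -> C) : isd f f' -> ccont f' -> periodic2pi f ->
  ulim f (fourier f).
Proof.
move=> hf cf pf; have [U E] := c1_syn hf cf pf.
have e : f = syn (fourier f).
  by apply/funext; apply: eq_periodic => //; exact: ulim_periodic U.
by move: U; rewrite -e.
Qed.

(** The coefficients are divided by [i k], legitimately because the mean of [a] is 0.
    Differentiating them back gives those of [a], so both series converge uniformly. *)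
Lemma antiderivative (a a' : R -> C) : isd a a' -> ccont a' -> periodic2pi a ->
  tint a = 0 -> exists2 th, isd th a & periodic2pi th.
Proof.
move=> ha ca pa a0.
have U := c1_synT ha ca pa.
pose d k := if k == 0 then 0 else fourier a k / ('i%C * k%:~R).
have dE : Dz d = fourier a.
  apply/funext => k; rewrite /Dz /d; case: eqP => [->|/eqP k0].
    by rewrite mulr0 fourierE -[LHS]a0; apply: eq_tint => x _; rewrite oppr0 ex0 mulr1.
  by rewrite mulrC divfK// mulf_neq0 ?i_neq0// intr_eq0.
have Ud : ulim (syn d) d.
  apply: (@c1_ulim_syn _ _ (L2sq a)) => m; rewrite dE.
  by apply: bessel; exact: isd_ccont ha.
exists (syn d); last exact: ulim_periodic Ud.
by apply: (ulim_isd Ud); rewrite dE.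
Qed.

(** With [th' = A - m], the function [G0 = exp (i th / 2)] has logarithmic derivative
    [i (A - m) / 2]. Multiplication by [exp (- i l x)] replaces [m] by [m + 2 l], which has the same
    imaginary part. Since [G0] never vanishes, some coefficient [l] of it is nonzero, and that
    coefficient becomes the mean of [G]. *)
Lemma gauge (A A' : R -> C) : isd A A' -> ccont A' -> periodic2pi A ->
  exists (lam : C) (G G' G'' : R -> C),
  [/\ Im lam = Im (tint A),
      isd G G', isd G' G'', ccont G'' & periodic2pi G] /\
  (forall x, G' x = 'i%C / 2 * (A x - lam) * G x) /\ tint G != 0.
Proof.
move=> hA cA pA; have ccA := isd_ccont hA.
pose m := tint A.
have [th hth pth] : exists2 th, isd th (fun x => A x - m) & periodic2pi th.
  apply: (@antiderivative _ A') => //.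
  - by apply: isd_ext (isdB hA (isd_cst m)) => x //; rewrite subr0.
  - by move=> x; rewrite pA.
  - by rewrite tintB ?tint_cst ?subrr//; apply: cintg_cont => //; exact: ccont_cst.
pose G0 x := cexp ('i%C / 2 * th x).
have hG0 := isd_cexp (isdZ ('i%C / 2) hth).
have cG0 : ccont G0 := isd_ccont hG0.
have pG0 : periodic2pi G0 by move=> x; rewrite /G0 pth.
have [l hl] : exists l, fourier G0 l != 0.
  apply: contrapT => H; have /eqP := cexp_neq0 ('i%C / 2 * th 0); apply.
  apply: (uniq_cont cG0 pG0) => [k|].
    by apply/eqP; apply: contrapT => /negP h; apply: H; exists k.
  by rewrite /period /= in_itv/= oppr_le0 pi_ge0.
pose lam := m + 2 * l%:~R.
pose G x := G0 x * ex (- l) x.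
pose G' x := 'i%C / 2 * (A x - lam) * G x.
have hG : isd G G'.
  apply: isd_ext (isdM hG0 (isd_ex (- l))) => x //.
  by rewrite /G' /G /lam mulrNz -/(G0 x); field.
pose G'' x := 'i%C / 2 * (A' x * G x + (A x - lam) * G' x).
exists lam, G, G', G''; split.
  split => //.
  - rewrite /lam ImD ReImE -(rmorph_int (real_complex R)) /=.
    by rewrite mulr0 addr0 mul0r !addr0.
  - have h := isdZ ('i%C / 2) (isdM (isdB hA (isd_cst lam)) hG).
    by apply: isd_ext h => x; rewrite /G' /G'' ?subr0// mulrA.
  - have cG := isd_ccont hG.
    apply: ccontM; first exact: ccont_cst.
    apply: ccontD; first exact: ccontM.
    apply: ccontM; first by apply: ccontB => //; exact: ccont_cst.
    apply: ccontM => //; apply: ccontM; first exact: ccont_cst.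
    by apply: ccontB => //; exact: ccont_cst.
  - by apply: periodicM => //; exact: periodic_ex.
by split=> //; rewrite fourierE in hl.
Qed.

End Gauge.

(** * Estimates at a fixed time *)

Section BigO.
Context {R : realType}.
Local Notation C := R[i].
Local Notation normc := (@ComplexField.Normc.normc R).
Context (T : Type) (valid : T -> Prop).

(* Bounds that are uniform over the valid indices of a family. *)
Definition bigO (eps : T -> R) (Z : T -> C) :=
  exists2 K, 0 <= K & forall q, valid q -> normc (Z q) <= K * eps q.
Definition L2b (a : T -> R) (f : T -> R -> C) :=
  (forall q, valid q -> ccont (f q)) /\
  exists2 K, 0 < K & forall q, valid q -> L2sq (f q) <= (K * a q) ^+ 2.
Definition Supb (a : T -> R) (f : T -> R -> C) :=
  (forall q, valid q -> ccont (f q)) /\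
  exists2 K, 0 < K & forall q, valid q -> forall x, period x -> normc (f q x) <= K * a q.

Lemma bigOD eps Z W : bigO eps Z -> bigO eps W -> bigO eps (fun q => Z q + W q).
Proof.
move=> [K K0 hK] [L L0 hL]; exists (K + L) => [|q hq]; first exact: addr_ge0.
by rewrite mulrDl; apply: le_trans (normc_add _ _) _; apply: lerD; [exact: hK|exact: hL].
Qed.
Lemma bigOZ eps c Z : bigO eps Z -> bigO eps (fun q => c * Z q).
Proof.
move=> [K K0 hK]; exists (normc c * K) => [|q hq]; first by rewrite mulr_ge0 ?normc_ge0.
by rewrite normc_mul -mulrA ler_wpM2l ?normc_ge0 ?hK.
Qed.
Lemma bigO_eq eps Z W : (forall q, valid q -> Z q = W q) -> bigO eps Z -> bigO eps W.
Proof. by move=> e [K K0 hK]; exists K => // q hq; rewrite -e//; exact: hK. Qed.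
Lemma bigO_le eps eps' Z : (forall q, valid q -> eps q <= eps' q) -> bigO eps Z -> bigO eps' Z.
Proof.
move=> e [K K0 hK]; exists K => // q hq; apply: le_trans (hK q hq) _.
by rewrite ler_wpM2l// e.
Qed.

Lemma SupbM a b f g : Supb a f -> Supb b g -> Supb (fun q => a q * b q) (fun q x => f q x * g q x).
Proof.
move=> [cf [K K0 hK]] [cg [L L0 hL]]; split=> [q hq|]; first exact: ccontM (cf q hq) (cg q hq).
exists (K * L) => [|q hq x px]; first exact: mulr_gt0.
rewrite normc_mul mulrACA; apply: ler_pM; rewrite ?normc_ge0//; [exact: hK|exact: hL].
Qed.
Lemma L2bM a b f g : L2b a f -> Supb b g -> L2b (fun q => a q * b q) (fun q x => f q x * g q x).
Proof.
move=> [cf [K K0 hK]] [cg [L L0 hL]].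
have cfg q (hq : valid q) : ccont (fun x => f q x * g q x) by exact: ccontM (cf q hq) (cg q hq).
split=> //; exists (K * L) => [|q hq]; first exact: mulr_gt0.
rewrite mulrACA exprMn [leRHS]mulrC.
apply: le_trans (ler_wpM2l (sqr_ge0 _) (hK q hq)).
rewrite /L2sq -rtintZ; last exact/rint_cont/continuous_sqr_normc/cf.
apply: rtint_le.
- exact/rint_cont/continuous_sqr_normc/cfg.
- exact/rintZ/rint_cont/continuous_sqr_normc/cf.
move=> x px; rewrite normc_mul exprMn mulrC ler_wpM2r ?sqr_ge0//.
by rewrite ler_sqr ?nnegrE ?normc_ge0 ?hL// (le_trans _ (hL q hq x px)) ?normc_ge0.
Qed.
Lemma Supb_L2b a f : Supb a f -> L2b a f.
Proof.
move=> [cf [K K0 hK]]; split=> //; exists K => // q hq.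
rewrite -(@rtint_cst R ((K * a q) ^+ 2)); apply: rtint_le.
- exact/rint_cont/continuous_sqr_normc/cf.
- exact/rint_cont/cst_continuous.
move=> x px; rewrite ler_sqr ?nnegrE ?normc_ge0 ?hK//.
by rewrite (le_trans _ (hK q hq x px)) ?normc_ge0.
Qed.
Lemma L2bJ a f : L2b a f -> L2b a (fun q x => ((f q x)^*)%C).
Proof.
move=> [cf [K K0 hK]]; split=> [q hq|]; first exact/ccontJ/cf.
exists K => // q hq; rewrite /L2sq; under eq_fun do rewrite normc_conj.
exact: hK.
Qed.
Lemma SupbJ a f : Supb a f -> Supb a (fun q x => ((f q x)^*)%C).
Proof.
move=> [cf [K K0 hK]]; split=> [q hq|]; first exact/ccontJ/cf.
by exists K => // q hq x px; rewrite normc_conj hK.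
Qed.
Lemma Supb_fix (f : R -> C) : ccont f -> Supb (fun=> 1) (fun _ => f).
Proof.
move=> cf; split=> [//|]; have [K K0 hK] := ccont_bounded cf.
by exists K => // q _ x px; rewrite mulr1 hK.
Qed.
Lemma Supb_ex (k : T -> int) : Supb (fun=> 1) (fun q => ex (k q)).
Proof.
split=> [q _|]; first exact: ccont_ex.
by exists 1 => // q _ x _; rewrite normc_ex mulr1.
Qed.
Lemma bigO_tint a b eps f g : L2b a f -> L2b b g ->
  (forall q, valid q -> [/\ 0 < a q, 0 < b q & a q * b q <= eps q]) ->
  bigO eps (fun q => tint (fun x => f q x * g q x)).
Proof.
move=> [cf [K K0 hK]] [cg [L L0 hL]] h; exists (2 * (K * L)) => [|q hq].
  by rewrite !mulr_ge0// ltW.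
have [a0 b0 ab] := h q hq.
have := @tintM_le R (f q) (g q) (fun=> 1) _ _ 1 (cf q hq) (cg q hq) (@ccont_cst R 1)
  (hK q hq) (hL q hq).
rewrite (eq_tint (g := fun x => f q x * g q x)); last by move=> x _; rewrite mulr1.
move=> /(_ _ (mulr_gt0 K0 a0) (mulr_gt0 L0 b0)) e; apply: le_trans (e _) _.
  by move=> x _; rewrite normc_one.
rewrite mulr1 (_ : 2 * (K * a q * (L * b q)) = 2 * (K * L) * (a q * b q)); last by ring.
by rewrite ler_wpM2l// !mulr_ge0// ltW.
Qed.

End BigO.

(** * Truncation of the Fourier series of a C^1 function *)

Section Truncation.
Context {R : realType}.
Local Notation C := R[i].
Local Notation normc := (@ComplexField.Normc.normc R).

Lemma zin_sqr_le m (k : int) : zin m k -> (k%:~R : R) ^+ 2 <= m%:R ^+ 2.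
Proof.
case: k => j /= jm; rewrite ?Posz_sqr ?Negz_sqr ler_sqr ?nnegrE// ler_nat//; exact: ltnW.
Qed.
Lemma zs_le_in m (g h : int -> R) : (forall k, zin m k -> g k <= h k) ->
  zs 0 m g <= zs 0 m h.
Proof.
move=> gh; rewrite /zs big_nat_cond [leRHS]big_nat_cond; apply: ler_sum => j /andP[/andP[_ jm] _].
by apply: lerD; exact: gh.
Qed.

Section C1.
Context (f f' : R -> C) (hf : isd f f') (cf : ccont f') (pf : periodic2pi f).
Let c := fourier f.

Lemma trunc_ulim : ulim f c. Proof. exact: c1_synT. Qed.
Lemma Dz_fourier : Dz c = fourier f'.
Proof. by apply/funext => k; rewrite /c -(fourier_deriv _ hf cf pf). Qed.
Lemma trunc_L2 M : (0 < M)%N -> L2sq (fun x => f x - Tz 0 M c x) <= 2 * (L2sq f' / M%:R ^+ 2).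
Proof.
move=> M0; have Mp : (0 : R) < M%:R ^+ 2 by rewrite exprn_gt0// ltr0n.
apply: ulim_L2; first exact: trunc_ulim.
move=> m'; rewrite ler_pdivlMr// mulrC -zsZ.
apply: le_trans (bessel m' cf); rewrite -Dz_fourier.
apply: (@le_trans _ _ (zs M m' (fun k => normc (Dz c k) ^+ 2))).
  by apply: zs_le => k mk; rewrite normc_Dz_sqr ler_wpM2r ?sqr_ge0// zin_sqr.
by apply: zs_sub => // k; exact: sqr_ge0.
Qed.
Lemma trunc_sup : exists2 K, 0 < K & forall M x, normc (Tz 0 M c x) <= K.
Proof.
have hA m : zs 0 m (fun k => normc (Dz c k) ^+ 2) <= L2sq f' by rewrite Dz_fourier bessel.
exists (1 + (zs 0 1 (normc \o c) + (L2sq f' + 4) / 2 / Num.sqrt 1%:R)).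
  rewrite ltr_pwDl// addr_ge0 ?zs_ge0//; first by move=> k; exact: normc_ge0.
  by rewrite !divr_ge0 ?sqrtr_ge0// addr_ge0 ?L2sq_ge0.
move=> M x; apply: le_trans (normc_Tz _ _ _ _) _; apply: ler_wpDl => //.
case: M => [|M].
  rewrite zs_geq// addr_ge0 ?zs_ge0//; first by move=> k; exact: normc_ge0.
  by rewrite !divr_ge0 ?sqrtr_ge0// addr_ge0 ?L2sq_ge0.
by rewrite (@zs_cat _ 0 1 M.+1)// lerD2l; exact: c1_sum.
Qed.
Lemma trunc_deriv_L2 M : L2sq (Tz 0 M (Dz c)) <= L2sq f'.
Proof. by rewrite L2sq_Tz0 Dz_fourier bessel. Qed.
(** Only one derivative of [f] is available; the second falls on the truncation and costs a factor
    [M]. *)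
Lemma trunc_deriv2_L2 M : L2sq (Tz 0 M (Dz (Dz c))) <= M%:R ^+ 2 * L2sq f'.
Proof.
rewrite L2sq_Tz0; apply: (@le_trans _ _ (zs 0 M (fun k => M%:R ^+ 2 * normc (Dz c k) ^+ 2))).
  by apply: zs_le_in => k mk; rewrite normc_Dz_sqr ler_wpM2r ?sqr_ge0// zin_sqr_le.
by rewrite zsZ ler_wpM2l ?sqr_ge0// Dz_fourier bessel.
Qed.

End C1.

(** The added 1 turns the root into a strictly positive constant, the form in which L^2 bounds are
    kept. *)
Lemma le_sqr_sqrt (a b : R) : 0 <= a -> a <= b -> a <= (Num.sqrt b + 1) ^+ 2.
Proof.
move=> a0 ab; apply: (le_trans ab).
rewrite -[leLHS](@sqr_sqrtr R) ?(le_trans a0)//.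
by rewrite ler_sqr ?nnegrE ?addr_ge0 ?sqrtr_ge0// lerDl.
Qed.

Context (T : Type) (valid : T -> Prop) (M : T -> nat) (M0 : forall q, valid q -> (0 < M q)%N).
Context (f f' : R -> C) (hf : isd f f') (cf : ccont f') (pf : periodic2pi f).

Lemma L2b_tail : L2b valid (fun q => (M q)%:R^-1) (fun q x => f x - Tz 0 (M q) (fourier f) x).
Proof.
split=> [q _|]; first by apply: ccontB; [exact: isd_ccont hf|exact: ccont_Tz].
exists (Num.sqrt (2 * L2sq f') + 1) => [|q hq]; first by rewrite ltr_wpDl ?sqrtr_ge0.
rewrite exprMn exprVn; apply: le_trans (trunc_L2 hf cf pf (M0 hq)) _.
rewrite mulrA ler_wpM2r ?invr_ge0 ?sqr_ge0//; apply: le_sqr_sqrt => //.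
by rewrite mulr_ge0 ?L2sq_ge0.
Qed.
Lemma Supb_trunc : Supb valid (fun=> 1) (fun q => Tz 0 (M q) (fourier f)).
Proof.
split=> [q _|]; first exact: ccont_Tz.
have [K K0 hK] := trunc_sup hf cf pf; exists K => // q _ x _.
by rewrite mulr1.
Qed.
Lemma L2b_trunc_deriv : L2b valid (fun=> 1) (fun q => Tz 0 (M q) (Dz (fourier f))).
Proof.
split=> [q _|]; first exact: ccont_Tz.
exists (Num.sqrt (L2sq f') + 1) => [|q _]; first by rewrite ltr_wpDl ?sqrtr_ge0.
by rewrite mulr1; apply: le_sqr_sqrt; rewrite ?L2sq_ge0// trunc_deriv_L2.
Qed.
Lemma L2b_trunc_deriv2 : L2b valid (fun q => (M q)%:R) (fun q => Tz 0 (M q) (Dz (Dz (fourier f)))).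
Proof.
split=> [q _|]; first exact: ccont_Tz.
exists (Num.sqrt (L2sq f') + 1) => [|q _]; first by rewrite ltr_wpDl ?sqrtr_ge0.
apply: le_trans (trunc_deriv2_L2 hf cf pf _) _.
rewrite exprMn mulrC ler_wpM2r ?sqr_ge0//.
by apply: le_sqr_sqrt; rewrite ?L2sq_ge0.
Qed.

End Truncation.

Ltac cc_atom := match goal with
  | h : ccont ?g |- ccont ?g => exact h
  | h : ccont ?g |- ccont (fun x => ?g x) => exact h
  | h : ccont (fun x => ?g x) |- ccont ?g => exact h
  end.

(** Continuity by recursion on the syntax of the function; the leaves are hypotheses, trigonometric
    sums, characters and constants. *)
Ltac cc := lazymatch goal with
  | |- ccont (fun x => (@?f x + @?g x)%R) => refine (@ccontD _ f g _ _); cc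
  | |- ccont (fun x => (@?f x * @?g x)%R) => refine (@ccontM _ f g _ _); cc
  | |- ccont (fun x => (- @?f x)%R) => refine (@ccontN _ f _); cc
  | |- ccont (fun x => (conjc (@?f x))) => refine (@ccontJ _ f _); cc
  | |- ccont (fun x => Tz _ _ _ x) => exact: ccont_Tz
  | |- ccont (Tz _ _ _) => exact: ccont_Tz
  | |- ccont (fun x => ex _ x) => exact: ccont_ex
  | |- ccont (ex _) => exact: ccont_ex
  | |- ccont (fun x => ?c) => first [cc_atom | exact (@ccont_cst _ c)]
  | |- ccont _ => cc_atom
  end.

Section TintLinear.
Context {R : realType}.
Local Notation C := R[i].
Lemma tint_addc (f g : R -> C) : ccont f -> ccont g ->
  tint f + tint g = tint (fun x => f x + g x).
Proof. by move=> hf hg; rewrite tintD//; exact: cintg_cont. Qed.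
Lemma tint_subc (f g : R -> C) : ccont f -> ccont g ->
  tint f - tint g = tint (fun x => f x - g x).
Proof. by move=> hf hg; rewrite tintB//; exact: cintg_cont. Qed.
Lemma tint_mulc c (f : R -> C) : ccont f -> c * tint f = tint (fun x => c * f x).
Proof. by move=> hf; rewrite tintZ//; exact: cintg_cont. Qed.
Lemma tint_oppc (f : R -> C) : ccont f -> - tint f = tint (fun x => - f x).
Proof. by move=> hf; rewrite tintN//; exact: cintg_cont. Qed.
Lemma tint_trig_orth (a b : nat) (u w : R -> C) k : trig a u -> trig b w -> (a + b < `|k|)%N ->
  tint (fun x => u x * (w x * ex k x)) = 0.
Proof.
move=> hu hw h; rewrite -(trig_orth (trig_mul hu hw) h).
by apply: eq_tint => x _; rewrite mulrA.
Qed.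
End TintLinear.

(** * Equations satisfied by the pairings, up to errors *)

Section Static.
Context {R : realType}.
Local Notation C := R[i].
Local Notation Re := (@complex.Re R).
Local Notation Im := (@complex.Im R).
Local Notation normc := (@ComplexField.Normc.normc R).

(** The index of the uniform estimates: cutoff [qM], frequency [qn], Fourier coefficients [qc] of
    the state at some time, and a bound [qd] for its distance to the data. Times and scales thus
    vary together, and one constant serves them all. *)
Record cfg := Cfg { qM : nat; qn : int; qc : int -> C; qd : R }.

Context (F : @pexp R) (d : nat) (hd : forall M f g, trig M f -> trig M g ->
  trig (d * M) (fun x => pv F (f x) (g x))).
Context (s X : R) (hs : 5 / 2 < s) (X0 : 0 < X) (phi phi1 : R -> C)
  (cphi : ccont phi) (cphi1 : ccont phi1).

(** The frequency [(d + 3) M] exceeds both [(d + 1) M], the degree of [F] at the low part times a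
    test of degree [M], and [2 M], the degree of the low part times such a test. The bound
    [1 / M <= qd] lets truncation errors be absorbed into the distance to the data. *)
Definition valid (q : cfg) :=
  [/\ (0 < qM q)%N, `|qn q|%N = ((d + 3) * qM q)%N, HB s X (qc q),
      (qM q)%:R^-1 <= qd q <= 1 &
      forall x, normc (syn (qc q) x - phi x) <= qd q /\
                normc (syn (Dz (qc q)) x - phi1 x) <= qd q].

Let m (q : cfg) : R := (qM q)%:R.
Let be (q : cfg) : R := dec s (qM q).
Let f (q : cfg) := syn (qc q).
Let f1 (q : cfg) := syn (Dz (qc q)).
Let L (q : cfg) := Tz 0 (qM q) (qc q).
Let L1 (q : cfg) := Tz 0 (qM q) (Dz (qc q)).
Let H (q : cfg) x := f q x - L q x.
Let H1 (q : cfg) x := f1 q x - L1 q x.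

(** Two levels of error. [eps2], which is [M^(1-s)], is the L^2 size of the differentiated high
    part; [eps1] is smaller by the distance [qd] to the data and is what the equation of the main
    pairing tolerates. *)
Definition eps2 (q : cfg) : R := (qM q)%:R * dec s (qM q).
Definition eps1 (q : cfg) : R := (qM q)%:R * dec s (qM q) * qd q.

Lemma qM_gt0 q : valid q -> 0 < m q. Proof. by case=> h _ _ _ _; rewrite ltr0n. Qed.
Lemma qM_ge1 q : valid q -> 1 <= m q. Proof. by case=> h _ _ _ _; rewrite ler1n. Qed.
Lemma dec_qM_gt0 q : valid q -> 0 < be q. Proof. by case=> h _ _ _ _; exact: dec_gt0. Qed.
Lemma qd_gt0 q : valid q -> 0 < qd q.
Proof. by move=> /[dup]/qM_gt0 h [_ _ _ /andP[h1 _] _]; apply: lt_le_trans h1; rewrite invr_gt0. Qed.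
Lemma qM_qd_ge1 q : valid q -> 1 <= m q * qd q.
Proof.
by move=> /[dup]/qM_gt0 h [_ _ _ /andP[h1 _] _]; rewrite mulrC -ler_pdivrMr// mul1r.
Qed.
Lemma dec_le_eps1 q : valid q -> be q <= eps1 q.
Proof.
move=> hq; rewrite /eps1 mulrAC -[leLHS]mul1r ler_wpM2r ?(ltW (dec_qM_gt0 hq))//; exact: qM_qd_ge1.
Qed.
(** Since [s >= 2], [M^(1-s) <= 1 / M <= qd]. Quadratic terms in the high part are therefore of
    order [eps1]. *)
Lemma qM_dec_le_qd q : valid q -> m q * be q <= qd q.
Proof.
move=> hq; have h0 := qM_gt0 hq; have h1 := qM_ge1 hq.
have [_ _ _ /andP[h2 _] _] := hq; apply: le_trans h2.
have s2 : 2 <= s by move: hs; lra.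
have : m q ^+ 2 <= m q `^ s.
  by rewrite -powR_mulrn ?(ltW h0)//; exact: ler_powR.
move=> h3; rewrite /be /dec -/(m q).
by rewrite ler_pdivrMr ?powR_gt0// mulrC ler_pdivlMr// -expr2.
Qed.
Lemma qM_dec_sqr_le q : valid q -> (m q * be q) * (m q * be q) <= eps1 q.
Proof.
move=> hq; rewrite /eps1 ler_wpM2l ?qM_dec_le_qd//.
by rewrite mulr_ge0 ?(ltW (qM_gt0 hq)) ?(ltW (dec_qM_gt0 hq)).
Qed.
Lemma eps1_le_eps2 q : valid q -> eps1 q <= eps2 q.
Proof.
move=> hq; have [_ _ _ /andP[_ h] _] := hq; rewrite /eps1 -[leRHS]mulr1.
by rewrite ler_wpM2l// mulr_ge0 ?(ltW (qM_gt0 hq)) ?(ltW (dec_qM_gt0 hq)).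
Qed.

Lemma ccont_state q : valid q -> ccont (f q).
Proof. by case=> _ _ h _ _; have [U _] := HB_ulim hs X0 h; exact: ulim_ccont U. Qed.
Lemma ccont_state1 q : valid q -> ccont (f1 q).
Proof. by case=> _ _ h _ _; have [_ U] := HB_ulim hs X0 h; exact: ulim_ccont U. Qed.
Lemma isd_state q : valid q -> isd (f q) (f1 q).
Proof. by case=> _ _ h _ _; exact: HB_isd hs X0 _ h. Qed.
Lemma periodic_state q : valid q -> periodic2pi (f q).
Proof. by case=> _ _ h _ _; have [U _] := HB_ulim hs X0 h; exact: ulim_periodic U. Qed.
Lemma ccont_high q : valid q -> ccont (H q).
Proof. by move=> /ccont_state h; apply: ccontB => //; exact: ccont_Tz. Qed.
Lemma ccont_high1 q : valid q -> ccont (H1 q).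
Proof. by move=> /ccont_state1 h; apply: ccontB => //; exact: ccont_Tz. Qed.
Lemma isd_high q : valid q -> isd (H q) (H1 q).
Proof. by move=> /isd_state h; apply: isdB => //; exact: isd_Tz. Qed.
Lemma periodic_high q : valid q -> periodic2pi (H q).
Proof. by move=> /periodic_state h x; rewrite /H h /L periodic_Tz. Qed.

Lemma L2b_high : L2b valid be H.
Proof.
split=> [q /ccont_high//|]; exists (2 * X) => [|q [M0 _ h _ _]]; first exact: mulr_gt0.
have [U _] := HB_ulim hs X0 h; have s0 : 0 <= s by move: hs; lra.
apply: le_trans (ulim_L2 U (fun m' => HB_L2 m' s0 M0 h)) _.
by rewrite -mulrA [leRHS]exprMn ler_wpM2r ?sqr_ge0//; lra.
Qed.
Lemma L2b_high1 : L2b valid (fun q => m q * be q) H1.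
Proof.
split=> [q /ccont_high1//|]; exists (2 * X) => [|q [M0 _ h _ _]]; first exact: mulr_gt0.
have [_ U] := HB_ulim hs X0 h; have s0 : 1 <= s by move: hs; lra.
apply: le_trans (ulim_L2 U (fun m' => HB_L2_deriv m' s0 M0 h)) _.
by rewrite -mulrA [leRHS]exprMn ler_wpM2r ?sqr_ge0//; lra.
Qed.

Lemma sup_bounds q x : valid q -> [/\ normc (f q x) <= 4 * X, normc (f1 q x) <= 4 * X,
  normc (L q x) <= 4 * X & normc (L1 q x) <= 4 * X].
Proof.
case=> M0 _ h _ _; have [U U'] := HB_ulim hs X0 h; split.
- by apply: (ulim_sup x U) => m'; have [] := HB_l1_full m' hs X0 h.
- by apply: (ulim_sup x U') => m'; have [] := HB_l1_full m' hs X0 h.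
- by apply: le_trans (normc_Tz _ _ _ _) _; have [] := HB_l1_full (qM q) hs X0 h.
- by apply: le_trans (normc_Tz _ _ _ _) _; have [] := HB_l1_full (qM q) hs X0 h.
Qed.

(** The state is within [qd] of the data, and its tail beyond [M] is [O(1 / M)] in sup norm, hence
    [O(qd)]. *)
Lemma low_near_data q x : valid q -> normc (L q x - phi x) <= (2 * X + 1) * qd q /\
  normc (L1 q x - phi1 x) <= (2 * X + 1) * qd q.
Proof.
case=> M0 _ h /andP[h1 _] /(_ x)[h2 h3]; have [U U'] := HB_ulim hs X0 h.
have X2 : 0 <= 2 * X by rewrite mulr_ge0// ltW.
have t1 := ulim_tail x U (fun m' => HB_l1 m' hs X0 M0 h).
have t2 := ulim_tail x U' (fun m' => HB_l1_deriv m' hs X0 M0 h).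
have h4 : 2 * X / (qM q)%:R <= 2 * X * qd q by rewrite ler_wpM2l.
split.
  rewrite (_ : _ - _ = (f q x - phi x) - (f q x - L q x)); last by ring.
  by apply: le_trans (normc_sub _ _) _; move: t1 h2 h4; rewrite /f /L; lra.
rewrite (_ : _ - _ = (f1 q x - phi1 x) - (f1 q x - L1 q x)); last by ring.
by apply: le_trans (normc_sub _ _) _; move: t2 h3 h4; rewrite /f1 /L1; lra.
Qed.

Let Fi i (q : cfg) x := Fd F i (L q x) (L1 q x).

Lemma ccont_Fd i (u w : R -> C) : ccont u -> ccont w -> ccont (fun x => Fd F i (u x) (w x)).
Proof.
move=> hu hw; apply: (@ev_vec_closed R ccont u w) => //.
- exact: ccont_cst.
- exact: ccontJ.
- exact: ccontD.
- exact: ccontM.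
Qed.
Lemma ccont_pv (u w : R -> C) : ccont u -> ccont w -> ccont (fun x => pv F (u x) (w x)).
Proof.
move=> hu hw; apply: (@ev_vec_closed R ccont u w) => //.
- exact: ccont_cst.
- exact: ccontJ.
- exact: ccontD.
- exact: ccontM.
Qed.
Lemma Supb_Fd i : Supb valid (fun=> 1) (Fi i).
Proof.
split=> [q hq|]; first by apply: ccont_Fd; exact: ccont_Tz.
have [K K0 hK] := Fd_bound F i (4 * X); exists (K + 1) => [|q hq x _].
  by rewrite ltr_wpDl.
have [_ _ h1 h2] := sup_bounds x hq; rewrite mulr1; apply: le_trans (hK _ _ h1 h2) _.
by rewrite lerDl.
Qed.
Lemma Supb_Fd_sub i : Supb valid qd (fun q x => Fi i q x - Fd F i (phi x) (phi1 x)).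
Proof.
split=> [q hq|]; first by apply: ccontB; apply: ccont_Fd => //; exact: ccont_Tz.
have [gauge_test P0 hP] := ccont_bounded cphi; have [gauge_test1 P10 hP1] := ccont_bounded cphi1.
pose r := 4 * X + gauge_test + gauge_test1.
have X4 : 0 <= 4 * X by rewrite mulr_ge0// ltW.
have [K K0 hK] := Fd_lip F i r; exists (K * (2 * (2 * X + 1)) + 1) => [|q hq x px].
  by rewrite ltr_wpDl// mulr_ge0// mulr_ge0// addr_ge0// mulr_ge0// ltW.
have [_ _ h1 h2] := sup_bounds x hq; have [l1 l2] := low_near_data x hq.
have := hP x px; have := hP1 x px => p2 p1.
apply: le_trans (hK _ _ _ _ _ _ _ _) _; rewrite /r; try lra.
have D0 := qd_gt0 hq.
have e : K * (normc (L q x - phi x) + normc (L1 q x - phi1 x)) <=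
   K * (2 * (2 * X + 1) * qd q) by rewrite ler_wpM2l//; lra.
apply: (le_trans e).
have -> : (K * (2 * (2 * X + 1)) + 1) * qd q = K * (2 * (2 * X + 1) * qd q) + qd q by ring.
by rewrite lerDl ltW.
Qed.

Lemma rtint_sum_sqr (u w : R -> C) : ccont u -> ccont w ->
  rtint (fun x => (normc (u x) + normc (w x)) ^+ 2) <= 2 * (L2sq u + L2sq w).
Proof.
move=> cu cw; have iu := rint_cont (continuous_sqr_normc cu).
have iw := rint_cont (continuous_sqr_normc cw).
rewrite /L2sq -rtintD// -rtintZ; last exact: rintD.
apply: rtint_le; last by move=> x _; have := sqr_ge0 (normc (u x) - normc (w x)); nra.
  have cs : continuous (fun x => normc (u x) + normc (w x)).
    by move=> x; apply: (@continuousD _ _ _ _ _ x); exact: continuous_normc.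
  by apply: rint_cont => x; apply: (@continuousM _ _ _ _ x); exact: cs.
exact/rintZ/rintD.
Qed.

(** Taylor expansion at the low part. The remainder is quadratic in the high part and its
    derivative, the undifferentiated linear terms are [O(M^-s)], and both are [O(eps1)]; what
    survives are the linear terms in [H1] and its conjugate. *)
Lemma linearize_high (W : cfg -> R -> C) : Supb valid (fun=> 1) W ->
  bigO valid eps1 (fun q => tint (fun x => pv F (f q x) (f1 q x) * W q x) -
    tint (fun x => pv F (L q x) (L1 q x) * W q x) -
    (tint (fun x => H1 q x * (Fi 1%R q x * W q x)) +
     tint (fun x => ((H1 q x)^*)%C * (Fi 3%R q x * W q x)))).
Proof.
move=> hW; have [cW [S S0 hS]] := hW.
pose Q q x := pv F (f q x) (f1 q x) - pv F (L q x) (L1 q x) -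
  (Fi 0%R q x * H q x + Fi 1%R q x * H1 q x + Fi 2%R q x * ((H q x)^*)%C +
   Fi 3%R q x * ((H1 q x)^*)%C).
have cFiq i q : ccont (Fi i q) by apply: ccont_Fd; exact: ccont_Tz.
have cQ q : valid q -> ccont (Q q).
  move=> hq; have := ccont_high hq; have := ccont_high1 hq => ? ?.
  have := ccont_pv (ccont_state hq) (ccont_state1 hq); have := ccont_pv (ccont_Tz 0 (qM q) (qc q)) (ccont_Tz 0 (qM q) (Dz (qc q))).
  have ? := cFiq 0%R q; have ? := cFiq 1%R q; have ? := cFiq 2%R q; have ? := cFiq 3%R q.
  by move=> ? ?; rewrite /Q; cc.
have t0 : bigO valid eps1 (fun q => tint (fun x => H q x * (Fi 0%R q x * W q x))).
  apply: (bigO_tint L2b_high (Supb_L2b (SupbM (Supb_Fd 0%R) hW))) => q hq.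
  by rewrite !mulr1; split=> //; [exact: dec_qM_gt0|exact: dec_le_eps1].
have t2 : bigO valid eps1 (fun q => tint (fun x => ((H q x)^*)%C * (Fi 2%R q x * W q x))).
  apply: (bigO_tint (L2bJ L2b_high) (Supb_L2b (SupbM (Supb_Fd 2%R) hW))) => q hq.
  by rewrite !mulr1; split=> //; [exact: dec_qM_gt0|exact: dec_le_eps1].
have tQ : bigO valid eps1 (fun q => tint (fun x => Q q x * W q x)).
  have [K K0 hK] := pv_taylor F (4 * X).
  have [_ [k1 k10 hk1]] := L2b_high; have [_ [k2 k20 hk2]] := L2b_high1.
  exists (2 * (K * S * (2 * (k1 ^+ 2 + k2 ^+ 2)))) => [|q hq].
    by rewrite !mulr_ge0// ?(ltW S0)// addr_ge0 ?sqr_ge0.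
  have cHq := ccont_high hq; have cH1q := ccont_high1 hq.
  have cs : continuous (fun x => normc (H q x) + normc (H1 q x)).
    by move=> x; apply: (@continuousD _ _ _ _ _ x); exact: continuous_normc.
  have is2 : rint (fun x => (normc (H q x) + normc (H1 q x)) ^+ 2).
    by apply: rint_cont => x; apply: (@continuousM _ _ _ _ x); exact: cs.
  apply: (@le_trans _ _ (2 * rtint (fun x => K * S * (normc (H q x) + normc (H1 q x)) ^+ 2))).
    apply: tint_le.
    - exact/cintg_cont/(ccontM (cQ q hq))/cW.
    - exact: rintZ.
    move=> x px; rewrite normc_mul mulrAC; apply: ler_pM; rewrite ?normc_ge0//; last first.
      by have := hS q hq x px; rewrite mulr1.
    have [b1 b2 b3 b4] := sup_bounds x hq.
    have := hK (L q x) (L1 q x) (H q x) (H1 q x) b3 b4.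
    rewrite (_ : L q x + H q x = f q x); last by rewrite /H addrC subrK.
    rewrite (_ : L1 q x + H1 q x = f1 q x); last by rewrite /H1 addrC subrK.
    by move=> /(_ b1 b2).
  rewrite rtintZ// -!mulrA ler_pM2l// ler_wpM2l// ler_wpM2l ?(ltW S0)//.
  apply: le_trans (rtint_sum_sqr cHq cH1q) _; rewrite ler_pM2l//.
  have e1 := hk1 q hq; have e2 := hk2 q hq.
  have e3 := qM_dec_sqr_le hq; have B0 := dec_qM_gt0 hq; have M1 := qM_ge1 hq; have M0 := qM_gt0 hq.
  apply: le_trans (lerD e1 e2) _; rewrite mulrDl; apply: lerD.
    rewrite exprMn ler_wpM2l ?sqr_ge0//; apply: le_trans e3.
    by rewrite expr2; apply: ler_pM; rewrite ?(ltW B0)// ler_peMl// ltW.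
  by rewrite exprMn ler_wpM2l ?sqr_ge0// expr2.
apply: (bigO_eq _ (bigOD tQ (bigOD t0 t2))) => q hq.
have := ccont_high hq; have := ccont_high1 hq; have := cQ q hq; have := cW q hq => ? ? ? ?.
have ? := ccont_pv (ccont_state hq) (ccont_state1 hq); have ? := cFiq 0%R q; have ? := cFiq 1%R q.
have ? := ccont_pv (ccont_Tz 0 (qM q) (qc q)) (ccont_Tz 0 (qM q) (Dz (qc q))).
have ? := cFiq 2%R q; have ? := cFiq 3%R q.
rewrite !tint_addc; try by cc.
rewrite !tint_subc; try by cc.
by apply: eq_tint => x _; rewrite /Q; ring.
Qed.


Lemma frequency_gap q k : valid q -> `|k|%N = `|qn q|%N -> (qM q + qM q < `|k|)%N.
Proof. by move=> [h1 h2 _ _ _] ->; rewrite h2; nia. Qed.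

(** The low part times [w] has degree at most [2 M], below the frequency, and drops out of the
    pairing. *)
Lemma tint_high q w k : valid q -> trig (qM q) w -> `|k|%N = `|qn q|%N ->
  tint (fun x => f q x * (w x * ex k x)) = tint (fun x => H q x * (w x * ex k x)).
Proof.
move=> hq tw hk; have ? := ccont_state hq; have ? := trig_ccont tw.
rewrite -[RHS]addr0 -(tint_trig_orth (trig_Tz (qM q) (qc q)) tw (frequency_gap hq hk)) tint_addc; try by cc.
  by apply: eq_tint => x _; rewrite /H /L; ring.
by have ? := ccont_high hq; cc.
Qed.
Lemma tint_highJ q w k : valid q -> trig (qM q) w -> `|k|%N = `|qn q|%N ->
  tint (fun x => ((f q x)^*)%C * (w x * ex k x)) =
  tint (fun x => ((H q x)^*)%C * (w x * ex k x)).
Proof.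
move=> hq tw hk; have ? := ccont_state hq; have ? := trig_ccont tw; have ? := ccont_high hq.
rewrite -[RHS]addr0 -(tint_trig_orth (trigJ (trig_Tz (qM q) (qc q))) tw (frequency_gap hq hk)) tint_addc; try by cc.
by apply: eq_tint => x _; rewrite /H /L (rmorphB (@conjc R)) -/(L q x); ring.
Qed.
(** [F] at the low part has degree at most [d M], hence [(d + 1) M] after multiplication by [w],
    still below the frequency. *)
Lemma tint_pv_low q w k : valid q -> trig (qM q) w -> `|k|%N = `|qn q|%N ->
  tint (fun x => pv F (L q x) (L1 q x) * (w x * ex k x)) = 0.
Proof.
move=> [h1 h2 _ _ _] tw hk.
apply: (tint_trig_orth (hd (trig_Tz (qM q) (qc q)) (trig_Tz (qM q) (Dz (qc q)))) tw).
by rewrite hk h2; nia.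
Qed.

Let nn (q : cfg) : C := (qn q)%:~R.

Lemma Supb_n : Supb valid m (fun q _ => nn q).
Proof.
split=> [q _|]; first exact: ccont_cst.
exists (d + 3)%:R => [|q [_ h _ _ _] x _]; first by rewrite ltr0n addn3.
rewrite /nn normc_int -intr_norm -natr_absz h natrM.
exact: lexx.
Qed.

Section Conjugate.
Context (k k' : R -> C) (hk : isd k k') (ck' : ccont k') (pk : periodic2pi k).
Let KL (q : cfg) := Tz 0 (qM q) (fourier k).
Let KL1 (q : cfg) := Tz 0 (qM q) (Dz (fourier k)).
Let KL2 (q : cfg) := Tz 0 (qM q) (Dz (Dz (fourier k))).

(** The conjugate of [K_M e_(-n)]. Pairing the state with it yields the conjugate of the quantity z
    of the overview, so that the equation can be used without conjugating it. *)
Definition conj_test (q : cfg) x := ((Tz 0 (qM q) (fourier k) x)^*)%C * ex (qn q) x.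
Definition conj_test1 (q : cfg) x := ((Tz 0 (qM q) (Dz (fourier k)) x)^*)%C * ex (qn q) x +
  ((Tz 0 (qM q) (fourier k) x)^*)%C * ('i%C * (qn q)%:~R * ex (qn q) x).
Definition conj_test2 (q : cfg) x := ((Tz 0 (qM q) (Dz (Dz (fourier k))) x)^*)%C * ex (qn q) x +
  2 * ('i%C * (qn q)%:~R) * (((Tz 0 (qM q) (Dz (fourier k)) x)^*)%C * ex (qn q) x) -
  (qn q)%:~R ^+ 2 * (((Tz 0 (qM q) (fourier k) x)^*)%C * ex (qn q) x).

Lemma isd_conj_test q : isd (conj_test q) (conj_test1 q) /\ isd (conj_test1 q) (conj_test2 q).
Proof.
have h (c : int -> C) := isdM (isdJ (isd_Tz 0 (qM q) c)) (isd_ex (qn q)).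
split; first exact: h.
apply: isd_ext (isdD (h (Dz (fourier k))) (isdZ ('i%C * (qn q)%:~R) (h (fourier k)))) => x.
  by rewrite /conj_test1; ring.
rewrite /conj_test2; set a := _ ^+ 2; have -> : a = - (('i%C * (qn q)%:~R) * ('i%C * (qn q)%:~R)).
  by rewrite mulrACA i_sqr /a expr2; ring.
ring.
Qed.
Lemma trig_conj_test q : trig (qM q + `|qn q|) (conj_test q).
Proof.
apply: trig_mul; first exact/trigJ/trig_Tz.
by apply: (trig_eq (@trig_ex R _ (qn q) 1 _)) => // x; rewrite mul1r.
Qed.

Lemma Supb_conj_test : Supb valid (fun=> 1) conj_test.
Proof.
have [c [K K0 hK]] := SupbM (SupbJ (Supb_trunc valid qM hk ck' pk)) (@Supb_ex _ _ valid qn).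
by split=> //; exists K => // q hq x px; rewrite -[1 in leRHS]mulr1 hK.
Qed.

Lemma conj_pairing_small : bigO valid eps1 (fun q => tint (fun x => f q x * conj_test q x)).
Proof.
have h : bigO valid eps1 (fun q => tint (fun x => H q x * conj_test q x)).
  apply: (bigO_tint L2b_high (Supb_L2b Supb_conj_test)) => q hq.
  by rewrite mulr1; split=> //; [exact: dec_qM_gt0|exact: dec_le_eps1].
apply: (bigO_eq _ h) => q hq.
exact/esym/(tint_high hq (trigJ (trig_Tz (qM q) (fourier k))) (erefl _)).
Qed.

(** The cruder error [eps2] suffices, since this equation enters the energy estimate divided by
    [2 n]. Of the second derivative of the test only the [n^2] term is kept, and the nonlinear terms
    are bounded by the size of [H1]. *)
Lemma conj_pairing : bigO valid eps2 (fun q => - 'i%C * tint (fun x => f q x * conj_test2 q x) +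
  tint (fun x => pv F (f q x) (f1 q x) * conj_test q x) -
  'i%C * (qn q)%:~R ^+ 2 * tint (fun x => f q x * conj_test q x)).
Proof.
have vM q : valid q -> (0 < qM q)%N by case.
have SP := Supb_conj_test.
have b1 : bigO valid eps2 (fun q => tint (fun x => H1 q x * (Fi 1%R q x * conj_test q x))).
  apply: (bigO_tint L2b_high1 (Supb_L2b (SupbM (Supb_Fd 1%R) SP))) => q hq.
  by rewrite !mulr1; split=> //; rewrite mulr_gt0 ?qM_gt0 ?dec_qM_gt0.
have b3 : bigO valid eps2 (fun q => tint (fun x => ((H1 q x)^*)%C * (Fi 3%R q x * conj_test q x))).
  apply: (bigO_tint (L2bJ L2b_high1) (Supb_L2b (SupbM (Supb_Fd 3%R) SP))) => q hq.
  by rewrite !mulr1; split=> //; rewrite mulr_gt0 ?qM_gt0 ?dec_qM_gt0.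
have bN := bigO_le eps1_le_eps2 (linearize_high SP).
have e1 : bigO valid eps2 (fun q => tint (fun x => H q x *
    (((KL2 q x)^*)%C * ex (qn q) x))).
  apply: (bigO_tint L2b_high (L2bM (L2bJ (L2b_trunc_deriv2 valid qM hk ck' pk))
    (@Supb_ex _ _ valid qn))) => q hq.
  by rewrite !mulr1 mulrC; split=> //; [exact: dec_qM_gt0|exact: qM_gt0].
have e2 : bigO valid eps2 (fun q => tint (fun x => (H q x * nn q) *
    (((KL1 q x)^*)%C * ex (qn q) x))).
  apply: (bigO_tint (L2bM L2b_high Supb_n) (L2bM (L2bJ (L2b_trunc_deriv valid qM hk ck' pk))
    (@Supb_ex _ _ valid qn))) => q hq.
  by rewrite !mulr1 mulrC; split=> //; rewrite mulr_gt0 ?qM_gt0 ?dec_qM_gt0.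
have S := bigOD (bigOD bN (bigOD b1 b3)) (bigOD (bigOZ (- 'i%C) e1) (bigOZ 2 e2)).
apply: (bigO_eq _ S) => q hq.
have t0 := trigJ (trig_Tz (qM q) (fourier k)).
have t1 := trigJ (trig_Tz (qM q) (Dz (fourier k))).
have t2 := trigJ (trig_Tz (qM q) (Dz (Dz (fourier k)))).
have ? := ccont_state hq; have ? := ccont_high hq.
rewrite (tint_pv_low hq t0 (erefl _)) -(tint_high hq t2 (erefl _)).
have -> : tint (fun x => H q x * nn q * (((KL1 q x)^*)%C * ex (qn q) x)) =
    nn q * tint (fun x => f q x * (((KL1 q x)^*)%C * ex (qn q) x)).
  rewrite (tint_high hq t1 (erefl _)) tint_mulc; last by rewrite /KL1; cc.
  by apply: eq_tint => x _; ring.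
have -> : tint (fun x => f q x * conj_test2 q x) =
   tint (fun x => f q x * (((KL2 q x)^*)%C * ex (qn q) x)) +
   2 * ('i%C * nn q) * tint (fun x => f q x * (((KL1 q x)^*)%C * ex (qn q) x)) -
   nn q ^+ 2 * tint (fun x => f q x * conj_test q x).
  rewrite !tint_mulc; try by rewrite /KL1 /conj_test; cc.
  rewrite tint_addc; try by rewrite /KL1 /KL2; cc.
  rewrite tint_subc; try by rewrite /KL1 /KL2 /conj_test; cc.
  by apply: eq_tint => x _; rewrite /conj_test2 /conj_test /nn /KL1 /KL2; ring.
rewrite -/(nn q).
set a1 := tint _; set a2 := tint _; set a3 := tint _; set a4 := tint _; set a5 := tint _.
set a6 := tint _.
have ii := @i_sqr R; ring: ii.
Qed.
End Conjugate.

Section Gauged.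
Context (G G' G'' Bf Bf' A' : R -> C) (lam : C).
Context (hG : isd G G') (hG' : isd G' G'') (cG'' : ccont G'') (pG : periodic2pi G).
Let A x := Fd F 1%R (phi x) (phi1 x).
Context (hA : isd A A') (cA' : ccont A') (pA : periodic2pi A).
Context (BfE : Bf =1 fun x => Fd F 3%R (phi x) (phi1 x)).
Context (hB : isd Bf Bf') (cB' : ccont Bf') (pB : periodic2pi Bf).
Context (GE : forall x, G' x = 'i%C / 2 * (A x - lam) * G x).
Let K x := Bf x * G x.
Let GL (q : cfg) := Tz 0 (qM q) (fourier G).
Let GL1 (q : cfg) := Tz 0 (qM q) (Dz (fourier G)).
Let GL2 (q : cfg) := Tz 0 (qM q) (Dz (Dz (fourier G))).
Let KL (q : cfg) := Tz 0 (qM q) (fourier K).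
Let e (q : cfg) := @ex R (- qn q).

Definition gauge_test (q : cfg) x := Tz 0 (qM q) (fourier G) x * ex (- qn q) x.
Definition gauge_test1 (q : cfg) x := Tz 0 (qM q) (Dz (fourier G)) x * ex (- qn q) x -
  'i%C * (qn q)%:~R * (Tz 0 (qM q) (fourier G) x * ex (- qn q) x).
Definition gauge_test2 (q : cfg) x := Tz 0 (qM q) (Dz (Dz (fourier G))) x * ex (- qn q) x -
  2 * ('i%C * (qn q)%:~R) * (Tz 0 (qM q) (Dz (fourier G)) x * ex (- qn q) x) -
  (qn q)%:~R ^+ 2 * (Tz 0 (qM q) (fourier G) x * ex (- qn q) x).

Lemma isd_gauge_test q : isd (gauge_test q) (gauge_test1 q) /\ isd (gauge_test1 q) (gauge_test2 q).
Proof.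
have h (c : int -> C) := isdM (isd_Tz 0 (qM q) c) (isd_ex (- qn q)).
have nE : (- qn q)%:~R = - (qn q)%:~R :> C by rewrite intrN.
split; first by apply: isd_ext (h (fourier G)) => x //; rewrite /gauge_test1 nE; ring.
apply: isd_ext (isdD (h (Dz (fourier G))) (isdZ (- ('i%C * (qn q)%:~R)) (h (fourier G)))) => x.
  by rewrite /gauge_test1; ring.
rewrite /gauge_test2 nE; set a := _ ^+ 2; have -> : a = - (('i%C * (qn q)%:~R) * ('i%C * (qn q)%:~R)).
  by rewrite mulrACA i_sqr /a expr2; ring.
ring.
Qed.
Lemma trig_gauge_test q : trig (qM q + `|qn q|) (gauge_test q).
Proof.
apply: trig_mul; first exact/trig_Tz.
by apply: (trig_eq (@trig_ex R _ (- qn q) 1 _)) => [|x]; rewrite ?mul1r ?abszN.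
Qed.

Lemma Supb_gauge_test : Supb valid (fun=> 1) gauge_test.
Proof.
have [c [k k0 hk]] := SupbM (Supb_trunc valid qM hG (isd_ccont hG') pG)
  (@Supb_ex R _ valid (fun q => - qn q)).
by split=> //; exists k => // q hq x px; rewrite -[1 in leRHS]mulr1 hk.
Qed.

(** The cross term of the second derivative of the test gives [- 2 n] times the pairing of [H] with
    [G']. Integrating the term in [A H1] by parts gives [i n] times the pairing of [H] with [A G].
    As [i A G - 2 G' = i lam G], the variable coefficient collapses to [lam]. The conjugate term
    admits no such cancellation and remains as the coupling. *)
Lemma gauged_pairing : bigO valid eps1 (fun q => - 'i%C * tint (fun x => f q x * gauge_test2 q x) +
  tint (fun x => pv F (f q x) (f1 q x) * gauge_test q x) -
  ('i%C * ((qn q)%:~R ^+ 2 + lam * (qn q)%:~R) * tint (fun x => f q x * gauge_test q x) +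
   'i%C * (qn q)%:~R * tint (fun x => ((f q x)^*)%C *
     (Tz 0 (qM q) (fourier (fun x => Bf x * G x)) x * ex (- qn q) x)))).
Proof.
have vM q : valid q -> (0 < qM q)%N by case.
have cG := isd_ccont hG; have cG' := isd_ccont hG'.
have cA := isd_ccont hA; have cB := isd_ccont hB.
have hK := isdM hB hG; have cK : ccont K by rewrite /K; cc.
have hAG := isdM hA hG.
have cK' : ccont (fun x => Bf' x * G x + Bf x * G' x) by cc.
have cAG' : ccont (fun x => A' x * G x + A x * G' x) by cc.
have pK : periodic2pi K by exact: periodicM pB pG.
have pAG : periodic2pi (fun x => A x * G x) by exact: periodicM pA pG.
have pG' := periodic_isd hG pG.
have dG : fourier G' = Dz (fourier G) by rewrite (Dz_fourier hG cG' pG).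
have ce q := @ccont_ex R (- qn q).
have Se := @Supb_ex R _ valid (fun q => - qn q).
have SP := Supb_gauge_test.
have TG := L2bM (L2b_tail vM hG cG' pG) Se.
have TG' := L2bM (L2b_tail vM hG' cG'' pG') Se.
have TK := L2bM (L2b_tail vM hK cK' pK) Se.
have SA := Supb_fix valid cA; have SB := Supb_fix valid cB.
have side1 q : valid q -> [/\ 0 < m q * be q, 0 < (m q)^-1 & m q * be q * (m q)^-1 <= eps1 q].
  move=> hq; have M0 := qM_gt0 hq; split; first exact: mulr_gt0 (dec_qM_gt0 hq).
    by rewrite invr_gt0.
  by rewrite mulrAC mulfV ?mul1r ?dec_le_eps1// gt_eqF.
have side2 q : valid q -> [/\ 0 < be q, 0 < 1 :> R & be q * 1 <= eps1 q].
  by move=> hq; rewrite mulr1 dec_qM_gt0 ?dec_le_eps1.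
have side3 q : valid q -> [/\ 0 < m q * be q, 0 < qd q & m q * be q * qd q <= eps1 q].
  by move=> hq; split=> //; [exact: mulr_gt0 (qM_gt0 hq) (dec_qM_gt0 hq)|exact: qd_gt0].
have bN := linearize_high SP.
(* Coefficients at the low part are replaced by those at [phi], at the cost [qd] against [H1] of
   size [M^(1-s)]. *)
have E5 : bigO valid eps1 (fun q => tint (fun x => H1 q x * ((Fi 1%R q x - A x) * gauge_test q x))).
  apply: (bigO_tint L2b_high1 (Supb_L2b (SupbM (Supb_Fd_sub 1%R) SP))) => q hq.
  by rewrite mulr1; exact: side3.
have E6 : bigO valid eps1 (fun q => tint (fun x => ((H1 q x)^*)%C * ((Fi 3%R q x - Bf x) * gauge_test q x))).
  have := bigO_tint (L2bJ L2b_high1) (Supb_L2b (SupbM (Supb_Fd_sub 3%R) SP)).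
  move=> /(_ eps1) h; apply: bigO_eq (h _) => q hq; first by under eq_fun do rewrite -BfE.
  by rewrite mulr1; exact: side3.
have HA := L2bM L2b_high1 SA; have HB' := L2bM (L2bJ L2b_high1) SB.
have HN := L2bM L2b_high Supb_n; have HNJ := L2bM (L2bJ L2b_high) Supb_n.
(* Here the truncation of [G] costs [1 / M] in L^2. *)
have E7 : bigO valid eps1 (fun q => tint (fun x => (H1 q x * A x) * ((G x - GL q x) * e q x))).
  by apply: (bigO_tint HA TG) => q hq; rewrite !mulr1; exact: side1.
have E11 : bigO valid eps1 (fun q => tint (fun x => (((H1 q x)^*)%C * Bf x) * ((G x - GL q x) * e q x))).
  by apply: (bigO_tint HB' TG) => q hq; rewrite !mulr1; exact: side1.
(* When the derivative is moved from the high part to the coefficient, only [H] of size [M^-s] is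
   left. *)
have E8 : bigO valid eps1 (fun q => tint (fun x => H q x * ((A' x * G x + A x * G' x) * e q x))).
  apply: (bigO_tint L2b_high (Supb_L2b (SupbM (Supb_fix valid cAG') Se))) => q hq.
  by rewrite !mulr1; move/side2: hq; rewrite mulr1.
have E12 : bigO valid eps1 (fun q => tint (fun x => ((H q x)^*)%C * ((Bf' x * G x + Bf x * G' x) * e q x))).
  apply: (bigO_tint (L2bJ L2b_high) (Supb_L2b (SupbM (Supb_fix valid cK') Se))) => q hq.
  by rewrite !mulr1; move/side2: hq; rewrite mulr1.
(* The factor [n], of size [M], is compensated by a truncation error [1 / M]. *)
have E9 : bigO valid eps1 (fun q => tint (fun x => (H q x * nn q) * ((G x - GL q x) * e q x))).
  by apply: (bigO_tint HN TG) => q hq; rewrite !mulr1 mulrC; exact: side1.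
have E10 : bigO valid eps1 (fun q => tint (fun x => (H q x * nn q) * ((G' x - GL1 q x) * e q x))).
  have := bigO_tint HN TG'; rewrite dG => /(_ eps1) h; apply: h => q hq.
  by rewrite !mulr1 mulrC; exact: side1.
have E13 : bigO valid eps1 (fun q => tint (fun x => (((H q x)^*)%C * nn q) * ((K x - KL q x) * e q x))).
  by apply: (bigO_tint HNJ TK) => q hq; rewrite !mulr1 mulrC; exact: side1.
(* Two derivatives of the truncated [G] stay bounded in L^2 because [G'] is itself C^1. *)
have E14 : bigO valid eps1 (fun q => tint (fun x => H q x * (GL2 q x * e q x))).
  have := bigO_tint L2b_high (L2bM (L2b_trunc_deriv valid qM hG' cG'' pG') Se).
  by rewrite dG => /(_ eps1) h; apply: h => q hq; rewrite !mulr1; move/side2: hq; rewrite mulr1.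
have S := bigOD (bigOD bN (bigOD (bigOD E5 E6) (bigOD (bigOZ (-1) E7) (bigOZ (-1) E11))))
  (bigOD (bigOD (bigOZ (-1) E8) (bigOZ (-1) E12)) (bigOD (bigOD (bigOZ ('i%C * lam) E9) (bigOZ 2 E10))
    (bigOD (bigOZ 'i%C E13) (bigOZ (- 'i%C) E14)))).
apply: (bigO_eq _ S) => q hq.
have nk : `|- qn q|%N = `|qn q|%N by rewrite abszN.
have t0 := trig_Tz (qM q) (fourier G).
have t1 := trig_Tz (qM q) (Dz (fourier G)).
have t2 := trig_Tz (qM q) (Dz (Dz (fourier G))).
have tK := trig_Tz (qM q) (fourier K).
have cfq := ccont_state hq; have cHq := ccont_high hq; have cH1q := ccont_high1 hq.
have c1 : ccont (Fi 1%R q) by apply: ccont_Fd; exact: ccont_Tz.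
have c3 : ccont (Fi 3%R q) by apply: ccont_Fd; exact: ccont_Tz.
rewrite (tint_pv_low hq t0 nk).
rewrite -/(nn q) -/K -/(KL q) -/(e q).
have s0 := tint_high hq t0 nk; have s1 := tint_high hq t1 nk; have s2 := tint_high hq t2 nk.
have s3 := tint_highJ hq tK nk.
rewrite -/(GL q) -/(e q) in s0; rewrite -/(GL1 q) -/(e q) in s1.
rewrite -/(GL2 q) -/(e q) in s2; rewrite -/(KL q) -/(e q) in s3.
have fP2 : tint (fun x => f q x * gauge_test2 q x) = tint (fun x => H q x * (GL2 q x * e q x)) -
   2 * ('i%C * nn q) * tint (fun x => H q x * (GL1 q x * e q x)) -
   nn q ^+ 2 * tint (fun x => H q x * (GL q x * e q x)).
  rewrite -s0 -s1 -s2 !tint_mulc; try by rewrite /GL /GL1 /e; cc.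
  rewrite tint_subc; try by rewrite /GL1 /GL2 /e; cc.
  rewrite tint_subc; try by rewrite /GL /GL1 /GL2 /e; cc.
  by apply: eq_tint => x _; rewrite /gauge_test2 /nn /GL /GL1 /GL2 /e; ring.
have fP : tint (fun x => f q x * gauge_test q x) = tint (fun x => H q x * (GL q x * e q x)) by exact: s0.
have pe : periodic2pi (e q) by exact: periodic_ex.
(* Integration by parts against [u e_(-n)]: the derivative falls either on [u], giving an error, or
   on the character, giving the main term with factor [i n]. *)
have parts (h h' u u' : R -> C) : isd h h' -> ccont h' -> periodic2pi h -> isd u u' -> ccont u' ->
    periodic2pi u -> tint (fun x => h' x * (u x * e q x)) =
   - tint (fun x => h x * (u' x * e q x)) + 'i%C * nn q * tint (fun x => h x * (u x * e q x)).
  move=> ih ch ph iu cu pu; have ch' := isd_ccont ih; have cu' := isd_ccont iu.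
  have cex : ccont (fun x => u' x * e q x + u x * ('i%C * (- qn q)%:~R * e q x)).
    by rewrite /e; cc.
  rewrite (tint_by_parts ih (isdM iu (isd_ex (- qn q))) ch cex ph (periodicM pu pe)).
  rewrite tint_mulc; last by rewrite /e; cc.
  rewrite !tint_oppc; try by rewrite /e; cc.
  rewrite tint_addc; try by rewrite /e; cc.
  by apply: eq_tint => x _; rewrite intrN /nn /e; ring.
have iJ : isd (fun x => ((H q x)^*)%C) (fun x => ((H1 q x)^*)%C) by exact: isdJ (isd_high hq).
have pJ : periodic2pi (fun x => ((H q x)^*)%C) by exact: periodicJ (periodic_high hq).
have cJ : ccont (fun x => ((H1 q x)^*)%C) by exact: ccontJ.
have byA := parts _ _ _ _ (isd_high hq) cH1q (periodic_high hq) hAG cAG' pAG.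
have byB := parts _ _ K _ iJ cJ pJ hK cK' pK.
(* The gauge equation in the form [A G = lam G - 2 i G'], with [G] and [G'] then split into
   truncations and tails. *)
have AGE : nn q * tint (fun x => H q x * (A x * G x * e q x)) =
   lam * (tint (fun x => (H q x * nn q) * ((G x - GL q x) * e q x)) +
          nn q * tint (fun x => H q x * (GL q x * e q x))) -
   2 * 'i%C * (tint (fun x => (H q x * nn q) * ((G' x - GL1 q x) * e q x)) +
          nn q * tint (fun x => H q x * (GL1 q x * e q x))).
  rewrite !tint_mulc; try by rewrite /GL /GL1 /e; cc.
  rewrite !tint_addc; try by rewrite /GL /GL1 /e; cc.
  rewrite !tint_mulc; try by rewrite /GL /GL1 /e; cc.
  rewrite tint_subc; try by rewrite /GL /GL1 /e; cc.
  have AG x : A x * G x = lam * G x - 2 * 'i%C * G' x.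
    have -> : 2 * 'i%C * G' x = ('i%C * 'i%C) * (2 * 2^-1) * ((A x - lam) * G x) by rewrite GE; ring.
    by rewrite i_sqr mulfV ?pnatr_eq0//; ring.
  by apply: eq_tint => x _; rewrite AG; ring.
have KGE : nn q * tint (fun x => ((H q x)^*)%C * (K x * e q x)) =
   tint (fun x => (((H q x)^*)%C * nn q) * ((K x - KL q x) * e q x)) +
   nn q * tint (fun x => ((H q x)^*)%C * (KL q x * e q x)).
  rewrite !tint_mulc; try by rewrite /KL /e; cc.
  rewrite !tint_addc; try by rewrite /KL /e; cc.
  by apply: eq_tint => x _; ring.
have A1 : tint (fun x => H1 q x * (Fi 1%R q x * gauge_test q x)) =
  tint (fun x => H1 q x * ((Fi 1%R q x - A x) * gauge_test q x)) -
  tint (fun x => (H1 q x * A x) * ((G x - GL q x) * e q x)) +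
  tint (fun x => H1 q x * (A x * G x * e q x)).
  rewrite tint_subc; try by rewrite /gauge_test /GL /e; cc.
  rewrite tint_addc; try by rewrite /gauge_test /GL /e; cc.
  by apply: eq_tint => x _; rewrite /gauge_test /GL /e; ring.
have B1 : tint (fun x => ((H1 q x)^*)%C * (Fi 3%R q x * gauge_test q x)) =
  tint (fun x => ((H1 q x)^*)%C * ((Fi 3%R q x - Bf x) * gauge_test q x)) -
  tint (fun x => (((H1 q x)^*)%C * Bf x) * ((G x - GL q x) * e q x)) +
  tint (fun x => ((H1 q x)^*)%C * (K x * e q x)).
  rewrite tint_subc; try by rewrite /gauge_test /GL /e; cc.
  rewrite tint_addc; try by rewrite /gauge_test /GL /e; cc.
  by apply: eq_tint => x _; rewrite /gauge_test /GL /e /K; ring.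
rewrite A1 B1 byA byB fP2 fP s3.
(* All integrals become variables, and what remains is a ring identity modulo [i^2 = -1]. *)
have alg (i n l a b c0 c2 c4 c5 c7 c8 c9 c10 c11 c12 c13 c14 c15 c17 : C) : i * i = -1 ->
    n * a = l * (c0 + n * c2) - 2 * i * (c4 + n * c5) -> n * b = c7 + n * c8 ->
    c9 - 0 - (c10 - c11 + (- c12 + i * n * a) + (c13 - c14 + (- c15 + i * n * b))) +
    (c10 + c13 + (-1 * c11 + -1 * c14)) + (-1 * c12 + -1 * c15 +
    (i * l * c0 + 2 * c4 + (i * c7 + - i * c17))) =
    - i * (c17 - 2 * (i * n) * c5 - n ^+ 2 * c2) + c9 -
    (i * (n ^+ 2 + l * n) * c2 + i * n * c8).
  by move=> ii h1 h2; rewrite -!(mulrA i n) h1 h2; ring: ii.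
exact: alg (@i_sqr R) AGE KGE.
Qed.
End Gauged.
End Static.

(** * Energy estimates and the weak formulation *)

Section Energy.
Context {R : realType}.

(** The function [exp (- ga t) (w - E / ga)] is nondecreasing. This is Gronwall read from [t1] back
    to 0: a quantity forced to grow at rate [ga] starts no larger than the forcing level plus an
    exponentially small multiple of its final value. *)
Lemma energy (w w' : R -> R) (ga E t1 : R) : 0 < ga -> 0 <= E -> 0 < t1 ->
  continuous w -> (forall t, 0 < t < t1 -> is_derive t (1 : R) w (w' t)) ->
  (forall t, 0 < t < t1 -> ga * w t - E <= w' t) ->
  w 0 <= E / ga + expR (- (ga * t1)) * w t1.
Proof.
move=> g0 E0 t0 cw dw hw.
have EE : E = ga * (E / ga) by rewrite mulrC divfK ?gt_eqF.
move: (E / ga) EE => u EE.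
pose g (t : R) := expR (- (ga * t)) * (w t - u).
have de (t : R) : is_derive t (1 : R) (fun t => expR (- (ga * t))) (- ga * expR (- (ga * t))).
  apply: is_derive_eq; rewrite /GRing.scale/=; ring.
have dg t : t \in `]0, t1[ -> is_derive t (1 : R) g
    (expR (- (ga * t)) * (w' t - ga * w t + ga * u)).
  rewrite in_itv/= => ht; have := dw t ht => dwt.
  apply: is_derive_eq; rewrite /GRing.scale/= subr0.
  ring.
have cg : continuous g.
  move=> t; apply: (@continuousM _ _ _ _ t).
    by apply/differentiable_continuous/derivable1_diffP; have [] := de t.
  by apply: (@continuousB _ _ _ _ _ t); [exact: cw|exact: cst_continuous].
have [c hc] := @MVT R g _ 0 t1 t0 dg (continuous_subspaceT cg).
rewrite subr0 /g mulr0 oppr0 expR0 mul1r => e.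
have : 0 <= expR (- (ga * c)) * (w' c - ga * w c + ga * u) * t1.
  rewrite mulr_ge0 ?(ltW t0)// mulr_ge0 ?expR_ge0//.
  by move: hc; rewrite in_itv/= => /hw; lra.
rewrite -e mulrBr => h.
have : 0 <= expR (- (ga * t1)) * u by rewrite mulr_ge0 ?expR_ge0// -(pmulr_rge0 _ g0) -EE.
lra.
Qed.
End Energy.

Section CoupledEnergy.
Context {R : realType}.
Local Notation C := R[i].
Local Notation Re := (@complex.Re R).
Local Notation Im := (@complex.Im R).
Local Notation normc := (@ComplexField.Normc.normc R).

(* The correction [conj x / (2 n)] of [y] cancels the coupling term [i n conj x]. *)
Lemma coupled_energy (y x Y Dy Dx : R -> C) (lam : C) (sg n ga t1 E1 E2 E3 E : R) :
  sg * sg = 1 -> n != 0 -> - (sg * n * Im lam) = ga -> 0 < ga -> 0 < t1 ->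
  ccont y -> ccont x ->
  (forall t, 0 < t < t1 ->
    [/\ is_derive t (1 : R) (Re \o y) (Re (sg%:C * Dy t)) /\
        is_derive t (1 : R) (Im \o y) (Im (sg%:C * Dy t)),
        is_derive t (1 : R) (Re \o x) (Re (sg%:C * Dx t)) /\
        is_derive t (1 : R) (Im \o x) (Im (sg%:C * Dx t)),
        normc (Dy t - ('i%C * (n%:C ^+ 2 + lam * n%:C) * y t + 'i%C * n%:C * ((x t)^*)%C)) <= E1,
        normc (Dx t - 'i%C * n%:C ^+ 2 * x t) <= E2 & normc (x t) <= E3]) ->
  E1 + E2 / `|2 * n| + normc lam * E3 <= E ->
  (forall t, Y t = y t + (2 * n)^-1%:C * ((x t)^*)%C) ->
  normc (Y 0) ^+ 2 <= E ^+ 2 / ga ^+ 2 + expR (- (ga * t1)) * normc (Y t1) ^+ 2.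
Proof.
move=> sg2 n0 gaE g0 t0 cy cx hyp hE YE.
pose w t := normc (Y t) ^+ 2.
pose r := (2 * n)^-1.
have rn : 2 * n * r = 1 by rewrite /r mulfV// mulf_neq0.
have ReY t : Re (Y t) = Re (y t) + r * Re (x t).
  by rewrite YE ReD ReM ReJ /= mul0r subr0.
have ImY t : Im (Y t) = Im (y t) - r * Im (x t).
  by rewrite YE ImD ImM ImJ /= mul0r addr0 mulrN.
have wE t : w t = (Re (y t) + r * Re (x t)) ^+ 2 + (Im (y t) - r * Im (x t)) ^+ 2.
  by rewrite /w sqr_normcE ReY ImY.
pose w' t := 2 * sg * ((Re (y t) + r * Re (x t)) * (Re (Dy t) + r * Re (Dx t)) +
  (Im (y t) - r * Im (x t)) * (Im (Dy t) - r * Im (Dx t))).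
have rsg (z : C) : Re (sg%:C * z) = sg * Re z by rewrite ReM /= mul0r subr0.
have isg (z : C) : Im (sg%:C * z) = sg * Im z by rewrite ImM /= mul0r addr0.
have dw t : 0 < t < t1 -> is_derive t (1 : R) w (w' t).
  move=> ht; have [[d1 d2] [d3 d4] _ _ _] := hyp t ht.
  rewrite rsg in d1; rewrite isg in d2; rewrite rsg in d3; rewrite isg in d4.
  rewrite (_ : w = (fun t => ((Re \o y) t + r * (Re \o x) t) ^+ 2 + ((Im \o y) t - r * (Im \o x) t) ^+ 2)).
    by apply: is_derive_eq; rewrite /GRing.scale/= /w'; ring.
  by apply/funext => z; exact: wE.
have cw : continuous w.
  apply: continuous_sqr_normc; rewrite (funext YE); apply: ccontD => //; apply: ccontM; first exact: ccont_cst.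
  exact: ccontJ.
have E0 : 0 <= E ^+ 2 / ga by rewrite divr_ge0 ?sqr_ge0 ?ltW.
have hw t : 0 < t < t1 -> ga * w t - E ^+ 2 / ga <= w' t.
  move=> ht; have [_ _ b1 b2 b3] := hyp t ht.
  pose e1 := Dy t - ('i%C * (n%:C ^+ 2 + lam * n%:C) * y t + 'i%C * n%:C * ((x t)^*)%C).
  pose e2 := Dx t - 'i%C * n%:C ^+ 2 * x t.
  (* The total error in the equation of [Y]. The coupling [i n] minus twice [i n^2 r] is 0 because
     [2 n r = 1]; the term [lam n r] of the correction is not cancelled and counts as an error. *)
  pose er := e1 + r%:C * (e2^*)%C - 'i%C * lam * ((n * r)%:C * ((x t)^*)%C).
  have hr : normc er <= E.
    apply: le_trans hE; apply: le_trans (normc_sub _ _) _; apply: lerD.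
      apply: le_trans (normc_add _ _) _; apply: lerD => //.
      by rewrite normc_mul normc_conj normc_real /r normfV mulrC ler_wpM2r// invr_ge0.
    rewrite !normc_mul normc_i mul1r normc_conj normc_real ler_wpM2l ?normc_ge0//.
    apply: le_trans b3; rewrite -[leRHS]mul1r ler_wpM2r ?normc_ge0//.
    have -> : n * r = 2^-1 by rewrite /r invfM mulrCA mulfV// mulr1.
    by rewrite ger0_norm ?invr_ge0// invf_le1// ler1n.
  have er2 : Re er ^+ 2 + Im er ^+ 2 <= E ^+ 2.
    rewrite -sqr_normcE ler_sqr ?nnegrE ?normc_ge0//.
    exact: le_trans (normc_ge0 _) hr.
  have e1E : Dy t = e1 + ('i%C * (n%:C ^+ 2 + lam * n%:C) * y t + 'i%C * n%:C * ((x t)^*)%C).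
    by rewrite /e1; ring.
  have e2E : Dx t = e2 + 'i%C * n%:C ^+ 2 * x t by rewrite /e2; ring.
  have DE : Dy t + r%:C * ((Dx t)^*)%C = 'i%C * (n%:C ^+ 2 + lam * n%:C) * Y t + er.
    have rnC : 2 * n%:C * r%:C = 1 :> C by rewrite -(rmorph_nat (real_complex R)) -!rmorphM rn rmorph1.
    have nJ : ((n%:C : C)^*)%C = n%:C by apply: cext; rewrite ?ReJ ?ImJ /= ?oppr0.
    have iJ : (('i%C : C)^*)%C = - 'i%C by apply: cext; rewrite ?ReJ ?ImJ ?ReN ?ImN /= ?oppr0.
    rewrite /er YE -/r e1E e2E (expr2 n%:C) conjcD !conjcM iJ nJ rmorphM.
    set X := ((x t)^*)%C; set X2 := (e2^*)%C.
    transitivity ('i%C * (n%:C ^+ 2 + lam * n%:C) * (y t + r%:C * X) + (e1 + r%:C * X2 - 'i%C * lam * (n%:C * r%:C * X)) + 'i%C * n%:C * X * (1 - 2 * n%:C * r%:C)).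
      by ring.
    by rewrite rnC subrr mulr0 addr0.
  have ReDy : Re (Dy t) + r * Re (Dx t) = Re ('i%C * (n%:C ^+ 2 + lam * n%:C) * Y t + er).
    by rewrite -DE ReD ReM ReJ /= mul0r subr0.
  have ImDy : Im (Dy t) - r * Im (Dx t) = Im ('i%C * (n%:C ^+ 2 + lam * n%:C) * Y t + er).
    by rewrite -DE ImD ImM ImJ /= mul0r addr0 mulrN.
  clearbody er; rewrite /w' ReDy ImDy wE -ReY -ImY.
  set mu := 'i%C * (n%:C ^+ 2 + lam * n%:C).
  have Remu : Re mu = - (n * Im lam).
    by rewrite /mu expr2 !(ReM, ImM, ReD, ImD) /=; ring.
  rewrite !ReD !ImD (ReM mu) (ImM mu) Remu.
  move: (Re (Y t)) (Im (Y t)) (Im mu) => a b m.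
  move: (Re er) (Im er) er2 => p q pq.
  have -> : 2 * sg * (a * (- (n * Im lam) * a - m * b + p) + b * (- (n * Im lam) * b + m * a + q)) =
     2 * (- (sg * n * Im lam)) * (a ^+ 2 + b ^+ 2) + 2 * sg * (a * p + b * q) by ring.
  rewrite gaE -subr_ge0 -(pmulr_rge0 _ g0).
  (* The derivative of [|Y|^2] is [2 ga |Y|^2] plus a cross term with the error; completing the
     square spends half of the growth rate on that cross term. *)
  have -> : ga * (2 * ga * (a ^+ 2 + b ^+ 2) + 2 * sg * (a * p + b * q) -
      (ga * (a ^+ 2 + b ^+ 2) - E ^+ 2 / ga)) = (ga * a + sg * p) ^+ 2 + (ga * b + sg * q) ^+ 2 +
      (E ^+ 2 * (ga / ga) - (sg * sg) * (p ^+ 2 + q ^+ 2)) by ring.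
  rewrite sg2 mulfV ?gt_eqF// mulr1 mul1r; apply: addr_ge0; last by rewrite subr_ge0.
  by rewrite addr_ge0 ?sqr_ge0.
have := energy g0 E0 t0 cw dw hw.
by rewrite -mulrA -invfM -expr2.
Qed.
End CoupledEnergy.

(** * From tested time integrals to a pointwise differential equation *)

Section FTC.
Context {R : realType}.
Local Notation mu := (@lebesgue_measure R).

Lemma le_harmonic (x e K : R) : 0 <= K -> (forall n : nat, x <= e + K * n.+1%:R^-1) -> x <= e.
Proof.
move=> K0 h; apply/ler_addgt0Pr => d d0.
have [n hn] : exists n : nat, K / d < n.+1%:R.
  exists (Num.truncn (K / d)); exact: truncnS_gt.
apply: le_trans (h n) _; rewrite lerD2l ler_pdivrMr ?ltr0n//.
by rewrite ltr_pdivrMr// in hn; rewrite mulrC ltW.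
Qed.

Context (T : R) (T0 : 0 < T).
Let itg (f : R -> R) := mu.-integrable `[0, T] (EFin \o f).

Lemma itg_cont f : continuous f -> itg f.
Proof.
move=> cf; apply: continuous_compact_integrable; first exact: segment_compact.
exact: continuous_subspaceT.
Qed.

Lemma is_derive_cont (f : R -> R) t l : is_derive t (1 : R) f l -> {for t, continuous f}.
Proof. by case=> + _ => /derivable1_diffP; exact: differentiable_continuous. Qed.

Lemma ftc2 (f F : R -> R) : continuous f -> continuous F ->
  (forall t : R, 0 < t < T -> is_derive t (1 : R) F (f t)) ->
  \int[mu]_(t in `[0, T]) f t = F T - F 0.
Proof.
move=> cf cF dF; rewrite /Rintegral (@continuous_FTC2 _ f F 0 T T0)//.
- exact: continuous_subspaceT.
- split.
  + by move=> t; rewrite in_itv/= => /dF[].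
  + by apply: cvg_at_right_filter; exact: cF.
  + by apply: cvg_at_left_filter; exact: cF.
- move=> t; rewrite in_itv/= => /dF h.
  by rewrite derive1E; exact: derive_val.
Qed.

(** Integrating from -1 instead of 0 makes 0 an interior point, so that [Q] is differentiable, hence
    continuous, there. *)
Lemma antiderivative_itv (q : R -> R) c : continuous q -> exists2 Q : R -> R,
  Q 0 = c & forall t : R, -1 < t -> is_derive t (1 : R) Q (q t).
Proof.
move=> cq; pose Q0 x := \int[mu]_(t in `[-1, x]) q t.
have dQ (t : R) : -1 < t -> is_derive t (1 : R) Q0 (q t).
  move=> t1; have tt : t < t + 1 by rewrite ltrDl.
  have h : mu.-integrable `[-1, t + 1] (EFin \o q).
    apply: continuous_compact_integrable; first exact: segment_compact.
    exact: continuous_subspaceT.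
  have [d e] := continuous_FTC1_closed tt h t1 (cq t).
  by rewrite -e derive1E; exact: derivableP.
exists (fun x => Q0 x + (c - Q0 0)); first by rewrite addrC subrK.
by move=> t /dQ ?; apply: is_derive_eq; rewrite addr0.
Qed.

(** This is the kernel [k / y^2 exp (- k / y)]: nonnegative, and [O(k)] at a fixed distance from
    0. *)
Lemma bump_weight (k y e : R) : 0 < k -> 0 < e -> 0 <= bump (bump_poly k 1) k y /\
  (e <= y -> bump (bump_poly k 1) k y <= k / e ^+ 2).
Proof.
move=> k0 e0; rewrite /bump /bump_poly; case: ifP => [y0|/negbT]; last first.
  by rewrite -leNgt => y0; split=> // ey; have := lt_le_trans e0 (le_trans ey y0); rewrite ltxx.
have -> : ('X^2 * (k%:P * 1 - 1^`())).[y^-1] = k / y ^+ 2.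
  by rewrite -polyC1 derivC subr0 mulr1 !hornerE/= exprVn mulrC.
have h : 0 <= k / y ^+ 2 by rewrite divr_ge0 ?sqr_ge0 ?ltW.
split=> [|ey]; first by rewrite mulr_ge0 ?expR_ge0.
rewrite -[leRHS]mulr1; apply: ler_pM; [exact: h|exact: expR_ge0| |].
  by rewrite ler_pM2l// lef_pV2 ?posrE ?exprn_gt0// ler_sqr ?nnegrE ?(ltW e0) ?(ltW y0).
by rewrite -expR0 ler_expR oppr_le0 mulr_ge0 ?invr_ge0 ?(ltW k0) ?(ltW y0).
Qed.

Lemma bump_ge (k y : R) : 0 < y -> 1 - k / y <= bump 1 k y.
Proof. by move=> y0; rewrite /bump y0 hornerC mul1r; exact: expR_ge1Dx. Qed.

(* As [k] tends to 0 the test functions [bump 1 k (a - t)] increase to the indicator of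
   [t < a], and minus their derivative is an approximate identity at [a]. *)
Lemma du_bois_reymond (p q Q : R -> R) (a : R) : 0 < a < T -> continuous p -> continuous q ->
  (forall t : R, -1 < t -> is_derive t (1 : R) Q (q t)) ->
  (forall k, 0 < k -> \int[mu]_(t in `[0, T]) (p t * bump (bump_poly k 1) k (a - t)) =
    bump 1 k a * Q 0 + \int[mu]_(t in `[0, T]) (q t * bump 1 k (a - t))) ->
  p a = Q a.
Proof.
move=> /andP[a0 aT] cp cq dQ hyp.
(* [Q] is controlled only to the right of -1; composing it with the positive part gives a function
   continuous on the whole line and unchanged on [[0, T]]. *)
pose pos (t : R) := Num.max t 0.
have cpos : continuous pos.
  by move=> t; apply: (@continuous_max _ _ (fun t => t) (fun=> 0) t); [exact: id|exact: cst_continuous].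
have posE t : 0 <= t -> pos t = t by move=> t0; rewrite /pos max_l.
have pos0 t : 0 <= pos t by rewrite /pos le_max lexx orbT.
pose Qb t := Q (pos t).
have cQ : continuous Qb.
  move=> t; apply: continuous_comp; first exact: cpos.
  by apply: (is_derive_cont (dQ _ _)); apply: lt_le_trans (pos0 _); lra.
pose d t := p t - Qb t.
have cd : continuous d.
  by move=> t; apply: (@continuousB _ _ _ _ _ t); [exact: cp|exact: cQ].
suff : `|d a| <= 0.
  by rewrite normr_le0 /d /Qb posE ?ltW// subr_eq0 => /eqP.
have cr k : 0 < k -> forall P, continuous (fun t => bump P k (a - t)).
  move=> k0 P t; apply: (continuous_comp (f := fun t => a - t)); last exact: continuous_bump.
  by apply: (@continuousB _ _ _ _ _ t); [exact: cst_continuous|exact: id].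
have dr k : 0 < k -> forall t, is_derive t (1 : R) (fun t => bump 1 k (a - t))
    (- bump (bump_poly k 1) k (a - t)).
  move=> k0 t.
  have h : is_derive t (1 : R) (fun t : R => a - t) (-1).
    by apply: is_derive_eq; rewrite add0r [LHS]mul1r.
  by rewrite -mulrN1; apply: (@is_derive1_comp R (bump 1 k) (fun t => a - t)); exact: is_derive_bump.
have bT k : bump 1 k (a - T) = 0 by rewrite /bump subr_gt0 ltNge (ltW aT).
(* Integrating the derivative of [Q(t) bump (a - t)], whose boundary terms are 0 at [T] and the
   initial term at 0, turns the hypothesis into orthogonality of [p - Q] to the kernel. *)
have key k : 0 < k -> \int[mu]_(t in `[0, T]) (d t * bump (bump_poly k 1) k (a - t)) = 0.
  move=> k0; set r := fun t => bump (bump_poly k 1) k (a - t).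
  set et := fun t => bump 1 k (a - t).
  have cpr : continuous (fun t => p t * r t).
    by move=> t; apply: (@continuousM _ _ _ _ t); [exact: cp|exact: cr].
  have cqe : continuous (fun t => q t * et t).
    by move=> t; apply: (@continuousM _ _ _ _ t); [exact: cq|exact: cr].
  have cQr : continuous (fun t => Qb t * r t).
    by move=> t; apply: (@continuousM _ _ _ _ t); [exact: cQ|exact: cr].
  have -> : \int[mu]_(t in `[0, T]) (d t * r t) =
     \int[mu]_(t in `[0, T]) (p t * r t) - \int[mu]_(t in `[0, T]) (Qb t * r t).
    rewrite -RintegralB//; [|exact: itg_cont|exact: itg_cont].
    by apply: eq_Rintegral => t _; rewrite /d mulrBl.
  rewrite hyp// -addrA -RintegralB//; [|exact: itg_cont|exact: itg_cont].
  have dQe (t : R) : 0 < t < T ->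
      is_derive t (1 : R) (fun t => Qb t * et t) (q t * et t - Qb t * r t).
    move=> /andP[t0 _].
    have dt : is_derive t (1 : R) Qb (q t).
      apply: (@near_eq_is_derive _ _ _ Q); last by apply: dQ; lra.
      near=> z; rewrite /Qb posE//; apply: ltW; near: z; exact: lt_nbhsr.
    have de := dr k k0 t.
    by apply: is_derive_eq; rewrite /GRing.scale/= -/(et t) -/(r t); ring.
  have h1 : continuous (fun t => q t * et t - Qb t * r t).
    by move=> t; apply: (@continuousB _ _ _ _ _ t); [exact: cqe|exact: cQr].
  have h2 : continuous (fun t => Qb t * et t).
    by move=> t; apply: (@continuousM _ _ _ _ t); [exact: cQ|exact: cr].
  have -> := ftc2 h1 h2 dQe.
  by rewrite /et /Qb bT mulr0 subr0 posE// sub0r mulrC subrr.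
have mass k : 0 < k -> \int[mu]_(t in `[0, T]) bump (bump_poly k 1) k (a - t) = bump 1 k a.
  move=> k0; have h1 : continuous (fun t => - bump 1 k (a - t)).
    by move=> t; apply: (@continuousN _ _ _ _ t); exact: cr.
  have h2 (t : R) : 0 < t < T -> is_derive t (1 : R) (fun t => - bump 1 k (a - t))
      (bump (bump_poly k 1) k (a - t)).
    by move=> _; have de := dr k k0 t; apply: is_derive_eq; rewrite opprK.
  by have -> := ftc2 (cr k k0 _) h1 h2; rewrite bT subr0 oppr0 sub0r opprK.
have [m1 _ h1] := EVT_max (ltW T0) (continuous_subspaceT (A := `[0, T]) (f := fun t => `|d t|)
  (fun t => continuous_comp (cd t) (@norm_continuous _ _ _))).
apply/ler_addgt0Pr => e e0; rewrite add0r.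
have [del del0 hdel] : exists2 del, 0 < del & forall t, `|a - t| < del -> `|d a - d t| <= e.
  have := cd a; move=> /cvgrPdist_le/(_ _ e0)/nbhs_ballP[del /= d0 hd].
  by exists del => // t ht; apply: hd; exact: ht.
(* Off the [del]-neighbourhood the difference is at most twice the maximum and the kernel at most
   [k / del^2]; together with the mass of the kernel this yields
   [|d a| (1 - k / a) <= e + B T k]. *)
pose B := 2 * `|d m1| / del ^+ 2.
have B0 : 0 <= B by rewrite divr_ge0 ?sqr_ge0 ?mulr_ge0.
apply: (@le_harmonic _ _ (B * T + `|d a| / a)).
  by apply: addr_ge0; [exact: mulr_ge0 B0 (ltW T0)|exact: divr_ge0 (normr_ge0 _) (ltW a0)].
move=> n; set k := n.+1%:R^-1; have k0 : 0 < k by rewrite invr_gt0 ltr0n.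
have ckr := cr k k0 (bump_poly k 1).
have cdr : continuous (fun t => d t * bump (bump_poly k 1) k (a - t)).
  by move=> t; apply: (@continuousM _ _ _ _ t); [exact: cd|exact: ckr].
have cbr (b : R -> R) : continuous b -> continuous (fun t => b t * bump (bump_poly k 1) k (a - t)).
  by move=> cb t; apply: (@continuousM _ _ _ _ t); [exact: cb|exact: ckr].
have cda : continuous (fun t => d a - d t).
  by move=> t; apply: (@continuousB _ _ _ _ _ t); [exact: cst_continuous|exact: cd].
have e1 : d a * bump 1 k a = \int[mu]_(t in `[0, T]) ((d a - d t) * bump (bump_poly k 1) k (a - t)).
  rewrite -(mass k k0) -RintegralZl//; last exact: itg_cont.
  rewrite -[LHS]subr0 -[X in _ - X = _](key k k0) -RintegralB//; last 2 first.
  - by apply: itg_cont; apply: (cbr (fun=> d a)); exact: cst_continuous.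
  - exact: itg_cont.
  by apply: eq_Rintegral => t _; rewrite [RHS]mulrBl.
have e2 : `|d a * bump 1 k a| <= e + B * T * k.
  rewrite e1; apply: le_trans (le_normr_Rintegral _ _) _ => //; first exact/itg_cont/cbr.
  apply: (@le_trans _ _ (\int[mu]_(t in `[0, T]) (e * bump (bump_poly k 1) k (a - t) + B * k))).
    apply: le_Rintegral => //.
    - apply: itg_cont => t; exact: (continuous_comp (cbr _ cda t) (@norm_continuous _ _ _)).
    - apply: itg_cont => t; apply: (@continuousD _ _ _ _ _ t); last exact: cst_continuous.
      by apply: cbr; exact: cst_continuous.
    move=> t; rewrite /= in_itv/= => /andP[t0 tT].
    have [r0 r1] := bump_weight (a - t) k0 del0.
    have Bk : 0 <= B * k by rewrite mulr_ge0 ?(ltW k0).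
    rewrite normrM (ger0_norm r0); case: (ltP `|a - t| del) => ht.
      by apply: ler_wpDr => //; rewrite ler_wpM2r// hdel.
    case: (leP t a) => ta; last first.
      rewrite {1}/bump subr_gt0 ltNge (ltW ta)/= mulr0 addr_ge0// mulr_ge0// ltW//.
    apply: ler_wpDl; first by rewrite mulr_ge0// ltW.
    rewrite ger0_norm ?subr_ge0// in ht.
    rewrite /B mulrAC -[leRHS]mulrA; apply: ler_pM => //; last exact: r1.
    have := h1 t; have := h1 a; rewrite !in_itv/= t0 tT (ltW a0) (ltW aT) => /(_ isT) ha /(_ isT) hb.
    by apply: le_trans (ler_normB _ _) _; lra.
  rewrite RintegralD//; last 2 first.
  - by apply: itg_cont; apply: (cbr (fun=> e)); exact: cst_continuous.
  - by apply: itg_cont; exact: cst_continuous.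
  rewrite RintegralZl//; last exact: itg_cont.
  rewrite mass// Rintegral_cst//.
  have -> : fine (mu `[0, T]) = T.
    by have := lebesgue_measure_itv `[0, T : R]; rewrite /= lte_fin T0/= oppr0 addr0 => -> /=.
  have /andP[_ b1] := bump01 a k0.
  have -> : B * k * T = B * T * k by ring.
  by rewrite lerD2r -[leRHS]mulr1 ler_wpM2l// ltW.
have /andP[b0 _] := bump01 a k0; have b2 := bump_ge k a0.
rewrite normrM (ger0_norm b0) in e2.
have : `|d a| * (1 - k / a) <= `|d a| * bump 1 k a by rewrite ler_wpM2l.
rewrite mulrBr mulr1 mulrDl => h.
have -> : `|d a| / a * k = `|d a| * (k / a) by rewrite mulrAC mulrA.
lra.
Unshelve. all: by end_near. Qed.
End FTC.

(** * Separable test functions in space and time *)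

Section TestFunctions.
Context {R : realType}.
Local Notation C := R[i].
Local Notation Re := (@complex.Re R).
Local Notation Im := (@complex.Im R).

(** The time factor vanishes for [t >= a] if [sg = 1] and for [t <= - a] if [sg = -1]. The
    polynomial [p] is there to make the family stable under time derivatives. *)
Definition sep_test (p : {poly R}) (k a sg : R) (P : R -> C) (t x : R) : C :=
  (bump p k (a - sg * t))%:C * P x.

Lemma dt_sep_test p k a sg P : 0 < k ->
  dt_test (sep_test p k a sg P) = sep_test (- sg *: bump_poly k p) k a sg P.
Proof.
move=> k0; apply/funext => t; apply/funext => x; rewrite /dt_test /pderiv /=.
have db (t' : R) : is_derive t' (1 : R) (fun t' => bump p k (a - sg * t'))
    (bump (bump_poly k p) k (a - sg * t') * - sg).
  apply: (@is_derive1_comp R (bump p k) (fun t' => a - sg * t')); first exact: is_derive_bump.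
  by apply: is_derive_eq; rewrite /GRing.scale/= add0r mulr1; ring.
have -> := isd_cderive1 (isdM (isd_realC db) (isd_cst (P x))).
rewrite mulr0 addr0 /sep_test; congr (_%:C * _).
by rewrite /bump; case: ifP => _; rewrite ?mul0r// hornerZ; ring.
Qed.
Lemma dx_sep_test p k a sg P P' : isd P P' ->
  dx_test (sep_test p k a sg P) = sep_test p k a sg P'.
Proof.
move=> hP; apply/funext => t; rewrite /dx_test /pderiv /=.
exact: isd_cderive1 (isdZ _ hP).
Qed.

Lemma differentiable_prod (b r : R -> R) (p : R * R) : (forall t, derivable b t 1) ->
  (forall x, derivable r x 1) -> differentiable (fun q : R * R => b q.1 * r q.2) p.
Proof.
move=> db dr; apply: (@differentiableM _ _ (fun q : R * R => b q.1) (fun q : R * R => r q.2)).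
  apply: (@differentiable_comp _ _ _ _ fst b); last exact/derivable1_diffP/db.
  by apply: linear_differentiable => q; exact: cvg_fst.
apply: (@differentiable_comp _ _ _ _ snd r); last exact/derivable1_diffP/dr.
by apply: linear_differentiable => q; exact: cvg_snd.
Qed.

(** Each derivative in [t] changes only [p], and each derivative in [x] replaces [P] by another
    trigonometric polynomial of the same degree bound; every iterated derivative is thus again a
    product of one-variable functions. *)
Lemma smooth_sep_test M p k a sg P : 0 < k -> trig M P -> smooth_tx (sep_test p k a sg P).
Proof.
move=> k0 tP w q.
have [p' [P' [tP' ->]]] : exists p' P', trig M P' /\ foldr pderiv (sep_test p k a sg P) w =
    sep_test p' k a sg P'.
  elim: w => [|[] w [p' [P' [tP' IH]]]] /=; first by exists p, P.
    by exists (- sg *: bump_poly k p'), P'; rewrite IH -(dt_sep_test _ _ _ _ k0).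
  have [P2 tP2 h] := trig_isd tP'; exists p', P2; split=> //.
  by rewrite IH -(dx_sep_test _ _ _ _ h).
have [P2 tP2 h] := trig_isd tP'.
have db (t : R) : derivable (fun t => bump p' k (a - sg * t)) t 1.
  have : is_derive t (1 : R) (fun t' => bump p' k (a - sg * t'))
    (bump (bump_poly k p') k (a - sg * t) * - sg).
    apply: (@is_derive1_comp R (bump p' k) (fun t' => a - sg * t')); first exact: is_derive_bump.
    by apply: is_derive_eq; rewrite /GRing.scale/= add0r mulr1; ring.
  by case.
split.
  rewrite (_ : (fun _ => _) = fun q : R * R => bump p' k (a - sg * q.1) * (Re \o P') q.2).
    by apply: (differentiable_prod (b := fun t => bump p' k (a - sg * t))) => // x; have [[]] := h x.
  by apply/funext => y; rewrite /sep_test ReM /= mul0r subr0.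
rewrite (_ : (fun _ => _) = fun q : R * R => bump p' k (a - sg * q.1) * (Im \o P') q.2).
  by apply: (differentiable_prod (b := fun t => bump p' k (a - sg * t))) => // x; have [_ []] := h x.
by apply/funext => y; rewrite /sep_test ImM /= mul0r addr0.
Qed.

Lemma periodic_sep_test M p k a sg P t : trig M P -> periodic2pi (sep_test p k a sg P t).
Proof. by move=> /trig_periodic h x; rewrite /sep_test h. Qed.
Lemma test_fwd_sep_test M k a T P : 0 < k -> a < T -> trig M P ->
  test_fwd T (sep_test 1 k a 1 P).
Proof.
move=> k0 aT tP; split; first exact: smooth_sep_test tP.
  by move=> t; exact: periodic_sep_test tP.
exists a => // t x ta; rewrite /sep_test /bump subr_gt0 mul1r ltNge ta/=.
exact: mul0r.
Qed.
Lemma test_bwd_sep_test M k a T P : 0 < k -> a < T -> trig M P ->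
  test_bwd T (sep_test 1 k a (-1) P).
Proof.
move=> k0 aT tP; split; first exact: smooth_sep_test tP.
  by move=> t; exact: periodic_sep_test tP.
exists (- a) => [|t x ta]; first by rewrite ltrN2.
rewrite /sep_test /bump mulN1r opprK -[a]opprK addrC subr_gt0 ltNge ta/=.
exact: mul0r.
Qed.

End TestFunctions.

Section HsDifference.
Context {R : realType}.
Local Notation C := R[i].
Local Notation Re := (@complex.Re R).
Local Notation Im := (@complex.Im R).
Local Notation normc := (@ComplexField.Normc.normc R).
Local Notation mu := (@lebesgue_measure R).

Lemma HB_add (s B B' : R) (c c' : int -> C) : 0 <= B -> 0 <= B' -> HB s B c -> HB s B' c' ->
  HB s (2 * (B + B')) (fun k => c k + c' k).
Proof.
move=> B0 B0' h h' m.
apply: (@le_trans _ _ (zs 0 m (fun k => 2 * (wt s k * normc (c k) ^+ 2) + 2 * (wt s k * normc (c' k) ^+ 2)))).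
  apply: zs_le => k _; have w0 : 0 <= wt s k by rewrite /wt powR_ge0.
  have n1 := normc_add (c k) (c' k); have n0 := normc_ge0 (c k + c' k).
  have -> : 2 * (wt s k * normc (c k) ^+ 2) + 2 * (wt s k * normc (c' k) ^+ 2) =
     wt s k * (2 * normc (c k) ^+ 2 + 2 * normc (c' k) ^+ 2) by ring.
  rewrite ler_wpM2l//; have := sqr_ge0 (normc (c k) - normc (c' k)).
  move: n0 n1 (normc_ge0 (c k)) (normc_ge0 (c' k)).
  by move: (normc _) (normc _) (normc _) => x y z; nra.
rewrite zsD !zsZ; have := h m; have := h' m.
by move: (zs _ _ _) (zs _ _ _) => x y; nra.
Qed.
Lemma HB_opp (s B : R) (c : int -> C) : HB s B c -> HB s B (fun k => - c k).
Proof. by move=> h m; under eq_zs do rewrite normc_opp; exact: h. Qed.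

Lemma L2TB (f g : R -> C) : L2T f -> L2T g -> L2T (fun x => f x - g x).
Proof.
move=> [pf fr fi hf] [pg gr gi hg].
have cd : cmeas (fun x => f x - g x).
  have -> : (fun x => f x - g x) = (fun x => f x + (-1) * g x).
    by apply/funext => x; rewrite mulN1r.
  by apply: cmeasD => //; apply: cmeasM => //; exact/cmeas_cont/ccont_cst.
have [mr mi] := cd; split=> //; first by move=> x; rewrite pf pg.
have mn (h : R -> C) : cmeas h -> measurable_fun period (fun x => (normc (h x) ^+ 2)%:E).
  move=> [hr hi]; apply/measurable_EFinP.
  rewrite (_ : (fun x => _) = (fun x => Re (h x) ^+ 2 + Im (h x) ^+ 2)).
    by apply: measurable_funTS; apply: measurable_funD; apply: measurable_funX.
  by apply/funext => x; rewrite sqr_normcE.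
have mp := @measurable_period R.
have n0 (h : R -> C) x : (0 <= (normc (h x) ^+ 2)%:E)%E by rewrite lee_fin sqr_ge0.
apply: (@le_lt_trans _ _ (2%:E * (\int[mu]_(x in period) (normc (f x) ^+ 2)%:E) +
   2%:E * (\int[mu]_(x in period) (normc (g x) ^+ 2)%:E))%E); last first.
  by apply: lte_add_pinfty; apply: lte_mul_pinfty.
have m2 (h : R -> C) : cmeas h -> measurable_fun period (fun x => 2%:E * (normc (h x) ^+ 2)%:E)%E.
  by move=> ch; apply: measurable_funeM; exact: mn.
rewrite -!ge0_integralZl ?lee_fin//; try by apply: mn.
have p2 (h : R -> C) x : (0 <= 2%:E * (normc (h x) ^+ 2)%:E)%E by exact: mule_ge0.
rewrite -ge0_integralD//; try exact: m2.
apply: ge0_le_integral => //.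
- by move=> x _; exact: (n0 (fun x => f x - g x)).
- exact: (mn (fun x => f x - g x)).
- by apply: emeasurable_funD; exact: m2.
move=> x _; rewrite -!EFinM -EFinD lee_fin.
have := normc_sub (f x) (g x); have := normc_ge0 (f x - g x).
move: (normc_ge0 (f x)) (normc_ge0 (g x)); have := sqr_ge0 (normc (f x) - normc (g x)).
by move: (normc _) (normc _) (normc _) => u v w; nra.
Qed.

Lemma HsB (s : R) (f g : R -> C) : Hs s f -> Hs s g -> Hs s (fun x => f x - g x).
Proof.
move=> hf hg; have Lf := hf.1; have Lg := hg.1.
have n0 h : 0 <= Hs_norm s h by rewrite sqrtr_ge0.
apply: (@HB_Hs _ _ _ (2 * (Hs_norm s f + Hs_norm s g))); first exact: L2TB.
have -> : fourier (fun x => f x - g x) = fun k => fourier f k + - fourier g k.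
  by apply/funext => k; rewrite cintg_fourierB//; exact: L2T_cintg.
by apply: HB_add => //; [exact: Hs_HB hf (lexx _)|exact/HB_opp/(Hs_HB hg (lexx _))].
Qed.
End HsDifference.

Section Clamp.
Context {R : realType}.
(** Precomposition with this projection onto [[0, T]] extends a solution by constants, so that
    continuity in time can be stated on the whole line. *)
Definition clamp (T t : R) := Num.max 0 (Num.min t T).
Lemma clamp_in T t : 0 <= T -> 0 <= clamp T t <= T.
Proof. by move=> T0; rewrite /clamp le_max lexx/= ge_max T0 ge_min lexx orbT. Qed.
Lemma clamp_id T t : 0 <= t <= T -> clamp T t = t.
Proof. by move=> /andP[t0 tT]; rewrite /clamp min_l// max_r. Qed.
Lemma continuous_clamp T : continuous (clamp T).
Proof.
move=> t; apply: (@continuous_max _ _ (fun=> 0) (fun t => Num.min t T) t).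
  exact: cst_continuous.
apply: (@continuous_min _ _ (fun t => t) (fun=> T) t); [exact: id|exact: cst_continuous].
Qed.
End Clamp.

Section TimeIntegral.
Context {R : realType}.
Local Notation C := R[i].
Local Notation Re := (@complex.Re R).
Local Notation Im := (@complex.Im R).
Local Notation normc := (@ComplexField.Normc.normc R).
Local Notation mu := (@lebesgue_measure R).

Lemma eq_cint (D : set R) (f g : R -> C) : (forall t, D t -> f t = g t) -> cint D f = cint D g.
Proof.
move=> h; rewrite /cint; congr (_ +i* _); apply: eq_Rintegral => t; rewrite inE => /h ->//.
Qed.

Lemma ccont_eps (f : R -> C) : (forall t0, exists2 K, 0 <= K & forall e, 0 < e <= 1 ->
  \forall t \near t0, normc (f t - f t0) <= K * e) -> ccont f.
Proof.
move=> h; have key (r : C -> R) : (forall z, `|r z| <= normc z) -> {morph r : x y / x - y} ->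
    continuous (r \o f).
  move=> hr hB t0; have [K K0 hK] := h t0; apply/cvgrPdist_le => e e0.
  have d0 : 0 < Num.min 1 (e / (K + 1)) by rewrite lt_min ltr01 divr_gt0// ltr_wpDl.
  have := hK (Num.min 1 (e / (K + 1))); rewrite d0 ge_min lexx => /(_ isT).
  apply: filterS => t ht; rewrite -normrN opprB /= -hB; apply: le_trans (hr _) _.
  apply: (le_trans ht); apply: (@le_trans _ _ ((K + 1) * (e / (K + 1)))).
    by apply: ler_pM; rewrite ?(ltW d0)// ?lerDl// ge_min lexx orbT.
  by rewrite mulrC divfK// gt_eqF// ltr_wpDl.
split; apply: key.
- exact: normc_Re.
- by move=> x y; rewrite ReD ReN.
- exact: normc_Im.
- by move=> x y; rewrite ImD ImN.
Qed.

Section Interval.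
Context (a b : R).
Let itg (f : R -> R) := mu.-integrable `[a, b] (EFin \o f).
Let itgc f : continuous f -> itg f.
Proof.
move=> cf; apply: continuous_compact_integrable; first exact: segment_compact.
exact: continuous_subspaceT.
Qed.

Lemma cintD (f g : R -> C) : ccont f -> ccont g ->
  cint `[a, b] (fun t => f t + g t) = cint `[a, b] f + cint `[a, b] g.
Proof.
move=> [fr fi] [gr gi]; apply: cext; rewrite ?ReD ?ImD /cint/=.
  rewrite -(@RintegralD _ _ _ mu)//; [|exact: (itgc fr)|exact: (itgc gr)].
  by apply: eq_Rintegral => t _ /=; rewrite ReD.
rewrite -(@RintegralD _ _ _ mu)//; [|exact: (itgc fi)|exact: (itgc gi)].
by apply: eq_Rintegral => t _ /=; rewrite ImD.
Qed.
Lemma cintZ c (f : R -> C) : ccont f ->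
  cint `[a, b] (fun t => c * f t) = c * cint `[a, b] f.
Proof.
have cZ (r : R) (g : R -> R) : continuous g -> continuous (fun t => r * g t).
  by move=> cg t; apply: (@continuousM _ _ _ _ t); [exact: cst_continuous|exact: cg].
have IZ (r : R) (g : R -> R) : continuous g ->
    r * \int[mu]_(t in `[a, b]) g t = \int[mu]_(t in `[a, b]) (r * g t).
  by move=> cg; rewrite RintegralZl//; exact: itgc.
move=> [fr fi]; apply: cext; rewrite ?ReM ?ImM /cint/= !(IZ _ _ fr) !(IZ _ _ fi).
  rewrite -(@RintegralB _ _ _ mu)//; [|exact/itgc/cZ|exact/itgc/cZ].
  by apply: eq_Rintegral => t _ /=; rewrite ReM.
rewrite -(@RintegralD _ _ _ mu)//; [|exact/itgc/cZ|exact/itgc/cZ].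
by apply: eq_Rintegral => t _ /=; rewrite ImM.
Qed.

Lemma cint_reflect (f : R -> C) : a <= b -> ccont f ->
  cint `[- b, - a] f = cint `[a, b] (fun t => f (- t)).
Proof.
move=> ab [fr fi]; rewrite /cint /Rintegral; congr (fine _ +i* fine _).
  by rewrite (@integration_by_substitution_oppr R (Re \o f) a b ab)//; exact: continuous_subspaceT.
by rewrite (@integration_by_substitution_oppr R (Im \o f) a b ab)//; exact: continuous_subspaceT.
Qed.
End Interval.
End TimeIntegral.

(** * Continuity in time of pairings with a curve in H^s *)

Section Coefficients.
Context {R : realType}.
Local Notation C := R[i].
Local Notation normc := (@ComplexField.Normc.normc R).
Context (s : R) (hs : 5 / 2 < s).

Lemma syn_close (B B' e : R) (c c' : int -> C) x : 0 < B -> 0 < B' -> 0 < e ->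
  HB s B c -> HB s B' c' -> HB s e (fun k => c k - c' k) ->
  normc (syn c x - syn c' x) <= 4 * e /\ normc (syn (Dz c) x - syn (Dz c') x) <= 4 * e.
Proof.
move=> B0 B0' e0 h h' he; have [U1 U2] := HB_ulim hs B0 h; have [V1 V2] := HB_ulim hs B0' h'.
split.
  by apply: (ulim_sup x (ulimB U1 V1)) => m; have [] := HB_l1_full m hs e0 he.
apply: (ulim_sup x (ulimB U2 V2)) => m; have [_] := HB_l1_full m hs e0 he.
by under [X in X <= _ -> _]eq_zs do rewrite /= /Dz mulrBr.
Qed.

Lemma syn_bound (B : R) (c : int -> C) x : 0 < B -> HB s B c ->
  normc (syn c x) <= 4 * B /\ normc (syn (Dz c) x) <= 4 * B.
Proof.
move=> B0 h; have [U1 U2] := HB_ulim hs B0 h; split.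
  by apply: (ulim_sup x U1) => m; have [] := HB_l1_full m hs B0 h.
by apply: (ulim_sup x U2) => m; have [] := HB_l1_full m hs B0 h.
Qed.

(** Continuity in time with values in H^s, transcribed to Fourier coefficients through the bounds
    [HB]. *)
Definition coef_cont (c : R -> int -> C) := (forall t, exists2 B, 0 < B & HB s B (c t)) /\
  forall (t0 e : R), 0 < e -> \forall t \near t0, HB s e (fun k => c t k - c t0 k).

Context (c : R -> int -> C) (hc : coef_cont c) (F : @pexp R).

Lemma ccont_syn t : ccont (syn (c t)) /\ ccont (syn (Dz (c t))).
Proof.
have [B B0 h] := hc.1 t; have [U1 U2] := HB_ulim hs B0 h.
by split; [exact: ulim_ccont U1|exact: ulim_ccont U2].
Qed.

Lemma ccont_pvs t : ccont (fun x => pv F (syn (c t) x) (syn (Dz (c t)) x)).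
Proof.
have [c1 c2] := ccont_syn t; apply: (@ev_vec_closed R ccont) => //.
- exact: ccont_cst.
- exact: ccontJ.
- exact: ccontD.
- exact: ccontM.
Qed.

Lemma near_HB (t0 : R) : exists2 B, 0 < B & \forall t \near t0, HB s B (c t).
Proof.
have [B B0 h] := hc.1 t0; exists (2 * (1 + B)); first by rewrite mulr_gt0// addr_gt0.
apply: filterS (hc.2 t0 1 ltr01) => t ht m.
have := HB_add ler01 (ltW B0) ht h m.
by under eq_zs do rewrite subrK.
Qed.

Lemma ccont_pair (W : R -> C) : ccont W -> ccont (fun t => tint (fun x => syn (c t) x * W x)).
Proof.
move=> cW; have [w w0 hw] := ccont_bounded cW; apply: ccont_eps => t0.
exists (2 * (4 * w)) => [|e /andP[e0 _]]; first by rewrite !mulr_ge0// ltW.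
have [B B0 hB] := near_HB t0; have [B' B0' hB'] := hc.1 t0.
apply: filterS2 hB (hc.2 t0 e e0) => t h1 h2.
have [c1 _] := ccont_syn t; have [c0 _] := ccont_syn t0.
rewrite tint_subc; [|exact: ccontM|exact: ccontM].
rewrite -mulrA; apply: tint_le_cst.
  by apply: cintg_cont; apply: ccontB; exact: ccontM.
move=> x px; rewrite -mulrBl normc_mul mulrAC; apply: ler_pM; rewrite ?normc_ge0 ?hw//.
by have [] := syn_close x B0 B0' e0 h1 hB' h2.
Qed.

Lemma ccont_pv_pair (W : R -> C) : ccont W ->
  ccont (fun t => tint (fun x => pv F (syn (c t) x) (syn (Dz (c t)) x) * W x)).
Proof.
move=> cW; have [w w0 hw] := ccont_bounded cW; apply: ccont_eps => t0.
have [B B0 hB] := near_HB t0; have [B' B0' hB'] := hc.1 t0.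
have [K K0 hK] := pv_lip F (4 * B + 4 * B').
exists (2 * (K * 8 * w)) => [|e /andP[e0 _]]; first by rewrite !mulr_ge0// ltW.
apply: filterS2 hB (hc.2 t0 e e0) => t h1 h2.
have c1 := ccont_pvs t; have c0 := ccont_pvs t0.
rewrite tint_subc; [|exact: ccontM|exact: ccontM].
rewrite -mulrA; apply: tint_le_cst.
  by apply: cintg_cont; apply: ccontB; exact: ccontM.
move=> x px; rewrite -mulrBl normc_mul mulrAC; apply: ler_pM; rewrite ?normc_ge0 ?hw//.
have [l1 l2] := syn_close x B0 B0' e0 h1 hB' h2.
have [b1 b2] := syn_bound x B0 h1; have [b3 b4] := syn_bound x B0' hB'.
apply: le_trans (hK _ _ _ _ _ _ _ _) _; try by move: B0 B0'; lra.
by rewrite -mulrA ler_wpM2l//; lra.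
Qed.
End Coefficients.

(** * The weak solution as a system of ordinary differential equations *)

Section Evolution.
Context {R : realType}.
Local Notation C := R[i].
Local Notation Re := (@complex.Re R).
Local Notation Im := (@complex.Im R).
Local Notation normc := (@ComplexField.Normc.normc R).
Local Notation mu := (@lebesgue_measure R).

Definition pairing (c : R -> int -> C) (P : R -> C) t := tint (fun x => syn (c t) x * P x).
Definition pv_pairing (F : @pexp R) (c : R -> int -> C) (P : R -> C) t :=
  tint (fun x => pv F (syn (c t) x) (syn (Dz (c t)) x) * P x).

(* The Fourier coefficients [c] of a solution, tested against trigonometric polynomials;
   [sg = -1] is the equation after reversal of time. *)
Definition evol (F : @pexp R) (s sg T : R) (phi : R -> C) (c : R -> int -> C) : Prop :=
  coef_cont s c /\ forall M P P1 P2, trig M P -> isd P P1 -> isd P1 P2 ->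
  [/\ pairing c P 0 = tint (fun x => phi x * P x), ccont (pairing c P) &
    forall t, 0 < t < T ->
      let q := sg%:C * (pv_pairing F c P t - 'i%C * pairing c P2 t) in
      is_derive t (1 : R) (Re \o pairing c P) (Re q) /\
      is_derive t (1 : R) (Im \o pairing c P) (Im q)].

(** The reparametrization [h] covers both directions of time: it is [clamp T] for the forward
    problem and its opposite for the backward one. *)
Lemma C_Hs_coef (s a b : R) (u : R -> R -> C) (h : R -> R) : C_Hs s a b u ->
  continuous h -> (forall t, a <= h t <= b) -> coef_cont s (fun t => fourier (u (h t))).
Proof.
move=> cu ch hab.
have hH t : Hs s (u (h t)) by have [] := cu (h t); rewrite // in_itv/=.
split=> [t|t0 e e0].
  exists (Hs_norm s (u (h t)) + 1); first by rewrite ltr_wpDl ?sqrtr_ge0.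
  by apply: Hs_HB (hH t) _; rewrite lerDl.
have := cu (h t0); rewrite in_itv/= hab => /(_ isT)[_].
move=> /cvgrPdist_le/(_ e e0); rewrite near_withinE => H.
have H' : \forall t \near t0, h t \in `[a, b] -> `|0 - Hs_norm s (u (h t) \- u (h t0))| <= e.
  exact: (ch t0 _ H).
apply: filterS H' => t; rewrite in_itv/= hab => /(_ isT).
rewrite sub0r normrN => ht m.
have := Hs_HB (HsB (hH t) (hH t0)) (le_trans (ler_norm _) ht) m.
by under [X in X <= _ -> _]eq_zs do rewrite (cintg_fourierB _ (L2T_cintg (hH t).1) (L2T_cintg (hH t0).1)).
Qed.

Section Pairings.
Context (s : R) (hs : 5 / 2 < s) (F : mpoly.mpoly 4 C) (p : @pexp R)
  (pE : forall v, mpoly.meval v F = ev p v).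

Lemma rep_pairing (f W : R -> C) : Hs s f -> ccont W ->
  tint (fun x => f x * W x) = tint (fun x => syn (fourier f) x * W x).
Proof.
move=> hf cW; have B0 : 0 < Hs_norm s f + 1 by rewrite ltr_wpDl ?sqrtr_ge0.
have hB : HB s (Hs_norm s f + 1) (fourier f) by apply: Hs_HB hf _; rewrite lerDl.
have [U _] := HB_ulim hs B0 hB; have aeF := ae_filter_ringOfSetsType mu.
apply: tint_ae.
- by apply: cmeasM; [exact: L2T_cmeas hf.1|exact: cmeas_cont].
- by apply: cmeas_cont; apply: ccontM => //; exact: ulim_ccont U.
- by apply: filterS (rep_ae hs B0 hf.1 hB) => x h px; rewrite h.
Qed.

Lemma cmeas_evalF (f g : R -> C) : cmeas f -> cmeas g -> cmeas (fun x => evalF F (f x) (g x)).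
Proof.
move=> mf mg; rewrite (_ : (fun x => _) = fun x => ev p (vec (f x) (g x))); last first.
  by apply/funext => x; exact: evalFE.
apply: (@ev_vec_closed R cmeas) => //.
- by move=> c; exact/cmeas_cont/ccont_cst.
- exact: cmeasJ.
- exact: cmeasD.
- exact: cmeasM.
Qed.

Lemma rep_pv_pairing (f W : R -> C) : Hs s f -> ccont W ->
  tint (fun x => evalF F (f x) (dx f x) * W x) =
  tint (fun x => pv p (syn (fourier f) x) (syn (Dz (fourier f)) x) * W x).
Proof.
move=> hf cW; have B0 : 0 < Hs_norm s f + 1 by rewrite ltr_wpDl ?sqrtr_ge0.
have hB : HB s (Hs_norm s f + 1) (fourier f) by apply: Hs_HB hf _; rewrite lerDl.
have [U U'] := HB_ulim hs B0 hB; have aeF := ae_filter_ringOfSetsType mu.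
apply: tint_ae.
- apply: cmeasM; last exact: cmeas_cont.
  apply: cmeas_evalF; [exact: L2T_cmeas hf.1|exact: L2T_cmeas (dx_L2T hs B0 hf.1 hB)].
- apply: cmeasM; last exact: cmeas_cont.
  rewrite (_ : (fun x => pv _ _ _) = fun x => evalF F (syn (fourier f) x) (syn (Dz (fourier f)) x)).
    by apply: cmeas_evalF; apply: cmeas_cont; [exact: ulim_ccont U|exact: ulim_ccont U'].
  by apply/funext => x; rewrite (evalFE pE).
- apply: filterS2 (rep_ae hs B0 hf.1 hB) (dx_ae hs B0 hf.1 hB) => x h1 h2 px.
  by rewrite h1// h2// (evalFE pE).
Qed.

Section Weak.
Context (T sg : R) (T0 : 0 < T) (phi : R -> C) (c : R -> int -> C) (hc : coef_cont s c).
Context (weak : forall M P P1 P2 k a, trig M P -> isd P P1 -> isd P1 P2 -> 0 < k -> 0 < a < T ->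
  cint `[0, T] (fun t => (bump (bump_poly k 1) k (a - t))%:C * pairing c P t)
  = (bump 1 k a)%:C * tint (fun x => phi x * P x) +
    cint `[0, T] (fun t => (bump 1 k (a - t))%:C *
      (sg%:C * (pv_pairing p c P t - 'i%C * pairing c P2 t)))).

(** Both the pairing and its expected derivative are continuous in time, so du Bois-Reymond
    identifies the pairing on []0, T[] with the antiderivative that starts at the pairing of the
    data. *)
Lemma weak_evol : evol p s sg T phi c.
Proof.
split=> // M P P1 P2 tP hP hP1.
have cP := trig_ccont tP; have cP2 : ccont P2.
  have [P' tP' h] := trig_isd tP; have [P'' tP'' h'] := trig_isd tP'.
  have e : P1 = P' by rewrite -(isd_cderive1 hP) (isd_cderive1 h).
  rewrite e in hP1.
  by rewrite -(isd_cderive1 hP1) (isd_cderive1 h'); exact: trig_ccont tP''.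
pose q t : C := sg%:C * (pv_pairing p c P t - 'i%C * pairing c P2 t).
have cg : ccont (pairing c P) by exact: (ccont_pair hs hc cP).
have cq : ccont q.
  apply: ccontM; first exact: ccont_cst.
  apply: ccontB; first exact: (ccont_pv_pair hs hc p cP).
  by apply: ccontM; [exact: ccont_cst|exact: (ccont_pair hs hc cP2)].
(* The real statement is proved once for a functional [r] compatible with the operations involved,
   and used for both the real and the imaginary part. *)
have key (r : C -> R) : (forall f : R -> C, ccont f -> continuous (r \o f)) ->
    (forall (b : R) z, r (b%:C * z) = b * r z) -> {morph r : x y / x + y} ->
    (forall f, r (cint `[0, T] f) = \int[mu]_(t in `[0, T]) r (f t)) ->
    r (pairing c P 0) = r (tint (fun x => phi x * P x)) /\
    forall t, 0 < t < T -> is_derive t (1 : R) (r \o pairing c P) (r (q t)).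
  move=> rc rM rD rI.
  have [Q Q0 dQ] := antiderivative_itv (r (tint (fun x => phi x * P x))) (rc _ cq).
  have eQ a : 0 < a < T -> r (pairing c P a) = Q a.
    move=> ha; apply: (du_bois_reymond T0 ha (rc _ cg) (rc _ cq) dQ) => k k0.
    have := congr1 r (weak tP hP hP1 k0 ha).
    rewrite rD rM !rI Q0 => e.
    transitivity (\int[mu]_(t in `[0, T])
        r ((bump (bump_poly k 1) k (a - t))%:C * pairing c P t)).
      by apply: eq_Rintegral => t _; rewrite rM mulrC.
    by rewrite e; congr (_ + _); apply: eq_Rintegral => t _; rewrite rM mulrC.
  split; last first.
    move=> t ht; apply: (@near_eq_is_derive _ _ _ Q).
      have /andP[t0 tT] := ht.
      near=> z; rewrite /= eQ//; apply/andP; split; near: z; [exact: lt_nbhsr|exact: lt_nbhsl].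
    by apply: dQ; have /andP[t0 _] := ht; lra.
  (* The equality on []0, T[] extends to 0 because both sides are continuous from the right; this
     recovers the initial condition. *)
  have c1 : (r \o pairing c P) x @[x --> 0^'+] --> r (pairing c P 0).
    by apply: cvg_at_right_filter; exact: (rc _ cg).
  have c2 : Q x @[x --> 0^'+] --> Q 0.
    by apply: cvg_at_right_filter; apply: (is_derive_cont (dQ _ _)); lra.
  rewrite -Q0; apply: (cvg_unique _ c1) => //; apply: cvg_trans c2; apply: near_eq_cvg.
  near=> z; rewrite /= eQ//; apply/andP; split; near: z; first exact: nbhs_right_gt.
  exact: nbhs_right_lt.
have [Re0 dRe] := key Re (fun f h => h.1) (fun b z => ltac:(by rewrite ReM /= mul0r subr0)) (@ReD R) (fun f => erefl).
have [Im0 dIm] := key Im (fun f h => h.2) (fun b z => ltac:(by rewrite ImM /= mul0r addr0)) (@ImD R) (fun f => erefl).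
split=> //; first exact: cext.
by move=> t ht; split; [exact: dRe|exact: dIm].
Unshelve. all: by end_near. Qed.
End Weak.

Lemma ccont_bump (P : {poly R}) (k a : R) : 0 < k -> ccont (fun t => (bump P k (a - t))%:C).
Proof.
move=> k0; apply: ccont_realC => t.
apply: (continuous_comp (f := fun t => a - t)); last exact: continuous_bump.
by apply: (@continuousB _ _ _ _ _ t); [exact: cst_continuous|exact: id].
Qed.

Lemma pull_pairing (b : R) (f W : R -> C) : Hs s f -> ccont W ->
  tint (fun x => f x * (b%:C * W x)) = b%:C * tint (fun x => syn (fourier f) x * W x).
Proof.
move=> hf cW; have B0 : 0 < Hs_norm s f + 1 by rewrite ltr_wpDl ?sqrtr_ge0.
have hB : HB s (Hs_norm s f + 1) (fourier f) by apply: Hs_HB hf _; rewrite lerDl.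
have [U _] := HB_ulim hs B0 hB; have cs := ulim_ccont U.
rewrite rep_pairing//; last by apply: ccontM => //; exact: ccont_cst.
rewrite tint_mulc; last exact: ccontM.
by apply: eq_tint => x _; ring.
Qed.

Lemma pull_pv_pairing (b : R) (f W : R -> C) : Hs s f -> ccont W ->
  tint (fun x => evalF F (f x) (dx f x) * (b%:C * W x)) =
  b%:C * tint (fun x => pv p (syn (fourier f) x) (syn (Dz (fourier f)) x) * W x).
Proof.
move=> hf cW; have B0 : 0 < Hs_norm s f + 1 by rewrite ltr_wpDl ?sqrtr_ge0.
have hB : HB s (Hs_norm s f + 1) (fourier f) by apply: Hs_HB hf _; rewrite lerDl.
have [U U'] := HB_ulim hs B0 hB.
have cs := ccont_pv p (ulim_ccont U) (ulim_ccont U').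
rewrite rep_pv_pairing//; last by apply: ccontM => //; exact: ccont_cst.
rewrite tint_mulc; last exact: ccontM.
by apply: eq_tint => x _; ring.
Qed.

Lemma ccont_isd2 M (P P1 P2 : R -> C) : trig M P -> isd P P1 -> isd P1 P2 -> ccont P2.
Proof.
move=> tP hP hP1.
have [P' tP' h] := trig_isd tP; have [P'' tP'' h'] := trig_isd tP'.
have e : P1 = P' by rewrite -(isd_cderive1 hP) (isd_cderive1 h).
rewrite e in hP1.
by rewrite -(isd_cderive1 hP1) (isd_cderive1 h'); exact: trig_ccont tP''.
Qed.

(* With [sg = -1] the equation of [solution_bwd] has been reflected to positive times. *)
Lemma weak_form (T sg k a : R) (c : R -> int -> C) M (P P1 P2 : R -> C) (z0 : C) :
  coef_cont s c -> 0 < k -> trig M P -> isd P P1 -> isd P1 P2 ->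
  - cint `[0, T] (fun t => (bump (- sg *: bump_poly k 1) k (a - t))%:C * pairing c P t) -
    sg%:C * ((bump 1 k a)%:C * z0) +
    'i%C * cint `[0, T] (fun t => (bump 1 k (a - t))%:C * pairing c P2 t) =
    cint `[0, T] (fun t => (bump 1 k (a - t))%:C * pv_pairing p c P t) ->
  sg * sg = 1 ->
  cint `[0, T] (fun t => (bump (bump_poly k 1) k (a - t))%:C * pairing c P t)
  = (bump 1 k a)%:C * z0 +
    cint `[0, T] (fun t => (bump 1 k (a - t))%:C *
      (sg%:C * (pv_pairing p c P t - 'i%C * pairing c P2 t))).
Proof.
move=> hc k0 tP hP hP1 eq sg2.
have cP := trig_ccont tP; have cP2 := ccont_isd2 tP hP hP1.
have c0 := ccont_pair hs hc cP; have c2 := ccont_pair hs hc cP2.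
have cF := ccont_pv_pair hs hc p cP.
have cb := ccont_bump (bump_poly k 1) a k0; have c1 := ccont_bump 1 a k0.
have e1 : cint `[0, T] (fun t => (bump (- sg *: bump_poly k 1) k (a - t))%:C * pairing c P t) =
   - sg%:C * cint `[0, T] (fun t => (bump (bump_poly k 1) k (a - t))%:C * pairing c P t).
  rewrite -cintZ; last exact: ccontM.
  apply: eq_cint => t _; rewrite mulrA; congr (_ * _).
  have -> : bump (- sg *: bump_poly k 1) k (a - t) = - sg * bump (bump_poly k 1) k (a - t).
    by rewrite /bump; case: ifP => _; rewrite ?mulr0// hornerZ; ring.
  by rewrite rmorphM rmorphN.
have e2 : cint `[0, T] (fun t => (bump 1 k (a - t))%:C *
      (sg%:C * (pv_pairing p c P t - 'i%C * pairing c P2 t))) =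
   sg%:C * cint `[0, T] (fun t => (bump 1 k (a - t))%:C * pv_pairing p c P t) +
   (- sg%:C * 'i%C) * cint `[0, T] (fun t => (bump 1 k (a - t))%:C * pairing c P2 t).
  rewrite -!cintZ; try exact: ccontM.
  rewrite -cintD; try by apply: ccontM; [exact: ccont_cst|exact: ccontM].
  by apply: eq_cint => t _; ring.
have ss : sg%:C * sg%:C = 1 :> C by rewrite -rmorphM sg2.
rewrite e2 -eq e1; move: (cint _ _) (cint _ _) => v u; ring: ss.
Qed.

Lemma solution_fwd_evol (T : R) (phi : R -> C) u : 0 < T -> Hs s phi -> C_Hs s 0 T u ->
  solution_fwd s T F phi u -> evol p s 1 T phi (fun t => fourier (u (clamp T t))).
Proof.
move=> T0 hphi hu [_ sol].
have hc : coef_cont s (fun t => fourier (u (clamp T t))).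
  apply: (C_Hs_coef hu); first exact: continuous_clamp.
  by move=> t; exact: clamp_in (ltW T0).
apply: weak_evol => // M P P1 P2 k a tP hP hP1 k0 /andP[a0 aT].
have cP := trig_ccont tP; have cP2 := ccont_isd2 tP hP hP1.
have hH t : 0 <= t <= T -> Hs s (u t) by move=> ht; have [] := hu t; rewrite // in_itv.
apply: (weak_form hc k0 tP hP hP1); last by rewrite mulr1.
have := sol _ (test_fwd_sep_test k0 aT tP).
rewrite (dt_sep_test _ _ _ _ k0) (dx_sep_test _ _ _ _ hP) (dx_sep_test _ _ _ _ hP1).
have r0 (W : R -> C) q : ccont W -> cint `[0, T] (fun t => tint (fun x => u t x * sep_test q k a 1 W t x)) =
   cint `[0, T] (fun t => (bump q k (a - t))%:C * pairing (fun t => fourier (u (clamp T t))) W t).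
  move=> cW; apply: eq_cint => t; rewrite /= in_itv/= => ht.
  by rewrite /sep_test mul1r (pull_pairing _ (hH _ ht) cW) /pairing clamp_id.
rewrite !r0// /sep_test mulr0 subr0 (pull_pairing _ hphi cP) -(rep_pairing hphi cP) mul1r.
move=> ->; apply: eq_cint => t; rewrite /= in_itv/= => ht.
by rewrite mul1r (pull_pv_pairing _ (hH _ ht) cP) /pv_pairing clamp_id.
Qed.

Lemma solution_bwd_evol (T : R) (phi : R -> C) u : 0 < T -> Hs s phi -> C_Hs s (- T) 0 u ->
  solution_bwd s T F phi u -> evol p s (-1) T phi (fun t => fourier (u (- clamp T t))).
Proof.
move=> T0 hphi hu [_ sol].
have hc : coef_cont s (fun t => fourier (u (- clamp T t))).
  apply: (C_Hs_coef hu) => t.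
    by apply: (@continuousN _ _ _ _ t); exact: continuous_clamp.
  by have := clamp_in t (ltW T0); rewrite lerN2 oppr_le0 andbC.
apply: weak_evol => // M P P1 P2 k a tP hP hP1 k0 /andP[a0 aT].
have cP := trig_ccont tP; have cP2 := ccont_isd2 tP hP hP1.
have hH t : - T <= t <= 0 -> Hs s (u t) by move=> ht; have [] := hu t; rewrite // in_itv.
apply: (weak_form hc k0 tP hP hP1); last by rewrite mulrNN mulr1.
have := sol _ (test_bwd_sep_test k0 aT tP).
rewrite (dt_sep_test _ _ _ _ k0) (dx_sep_test _ _ _ _ hP) (dx_sep_test _ _ _ _ hP1).
have refl (g : R -> C) : ccont g -> cint `[- T, 0] (fun t => g (- t)) = cint `[0, T] g.
  move=> cg; rewrite -[in LHS](oppr0 R) cint_reflect ?(ltW T0)//.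
    by apply: eq_cint => t _; rewrite opprK.
  have cN : continuous (fun t : R => - t) by move=> t; exact: (@continuousN _ _ _ (fun t => t) t).
  have [gr gi] := cg.
  by split=> t; [exact: (continuous_comp (cN t) (gr (- t)))|exact: (continuous_comp (cN t) (gi (- t)))].
have cid t : - T <= t <= 0 -> - clamp T (- t) = t.
  by move=> /andP[h1 h2]; rewrite clamp_id ?opprK// oppr_ge0 h2 lerNl.
have r0 (W : R -> C) q : ccont W -> cint `[- T, 0] (fun t => tint (fun x => u t x * sep_test q k a (-1) W t x)) =
   cint `[0, T] (fun t => (bump q k (a - t))%:C * pairing (fun t => fourier (u (- clamp T t))) W t).
  move=> cW; rewrite -refl.
    apply: eq_cint => t; rewrite /= in_itv/= => ht.
    by rewrite /sep_test mulN1r (pull_pairing _ (hH _ ht) cW) /pairing cid.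
  by apply: ccontM; [exact: ccont_bump|exact: (ccont_pair hs hc cW)].
rewrite !r0// /sep_test mulr0 subr0 (pull_pairing _ hphi cP) -(rep_pairing hphi cP).
rewrite rmorphN1 mulN1r !opprK => ->; rewrite -refl.
  apply: eq_cint => t; rewrite /= in_itv/= => ht.
  by rewrite mulN1r (pull_pv_pairing _ (hH _ ht) cP) /pv_pairing cid.
by apply: ccontM; [exact: ccont_bump|exact: (ccont_pv_pair hs hc p cP)].
Qed.
End Pairings.
End Evolution.

(** * Growth of a high frequency *)

Section Freeze.
Context {R : realType}.
Local Notation C := R[i].
Local Notation Re := (@complex.Re R).
Local Notation Im := (@complex.Im R).
Local Notation normc := (@ComplexField.Normc.normc R).

Lemma pv_bound (F : @pexp R) (r : R) : 0 <= r -> exists2 K, 0 <= K & forall a b : C,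
  normc a <= r -> normc b <= r -> normc (pv F a b) <= K.
Proof.
move=> r0; have [K K0 hK] := pv_lip F r.
exists (K * (r + r) + normc (pv F 0 0)) => [|a b ha hb].
  by rewrite addr_ge0 ?normc_ge0// mulr_ge0// addr_ge0.
have n0 : normc (0 : C) <= r by rewrite normc_zero.
have := hK a b 0 0 ha hb n0 n0; rewrite !subr0 => h.
rewrite -[pv F a b](subrK (pv F 0 0)); apply: le_trans (normc_add _ _) _; rewrite lerD2r.
by apply: (le_trans h); rewrite ler_wpM2l// lerD.
Qed.

Lemma trig_ex1 (k : int) : trig `|k| (@ex R k).
Proof. by apply: (trig_eq (@trig_ex R _ k 1 _)) => // x; rewrite mul1r. Qed.

Lemma isd_ex2 (k : int) : isd (@ex R k) (fun x => 'i%C * k%:~R * ex k x) /\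
  isd (fun x => 'i%C * k%:~R * @ex R k x) (fun x => - k%:~R ^+ 2 * ex k x).
Proof.
split; first exact: isd_ex.
apply: isd_ext (isdZ ('i%C * k%:~R) (isd_ex k)) => x //.
by rewrite mulrA mulrACA i_sqr mulN1r expr2.
Qed.

Lemma complex_mvt (f q : R -> C) (t K : R) : 0 <= t -> 0 <= K -> ccont f ->
  (forall r, 0 < r < t -> [/\ is_derive r (1 : R) (Re \o f) (Re (q r)),
     is_derive r (1 : R) (Im \o f) (Im (q r)) & normc (q r) <= K]) ->
  normc (f t - f 0) <= 2 * K * t.
Proof.
move=> t0 K0 [cr ci] h; have [t00|tn0] := eqVneq t 0.
  by rewrite t00 subrr normc_zero mulr0.
have tp : 0 < t by rewrite lt_neqAle eq_sym tn0.
have key (g g' : R -> R) : continuous g ->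
    (forall r, 0 < r < t -> is_derive r (1 : R) g (g' r) /\ `|g' r| <= K) -> `|g t - g 0| <= K * t.
  move=> cg hg; have dg (r : R) : r \in `]0, t[ -> is_derive r (1 : R) g (g' r).
    by rewrite in_itv/= => /hg[].
  have [z hz ->] := @MVT R g g' 0 t tp dg (continuous_subspaceT cg).
  move: hz; rewrite in_itv/= => /hg[_ b].
  by rewrite subr0 normrM (ger0_norm t0) ler_wpM2r.
have kr := key _ (Re \o q) cr; have ki := key _ (Im \o q) ci.
apply: le_trans (normc_le_ReIm _) _; rewrite ReD ReN ImD ImN.
have -> : 2 * K * t = K * t + K * t by ring.
apply: lerD; [apply: kr|apply: ki] => r /h[h1 h2 h3]; split=> //.
  exact: le_trans (normc_Re _) h3.
exact: le_trans (normc_Im _) h3.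
Qed.

Context (s : R) (hs : 5 / 2 < s) (p : @pexp R) (sg T : R) (T0 : 0 < T) (sg2 : sg * sg = 1).
Context (fc : int -> C) (B0 : R) (B00 : 0 < B0) (hB : HB s B0 fc).
Context (c : R -> int -> C) (hev : evol p s sg T (syn fc) c).

Lemma pairing_ex t k : pairing c (ex (- k)) t = c t k.
Proof.
have [hc _] := hev; have [B Bp h] := hc.1 t; have [U _] := HB_ulim hs Bp h.
by rewrite -(ulim_fourier k U) fourierE.
Qed.

Lemma evol_init k : c 0 k = fc k.
Proof.
have [_ ode] := hev; have [d1 d2] := isd_ex2 (- k).
have [e _ _] := ode _ _ _ _ (trig_ex1 (- k)) d1 d2.
have [U _] := HB_ulim hs B00 hB.
by rewrite -pairing_ex e -(ulim_fourier k U) fourierE.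
Qed.

(** The constant that [HB_add] gives for a state written as the data, of norm at most [B0], plus a
    difference of norm at most 1. *)
Definition evB : R := 2 * (1 + B0).
Lemma evB_gt0 : 0 < evB. Proof. by rewrite mulr_gt0// addr_gt0. Qed.

(** Continuity in H^s at time 0 gives [T1], which depends on the solution but on no frequency
    scale. *)
Lemma evol_uniform : exists2 T1, 0 < T1 < T & forall t, 0 <= t <= T1 ->
  HB s evB (c t) /\ HB s 1 (fun k => c t k - fc k).
Proof.
have [hc _] := hev; have := hc.2 0 1 ltr01 => /nbhs_ballP[d /= d0 hd].
exists (Num.min (d / 2) (T / 2)).
  rewrite lt_min !divr_gt0//= gt_min; apply/orP; right.
  by rewrite ltr_pdivrMr// ltr_pMr// ltr1n.
move=> t /andP[t0]; rewrite le_min => /andP[td tT].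
have h1 : HB s 1 (fun k => c t k - fc k).
  have : ball 0 d t.
    rewrite /ball /= sub0r normrN ger0_norm//; apply: le_lt_trans td _.
    by rewrite ltr_pdivrMr// ltr_pMr// ltr1n.
  by move=> /hd h m; have := h m; under [X in X <= _ -> _]eq_zs do rewrite evol_init.
split=> // m; have := HB_add ler01 (ltW B00) h1 hB m.
by under [X in X <= _ -> _]eq_zs do rewrite subrK.
Qed.

Section Short.
Context (T1 : R) (hT1 : 0 < T1 < T) (hX : forall t, 0 <= t <= T1 ->
  HB s evB (c t) /\ HB s 1 (fun k => c t k - fc k)).

(** Testing against the character of frequency [- k]: the nonlinearity is bounded and the second
    derivative costs [k^2], so the [k]-th coefficient moves at speed [O(1 + k^2)]. *)
Lemma evol_lip : exists2 C1, 0 <= C1 & forall t k, 0 <= t <= T1 ->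
  normc (c t k - fc k) <= C1 * t * (1 + k%:~R ^+ 2).
Proof.
have [hc ode] := hev; have X0 := evB_gt0.
have [K K0 hK] := pv_bound p (ltW (mulr_gt0 (ltr0n _ 4) X0)).
exists (2 * (2 * K + 2 * (4 * evB))) => [|t k /andP[t0 tT]].
  by rewrite !(mulr_ge0, addr_ge0)// ltW.
have [d1 d2] := isd_ex2 (- k).
have [_ cc dd] := ode _ _ _ _ (trig_ex1 (- k)) d1 d2.
rewrite -evol_init -!pairing_ex.
have k2 : 0 <= (k%:~R : R) ^+ 2 by rewrite sqr_ge0.
have -> : 2 * (2 * K + 2 * (4 * evB)) * t * (1 + k%:~R ^+ 2) =
   2 * ((2 * K + 2 * (4 * evB)) * (1 + k%:~R ^+ 2)) * t by ring.
pose q r := sg%:C * (pv_pairing p c (ex (- k)) r - 'i%C * pairing c (fun x => - (- k)%:~R ^+ 2 * ex (- k) x) r).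
apply: (complex_mvt (q := q)) => //.
  by apply: mulr_ge0; move: K0 X0 k2; move: (k%:~R ^+ 2) => z; lra.
move=> r /andP[r0 rt]; have rT : 0 < r < T.
  by rewrite r0/=; apply: lt_le_trans rt _; apply: (le_trans tT); case/andP: hT1 => _ /ltW.
have [h1 h2] := dd r rT; split=> //.
have rT1 : 0 <= r <= T1 by rewrite (ltW r0)/= (le_trans (ltW rt)).
have [hr _] := hX rT1.
have nsg : normc (sg%:C : C) = 1.
  rewrite normc_real; have : `|sg| ^+ 2 = 1 by rewrite -normrX expr2 sg2 normr1.
  by move=> /eqP; rewrite sqrf_eq1 => /orP[/eqP//|/eqP e]; have := normr_ge0 sg; rewrite e; lra.
have [cs _] := ccont_syn hs hc r; have cp := ccont_pvs hs hc p r.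
rewrite /q normc_mul nsg mul1r; apply: le_trans (normc_sub _ _) _.
have b1 : normc (pv_pairing p c (ex (- k)) r) <= 2 * K.
  apply: tint_le_cst; first by apply: cintg_cont; apply: ccontM => //; exact: ccont_ex.
  move=> x _; rewrite normc_mul normc_ex mulr1; have [h3 h4] := syn_bound hs x X0 hr.
  exact: hK.
have b2 : normc ('i%C * pairing c (fun x => - (- k)%:~R ^+ 2 * ex (- k) x) r) <= 2 * (4 * evB * k%:~R ^+ 2).
  rewrite normc_mul normc_i mul1r; apply: tint_le_cst.
    apply: cintg_cont; apply: ccontM => //; apply: ccontM; first exact: ccont_cst.
    exact: ccont_ex.
  move=> x _; have [h3 _] := syn_bound hs x X0 hr.
  rewrite !normc_mul normc_ex mulr1 normc_opp normc_X normc_int mulrNz normrN real_normK ?num_real//.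
  by rewrite ler_wpM2r.
apply: (le_trans (lerD b1 b2)).
have h3 := mulr_ge0 (mulr_ge0 (ler0n R 2) K0) k2.
by move: h3 X0; move: (k%:~R ^+ 2) => z; lra.
Qed.

(** The frequencies are split at [m = N^2]. Below, about [2 m] modes move by [O(t m^3)] each,
    derivatives included, which sums to [O(t N^8)] and is [O(1 / N)] for the times allowed. Above,
    the H^s bound 1 on the difference gives tails of size [2 / m]. *)
Lemma freeze : exists2 C2, 1 <= C2 & forall (N : nat) t x, (0 < N)%N -> 0 <= t <= T1 -> t * N%:R ^+ 10 <= 1 ->
  normc (syn (c t) x - syn fc x) <= C2 / N%:R /\
  normc (syn (Dz (c t)) x - syn (Dz fc) x) <= C2 / N%:R.
Proof.
have [C1 C10 hC] := evol_lip; exists (4 * C1 + 2) => [|N t x N0 ht tN].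
  by have := C10; lra.
have [h1 h2] := hX ht; have /andP[t0 _] := ht.
have [U1 U2] := HB_ulim hs evB_gt0 h1; have [V1 V2] := HB_ulim hs B00 hB.
pose m := (N ^ 2)%N; have m0 : (0 < m)%N by rewrite expn_gt0 N0.
have Np : (1 : R) <= N%:R by rewrite ler1n.
have Ng : (0 : R) < N%:R by rewrite ltr0n.
have mR : (m%:R : R) = N%:R ^+ 2 by rewrite natrX.
have m1 : (1 : R) <= m%:R by rewrite ler1n.
have lo k : zin m k -> normc (c t k - fc k) <= C1 * t * (2 * m%:R ^+ 3) /\
    normc (Dz (fun k => c t k - fc k) k) <= C1 * t * (2 * m%:R ^+ 3).
  move=> mk; have k2 := @zin_sqr_le R _ _ mk.
  have k1 : normc (k%:~R : C) <= m%:R.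
    rewrite normc_int -(@ler_sqr R) ?nnegrE//.
    by rewrite real_normK ?num_real.
  have Ct : 0 <= C1 * t by rewrite mulr_ge0.
  have e1 : normc (c t k - fc k) <= C1 * t * (2 * m%:R ^+ 2).
    apply: le_trans (hC t k ht) _; rewrite ler_wpM2l//.
    have : 1 <= (m%:R : R) ^+ 2 by rewrite exprn_ege1.
    by move: k2; lra.
  have e2 : 2 * (m%:R : R) ^+ 3 = m%:R * (2 * m%:R ^+ 2) by rewrite exprS; ring.
  have M0 : 0 <= 2 * (m%:R : R) ^+ 2 by rewrite mulr_ge0 ?sqr_ge0.
  split.
    by apply: (le_trans e1); rewrite ler_wpM2l// e2 ler_peMl.
  rewrite /Dz !normc_mul normc_i mul1r e2 mulrCA.
  by apply: ler_pM; rewrite ?normc_ge0.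
have tail (g : int -> C) : (forall k, zin m k -> normc (g k) <= C1 * t * (2 * m%:R ^+ 3)) ->
    (forall m', zs m m' (normc \o g) <= 2 * 1 / m%:R) -> forall m', zs 0 m' (normc \o g) <= (4 * C1 + 2) / N%:R.
  move=> g1 g2 m'.
  have g0 k : 0 <= (normc \o g) k by exact: normc_ge0.
  apply: (@le_trans _ _ (zs 0 m (normc \o g) + zs m (maxn m m') (normc \o g))).
    by rewrite -zs_cat ?leq_maxl//; apply: zs_sub => //; exact: leq_maxr.
  rewrite mulrDl; apply: lerD.
    apply: (@le_trans _ _ (zs 0 m (fun=> C1 * t * (2 * m%:R ^+ 3)))); first exact: zs_le_in.
    rewrite /zs sumr_const_nat subn0 -[leLHS]mulr_natr.
    have -> : (C1 * t * (2 * m%:R ^+ 3) + C1 * t * (2 * m%:R ^+ 3)) * m%:R =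
      4 * C1 * (t * m%:R ^+ 4) by rewrite (exprSr _ 3); ring.
    rewrite ler_wpM2l ?mulr_ge0// mR -exprM.
    rewrite -[leRHS]mul1r ler_pdivlMr// -mulrA -exprSr.
    apply: le_trans tN; rewrite ler_wpM2l//.
    by rewrite [leRHS](exprSr _ 9) ler_peMr// exprn_ge0// ltW.
  apply: (le_trans (g2 _)); rewrite mulr1 ler_wpM2l// mR lef_pV2 ?posrE ?exprn_gt0//.
  by rewrite expr2 ler_peMr// ltW.
split.
  apply: (ulim_sup x (ulimB U1 V1)); apply: tail => [k /lo[]//|m'].
  exact: HB_l1 m' hs ltr01 m0 h2.
apply: (ulim_sup x (ulimB U2 V2)) => m'.
have := tail (Dz (fun k => c t k - fc k)) (fun k mk => (lo k mk).2) (fun m' => HB_l1_deriv m' hs ltr01 m0 h2) m'.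
by under [X in X <= _ -> _]eq_zs do rewrite /= /Dz mulrBr.
Qed.
End Short.
End Freeze.

Section OneScale.
Context {R : realType}.
Local Notation C := R[i].
Local Notation Re := (@complex.Re R).
Local Notation Im := (@complex.Im R).
Local Notation normc := (@ComplexField.Normc.normc R).

(** An exponential in [N] beats the power of [N] on the right, since the scale [N ^ 16] is itself a
    power of [N]. *)
Lemma exp_beats_dec (s L W : R) : 0 < L -> 0 <= W -> exists N0 : nat, forall N : nat, (N0 <= N)%N -> (0 < N)%N ->
  expR (- (L * N%:R)) * W <= (dec s (N ^ 16) / N%:R) ^+ 2.
Proof.
move=> L0 W0; pose J := (Num.truncn `|s|).+1.
(* The powers of [N] in the square of [(N^16)^J N], where [J] bounds [s]. The Taylor term of order
   [e + 1] leaves one power of [N] to absorb [W] and the factorial. *)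
pose e := (32 * J + 2)%N; pose Fa : R := (e.+1)`!%:R.
have F0 : 0 < Fa by rewrite ltr0n fact_gt0.
have Le : 0 < L ^+ e.+1 by rewrite exprn_gt0.
exists (Num.truncn (W * Fa / L ^+ e.+1)).+1 => N hN N0.
have Ng : (0 : R) < N%:R by rewrite ltr0n.
have N1 : (1 : R) <= N%:R by rewrite ler1n.
have h1 : W * Fa / L ^+ e.+1 <= N%:R.
  by apply: le_trans (ltW (truncnS_gt _)) _; rewrite ler_nat.
have h2 := expR_gt_pow e (ltW (mulr_gt0 L0 Ng)).
have h3 : W * N%:R ^+ e <= expR (L * N%:R).
  apply: le_trans h2; rewrite exprMn exprS.
  rewrite ler_pdivrMr// in h1; rewrite ler_pdivlMr//.
  have -> : W * N%:R ^+ e * Fa = W * Fa * N%:R ^+ e by ring.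
  have -> : L ^+ e.+1 * (N%:R * N%:R ^+ e) = N%:R * L ^+ e.+1 * N%:R ^+ e by ring.
  by rewrite ler_wpM2r// exprn_ge0// ltW.
have sJ : s <= J%:R by apply: le_trans (ler_norm _) _; exact/ltW/truncnS_gt.
have h4 : ((N ^ 16)%:R : R) `^ s <= N%:R ^+ (16 * J).
  rewrite exprM -natrX -powR_mulrn ?ler0n//; apply: ler_powR => //.
  by rewrite ler1n expn_gt0 N0.
have p0 : 0 < ((N ^ 16)%:R : R) `^ s by rewrite powR_gt0// ltr0n expn_gt0 N0.
rewrite expRN mulrC ler_pdivrMr ?expR_gt0// /dec -invfM exprVn.
rewrite mulrC ler_pdivlMr ?exprn_gt0 ?mulr_gt0//; apply: le_trans h3.
rewrite ler_wpM2l//; apply: (@le_trans _ _ ((N%:R ^+ (16 * J) * N%:R) ^+ 2)).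
  rewrite ler_sqr ?nnegrE ?mulr_ge0 ?exprn_ge0 ?(ltW p0) ?(ltW Ng)//.
  by rewrite ler_wpM2r// ltW.
rewrite -exprSr -exprM; have -> : ((16 * J).+1 * 2)%N = e by rewrite /e; lia.
exact: lexx.
Qed.


(** The arithmetic of one scale: [m] is the cutoff M, [be] is M^-s, [C2 / N] the distance to the
    data, [a] and [w] are the moduli of Y at times 0 and [tau], [b] that of the oscillating pairing
    at 0, and [r] is [1 / (2 |n|)]. The sum [a + r b] bounds the main pairing at time 0. *)
Lemma scale_arith (m be C2 N L Kc K3 ga tau W a b w r : R) :
  0 < m -> 0 < be -> 1 <= C2 -> 0 < N -> 0 < L -> 0 <= Kc -> 0 <= K3 -> 0 < tau ->
  m * L <= ga -> N <= m * tau -> 0 <= a -> 0 <= b -> 0 <= w <= W -> 0 <= r <= m^-1 ->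
  b <= K3 * (m * be * (C2 / N)) ->
  a ^+ 2 <= (Kc * (m * be * (C2 / N))) ^+ 2 / ga ^+ 2 + expR (- (ga * tau)) * w ^+ 2 ->
  expR (- (L * N)) * W ^+ 2 <= (be / N) ^+ 2 ->
  a + r * b <= (Kc * C2 / L + 1 + K3 * C2) * (be / N).
Proof.
move=> m0 be0 C21 N0 L0 Kc0 K30 tau0 gam Nm a0 b0 /andP[w0 wW] /andP[r0 rm] hb ha hW.
have C20 : 0 <= C2 by lra.
have mL0 : 0 < m * L by rewrite mulr_gt0.
have ga0 : 0 < ga := lt_le_trans mL0 gam.
have bN0 : 0 <= be / N by rewrite divr_ge0 ?ltW.
have KL0 : 0 <= Kc * C2 / L by rewrite divr_ge0 ?mulr_ge0 ?(ltW L0).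
have e0 : 0 <= m * be * (C2 / N).
  by rewrite mulr_ge0 ?divr_ge0 ?(ltW N0)// mulr_ge0 ?(ltW m0) ?(ltW be0).
have t1 : (Kc * (m * be * (C2 / N))) ^+ 2 / ga ^+ 2 <= (Kc * C2 / L * (be / N)) ^+ 2.
  rewrite -expr_div_n ler_sqr ?nnegrE; last 2 first.
  - by rewrite divr_ge0 ?(ltW ga0)// mulr_ge0.
  - by rewrite mulr_ge0.
  rewrite ler_pdivrMr//.
  have -> : Kc * (m * be * (C2 / N)) = Kc * C2 / L * (be / N) * (m * L).
    have -> : Kc * C2 / L * (be / N) * (m * L) = Kc * (m * be * (C2 / N)) * (L / L) by ring.
    by rewrite mulfV ?gt_eqF// mulr1.
  by rewrite ler_wpM2l// mulr_ge0.
have t2 : expR (- (ga * tau)) * w ^+ 2 <= (be / N) ^+ 2.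
  apply: le_trans hW; apply: ler_pM; rewrite ?expR_ge0 ?sqr_ge0//.
    rewrite ler_expR lerN2; apply: le_trans (ler_wpM2r (ltW tau0) gam).
    have -> : m * L * tau = L * (m * tau) by ring.
    by rewrite ler_wpM2l// ltW.
  by rewrite ler_sqr ?nnegrE// (le_trans w0).
have t3 : a <= (Kc * C2 / L + 1) * (be / N).
  rewrite -ler_sqr ?nnegrE//; last by rewrite mulr_ge0 ?addr_ge0.
  apply: (le_trans ha); apply: le_trans (lerD t1 t2) _.
  move: (Kc * C2 / L) (be / N) KL0 => k u k0.
  have -> : ((k + 1) * u) ^+ 2 = (k * u) ^+ 2 + u ^+ 2 + 2 * k * u ^+ 2 by ring.
  by rewrite lerDl; exact: mulr_ge0 (mulr_ge0 (ler0n _ 2) k0) (sqr_ge0 u).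
rewrite [leRHS]mulrDl; apply: lerD => //.
apply: (@le_trans _ _ (m^-1 * (K3 * (m * be * (C2 / N))))); first exact: ler_pM.
have -> : m^-1 * (K3 * (m * be * (C2 / N))) = K3 * C2 * (be / N) * (m / m) by ring.
by rewrite mulfV ?gt_eqF// mulr1.
Qed.

Context (s : R) (hs : 5 / 2 < s) (p : @pexp R) (d : nat).
Context (hd : forall M f g, trig M f -> trig M g -> trig (d * M) (fun x => pv p (f x) (g x))).
Context (fc : int -> C) (B0 : R) (B00 : 0 < B0) (hB : HB s B0 fc).
Let phi := syn fc.
Let phi1 := syn (Dz fc).
Let A x := Fd p 1%R (phi x) (phi1 x).
Let Bf x := Fd p 3%R (phi x) (phi1 x).
Context (A' Bf' : R -> C) (hA : isd A A') (cA' : ccont A') (hBf : isd Bf Bf') (cB' : ccont Bf').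
Context (lam : C) (G G' G'' : R -> C) (hG : isd G G') (hG' : isd G' G'') (cG'' : ccont G'')
  (pG : periodic2pi G) (GE : forall x, G' x = 'i%C / 2 * (A x - lam) * G x).
Context (sg T : R) (T0 : 0 < T) (sg2 : sg * sg = 1) (c : R -> int -> C)
  (hev : evol p s sg T phi c).

(** The constants of the error estimates, the time [T1] and the freezing constant are all fixed
    before [N] and [n]; this uniformity is what makes [Kf] independent of the scale. The sign
    condition on [n] selects the frequency that grows along the evolution. *)
Lemma one_scale : Im lam != 0 -> exists2 Kf, 0 <= Kf & exists N0 : nat, forall (N : nat) (n : int),
  (N0 <= N)%N -> (0 < N)%N -> `|n|%N = ((d + 3) * N ^ 16)%N -> 0 < - (sg * n%:~R * Im lam) ->
  normc (tint (fun x => phi x * (Tz 0 (N ^ 16) (fourier G) x * ex (- n) x))) <=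
  Kf * (dec s (N ^ 16) / N%:R).
Proof.
move=> lam0; have [U V] := HB_ulim hs B00 hB.
have cphi := ulim_ccont U; have cphi1 := ulim_ccont V.
have pphi := ulim_periodic U; have pphi1 := ulim_periodic V.
have pA : periodic2pi A by move=> x; rewrite /A /phi /phi1 pphi pphi1.
have pB : periodic2pi Bf by move=> x; rewrite /Bf /phi /phi1 pphi pphi1.
have X0 := evB_gt0 B00; have [hc ode] := hev.
have hK := isdM hBf hG; have cB := isd_ccont hBf; have cG' := isd_ccont hG'.
have cG := isd_ccont hG.
have cK' : ccont (fun x => Bf' x * G x + Bf x * G' x) by cc.
have pK : periodic2pi (fun x => Bf x * G x) by exact: periodicM pB pG.
pose K x := Bf x * G x.
have [K1 K10 S1] := gauged_pairing hd hs X0 cphi cphi1 hG hG' cG'' pG hA cA' pA (fun=> erefl) hBf cB' pB GE.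
have [K2 K20 S2] := conj_pairing hd hs X0 phi phi1 hK cK' pK.
have [K3 K30 S3] := conj_pairing_small d hs X0 phi phi1 hK cK' pK.
have [_ [K4 K40 S4]] := Supb_gauge_test d s (evB B0) phi phi1 hG hG' pG.
have [_ [K5 K50 S5]] := Supb_conj_test d s (evB B0) phi phi1 hK cK' pK.
have [T1 hT1 hX] := evol_uniform hs T0 B00 hB hev.
have [C2 C21 hfr] := freeze hs sg2 B00 hB hev hT1 hX.
pose L := `|Im lam|; have L0 : 0 < L by rewrite normr_gt0.
pose W := 2 * (4 * evB B0 * K4) + 2 * (4 * evB B0 * K5).
pose Kc := K1 + K2 + normc lam * K3.
have Kc0 : 0 <= Kc by rewrite !addr_ge0// mulr_ge0 ?normc_ge0.
have [Ne hNe] := exp_beats_dec s L0 (sqr_ge0 W).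
exists (Kc * C2 / L + 1 + K3 * C2).
  by rewrite !addr_ge0 ?divr_ge0 ?mulr_ge0 ?(ltW L0)//; lra.
have /andP[T10 _] := hT1.
(* Three thresholds: for the exponential to win, for [tau <= T1], and for the distance [C2 / N] to
   be at most 1. *)
exists (Ne + (Num.truncn T1^-1).+1 + (Num.truncn C2).+1)%N => N n hN N0 hn hga.
have NeN : (Ne <= N)%N := leq_trans (leq_trans (leq_addr _ _) (leq_addr _ _)) hN.
have NT : T1^-1 <= N%:R.
  apply: le_trans (ltW (truncnS_gt _)) _; rewrite ler_nat.
  exact: leq_trans (leq_trans (leq_addl _ _) (leq_addr _ _)) hN.
have NC : C2 <= N%:R.
  apply: le_trans (ltW (truncnS_gt _)) _; rewrite ler_nat.
  exact: leq_trans (leq_addl _ _) hN.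
have N1 : (1 : R) <= N%:R by rewrite ler1n.
have Ng : (0 : R) < N%:R by rewrite ltr0n.
(* The time is [N^(-10)]: short enough to freeze the coefficients, long enough that
   [N^16 tau = N^6 >= N]. *)
have [tau [tau0 tauT tauN tauM]] : exists tau : R, [/\ 0 < tau, tau <= T1,
    forall t, t <= tau -> t * N%:R ^+ 10 <= 1 & N%:R <= (N ^ 16)%:R * tau].
  have p10 : 0 < N%:R ^+ 10 :> R by rewrite exprn_gt0.
  exists (N%:R ^+ 10)^-1; rewrite invr_gt0 p10; split=> //.
  - rewrite -[T1]invrK lef_pV2 ?posrE ?invr_gt0//; apply: (le_trans NT).
    by rewrite exprS ler_peMr ?exprn_ege1// ltW.
  - by move=> t; rewrite -ler_pdivlMr// mul1r.
  - rewrite natrX ler_pdivlMr// -exprS; exact: ler_weXn2l.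
have NM : N%:R <= (N ^ 16)%:R :> R by rewrite ler_nat -[X in (X <= _)%N]expn1 leq_pexp2l.
have M0 : (0 < N ^ 16)%N by rewrite expn_gt0 N0.
have hN' := hNe N NeN N0.
move: (N ^ 16)%N hn tauM NM M0 hN' => M hn tauM NM M0 hN'.
pose m : R := M%:R; have m0 : 0 < m by rewrite ltr0n.
pose be := dec s M; have be0 : 0 < be by exact: dec_gt0.
pose dl := C2 / N%:R; have dl0 : 0 < dl by rewrite divr_gt0//; lra.
have nE : `|n%:~R| = (d + 3)%:R * m :> R.
  by rewrite -intr_norm -natr_absz hn natrM.
have n0 : (n%:~R : R) != 0.
  by rewrite -normr_gt0 nE mulr_gt0// ltr0n addn3.
have nm : m <= `|n%:~R|.
  by rewrite nE ler_peMl ?(ltW m0)// ler1n addn3.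
(* Each time in [[0, tau]] gives one configuration, with the same cutoff and frequency. *)
pose q t := Cfg M n (c t) dl.
have m1dl : m^-1 <= dl.
  apply: (@le_trans _ _ N%:R^-1); first by rewrite lef_pV2.
  by rewrite /dl ler_peMl// invr_ge0 ltW.
have vq t : 0 <= t <= tau -> valid d s (evB B0) phi phi1 (q t).
  move=> /andP[t0 tt]; have tT1 : 0 <= t <= T1 by rewrite t0 (le_trans tt).
  have [h1 h2] := hX t tT1; split=> //=.
    by rewrite m1dl/= ler_pdivrMr// mul1r.
  by move=> x; apply: hfr => //; exact: tauN.
pose e1 := m * be * dl; have e10 : 0 <= e1 := mulr_ge0 (mulr_ge0 (ltW m0) (ltW be0)) (ltW dl0).
have nC : (n%:~R : R)%:C = n%:~R :> C by rewrite -(rmorph_int (real_complex R)).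
have bel : be <= e1.
  rewrite /e1 mulrAC -[leLHS]mul1r ler_wpM2r ?(ltW be0)//.
  by rewrite mulrC -ler_pdivrMr// mul1r.
have e2n : K2 * (m * be) / `|2 * n%:~R| <= K2 * e1.
  rewrite -mulrA ler_wpM2l//; apply: le_trans bel.
  rewrite ler_pdivrMr ?normr_gt0 ?mulf_neq0// mulrC ler_wpM2l ?(ltW be0)//.
  by rewrite normrM ger0_norm//; apply: (le_trans nm); rewrite ler_peMl// ler1n.
have hE : K1 * e1 + K2 * (m * be) / `|2 * n%:~R| + normc lam * (K3 * e1) <= Kc * e1.
  have -> : Kc * e1 = K1 * e1 + K2 * e1 + normc lam * (K3 * e1) by rewrite /Kc; ring.
  by rewrite lerD2r lerD2l.
have sg1 : `|sg| = 1.
  have : `|sg| ^+ 2 = 1 by rewrite -normrX expr2 sg2 normr1.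
  by move=> /eqP; rewrite sqrf_eq1 => /orP[/eqP//|/eqP e]; have := normr_ge0 sg; rewrite e; lra.
have gaE : - (sg * n%:~R * Im lam) = (d + 3)%:R * m * L.
  by rewrite -[LHS]gtr0_norm// normrN !normrM sg1 mul1r nE.
have gam : m * L <= (d + 3)%:R * m * L.
  by rewrite -mulrA ler_peMl ?mulr_ge0 ?(ltW m0) ?(ltW L0)// ler1n addn3.
have mL0 : 0 < m * L by rewrite mulr_gt0.
have r1 : normc ((2 * n%:~R)^-1%:C : C) <= m^-1.
  rewrite normc_real normfV lef_pV2 ?posrE ?normr_gt0 ?mulf_neq0//.
  by rewrite normrM ger0_norm//; apply: (le_trans nm); rewrite ler_peMl// ler1n.
have m1 : m^-1 <= 1 by rewrite invf_le1// ler1n.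
have tt : 0 <= tau <= tau by rewrite (ltW tau0) lexx.
have z0 : 0 <= (0 : R) <= tau by rewrite lexx ltW.
(* The test functions depend on a configuration only through its cutoff and frequency, so those of
   [q0] serve for all times. *)
pose q0 := Cfg M n fc dl; pose P0 := gauge_test G q0; pose P20 := gauge_test2 G q0.
pose Q0 := conj_test K q0; pose Q20 := conj_test2 K q0.
have [dP1 dP2] := isd_gauge_test G q0; have tP := trig_gauge_test G q0.
have [dQ1 dQ2] := isd_conj_test K q0; have tQ := trig_conj_test K q0.
have [y0 cy dy] := ode _ _ _ _ tP dP1 dP2.
have [x0 cx dx] := ode _ _ _ _ tQ dQ1 dQ2.
pose y := pairing c P0; pose x := pairing c Q0.
pose Y t := y t + (2 * n%:~R)^-1%:C * ((x t)^*)%C.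
pose Dy t := pv_pairing p c P0 t - 'i%C * pairing c P20 t.
pose Dx t := pv_pairing p c Q0 t - 'i%C * pairing c Q20 t.
have bnds t : 0 <= t <= tau ->
    [/\ normc (Dy t - ('i%C * ((n%:~R : R)%:C ^+ 2 + lam * (n%:~R : R)%:C) * y t +
          'i%C * (n%:~R : R)%:C * ((x t)^*)%C)) <= K1 * e1,
        normc (Dx t - 'i%C * (n%:~R : R)%:C ^+ 2 * x t) <= K2 * (m * be) & normc (x t) <= K3 * e1].
  move=> ht; have vt := vq t ht; rewrite nC.
  have cst := ccont_state hs X0 vt.
  have xJ : ((x t)^*)%C = tint (fun z => ((syn (c t) z)^*)%C *
      (Tz 0 M (fourier (fun z => Bf z * G z)) z * ex (- n) z)).
    rewrite /x /pairing -tintJ; last exact/cintg_cont/ccontM/(trig_ccont tQ).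
    apply: eq_tint => z _; rewrite conjcM /Q0 /conj_test conjcM exJ /=; congr (_ * (_ * _)).
    exact: conjcK.
  have h1 : normc (- 'i%C * pairing c P20 t + pv_pairing p c P0 t -
      ('i%C * (n%:~R ^+ 2 + lam * n%:~R) * y t + 'i%C * n%:~R *
       tint (fun z => ((syn (c t) z)^*)%C * (Tz 0 M (fourier (fun z => Bf z * G z)) z * ex (- n) z))))
      <= K1 * e1 := S1 _ vt.
  have h2 : normc (- 'i%C * pairing c Q20 t + pv_pairing p c Q0 t - 'i%C * n%:~R ^+ 2 * x t)
      <= K2 * (m * be) := S2 _ vt.
  have h3 : normc (x t) <= K3 * e1 := S3 _ vt.
  rewrite -xJ mulNr in h1; rewrite mulNr in h2; split; last exact: h3.
    by rewrite /Dy [X in X - _]addrC; exact: h1.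
  by rewrite /Dx [X in X - _]addrC; exact: h2.
have key : normc (Y 0) ^+ 2 <= (Kc * e1) ^+ 2 / (- (sg * n%:~R * Im lam)) ^+ 2 +
    expR (- (- (sg * n%:~R * Im lam) * tau)) * normc (Y tau) ^+ 2.
  apply: (coupled_energy sg2 n0 (erefl _) hga tau0 cy cx _ hE (fun=> erefl) (Dy := Dy) (Dx := Dx)).
  move=> t /andP[t0 ttau]; have tT : 0 < t < T.
    rewrite t0/=; case/andP: hT1 => _; apply: le_lt_trans; exact: le_trans (ltW ttau) tauT.
  have ht : 0 <= t <= tau by rewrite (ltW t0) (ltW ttau).
  have [b1 b2 b3] := bnds t ht.
  by split; [exact: dy|exact: dx|exact: b1|exact: b2|exact: b3].
have bP t (Q : R -> C) k : 0 <= k -> 0 <= t <= tau -> ccont Q -> (forall z, period z -> normc (Q z) <= k) ->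
    normc (pairing c Q t) <= 2 * (4 * evB B0 * k).
  move=> k0 ht cQ hQ; have vt := vq t ht; apply: tint_le_cst.
    exact/cintg_cont/ccontM/cQ/(ccont_state hs X0 vt).
  move=> z pz; rewrite normc_mul; have [b1 _ _ _] := sup_bounds hs X0 z vt.
  by apply: ler_pM; [exact: normc_ge0|exact: normc_ge0|exact: b1|exact: hQ].
(* A crude bound of Y at the final time, uniform in the scale, is enough against the exponential
   factor. *)
have Wy : normc (Y tau) <= W.
  apply: le_trans (normc_add _ _) _; apply: lerD.
    apply: (bP _ _ _ (ltW K40) tt (trig_ccont tP)).
    by move=> z pz; have := S4 _ (vq _ tt) z pz; rewrite mulr1.
  rewrite normc_mul normc_conj -[leRHS]mul1r.
  apply: ler_pM; [exact: normc_ge0|exact: normc_ge0|exact: le_trans r1 m1|].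
  apply: (bP _ _ _ (ltW K50) tt (trig_ccont tQ)).
  by move=> z pz; have := S5 _ (vq _ tt) z pz; rewrite mulr1.
have y0E : tint (fun z => phi z * (Tz 0 M (fourier G) z * ex (- n) z)) = y 0.
  exact: esym y0.
have [_ _ b3] := bnds 0 z0.
rewrite y0E -[y 0](addrK ((2 * n%:~R)^-1%:C * ((x 0)^*)%C)) -/(Y 0).
apply: le_trans (normc_sub _ _) _; rewrite normc_mul normc_conj.
rewrite gaE in key.
apply: (scale_arith m0 be0 C21 Ng L0 Kc0 K30 tau0 gam tauM (normc_ge0 _) (normc_ge0 _) _ _ b3 key hN').
  by rewrite normc_ge0.
by rewrite normc_ge0.
Qed.
End OneScale.

(** * Lacunary initial data *)

Section LacunarySums.
Context {R : realType}.
Local Notation C := R[i].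
Local Notation normc := (@ComplexField.Normc.normc R).

(** The tails are majorized by the supremum of the partial sums of moduli minus the current one; no
    rate of decay is involved. *)
Lemma bounded_ulim_syn (c : int -> C) (K : R) :
  (forall m, zs 0 m (normc \o c) <= K) -> ulim (syn c) c.
Proof.
move=> hK; have g0 k : 0 <= (normc \o c) k by exact: normc_ge0.
pose E := [set zs 0 m (normc \o c) | m in [set: nat]].
have Esup : has_sup E.
  split; first by exists (zs 0 0 (normc \o c)); exists 0%N.
  by exists K => _ [m _ <-].
apply: (@ulim_syn _ _ (fun m => sup E - zs 0 m (normc \o c))).
  move=> e e0; have [_ [M _ <-] hM] := sup_adherent e0 Esup.
  exists M => m Mm; have := zs_sub g0 (leqnn 0) Mm; lra.
move=> m m' mm'; rewrite lerBrDl -zs_cat//; apply: ub_le_sup; first by case: Esup.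
by exists m'.
Qed.

Lemma sum_halves (K : R) n : 0 <= K -> \sum_(0 <= i < n) K / 2 ^+ i <= 2 * K.
Proof.
move=> K0; have -> : \sum_(0 <= i < n) K / 2 ^+ i = 2 * K - 2 * K / 2 ^+ n.
  elim: n => [|n IH]; first by rewrite big_geq// expr0 divr1 subrr.
  rewrite big_nat_recr//= IH exprS invfM.
  have -> : 2 * K * (2^-1 * (2 ^+ n)^-1) = (2 * 2^-1) * (K / 2 ^+ n) by ring.
  by rewrite mulfV ?pnatr_eq0// mul1r; ring.
by rewrite gerBl divr_ge0// mulr_ge0.
Qed.

Context (f : nat -> nat) (finc : forall i, (f i < f i.+1)%N).

Lemma lac_le i : (i <= f i)%N.
Proof. by elim: i => // i IH; exact: leq_ltn_trans (finc i). Qed.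
Lemma lac_mono i j : (i < j)%N -> (f i < f j)%N.
Proof.
elim: j => // j IH; rewrite ltnS leq_eqVlt => /predU1P[->//|/IH h].
exact: ltn_trans h (finc j).
Qed.
Lemma lac_inj : injective f.
Proof.
move=> i j e; case: (ltngtP i j) => // /lac_mono; by rewrite e ltnn.
Qed.

(** The sequence with value [h i] at position [f i] and 0 elsewhere. Summing over [i <= j] reaches
    every index that matters because [i <= f i]. *)
Definition lacseq (h : nat -> R) (j : nat) : R :=
  \sum_(0 <= i < j.+1) (if f i == j then h i else 0).

Lemma lacseqE h i : lacseq h (f i) = h i.
Proof.
rewrite /lacseq (bigD1_seq i) ?mem_index_iota ?iota_uniq//= ?ltnS ?lac_le// eqxx.
rewrite big1 ?addr0// => j ji; case: eqP => // /lac_inj e.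
by rewrite e eqxx in ji.
Qed.
Lemma lacseq0 h j : (forall i, f i <> j) -> lacseq h j = 0.
Proof. by move=> H; rewrite /lacseq big1// => i _; case: eqP => // /H. Qed.
Lemma lacP j : (exists i, j = f i) \/ (forall i, f i <> j).
Proof.
have [[i ->]|h] := pselect (exists i, j = f i); first by left; exists i.
by right => i e; apply: h; exists i.
Qed.

Lemma sum_lacseq h m : (forall i, 0 <= h i) ->
  \sum_(0 <= j < m) lacseq h j <= \sum_(0 <= i < m) h i.
Proof.
move=> h0; apply: (@le_trans _ _ (\sum_(0 <= j < m) \sum_(0 <= i < m) (if f i == j then h i else 0))).
  rewrite big_nat_cond [leRHS]big_nat_cond; apply: ler_sum => j /andP[/andP[_ jm] _].
  rewrite /lacseq [leRHS](big_cat_nat (n := j.+1))//= lerDl sumr_ge0// => i _.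
  by case: ifP.
rewrite exchange_big_nat/=; apply: ler_sum => i _; rewrite -big_mkcond/=.
under eq_bigl do rewrite eq_sym.
by rewrite big_nat1_eq; case: ifP.
Qed.

Lemma zs_lacseq h m K : (forall i, 0 <= h i) -> (forall n, \sum_(0 <= i < n) h i <= K) ->
  zs 0 m (fun k => lacseq h `|k|) <= 2 * K.
Proof.
move=> h0 hK; have l0 j : 0 <= lacseq h j by apply: sumr_ge0 => i _; case: ifP.
rewrite /zs big_split/= (_ : 2 * K = K + K); last by ring.
apply: lerD; first exact: le_trans (sum_lacseq _ h0) (hK _).
apply: le_trans (hK m.+1); apply: le_trans (sum_lacseq _ h0).
by rewrite [leRHS]big_nat_recl//= lerDr.
Qed.
End LacunarySums.

Section Spikes.
Local Open Scope nat_scope.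

Definition scale (i : nat) : nat := (4 ^ i) ^ 16.
Lemma scale_gt0 i : 0 < scale i.
Proof. by rewrite !expn_gt0. Qed.
Lemma scaleS i : 4 * scale i <= scale i.+1.
Proof. by rewrite /scale -!expnM -expnS leq_exp2l// mulSn; lia. Qed.
Lemma scale_mono i j : i < j -> 4 * scale i <= scale j.
Proof.
elim: j => // j IH; rewrite ltnS leq_eqVlt => /predU1P[->|/IH h]; first exact: scaleS.
by apply: (leq_trans h); apply: leq_trans (scaleS j); rewrite leq_pmull.
Qed.

Definition spike (D i : nat) : nat := D * scale i.
Lemma spike_lt D : 0 < D -> forall i, spike D i < spike D i.+1.
Proof.
move=> D0 i; rewrite /spike ltn_mul2l D0/=; apply: leq_trans (scaleS i).
by have := scale_gt0 i; lia.
Qed.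

(** Spikes grow at least by a factor 4 while the window around spike [i] has radius [scale i]. With
    [D >= 3], [D / 4 < D - 1] excludes the spikes below and [D + 1 < 4 D] those above. *)
Lemma off_spike (D i z n : nat) : 3 <= D -> D * scale i <= z + scale i ->
  z <= D * scale i + scale i -> z <> D * scale i -> spike D n <> z.
Proof.
move=> D3 h1 h2 h3 e; rewrite /spike in e; have s0 := scale_gt0 i.
case: (ltngtP n i) => ni; last by rewrite ni in e; apply: h3.
  have h4 := scale_mono ni.
  have : D * (4 * scale n) <= D * scale i by rewrite leq_mul2l h4 orbT.
  by rewrite mulnCA e; move: (D * scale i) (scale i) s0 h1 h2 (leq_mul2r (scale i) 3 D) => A B; rewrite D3; lia.
have h4 := scale_mono ni.
have : D * (4 * scale i) <= D * scale n by rewrite leq_mul2l h4 orbT.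
by rewrite mulnCA e; move: (D * scale i) (scale i) s0 h1 h2 (leq_mul2r (scale i) 3 D) => A B; rewrite D3; lia.
Qed.
End Spikes.

Section LacunaryCoefficients.
Context {R : realType}.
Local Notation C := R[i].
Local Notation normc := (@ComplexField.Normc.normc R).
Context (s : R) (hs : 5 / 2 < s) (D : nat) (D0 : (0 < D)%N).

Definition lac (k : int) : C :=
  (lacseq (spike D) (fun i => dec s (scale i) / 2 ^+ i) `|k|)%:C.

Let h0 i : 0 <= dec s (scale i) / 2 ^+ i.
Proof. by rewrite divr_ge0 ?exprn_ge0// ltW// dec_gt0// scale_gt0. Qed.

Lemma lac_spike (k : int) i : `|k|%N = spike D i -> lac k = (dec s (scale i) / 2 ^+ i)%:C.
Proof. by move=> e; rewrite /lac e lacseqE//; exact: spike_lt D0. Qed.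
Lemma lac_eq0 (k : int) : (forall i, spike D i <> `|k|%N) -> lac k = 0.
Proof. by move=> e; rewrite /lac lacseq0. Qed.
Lemma normc_lac k : normc (lac k) = lacseq (spike D) (fun i => dec s (scale i) / 2 ^+ i) `|k|.
Proof.
rewrite /lac normc_real ger0_norm//; by apply: sumr_ge0 => i _; case: ifP.
Qed.

Lemma int_spike (k : int) i : `|k|%N = spike D i -> (k%:~R : R) ^+ 2 = (D%:R * (scale i)%:R) ^+ 2.
Proof.
move=> e; rewrite -real_normK ?num_real// -intr_norm -natr_absz e.
by rewrite /spike natrM.
Qed.

(** At spike [i] the H^s weight is at most [Cw] times [M^(2 s)], which the squared factor [dec]
    cancels exactly; what remains is [4^-i], bounded by [2^-i]. *)
Lemma HB_lac : exists2 B, 0 < B & HB s B lac.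
Proof.
pose Cw := (1 + D%:R ^+ 2 : R) `^ s; have Cw0 : 0 <= Cw by exact: powR_ge0.
exists (Num.sqrt (4 * Cw) + 1); first by rewrite ltr_wpDl ?sqrtr_ge0.
move=> m; apply: (@le_trans _ _ (2 * (2 * Cw))); last first.
  have -> : 2 * (2 * Cw) = 4 * Cw by ring.
  by apply: le_sqr_sqrt => //; exact: mulr_ge0.
apply: (@le_trans _ _ (zs 0 m (fun k => lacseq (spike D) (fun i => Cw / 2 ^+ i) `|k|))); last first.
  apply: zs_lacseq => [i|n]; last exact: sum_halves.
  by rewrite divr_ge0 ?exprn_ge0.
apply: zs_le => k _; rewrite normc_lac.
have [[i e]|e] := lacP (spike D) `|k|; last first.
  by rewrite !lacseq0// expr0n/= mulr0.
rewrite e !lacseqE; [|exact: spike_lt D0|exact: spike_lt D0].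
have M1 : 1 <= (scale i)%:R :> R by rewrite ler1n scale_gt0.
have M0 : 0 <= (scale i)%:R :> R by [].
have w1 : wt s k <= Cw * ((scale i)%:R `^ s) ^+ 2.
  have D1 : 0 <= 1 + D%:R ^+ 2 :> R by rewrite addr_ge0 ?sqr_ge0.
  rewrite /wt (int_spike e) -powR_sqr// -(powRM _ D1 (sqr_ge0 _)).
  apply: powR_mono; first by move: hs; lra.
    by rewrite addr_ge0 ?sqr_ge0.
  by rewrite mulrDl mul1r exprMn lerD2r exprn_ege1.
have p0 : 0 < (scale i)%:R `^ s :> R by rewrite powR_gt0// ltr0n scale_gt0.
rewrite exprMn; apply: (@le_trans _ _ (Cw * ((scale i)%:R `^ s) ^+ 2 * (dec s (scale i) ^+ 2 * (2 ^+ i)^-1 ^+ 2))).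
  by rewrite ler_wpM2r// mulr_ge0 ?sqr_ge0.
have -> : Cw * ((scale i)%:R `^ s) ^+ 2 * (dec s (scale i) ^+ 2 * (2 ^+ i)^-1 ^+ 2) =
   Cw * ((scale i)%:R `^ s * dec s (scale i)) ^+ 2 * (2 ^+ i)^-1 ^+ 2 by ring.
rewrite /dec mulfV ?gt_eqF// expr1n mulr1 ler_wpM2l// expr2 ler_piMr ?invr_ge0 ?exprn_ge0//.
by rewrite invf_le1 ?exprn_gt0// exprn_ege1// ler1n.
Qed.

(** Since [s > 2], a multiplier of size up to [k^2 = (D M)^2] is absorbed by [M^-s], and the factors
    [2^-i] make the sum finite. Hence the series is twice continuously differentiable. *)
Lemma sum_lac : exists2 K, 0 < K & forall m, [/\ zs 0 m (normc \o lac) <= K,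
  zs 0 m (normc \o Dz lac) <= K & zs 0 m (normc \o Dz (Dz lac)) <= K].
Proof.
pose D2 : R := D%:R ^+ 2; have D20 : 0 <= D2 by exact: sqr_ge0.
exists (2 * (2 * D2)) => [|m]; first by apply: mulr_gt0 => //; apply: mulr_gt0 => //; rewrite exprn_gt0// ltr0n.
have key (r : R -> R) : (forall x, 1 <= x -> 0 <= r x <= x ^+ 2) ->
    zs 0 m (fun k => r `|k%:~R| * normc (lac k)) <= 2 * (2 * D2).
  move=> hr; apply: (@le_trans _ _ (zs 0 m (fun k => lacseq (spike D) (fun i => D2 / 2 ^+ i) `|k|))); last first.
    apply: zs_lacseq => [i|n]; last exact: sum_halves.
    by rewrite divr_ge0 ?exprn_ge0.
  apply: zs_le => k _; rewrite normc_lac.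
  have [[i e]|e] := lacP (spike D) `|k|; last by rewrite !lacseq0// mulr0.
  rewrite e !lacseqE; [|exact: spike_lt D0|exact: spike_lt D0].
  have k1 : 1 <= `|k%:~R| :> R.
    by rewrite -intr_norm -natr_absz e ler1n muln_gt0 D0 scale_gt0.
  have /andP[r0 r1] := hr _ k1.
  have M1 : 1 <= (scale i)%:R :> R by rewrite ler1n scale_gt0.
  have p0 : 0 < (scale i)%:R `^ s :> R by rewrite powR_gt0// ltr0n scale_gt0.
  have M2 : (scale i)%:R ^+ 2 <= (scale i)%:R `^ s :> R.
    by rewrite -powR_mulrn//; apply: ler_powR => //; move: hs; lra.
  rewrite mulrA ler_wpM2r ?invr_ge0 ?exprn_ge0// /dec ler_pdivrMr//.
  apply: (le_trans r1); rewrite real_normK ?num_real// (int_spike e) exprMn.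
  by rewrite ler_wpM2l.
split.
- apply: le_trans (key (fun=> 1) _); last by move=> x x1; rewrite ler01/= exprn_ege1.
  by apply: zs_le => k _ /=; rewrite mul1r.
- apply: le_trans (key id _); last by move=> x x1 /=; rewrite expr2 ler_peMr// (le_trans ler01).
  by apply: zs_le => k _ /=; rewrite normc_Dz.
- apply: le_trans (key (fun x => x ^+ 2) _); last by move=> x x1; rewrite sqr_ge0 lexx.
  by apply: zs_le => k _ /=; rewrite !normc_Dz mulrA -expr2.
Qed.
End LacunaryCoefficients.

Section Data.
Context {R : realType}.
Local Notation C := R[i].
Local Notation Re := (@complex.Re R).
Local Notation Im := (@complex.Im R).
Local Notation normc := (@ComplexField.Normc.normc R).
Local Notation mu := (@lebesgue_measure R).

Lemma zs_head (m0 m : nat) (g : int -> R) : (forall k, 0 <= g k) ->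
  zs 0 m (fun k => if zin m0 k then g k else 0) <= zs 0 m0 g.
Proof.
move=> g0; set g' := fun k => _; have g0' k : 0 <= g' k by rewrite /g'; case: ifP.
apply: (@le_trans _ _ (zs 0 (maxn m0 m) g')); first by apply: zs_sub => //; exact: leq_maxr.
rewrite (@zs_cat _ 0 m0 (maxn m0 m)) ?leq_maxl//.
rewrite -[leRHS]addr0; apply: lerD.
  by apply: zs_le_in => k zk; rewrite /g' zk.
apply: (@le_trans _ _ (zs m0 (maxn m0 m) (fun=> 0))).
  by apply: zs_le => k zk; rewrite /g' (negbTE zk).
by rewrite /zs big1// => j _; rewrite addr0.
Qed.
Lemma zs_tail (m0 m : nat) (g : int -> R) : (forall k, 0 <= g k) ->
  zs 0 m (fun k => if zin m0 k then 0 else g k) <= zs m0 (maxn m0 m) g.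
Proof.
move=> g0; set g' := fun k => _; have g0' k : 0 <= g' k by rewrite /g'; case: ifP.
apply: (@le_trans _ _ (zs 0 (maxn m0 m) g')); first by apply: zs_sub => //; exact: leq_maxr.
rewrite (@zs_cat _ 0 m0 (maxn m0 m)) ?leq_maxl//.
rewrite -[leRHS]add0r; apply: lerD; last by apply: zs_le => k zk; rewrite /g' (negbTE zk).
apply: (@le_trans _ _ (zs 0 m0 (fun=> 0))).
  by apply: zs_le_in => k zk; rewrite /g' zk.
by rewrite /zs big1// => j _; rewrite addr0.
Qed.

Lemma cmeas_Fd (p : @pexp R) i (u w : R -> C) : cmeas u -> cmeas w -> cmeas (fun x => Fd p i (u x) (w x)).
Proof.
move=> hu hw; apply: (@ev_vec_closed R cmeas u w) => //.
- by move=> c; exact/cmeas_cont/ccont_cst.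
- exact: cmeasJ.
- exact: cmeasD.
- exact: cmeasM.
Qed.
Lemma isd_Fd (p : @pexp R) i (u w u' w' : R -> C) : isd u u' -> ccont u' -> isd w w' -> ccont w' ->
  exists2 g, isd (fun x => Fd p i (u x) (w x)) g & ccont g.
Proof.
move=> hu cu hw cw; apply: (@ev_vec_closed R (fun f => exists2 g, isd f g & ccont g) u w).
- by move=> c; exists (fun=> 0); [exact: isd_cst|exact: ccont_cst].
- by exists u'.
- by exists w'.
- by move=> f [g hg cg]; exists (fun x => ((g x)^*)%C); [exact: isdJ|exact: ccontJ].
- by move=> f f' [g hg cg] [g' hg' cg']; exists (fun x => g x + g' x); [exact: isdD|exact: ccontD].
- move=> f f' [g hg cg] [g' hg' cg']; exists (fun x => g x * f' x + f x * g' x); first exact: isdM.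
  have ? := isd_ccont hg; have ? := isd_ccont hg'.
  by apply: ccontD; exact: ccontM.
Qed.

Context (s : R) (hs : 5 / 2 < s).

Lemma rtint_F_beta (F : mpoly.mpoly 4 C) (p : @pexp R) (psi : R -> C) :
  (forall v, mpoly.meval v F = ev p v) -> Hs s psi ->
  rtint (fun x => Im (F_beta F (psi x) (dx psi x))) =
  Im (tint (fun x => Fd p 1%R (syn (fourier psi) x) (syn (Dz (fourier psi)) x))).
Proof.
move=> pE hf; have B0 : 0 < Hs_norm s psi + 1 by rewrite ltr_wpDl ?sqrtr_ge0.
have hB : HB s (Hs_norm s psi + 1) (fourier psi) by apply: Hs_HB hf _; rewrite lerDl.
have [U U'] := HB_ulim hs B0 hB; have aeF := ae_filter_ringOfSetsType mu.
have e : tint (fun x => Fd p 1%R (psi x) (dx psi x)) =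
    tint (fun x => Fd p 1%R (syn (fourier psi) x) (syn (Dz (fourier psi)) x)).
  apply: tint_ae.
  - by apply: cmeas_Fd; [exact: L2T_cmeas hf.1|exact: L2T_cmeas (dx_L2T hs B0 hf.1 hB)].
  - by apply: cmeas_Fd; apply: cmeas_cont; [exact: ulim_ccont U|exact: ulim_ccont U'].
  - by apply: filterS2 (rep_ae hs B0 hf.1 hB) (dx_ae hs B0 hf.1 hB) => x h1 h2 px; rewrite h1// h2.
rewrite -e; apply: eq_rtint => x _.
by rewrite (F_betaE (psi x) (dx psi x) pE).
Qed.

(* A truncation of [psi] plus a small lacunary series of H^s but of no better regularity. *)
Lemma lacunary_perturbation (p : @pexp R) (D : nat) (a : int -> C) (Ba : R) :
  (0 < D)%N -> 0 < Ba -> HB s Ba a ->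
  Im (tint (fun x => Fd p 1%R (syn a x) (syn (Dz a) x))) != 0 ->
  exists fc : int -> C, exists B : R, [/\ 0 < B, HB s B fc,
    ulim (syn (Dz (Dz fc))) (Dz (Dz fc)),
    Im (tint (fun x => Fd p 1%R (syn fc x) (syn (Dz fc) x))) != 0 &
    exists e : R, exists m0 : nat, 0 < e /\ forall k, ~~ zin m0 k -> fc k = e%:C * lac s D k].
Proof.
move=> D0 Ba0 hB; set I0 := tint _ => hI.
have [K K0 hK] := Fd_lip p 1%R (4 * Ba + 1).
(* A change of at most [eta] in the function and its derivative moves the integral by at most
   [4 K eta], which is less than [|Im I0|]. *)
pose eta := Num.min 1 (`|Im I0| / (8 * (K + 1))).
have I00 : 0 < `|Im I0| by rewrite normr_gt0.
have K1 : 0 < 8 * (K + 1) by rewrite mulr_gt0// ltr_wpDl.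
have eta0 : 0 < eta by rewrite lt_min ltr01 divr_gt0.
have eta1 : eta <= 1 by rewrite ge_min lexx.
have etaI : eta * (8 * (K + 1)) <= `|Im I0|.
  by rewrite -ler_pdivlMr// ge_min lexx orbT.
(* Half of [eta] is spent on cutting the tail of [a]; the factor [e] below is fixed so that the
   lacunary part uses the other half. *)
have [m0 m00 hm0] := inv_rate (2 * Ba) (divr_gt0 eta0 (ltr0n _ 2)).
have [Kl Kl0 hKl] := sum_lac hs D0.
have [Bl Bl0 hBl] := HB_lac hs D0.
pose e := eta / (2 * Kl); have e0 : 0 < e by rewrite divr_gt0// mulr_gt0.
have eK : e * Kl = eta / 2.
  by rewrite /e invfM mulrA -mulrA mulVf ?mulr1// gt_eqF.
pose h k : C := if zin m0 k then a k else 0.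
pose fc k := h k + e%:C * lac s D k.
have ne (z : C) : normc (e%:C * z) = e * normc z by rewrite normc_mul normc_real gtr0_norm.
have hBh : HB s Ba h.
  move=> m; apply: le_trans (hB m); apply: zs_le => k _; rewrite /h; case: ifP => // _.
  by rewrite normc_zero expr0n/= mulr0 mulr_ge0 ?sqr_ge0 ?wt_ge0.
have hBe : HB s (e * Bl) (fun k => e%:C * lac s D k).
  move=> m; rewrite exprMn; apply: le_trans (ler_wpM2l (sqr_ge0 e) (hBl m)).
  rewrite -zsZ; apply: zs_le => k _; rewrite ne exprMn le_eqVlt; apply/orP; left.
  by apply/eqP; ring.
have hBf : HB s (2 * (Ba + e * Bl)) fc by exact: HB_add (ltW Ba0) (mulr_ge0 (ltW e0) (ltW Bl0)) hBh hBe.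
have Bf0 : 0 < 2 * (Ba + e * Bl) by rewrite mulr_gt0// addr_gt0// mulr_gt0.
have [U1 U2] := HB_ulim hs Ba0 hB; have [V1 V2] := HB_ulim hs Bf0 hBf.
have dif k : fc k - a k = (if zin m0 k then 0 else - a k) + e%:C * lac s D k.
  by rewrite /fc /h; case: ifP => _; ring.
have l1 m : zs 0 m (normc \o (fun k => fc k - a k)) <= eta.
  apply: (@le_trans _ _ (zs 0 m (fun k => (if zin m0 k then 0 else normc (a k)) + e * normc (lac s D k)))).
    apply: zs_le => k _ /=; rewrite dif; apply: le_trans (normc_add _ _) _; rewrite ne lerD2r.
    by case: ifP => _; rewrite ?normc_zero ?normc_opp.
  rewrite zsD zsZ (splitr eta); apply: lerD.
    apply: le_trans (zs_tail _ _ _) _; first by move=> k; exact: normc_ge0.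
    exact: le_trans (HB_l1 _ hs Ba0 m00 hB) (hm0 _ (leqnn _)).
  by rewrite -eK ler_wpM2l ?(ltW e0)//; have [] := hKl m.
have l2 m : zs 0 m (normc \o (fun k => Dz fc k - Dz a k)) <= eta.
  apply: (@le_trans _ _ (zs 0 m (fun k => (if zin m0 k then 0 else normc (Dz a k)) + e * normc (Dz (lac s D) k)))).
    apply: zs_le => k _ /=; rewrite /Dz -mulrBr dif mulrDr; apply: le_trans (normc_add _ _) _.
    rewrite mulrCA ne lerD2r.
    by case: ifP => _; rewrite ?mulr0 ?normc_zero// mulrN normc_opp.
  rewrite zsD zsZ (splitr eta); apply: lerD.
    apply: le_trans (zs_tail _ _ _) _; first by move=> k; exact: normc_ge0.
    exact: le_trans (HB_l1_deriv _ hs Ba0 m00 hB) (hm0 _ (leqnn _)).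
  by rewrite -eK ler_wpM2l ?(ltW e0)//; have [] := hKl m.
exists fc, (2 * (Ba + e * Bl)); split; [exact: Bf0|exact: hBf| | |].
- apply: (@bounded_ulim_syn _ _ (zs 0 m0 (normc \o Dz (Dz a)) + e * Kl)) => m.
  apply: (@le_trans _ _ (zs 0 m (fun k => (if zin m0 k then normc (Dz (Dz a) k) else 0) + e * normc (Dz (Dz (lac s D)) k)))).
    apply: zs_le => k _ /=.
    have -> : Dz (Dz fc) k = (if zin m0 k then Dz (Dz a) k else 0) + e%:C * Dz (Dz (lac s D)) k.
      by rewrite /Dz /fc /h; case: ifP => _; ring.
    apply: le_trans (normc_add _ _) _; rewrite ne lerD2r.
    by case: ifP => _; rewrite ?normc_zero.
  rewrite zsD zsZ; apply: lerD; first by apply: zs_head => k; exact: normc_ge0.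
  by rewrite ler_wpM2l ?(ltW e0)//; have [] := hKl m.
- have cf x : normc (syn fc x - syn a x) <= eta by exact: (ulim_sup x (ulimB V1 U1) l1).
  have cf1 x : normc (syn (Dz fc) x - syn (Dz a) x) <= eta by exact: (ulim_sup x (ulimB V2 U2) l2).
  have c1 : ccont (fun x => Fd p 1%R (syn fc x) (syn (Dz fc) x)).
    by apply: ccont_Fd; [exact: ulim_ccont V1|exact: ulim_ccont V2].
  have c2 : ccont (fun x => Fd p 1%R (syn a x) (syn (Dz a) x)).
    by apply: ccont_Fd; [exact: ulim_ccont U1|exact: ulim_ccont U2].
  set I1 := tint _; have d01 : normc (I1 - I0) <= 2 * (K * (eta + eta)).
    rewrite /I1 /I0 tint_subc//; apply: tint_le_cst; first exact/cintg_cont/ccontB.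
    move=> x _; have [b1 b2] := syn_bound hs x Ba0 hB.
    have tri (u v : C) : normc v <= 4 * Ba -> normc (u - v) <= eta -> normc u <= 4 * Ba + 1.
      move=> hv huv; rewrite -[u](subrK v) addrC; apply: le_trans (normc_add _ _) _.
      by apply: lerD => //; exact: le_trans huv eta1.
    apply: le_trans (hK _ _ _ _ (tri _ _ b1 (cf x)) (tri _ _ b2 (cf1 x)) _ _) _.
    + by apply: (le_trans b1); rewrite lerDl.
    + by apply: (le_trans b2); rewrite lerDl.
    by rewrite ler_wpM2l//; apply: lerD.
  clearbody I1 I0; apply/eqP => I10; have := le_trans (normc_Im _) d01.
  rewrite ImD ImN I10 sub0r normrN => h'.
  have : 0 < K * eta + eta * 2 by rewrite ltr_wpDl ?mulr_ge0 ?mulr_gt0// ltW.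
  by move: etaI h' I00; move: (`|Im I0|) => z; lra.
- exists e, m0; split=> [|k zk]; first exact: e0.
  by rewrite /fc /h (negbTE zk) add0r.
Qed.
End Data.

(** * The contradiction at a large scale *)

Section Contradiction.
Context {R : realType}.
Local Notation C := R[i].
Local Notation Re := (@complex.Re R).
Local Notation Im := (@complex.Im R).
Local Notation normc := (@ComplexField.Normc.normc R).

Lemma eq_zs_in (V : nmodType) m (g h : int -> V) :
  (forall k, zin m k -> g k = h k) -> zs 0 m g = zs 0 m h.
Proof.
by move=> e; apply: eq_big_nat => j /andP[_ jm]; rewrite !e.
Qed.

Lemma zin_abs m (k : int) : (m < `|k|)%N -> ~~ zin m k.
Proof. by case: k => j /=; rewrite -leqNgt => h; rewrite -ltnS // ltnW. Qed.
Lemma abs_zin m (k : int) : zin m k -> (`|k| <= m)%N.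
Proof. by case: k => j /=; [exact: ltnW|]. Qed.

Context (s : R) (hs : 5 / 2 < s) (p : @pexp R) (d : nat).
Context (hd : forall M f g, trig M f -> trig M g -> trig (d * M) (fun x => pv p (f x) (g x))).
Context (fc : int -> C) (B0 : R) (B00 : 0 < B0) (hB : HB s B0 fc)
  (U3 : ulim (syn (Dz (Dz fc))) (Dz (Dz fc))).
Context (hI : Im (tint (fun x => Fd p 1%R (syn fc x) (syn (Dz fc) x))) != 0).
Context (e : R) (m0 : nat) (e0 : 0 < e)
  (hfc : forall k, ~~ zin m0 k -> fc k = e%:C * lac s (d + 3) k).

(** The truncated test sees only the frequencies [n - k] with [|k| <= scale i]. They lie beyond the
    polynomial part of the data, and [n] is the only spike among them, so only the coefficient of
    [g] at 0 contributes. *)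
Lemma tint_spike (g : int -> C) i (n : int) : `|n|%N = ((d + 3) * scale i)%N ->
  (m0 < scale i)%N ->
  tint (fun x => syn fc x * (Tz 0 (scale i) g x * ex (- n) x)) = g 0 * fc n.
Proof.
move=> hn hm; have [U V] := HB_ulim hs B00 hB; have cphi := ulim_ccont U.
have s0 := scale_gt0 i.
rewrite (eq_tint (g := fun x => Tz 0 (scale i) g x * (syn fc x * ex (- n) x))); last first.
  by move=> x _; ring.
rewrite tint_Tz; last by apply: ccontM => //; exact: ccont_ex.
have shift k : tint (fun x => ex k x * (syn fc x * ex (- n) x)) = fc (n - k).
  rewrite -(ulim_fourier (n - k) U) fourierE; apply: eq_tint => x _.
  by rewrite opprB exD; ring.
have D3 : (3 <= d + 3)%N by exact: leq_addl.
have off (k : int) : zin (scale i) k -> k != 0 -> fc (n - k) = 0.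
  move=> /abs_zin hk k0.
  have D3' : (3 * scale i <= (d + 3) * scale i)%N by rewrite leq_mul2r D3 orbT.
  have far : (m0 < `|n - k|)%N.
    by move: hn hm hk D3' s0; move: ((d + 3) * scale i)%N (scale i) => A B; lia.
  rewrite hfc; last exact: zin_abs.
  rewrite lac_eq0 ?mulr0// => j; apply: (off_spike (i := i)) => //.
  - by move: hn hk; move: ((d + 3) * scale i)%N (scale i) => A B; lia.
  - by move: hn hk; move: ((d + 3) * scale i)%N (scale i) => A B; lia.
  - by move: hn hk D3' k0 s0; move: ((d + 3) * scale i)%N (scale i) => A B; lia.
rewrite (eq_zs_in (h := fun k => (g k * fc n) * (k == 0)%:R)).
  by rewrite zs_delta /= s0.
move=> k zk; rewrite shift; have [->|k0] := eqVneq k 0; first by rewrite subr0 mulr1.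
by rewrite off// !mulr0.
Qed.

(** At the spike the pairing equals [tint G] times [e M^-s 2^-i], whereas [one_scale] bounds it by
    [Kf M^-s 4^-i]. *)
Lemma no_evol (sg T : R) (c : R -> int -> C) : sg * sg = 1 -> 0 < T ->
  ~ evol p s sg T (syn fc) c.
Proof.
move=> sg2 T0 hev; have [U V] := HB_ulim hs B00 hB.
have hphi := HB_isd hs B00 hB; have cphi1 := ulim_ccont V.
have hphi1 := ulim_isd V U3; have cphi2 := ulim_ccont U3.
have [A' hA cA'] := isd_Fd p 1%R hphi cphi1 hphi1 cphi2.
have [Bf' hBf cB'] := isd_Fd p 3%R hphi cphi1 hphi1 cphi2.
have pA : periodic2pi (fun x => Fd p 1%R (syn fc x) (syn (Dz fc) x)).
  by move=> x; rewrite (ulim_periodic U) (ulim_periodic V).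
have [lam [G [G' [G'' [[lamE hG hG' cG'' pG] [GE G0]]]]]] := gauge hA cA' pA.
have lam0 : Im lam != 0 by rewrite lamE.
have [Kf Kf0 [N0 hN0]] := one_scale hs hd B00 hB hA cA' hBf cB' hG hG' cG'' pG GE T0 sg2 hev lam0.
have g0E : fourier G 0 = tint G.
  by rewrite fourierE; apply: eq_tint => x _; rewrite oppr0 ex0 mulr1.
have G00 : 0 < normc (tint G).
  by rewrite lt_neqAle normc_ge0 andbT eq_sym; apply: contra G0 => /eqP/normc_eq0 ->.
have Ge : 0 < normc (tint G) * e by rewrite mulr_gt0.
(* Large enough for the estimate to apply, for the spike to lie beyond the polynomial part, and for
   [2^i] to exceed the ratio of the two constants. *)
pose i := (N0 + m0 + (Num.truncn (Kf / (normc (tint G) * e))).+1)%N.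
have i4 : (i < 4 ^ i)%N by exact: ltn_expl.
have iN : (N0 <= 4 ^ i)%N.
  by apply: leq_trans (ltnW i4); rewrite /i -addnA leq_addr.
have im : (m0 < scale i)%N.
  apply: (@leq_ltn_trans i); first by rewrite /i addnAC leq_addl.
  by apply: (leq_trans i4); rewrite /scale -[X in (X <= _)%N]expn1 leq_pexp2l// expn_gt0.
have iK : Kf < normc (tint G) * e * 2 ^+ i.
  rewrite mulrC -ltr_pdivrMr//; apply: lt_le_trans (truncnS_gt _) _.
  rewrite -natrX ler_nat; apply: leq_trans (ltnW (ltn_expl i (ltnSn 1))).
  by rewrite /i leq_addl.
have s0 := scale_gt0 i.
pose w := ((d + 3) * scale i)%N.
have w0 : (0 : R) < w%:R by rewrite ltr0n muln_gt0 s0 addn3.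
have sg0 : sg != 0 by apply/eqP => e'; move: sg2; rewrite e' mulr0 => /esym/eqP; rewrite oner_eq0.
(* The data have equal coefficients at both signs of the frequency, so the growing sign is available
   whatever [sg] and the sign of [Im lam]. *)
have [n hn hsgn] : exists2 n : int, `|n|%N = w & 0 < - (sg * n%:~R * Im lam).
  have nz : sg * w%:R * Im lam != 0.
    by rewrite !mulf_neq0// gt_eqF.
  have [h|h] := ltP (sg * w%:R * Im lam) 0.
    by exists (Posz w) => //; rewrite oppr_gt0.
  exists (- Posz w); first by rewrite abszN.
  by rewrite intrN mulrN mulNr opprK lt_neqAle eq_sym nz.
have N40 : (0 < 4 ^ i)%N by rewrite expn_gt0.
have := hN0 (4 ^ i)%N n iN N40 hn hsgn; rewrite -/(scale i) tint_spike//.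
have zn : ~~ zin m0 n.
  apply: zin_abs; rewrite hn; apply: leq_trans im _.
  by rewrite /w leq_pmull// addn3.
have D0' : (0 < d + 3)%N by rewrite addn3.
have lE : lac s (d + 3) n = (dec s (scale i) / 2 ^+ i)%:C by exact: lac_spike D0' _ _ hn.
rewrite g0E hfc// lE.
rewrite !normc_mul !normc_real gtr0_norm// ger0_norm; last first.
  by rewrite divr_ge0 ?exprn_ge0// ltW// dec_gt0.
have -> : ((4 ^ i)%:R : R) = 2 ^+ i * 2 ^+ i by rewrite natrX -exprMn -natrM.
have D0 := dec_gt0 s s0; have p0 : (0 : R) < 2 ^+ i by rewrite exprn_gt0.
rewrite invfM; set q := (2 ^+ i)^-1; have q0 : 0 < q by rewrite invr_gt0.
have -> : normc (tint G) * (e * (dec s (scale i) * q)) = (normc (tint G) * e) * (dec s (scale i) * q) by ring.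
have -> : Kf * (dec s (scale i) * (q * q)) = Kf * q * (dec s (scale i) * q) by ring.
rewrite ler_pM2r ?mulr_gt0// /q ler_pdivlMr// => h.
by have := le_lt_trans h iK; rewrite ltxx.
Qed.
End Contradiction.

Theorem theorem1p4 (R : realType) (s : R) (F : mpoly.mpoly 4 R[i]) :
  5 / 2 < s ->
  (exists psi : R -> R[i], Hs s psi /\
     rtint (fun x => complex.Im (F_beta F (psi x) (dx psi x))) <> 0) ->
  exists phi : R -> R[i], Hs s phi /\
    forall T : R, 0 < T ->
      ~ (exists u : R -> R -> R[i],
           C_Hs s 0 T u /\ solution_fwd s T F phi u) /\
      ~ (exists u : R -> R -> R[i],
           C_Hs s (- T) 0 u /\ solution_bwd s T F phi u).
Proof.
move=> hs [psi [hpsi hI]].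
have [p pE] := pexp_of_mpoly F; have [d hd] := trig_pv p.
have Ba0 : 0 < Hs_norm s psi + 1 by rewrite ltr_wpDl ?sqrtr_ge0.
have hBa : HB s (Hs_norm s psi + 1) (fourier psi) by apply: Hs_HB hpsi _; rewrite lerDl.
have hI' : complex.Im (tint (fun x => Fd p 1%R (syn (fourier psi) x) (syn (Dz (fourier psi)) x))) != 0.
  by apply/eqP; rewrite -(rtint_F_beta hs pE hpsi).
have D0 : (0 < d + 3)%N by rewrite addn3.
have [fc [B [B0 hB U3 hIm [e [m0 [e0 hfc]]]]]] := lacunary_perturbation hs D0 Ba0 hBa hI'.
have [U V] := HB_ulim hs B0 hB.
have hphi : Hs s (syn fc).
  apply: (@HB_Hs _ _ _ B); first exact: L2T_cont (ulim_ccont U) (ulim_periodic U).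
  rewrite (_ : fourier (syn fc) = fc)//; apply/funext => k; exact: ulim_fourier.
exists (syn fc); split=> // T T0; split=> -[u [hC hsol]].
  have ev := solution_fwd_evol hs pE T0 hphi hC hsol.
  by apply: (no_evol hs hd B0 hB U3 hIm e0 hfc _ T0 ev); rewrite mulr1.
have ev := solution_bwd_evol hs pE T0 hphi hC hsol.
by apply: (no_evol hs hd B0 hB U3 hIm e0 hfc _ T0 ev); rewrite mulrNN mulr1.
Qed.
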